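(* Assume the standing hypotheses described in the context, with in addition $\hat\ell_1(x,0,w)=0$ for all $(x,w)\in\mathbb{R}^n\times\mathcal C$. Let $(\bar S,\bar w^0,\bar w,\bar\alpha,\bar y^0,\bar y,\bar\beta)$ be a canonical local minimizer for the space-time problem with $\bar\beta(\bar S)<K$. Then, for every Boltyanski approximating cone $\Gamma$ of $\mathfrak T$ at $(\bar y^0,\bar y)(\bar S)$, there exists a multiplier $(p_0,p,\pi,\lambda)\in\mathbb{R}\times AC([0,\bar S],\mathbb{R}^n)\times(-\infty,0]\times[0,+\infty)$ with $\pi=0$ such that: (i) $(p_0,p,\lambda)\ne(0,0,0)$, and if $\bar y^0(\bar S)>0$ then $(p,\lambda)\ne(0,0)$; (ii) $(p_0,p(\bar S))\in-\lambda\Big(\frac{\partial\Psi}{\partial t},\frac{\partial\Psi}{\partial x}\Big)((\bar y^0,\bar y)(\bar S))-\Gamma^\perp$; (iii) $\frac{dp}{ds}(s)=-\frac{\partial H}{\partial x}(\bar y(s),p_0,p(s),0,\lambda,\bar w^0(s),\bar w(s),\bar\alpha(s))$ for a.e. $s\in[0,\bar S]$; (iv) $H(\bar y(s),p_0,p(s),0,\lambda,\bar w^0(s),\bar w(s),\bar\alpha(s))=\mathbf H(\bar y(s),p_0,p(s),0,\lambda)$ for a.e. $s\in[0,\bar S]$; (v) $\mathbf H(\bar y(s),p_0,p(s),0,\lambda)=0$ for all $s\in[0,\bar S]$; (vi) $p(s)\cdot g_i(\bar y(s))=0$ for all $s\in[0,\bar S]$ and $i=1,\dots,m_1$; (vii)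 $p(s)\cdot B(\bar y(s))=0$ for all $s\in[0,\bar S]$ and all $B\in\mathfrak B^0$.
   Context: Let $n,m,q\ge1$, $m=m_1+m_2$. Standing hypotheses: $\mathfrak T\subset\mathbb{R}_+\times\mathbb{R}^n$ closed target; $A\subset\mathbb{R}^q$ compact; $\mathcal C=\mathcal C_1\times\mathcal C_2\subseteq\mathbb{R}^m$ with $\mathcal C_1\subseteq\mathbb{R}^{m_1}$ a closed cone containing the lines $\mathbb{R}\mathbf e_i$, $i\le m_1$, and $\mathcal C_2\subseteq\mathbb{R}^{m_2}$ a closed cone containing no line; $f:\mathbb{R}^n\times A\to\mathbb{R}^n$ continuous with continuous $x$-partials; $g_1,\dots,g_m:\mathbb{R}^n\to\mathbb{R}^n$ of class $C^1$; $\ell(x,u,a)=\ell_0(x,a)+\ell_1(x,u)$ with $\ell_0$ and the recession function $\hat\ell_1(x,w^0,w):=\lim_{r\to w^0}r\ell_1(x,w/r)$ (on $\mathbb{R}^n\times\mathbb{R}_+\times\mathcal C$) continuous with continuous $x$-partials; $\Psi:\mathbb{R}\times\mathbb{R}^n\to\mathbb{R}$ of class $C^1$; $K\in(0,+\infty]$, $\check x\in\mathbb{R}^n$; $\ell^e(x,w^0,w,a):=\ell_0(x,a)w^0+\hat\ell_1(x,w^0,w)$. Space-time process: $S>0$, $(w^0,w,\alpha)\in L^\infty([0,S],\mathbb{R}_+\times\mathcal C\times A)$, $\operatorname{ess\,inf}(w^0+|w|)>0$, $(y^0,y,\beta)$ the solution of $\dot y^0=w^0$, $\dot y=f(y,\alpha)w^0+\sum_i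 g_i(y)w^i$, $\dot\beta=|w|$, $(y^0,y,\beta)(0)=(0,\check x,0)$; feasible if $(y^0(S),y(S))\in\mathfrak T$, $\beta(S)\le K$; cost $\Psi(y^0(S),y(S))+\int_0^S\ell^e(y,w^0,w,\alpha)ds$; canonical if $w^0+|w|=1$ a.e.; local minimizer: feasible with some $\delta>0$ such that its cost is $\le$ that of every feasible process with $|S-\bar S|+\sup_{s\ge0}|\tilde z(s)-\tilde{\bar z}(s)|<\delta$, $z=(y^0,y,\beta)$, $\tilde z$ the constant extension to $\mathbb{R}_+$. Boltyanski approximating cone of $Z\subseteq\mathbb{R}^N$ at $z$: a convex cone $LC$, $C\subset\mathbb{R}^M$ a convex cone, $L$ linear, with a continuous $F:V\cap C\to Z$ ($V$ neighborhood of $0$), $F(0)=z$, $F(v)=z+Lv+o(|v|)$. $X^\perp=\{p:p\cdot x\le0\ \forall x\in X\}$. Hamiltonians: $W=\{(w^0,w)\in\mathbb{R}_+\times\mathcal C:w^0+|w|=1\}$, $H(x,p_0,p,\pi,\lambda,w^0,w,a)=p_0w^0+p\cdot(f(x,a)w^0+\sum_ig_i(x)w^i)+\pi|w|-\lambda\ell^e(x,w^0,w,a)$, $\mathbf H=\max_{W\times A}H$. Admissible brackets: formal brackets in distinct indeterminates $X_1,\dots,X_q$ are defined recursively: each $X_j$ is a bracket of length 1, and if $b_1,b_2$ are brackets in disjoint sets of indeterminates then $[b_1,b_2]$ is a bracket, of length the sum of lengths; each indeterminate of $b$ appears exactly once. For a subbracket $S$ of $b$, $\mathfrak d(S;b)$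 is defined by $\mathfrak d(b;b)=0$ and $\mathfrak d(S_1;b)=\mathfrak d(S_2;b)=1+\mathfrak d([S_1,S_2];b)$. For vector fields $F_1,\dots,F_q$, $b(F_1,\dots,F_q)$ is obtained by substituting $F_j$ for $X_j$ and $[V,W]$ denotes the Lie bracket of vector fields. $(F_1,\dots,F_q)$ is of class $C^{b+k}$ if each $F_j$ is of class $C^{\mathfrak d(X_j;b)+k}$. For integer $k\ge0$, $\mathfrak B^k$ is the set of vector fields $b(F_1,\dots,F_q)$ where $b$ is a formal bracket of length $q\ge2$ and $(F_1,\dots,F_q)$, with each $F_j\in\{g_1,\dots,g_{m_1}\}$ (repetitions allowed), is of class $C^{b+k}$. *)

(* Defs.v *)
From HB Require Import structures.
From mathcomp Require Import all_boot all_order all_algebra.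
From mathcomp Require Import all_classical all_reals all_analysis.
Set Implicit Arguments. Unset Strict Implicit. Unset Printing Implicit Defensive.
Import Order.TTheory GRing.Theory Num.Theory.
Import numFieldNormedType.Exports.
Local Open Scope classical_set_scope.
Local Open Scope ring_scope.

Section Generic.
Variable R : realType.

Definition ev {N : nat} (j : 'I_N) : 'rV[R]_N := delta_mx 0 j.
Definition dotp {N : nat} (u v : 'rV[R]_N) : R := \sum_(i < N) u 0 i * v 0 i.
Definition enorm {N : nat} (v : 'rV[R]_N) : R := Num.sqrt (dotp v v).
Definition polar {N : nat} (X : set 'rV[R]_N) : set 'rV[R]_N :=
  [set p | forall x, X x -> dotp p x <= 0].
Definition is_cone {N : nat} (X : set 'rV[R]_N) : Prop :=
  X 0 /\ forall (t : R) v, 0 <= t -> X v -> X (t *: v).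
Definition is_convex {N : nat} (X : set 'rV[R]_N) : Prop :=
  forall u v (t : R), X u -> X v -> 0 <= t <= 1 -> X ((1 - t) *: u + t *: v).
Definition no_line {N : nat} (X : set 'rV[R]_N) : Prop :=
  forall v, (forall t : R, X (t *: v)) -> v = 0.
Definition tx {N : nat} (t : R) (x : 'rV[R]_N) : 'rV[R]_(1 + N) :=
  row_mx (const_mx t) x.

Fixpoint isCk {N : nat} {V : normedModType R} (k : nat) (F : 'rV[R]_N -> V) : Prop :=
  continuous F /\
  match k with
  | 0 => True
  | k'.+1 => forall j : 'I_N, (forall x, derivable F x (ev j)) /\
                             isCk k' (fun x => derive F x (ev j))
  end.

Definition grad {N : nat} (F : 'rV[R]_N -> R) (x : 'rV[R]_N) : 'rV[R]_N :=
  \row_j derive F x (ev j).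

Definition cont_xpartials {N : nat} {U : topologicalType} {V : normedModType R}
  (D : set U) (F : 'rV[R]_N -> U -> V) : Prop :=
  {within [set xa : 'rV[R]_N * U | D xa.2], continuous (fun xa => F xa.1 xa.2)} /\
  forall j : 'I_N,
    (forall x a, D a -> derivable (F^~ a) x (ev j)) /\
    {within [set xa : 'rV[R]_N * U | D xa.2],
       continuous (fun xa => derive (F^~ xa.2) xa.1 (ev j))}.

Definition boltyanski {N : nat} (Z : set 'rV[R]_N) (z : 'rV[R]_N) (G : set 'rV[R]_N) : Prop :=
  exists (M : nat) (Cc : set 'rV[R]_M) (L : 'M[R]_(M, N)) (V : set 'rV[R]_M)
         (F : 'rV[R]_M -> 'rV[R]_N),
    [/\ is_cone Cc /\ is_convex Cc,
        nbhs (0 : 'rV[R]_M) V,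
        {within V `&` Cc, continuous F} /\ (forall v, (V `&` Cc) v -> Z (F v)),
        F 0 = z /\
        (forall e : R, 0 < e -> exists d : R, 0 < d /\
           forall v, (V `&` Cc) v -> enorm v < d ->
             enorm (F v - z - v *m L) <= e * enorm v)
      & G = [set v *m L | v in Cc]].

Definition ACon {V : normedModType R} (a b : R) (F : R -> V) : Prop :=
  forall e : R, 0 < e -> exists d : R, 0 < d /\
    forall (K : nat) (u v : 'I_K -> R),
      (forall k, a <= u k /\ u k <= v k /\ v k <= b) ->
      (forall k l, k != l -> v k <= u l \/ v l <= u k) ->
      \sum_(k < K) (v k - u k) < d ->
      \sum_(k < K) `|F (v k) - F (u k)| < e.

Definition Icc (S : R) : set R := [set s | 0 <= s <= S].

Definition ae_R (P : R -> Prop) : Prop := almost_everywhere lebesgue_measure P.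

End Generic.
Arguments ev {R N} j.

Inductive fbr := FLeaf of nat | FNode of fbr & fbr.

Fixpoint fleaves (b : fbr) : seq nat :=
  match b with FLeaf j => [:: j] | FNode b1 b2 => fleaves b1 ++ fleaves b2 end.

(* b is a formal bracket in the distinct indeterminates X_0,...,X_(q-1),
   q = length of b, each appearing exactly once *)
Definition fbracket (b : fbr) : bool :=
  perm_eq (fleaves b) (iota 0 (size (fleaves b))).

Definition flength (b : fbr) : nat := size (fleaves b).

Fixpoint fdepth (j : nat) (b : fbr) : nat :=
  match b with
  | FLeaf _ => 0
  | FNode b1 b2 => (if j \in fleaves b1 then fdepth j b1 else fdepth j b2).+1
  end.

Section Brackets.
Variable R : realType.
Variable n : nat.

Definition lie (V W : 'rV[R]_n -> 'rV[R]_n) : 'rV[R]_n -> 'rV[R]_n :=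
  fun x => derive W x (V x) - derive V x (W x).

Fixpoint feval (F : nat -> 'rV[R]_n -> 'rV[R]_n) (b : fbr) : 'rV[R]_n -> 'rV[R]_n :=
  match b with
  | FLeaf j => F j
  | FNode b1 b2 => lie (feval F b1) (feval F b2)
  end.

Definition frakB (m1 : nat) (gs : 'I_m1 -> 'rV[R]_n -> 'rV[R]_n) (k : nat)
  : set ('rV[R]_n -> 'rV[R]_n) :=
  [set B | exists (b : fbr) (F : nat -> 'rV[R]_n -> 'rV[R]_n),
     [/\ fbracket b, (2 <= flength b)%N,
         (forall j, j \in fleaves b ->
            (exists i, F j = gs i) /\ isCk (fdepth j b + k) (F j))
       & B = feval F b]].
End Brackets.

Section Problem.
Variable R : realType.
Variables n m1 m2 q : nat.
Variable Targ : set 'rV[R]_(1 + n).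
Variable A : set 'rV[R]_q.
Variable C1 : set 'rV[R]_m1.
Variable C2 : set 'rV[R]_m2.
Variable f : 'rV[R]_n -> 'rV[R]_q -> 'rV[R]_n.
Variable g : 'I_(m1 + m2) -> 'rV[R]_n -> 'rV[R]_n.
Variable l0 : 'rV[R]_n -> 'rV[R]_q -> R.
Variable hl1 : 'rV[R]_n -> R -> 'rV[R]_(m1 + m2) -> R.
Variable Psi : 'rV[R]_(1 + n) -> R.
Variable K : \bar R.
Variable xc : 'rV[R]_n.

Definition Cset (w : 'rV[R]_(m1 + m2)) : Prop := C1 (lsubmx w) /\ C2 (rsubmx w).

Definition le_cost (x : 'rV[R]_n) (w0 : R) (w : 'rV[R]_(m1 + m2)) (a : 'rV[R]_q) : R :=
  l0 x a * w0 + hl1 x w0 w.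

Definition dyn (x : 'rV[R]_n) (w0 : R) (w : 'rV[R]_(m1 + m2)) (a : 'rV[R]_q) : 'rV[R]_n :=
  w0 *: f x a + \sum_(i < m1 + m2) w 0 i *: g i x.

Definition admissible_control (S : R) (w0 : R -> R) (w : R -> 'rV[R]_(m1 + m2))
  (al : R -> 'rV[R]_q) : Prop :=
  [/\ 0 < S,
      measurable_fun (Icc S) w0 /\
      (forall i, measurable_fun (Icc S) (fun s => w s 0 i)) /\
      (forall i, measurable_fun (Icc S) (fun s => al s 0 i)),
      exists M : R, ae_R (fun s => Icc S s ->
         `|w0 s| <= M /\ enorm (w s) <= M /\ enorm (al s) <= M),
      ae_R (fun s => Icc S s -> 0 <= w0 s /\ Cset (w s) /\ A (al s))
    & exists c : R, 0 < c /\ ae_R (fun s => Icc S s -> c <= w0 s + enorm (w s))].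

Definition solves (S : R) (w0 : R -> R) (w : R -> 'rV[R]_(m1 + m2)) (al : R -> 'rV[R]_q)
  (y0 : R -> R) (y : R -> 'rV[R]_n) (be : R -> R) : Prop :=
  [/\ y0 0 = 0 /\ y 0 = xc /\ be 0 = 0,
      ACon 0 S y0 /\ ACon 0 S y /\ ACon 0 S be
    & ae_R (fun s => 0 < s < S ->
        [/\ derivable y0 s 1 /\ derive y0 s 1 = w0 s,
            derivable y s 1 /\ derive y s 1 = dyn (y s) (w0 s) (w s) (al s)
          & derivable be s 1 /\ derive be s 1 = enorm (w s)])].

Definition process S w0 w al y0 y be : Prop :=
  admissible_control S w0 w al /\ solves S w0 w al y0 y be.

Definition feasible S w0 w al y0 y be : Prop :=
  [/\ process S w0 w al y0 y be, Targ (tx (y0 S) (y S)) & ((be S)%:E <= K)%E].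

Definition cost (S : R) (w0 : R -> R) (w : R -> 'rV[R]_(m1 + m2)) (al : R -> 'rV[R]_q)
  (y0 : R -> R) (y : R -> 'rV[R]_n) : R :=
  Psi (tx (y0 S) (y S)) +
  Rintegral lebesgue_measure (Icc S) (fun s => le_cost (y s) (w0 s) (w s) (al s)).

Definition canonical_process S w0 w al y0 y be : Prop :=
  process S w0 w al y0 y be /\ ae_R (fun s => Icc S s -> w0 s + enorm (w s) = 1).

(* |z~(s) - z~'(s)| with z = (y0,y,beta) extended constantly after S, resp. S' *)
Definition zdist (S : R) (y0 : R -> R) (y : R -> 'rV[R]_n) (be : R -> R)
  (S' : R) (y0' : R -> R) (y' : R -> 'rV[R]_n) (be' : R -> R) (s : R) : R :=
  let t := Num.min s S in let t' := Num.min s S' in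
  Num.sqrt ((y0 t - y0' t') ^+ 2 + enorm (y t - y' t') ^+ 2 + (be t - be' t') ^+ 2).

Definition local_minimizer Sb w0b wb alb y0b yb beb : Prop :=
  feasible Sb w0b wb alb y0b yb beb /\
  exists d : R, 0 < d /\
    forall S w0 w al y0 y be, feasible S w0 w al y0 y be ->
      (exists eta : R, `|S - Sb| + eta < d /\
         forall s, 0 <= s -> zdist S y0 y be Sb y0b yb beb s <= eta) ->
      cost Sb w0b wb alb y0b yb <= cost S w0 w al y0 y.

Definition Ham (x : 'rV[R]_n) (p0 : R) (p : 'rV[R]_n) (pi lam : R) (w0 : R)
  (w : 'rV[R]_(m1 + m2)) (a : 'rV[R]_q) : R :=
  p0 * w0 + dotp p (dyn x w0 w a) + pi * enorm w - lam * le_cost x w0 w a.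

Definition Wset : set (R * 'rV[R]_(m1 + m2)) :=
  [set ww | 0 <= ww.1 /\ Cset ww.2 /\ ww.1 + enorm ww.2 = 1].

Definition HamMax (x : 'rV[R]_n) (p0 : R) (p : 'rV[R]_n) (pi lam : R) : R :=
  sup [set r | exists ww a, [/\ Wset ww, A a & r = Ham x p0 p pi lam ww.1 ww.2 a]].

Definition dHam_dx (x : 'rV[R]_n) (p0 : R) (p : 'rV[R]_n) (pi lam : R) (w0 : R)
  (w : 'rV[R]_(m1 + m2)) (a : 'rV[R]_q) : 'rV[R]_n :=
  grad (fun x' => Ham x' p0 p pi lam w0 w a) x.

End Problem.

(* Main.v *)
Require Import Defs.
From HB Require Import structures.
From mathcomp Require Import all_boot all_order all_algebra.
From mathcomp Require Import all_classical all_reals all_analysis.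
From mathcomp Require Import measurable_realfun ring lra.
Import Order.TTheory GRing.Theory Num.Theory.
Import numFieldNormedType.Exports.
Local Open Scope classical_set_scope.
Local Open Scope ring_scope.

(**
Write the space-time system as a control system for the state (y0, y, cost), with control (w0, w, a)
in the compact set w0 + |w| = 1; along such processes beta(s) = s - y0(s), so near a reference with
beta < K the bound on beta is inactive.

The reference is perturbed by two kinds of first-order variations: a piece of the reference control
is skipped, or a short arc of another admissible trajectory is inserted while the reference clock
stands still. The inserted arc is either generated by a constant control, or it is a word in the flows
of +g_i and -g_i, i <= m1, run at w0 = 0, where the dynamics is +/- g_i and the running cost vanishes.
For a formal bracket B of length q the word associated with B displaces x by t^q B(x) + o(t^q) even
when B is merely continuous, so that run for the time t = e^(1/q) it realizes the direction B(x) at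
first order in e.

Transported to the final time by the adjoint flow, the variations span a convex cone. If this cone
together with the approximating cone of the target (lifted by the cost) were dense in the whole space,
a fixed point theorem applied to the endpoint map of multi-parameter variations would produce a
feasible process with smaller cost. Hence a hyperplane separates them; its normal, transported back by
the adjoint flow, is the multiplier. Skipping and inserting give Hamiltonian >= 0 along the reference
and <= 0 for all controls, and inserting g_i, -g_i, B and -B gives the orthogonality relations.
*)

Set Implicit Arguments. Unset Strict Implicit. Unset Printing Implicit Defensive.

(** * Null sets and absolutely continuous curves *)

Section Monotone.
Context {R : realType}.
Implicit Types (N : set R) (a b t : R).

(** The commutator estimate needs, for both factors, an expansion of differences [P t x' - P t x]
    ([near_id1]) besides the pointwise one. For a subbracket this is paid by its spare derivative:
    the word of the tangent lifts is the same word for fields of one class less, so its pointwise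
    expansion is an expansion of the differential of the original word. Hence only the outermost
    bracket may be merely continuous, which is exactly the regularity granted.

    As [e^(1/q)] is Hölder and not differentiable at 0, the endpoint map of a family is continuous
    and first-order close to its model, but not of class C^1; an implicit function theorem is out of
    reach and a topological one takes its place, obtained from Kuhn's labelling lemma by a count
    modulo 2. A family keeps a reference clock besides the state: arcs inserted with the clock
    stopped do not interact at first order, even at one instant, and all errors are uniform in the
    parameters. The final time being free, skipping and inserting may change the duration, which is
    what fixes the value 0 of the Hamiltonian. *)

Definition null N := (@lebesgue_measure R).-negligible N.

Lemma null_open_cover N e : null N -> 0 < e ->
  exists U : set R, [/\ open U, N `<=` U & (lebesgue_measure U < e%:E)%E].
Proof.
move=> [A [mA A0 NA]] e0.
have [|U [oU AU Ue]] := lebesgue_regularity_outer mA _ e0.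
  by rewrite [ltLHS](_ : _ = 0%E) ?ltry//; exact: A0.
exists U; split => //; first exact: subset_trans AU.
have -> : U = A `|` (U `\` A) by rewrite setDUK.
rewrite measureU //; first by rewrite [X in (X + _)%E]A0 add0e.
  by apply: measurableD => //; exact: measurable_realfun.open_measurable.
by rewrite setIDA setDE -setIA [U `&` _]setIC setIA setICr set0I.
Qed.

Definition nonoverlap K (u v : 'I_K -> R) :=
  (forall k, u k <= v k) /\ (forall k l, k != l -> v k <= u l \/ v l <= u k).

(** Only the open interiors are pairwise disjoint; they have the same lengths as the closed
    intervals, so additivity of the measure applies to them. *)
Lemma sum_length_le K (u v : 'I_K -> R) (U : set R) : nonoverlap u v -> open U ->
  (forall k, `[u k, v k] `<=` U) ->
  ((\sum_(k < K) (v k - u k))%:E <= lebesgue_measure U)%E.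
Proof.
move=> [uv nov] oU subU.
have H k : (lebesgue_measure (`]u k, v k[%classic : set R) = (v k - u k)%:E)%E.
  rewrite lebesgue_measure_itv /= lte_fin; case: ltP => // vu.
  by have -> : v k = u k; [apply/le_anti; rewrite vu uv|rewrite subrr].
rewrite -sumEFin (eq_bigr (fun k => lebesgue_measure (`]u k, v k[%classic : set R))); last first.
  by move=> k _; rewrite H.
rewrite -measure_bigsetU_ord //.
- apply: le_measure; rewrite ?inE.
  + by apply: bigsetU_measurable => k _; exact: measurable_itv.
  + exact: measurable_realfun.open_measurable.
  + apply: (big_ind (fun X : set R => X `<=` U)); first exact: sub0set.
      by move=> X Y XU YU x [/XU|/YU].
    move=> k _ x /= xk; apply: (subU k).
    by move: xk; rewrite /= !in_itv /= => /andP[/ltW -> /ltW ->].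
- apply/trivIsetP => k l _ _ kl; rewrite -subset0 => x /= [].
  rewrite !in_itv /= => /andP[? ?] /andP[? ?].
  by case: (nov _ _ kl) => ?; lra.
Qed.

(** Take the supremum of the [t] such that [G] holds on all of [[a, t]]. The last hypothesis asks
    only that points of [G] accumulate at [t] from the left; it gives [G] at the supremum, and the
    step then passes beyond it unless it is [b]. *)
Lemma real_induction a b (G : set R) : a <= b -> G a ->
  (forall t, a <= t < b -> G t -> exists2 h : R, 0 < h & forall s, t <= s <= t + h -> s <= b -> G s) ->
  (forall t, a < t <= b -> (forall s, a <= s < t -> exists2 r, s < r < t & G r) -> G t) ->
  G b.
Proof.
move=> ab Ga step lim.
pose E := [set t | a <= t <= b /\ forall s, a <= s <= t -> G s].
have Ea : E a by split; rewrite ?lexx ?ab // => s /andP[? ?]; have -> : s = a by lra.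
have Eb t : E t -> t <= b by move=> [/andP[]].
have hsE : has_sup E by split; [exists a | exists b => t /Eb].
pose c := sup E.
have ac : a <= c by apply: ub_le_sup => //; exists b => t /Eb.
have cb : c <= b by apply: ge_sup; [exists a|move=> t /Eb].
have below s : a <= s < c -> G s.
  move=> /andP[as_ sc]; have [|t [Et1 Et] st] := @sup_adherent _ E (c - s) _ hsE.
    lra.
  by apply: Et; rewrite as_; apply: ltW; rewrite -/c in st; lra.
have Ec : E c.
  split; first by rewrite ac cb.
  move=> s /andP[as_]; rewrite le_eqVlt => /orP[/eqP->|sc]; last by apply: below; rewrite as_.
  move: ac; rewrite le_eqVlt => /orP[/eqP<-//|ac].
  apply: lim; first by rewrite ac.
  move=> r /andP[ar rc]; exists ((r + c) / 2); first lra.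
  by apply: below; lra.
have [cb'|] := ltP c b; last by move=> bc; apply: Ec.2; rewrite ab.
have Gc : G c by apply: Ec.2; rewrite ac lexx.
have [|h h0 hG] := step c _ Gc; first by rewrite ac.
have : E (Num.min (c + h) b).
  split; first by rewrite le_min ge_min lexx orbT andbT ab andbT; lra.
  move=> s /andP[as_]; rewrite le_min => /andP[sch sb].
  have [sc|cs] := leP s c; first by apply: Ec.2; rewrite as_.
  by apply: hG => //; rewrite sch ltW.
move=> /(@ub_le_sup _ E) => /(_ (ex_intro _ b Eb)); rewrite -/c.
rewrite leNgt lt_min cb' ltrDl h0 //.
Qed.

Lemma ACon_unif {V : normedModType R} a b (F : R -> V) : ACon a b F ->
  forall e : R, 0 < e -> exists2 d : R, 0 < d &
    forall s t, a <= s <= b -> a <= t <= b -> `|s - t| < d -> `|F s - F t| < e.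
Proof.
move=> acF e /acF[d [d0 H]]; exists d => //.
have main s t : a <= s -> s <= t -> t <= b -> `|s - t| < d -> `|F s - F t| < e.
  move=> as_ st tb std.
  have := H 1%N (fun=> s) (fun=> t); rewrite !big_ord1 distrC; apply => //.
    by move=> k l; rewrite (ord1 k) (ord1 l) eqxx.
  by rewrite distrC ger0_norm in std; lra.
move=> s t /andP[as_ sb] /andP[at_ tb] std; have [st|/ltW ts] := leP s t; first exact: main.
by rewrite distrC; apply: main => //; rewrite distrC.
Qed.

Lemma null_set1 a : null [set a].
Proof. by exists [set a]; split => //; rewrite lebesgue_measure_set1. Qed.

Lemma nullU N N' : null N -> null N' -> null (N `|` N').
Proof. exact: negligibleU. Qed.

Lemma nullS N N' : N `<=` N' -> null N' -> null N.
Proof. by move=> NN' [A [mA A0 N'A]]; exists A; split => //; exact: subset_trans N'A. Qed.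

(* The exceptional null set is covered by an open [U] of small length; the variation of [phi]
   inside [U] up to time [t] compensates for the missing derivative information. *)
Lemma AC_ge (phi : R -> R) a b N : a <= b -> ACon a b phi -> null N ->
  (forall t, a < t < b -> ~ N t -> forall e : R, 0 < e ->
     exists2 d : R, 0 < d & forall h : R, 0 <= h <= d -> phi t - e * h <= phi (t + h)) ->
  phi a <= phi b.
Proof.
move=> ab ac nN0 H0.
(* The endpoint [a] joins the exceptional set: the derivative information concerns interior times
   only, while the induction below starts at [a]. *)
have nN : null (N `|` [set a]) by apply: nullU => //; exact: null_set1.
have H t : a <= t < b -> ~ (N `|` [set a]) t -> forall e : R, 0 < e ->
     exists2 d : R, 0 < d & forall h : R, 0 <= h <= d -> phi t - e * h <= phi (t + h).
  move=> /andP[at_ tb] Nt; apply: H0; last by move=> Nt'; apply: Nt; left.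
  rewrite tb andbT lt_neqAle at_ andbT; apply/eqP => ta; apply: Nt; right.
  by rewrite /= ta.
suff main e : 0 < e -> phi a - e * (b - a) - e <= phi b.
  apply/ler_addgt0Pr => e e0.
  have e1 : 0 < e / (b - a + 1) by rewrite divr_gt0 // ; lra.
  have := main _ e1.
  have -> : phi a - e / (b - a + 1) * (b - a) - e / (b - a + 1) = phi a - e.
    by field; apply/eqP; lra.
  lra.
move=> e0.
have [d [d0 Hd]] := ac _ e0.
have [U [oU NU Ud]] := null_open_cover nN d0.
pose E t := [set r | exists K (u v : 'I_K -> R), [/\ nonoverlap u v,
   forall k, a <= u k /\ v k <= t, forall k, `[u k, v k] `<=` U &
   r = \sum_(k < K) `|phi (v k) - phi (u k)|]].
have E0 t : E t 0.
  exists 0%N, (fun=> 0), (fun=> 0); split => //; try by case.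
    by split=> //; case.
  by rewrite big_ord0.
have Ee t r : t <= b -> E t r -> r <= e.
  move=> tb [K [u [v [nov auv UU ->]]]]; apply/ltW/Hd.
  - by move=> k; have [? ?] := auv k; split=> //; split; [exact: nov.1|lra].
  - exact: nov.2.
  - by rewrite -lte_fin; apply: le_lt_trans Ud; apply: sum_length_le.
have hsE t : t <= b -> has_sup (E t).
  by move=> tb; split; [exists 0|exists e => r; exact: Ee].
pose V t := sup (E t).
have Vmono s t : s <= t -> t <= b -> V s <= V t.
  move=> st tb; apply: ge_sup; first by exists 0.
  move=> r [K [u [v [nov auv UU ->]]]]; apply: ub_le_sup; first by case: (hsE t tb).
  exists K, u, v; split => // k; have [? ?] := auv k; split=> //; lra.
have Vjump s t : a <= s -> s <= t -> t <= b -> `[s, t] `<=` U ->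
    V s + `|phi t - phi s| <= V t.
  move=> as_ st tb stU; rewrite -lerBrDr; apply: ge_sup; first by exists 0.
  move=> r [K [u [v [nov auv UU ->]]]]; rewrite lerBrDr; apply: ub_le_sup.
    by case: (hsE t tb).
  exists K.+1, (fun k => oapp u s (unlift ord0 k)), (fun k => oapp v t (unlift ord0 k)).
  split.
  - split; first by move=> k; case: (unliftP ord0 k) => [j _|_] //=; exact: nov.1.
    move=> k l; case: (unliftP ord0 k) => [i ->|->]; case: (unliftP ord0 l) => [j ->|->] //=.
    + move=> ij; apply: nov.2; apply: contra ij => /eqP -> //.
    + by move=> _; left; have [? ?] := auv i.
    + by move=> _; right; have [? ?] := auv j.
  - move=> k; case: (unliftP ord0 k) => [j _|_] //=.
    by have [? ?] := auv j; split => //; lra.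
  - by move=> k; case: (unliftP ord0 k) => [j _|_] /=.
  - rewrite big_ord_recl /= unlift_none /= addrC; congr (_ + _).
    by apply: eq_bigr => i _; rewrite liftK.
suff G : phi a - e * (b - a) - V b <= phi b.
  have : V b <= e by apply: ge_sup; [exists 0|move=> r; exact: Ee].
  lra.
(* Invariant: [phi] has dropped by at most [e] per unit of time plus the variation spent in [U]. Off
   the exceptional set the slope term pays for a step; at a point of it a whole interval lies in [U]
   and the growth of [V] pays. *)
apply: (@real_induction a b [set t | phi a - e * (t - a) - V t <= phi t]) => //.
- rewrite /= subrr mulr0 subr0 gerBl.
  by apply: ub_le_sup => //; case: (hsE a ab).
- move=> t /andP[at_ tb] /= Gt.
  have [Nt|Nt] := pselect ((N `|` [set a]) t).
    have /open_nbhs_nbhs/nbhs_ballP[r /= r0 rU] : open_nbhs t U by split => //; exact: NU.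
    exists (r / 2); first lra.
    move=> s /andP[ts sr] sb.
    have tsU : `[t, s] `<=` U.
      move=> x /=; rewrite in_itv /= => /andP[? ?]; apply: rU.
      rewrite /ball /= ltr_norml; apply/andP; split; lra.
    have := Vjump t s at_ ts sb tsU.
    have : phi t - phi s <= `|phi s - phi t| by rewrite distrC ler_norm.
    have : 0 <= e * (s - t) by apply: mulr_ge0; lra.
    lra.
  have atb : a <= t < b by rewrite at_.
  have [h h0 hH] := H t atb Nt e e0.
  exists h => // s /andP[ts sh] sb.
  have := hH (s - t); rewrite subrKC.
  have : V t <= V s by apply: Vmono.
  have -> : (0 <= s - t <= h) by apply/andP; split; lra.
  move=> ? /(_ isT); rewrite /=; lra.
- move=> t /andP[at_ tb] lim /=; rewrite leNgt; apply/negP => gap.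
  have gap' : 0 < phi a - e * (t - a) - V t - phi t by lra.
  have [h h0 hc] := @ACon_unif R^o a b phi ac _ gap'.
  case: (lim (Num.max a (t - h))) => [|r].
    by rewrite le_max lexx /= gt_max at_ /=; lra.
  rewrite gt_max /= => /andP[/andP[ar tr] rt] Gr.
  have at' : a <= t <= b by rewrite (ltW at_).
  have ar' : a <= r <= b by rewrite (ltW ar); lra.
  have := hc t r at' ar'; rewrite ger0_norm; last lra.
  have : phi r - phi t <= `|phi t - phi r| by rewrite distrC ler_norm.
  have : V r <= V t by apply: Vmono; lra.
  have : e * (r - a) <= e * (t - a) by rewrite ler_pM2l//; lra.
  rewrite ltrBlDr => V1 V2 V3 V4; have : t < h + r.
    by have : t - h < r by []; lra.
  move=> /V4; lra.
Qed.

End Monotone.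

(** * Sup norm of row vectors *)

Section RowVectors.
Context {R : realType}.

Lemma rV_norm_le n (x : 'rV[R]_n) r : 0 <= r -> (forall j, `|x 0 j| <= r) -> `|x| <= r.
Proof.
move=> r0 H; rewrite /Num.norm /= mx_normrE; apply/bigmax_leP; split => // -[i j] _ /=.
by rewrite (ord1 i).
Qed.

Lemma rV_coord_le n (x : 'rV[R]_n) j : `|x 0 j| <= `|x|.
Proof.
rewrite [leRHS]/Num.norm /= mx_normrE.
exact: (le_bigmax (0:R) (fun i : 'I_1 * 'I_n => `|x i.1 i.2|) (0, j)).
Qed.

Lemma rV_norm_lt n (x : 'rV[R]_n) r : 0 < r -> (forall j, `|x 0 j| < r) -> `|x| < r.
Proof.
move=> r0 H; rewrite /Num.norm /= mx_normrE; apply/bigmax_ltP; split => // -[i j] _ /=.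
by rewrite (ord1 i).
Qed.

End RowVectors.

(** * Curves: derivatives, absolute continuity, mean value inequality, Gronwall *)

Section Derivatives.
Context {R : realType}.

(** The form used in all later estimates: non-strict inequalities, with [h = 0] allowed. *)
Lemma is_derive_approx {V : normedModType R} (c : R -> V) (t : R) v : is_derive t 1 c v <->
  forall e : R, 0 < e -> exists2 d : R, 0 < d &
    forall h : R, `|h| <= d -> `|c (t + h) - c t - h *: v| <= e * `|h|.
Proof.
split.
- move=> [dc <-] e e0.
  have /cvgrPdist_le /(_ _ e0) := dc.
  rewrite near_withinE => /nbhs_ballP[d /= d0 H].
  exists (d / 2); first lra.
  move=> h hd; have [->|h0] := eqVneq h 0.
    by rewrite addr0 scale0r subr0 subrr !normr0 mulr0.
  have := H h; rewrite /ball /= sub0r normrN => /(_ _ h0).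
  have -> : `|h| < d by lra.
  move=> /(_ isT).
  have -> : 'D_1 c t - h^-1 *: ((c \o shift t) (h *: 1) - c t) =
            - (h^-1 *: (c (t + h) - c t - h *: 'D_1 c t)).
    rewrite /= [h *: 1]mulr1 [h + t]addrC [in RHS]scalerBr scalerA mulVf // scale1r.
    by rewrite opprB.
  by rewrite normrN normrZ normfV mulrC ler_pdivrMr ?normr_gt0.
- move=> H.
  have cv : h^-1 *: ((c \o shift t) (h *: 1) - c t) @[h --> 0^'] --> v.
    apply/cvgrPdist_le => e e0; have [d d0 Hd] := H e e0.
    rewrite near_withinE; apply/nbhs_ballP; exists d => //= h.
    rewrite /ball /= sub0r normrN => hd h0.
    have -> : v - h^-1 *: ((c \o shift t) (h *: 1) - c t) =
            - (h^-1 *: (c (t + h) - c t - h *: v)).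
      rewrite /= [h *: 1]mulr1 [h + t]addrC [in RHS]scalerBr scalerA mulVf // scale1r.
      by rewrite opprB.
    rewrite normrN normrZ normfV mulrC ler_pdivrMr ?normr_gt0 //.
    exact/Hd/ltW.
  split; [exact: cvgP cv|exact: cvg_lim cv].
Qed.

Lemma is_derive_coord n (c : R -> 'rV[R]_n) (t : R) v : is_derive t 1 c v <->
  forall j, is_derive t 1 (fun s => c s 0 j) (v 0 j).
Proof.
split.
- move=> /is_derive_approx H j; apply/(@is_derive_approx R^o) => e /H[d d0 Hd].
  exists d => // h /Hd; apply: le_trans.
  by apply: le_trans (rV_coord_le _ j); rewrite !mxE.
- move=> H; apply/is_derive_approx => e e0.
  have {}H j := (is_derive_approx _ _ _).1 (H j) e e0.
  have /choice[d Hd] : forall j, exists d, 0 < d /\ forall h, `|h| <= d ->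
      `|c (t + h) 0 j - c t 0 j - h *: v 0 j| <= e * `|h|.
    by move=> j; have [d d0 ?] := H j; exists d.
  exists (\big[Num.min/1]_j d j).
    by apply/bigmin_gtP; split => // j _; have [] := Hd j.
  move=> h /bigmin_geP[h1 hd]; apply: rV_norm_le; first by rewrite mulr_ge0 // ltW.
  by move=> j; rewrite !mxE; apply: (Hd j).2; apply: hd.
Qed.

Lemma is_derive_eq_itv {V : normedModType R} (c c' : R -> V) (a b t : R) v : a < t < b ->
  (forall s, a <= s <= b -> c s = c' s) -> is_derive t 1 c v -> is_derive t 1 c' v.
Proof.
move=> /andP[at_ tb] cc' /is_derive_approx H; apply/is_derive_approx => e /H[d d0 Hd].
exists (Num.min d (Num.min (t - a) (b - t))).
  by rewrite !lt_min d0 !subr_gt0 at_.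
move=> h; rewrite !le_min => /andP[hd]; rewrite !ler_norml => /andP[/andP[? ?] /andP[? ?]].
have e1 : c (t + h) = c' (t + h) by apply: cc'; apply/andP; split; lra.
have e2 : c t = c' t by apply: cc'; apply/andP; split; lra.
by rewrite -e1 -e2; apply: Hd.
Qed.

Lemma is_derive_shift_arg {V : normedModType R} (c : R -> V) (t0 t : R) v :
  is_derive (t - t0) 1 c v -> is_derive t 1 (fun s => c (s - t0)) v.
Proof.
move=> /is_derive_approx H; apply/is_derive_approx => e /H[d d0 Hd].
by exists d => // h /Hd; rewrite [t + h - t0]addrAC.
Qed.

Definition lips {V : normedModType R} (L a b : R) (c : R -> V) :=
  forall s t, a <= s <= b -> a <= t <= b -> `|c s - c t| <= L * `|s - t|.

Lemma lips_le {V : normedModType R} L a b (c : R -> V) : 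
  (forall s t, a <= s -> s <= t -> t <= b -> `|c t - c s| <= L * (t - s)) -> lips L a b c.
Proof.
move=> H s t /andP[as_ sb] /andP[at_ tb]; have [st|/ltW ts] := leP s t.
- by rewrite distrC [in leRHS]distrC ger0_norm ?subr_ge0 // H.
- by rewrite [in leRHS]ger0_norm ?subr_ge0 // H.
Qed.

Lemma lips_sub {V : normedModType R} L a b a' b' (c : R -> V) : a <= a' -> b' <= b ->
  lips L a b c -> lips L a' b' c.
Proof.
move=> aa bb l s t /andP[as_ sb] /andP[at_ tb].
by apply: l; rewrite ?(le_trans aa as_) ?(le_trans aa at_) /= ?(le_trans sb bb) ?(le_trans tb bb).
Qed.

Lemma lips_AC {V : normedModType R} L a b (c : R -> V) : lips L a b c -> ACon a b c.
Proof.
move=> H e e0; exists (e / (`|L| + 1)); split; first by rewrite divr_gt0// ltr_wpDl.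
move=> K u v uv nov; rewrite ltr_pdivlMr ?ltr_wpDl // => S.
apply: le_lt_trans S; rewrite mulr_suml; apply: ler_sum => k _.
have [? [? ?]] := uv k.
have -> : v k - u k = `|v k - u k| by rewrite ger0_norm // subr_ge0.
apply: le_trans (H _ _ _ _) _; [by apply/andP; split; lra|by apply/andP; split; lra|].
rewrite mulrC ler_wpM2l //; apply: le_trans (ler_norm _) _; lra.
Qed.

Lemma ACon_coord n a b (c : R -> 'rV[R]_n) j : ACon a b c -> @ACon R R^o a b (fun s => c s 0 j).
Proof.
move=> H e /H[d [d0 Hd]]; exists d; split => // K u v uv nov S.
apply: le_lt_trans (Hd K u v uv nov S); apply: ler_sum => k _.
by apply: le_trans (rV_coord_le _ j); rewrite !mxE.
Qed.

Lemma AConD {V : normedModType R} a b (c c' : R -> V) : ACon a b c -> ACon a b c' ->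
  ACon a b (fun s => c s + c' s).
Proof.
move=> H H' e e0; have e2 : 0 < e / 2 by lra.
have [d [d0 Hd]] := H _ e2; have [d' [d0' Hd']] := H' _ e2.
exists (Num.min d d'); rewrite lt_min d0; split => // K u v uv nov.
rewrite lt_min => /andP[S S']; rewrite [e]splitr.
apply: le_lt_trans (ltrD (Hd K u v uv nov S) (Hd' K u v uv nov S')).
rewrite -big_split; apply: ler_sum => k _ /=.
by rewrite opprD addrACA ler_normD.
Qed.

Lemma AConN {V : normedModType R} a b (c : R -> V) : ACon a b c -> ACon a b (fun s => - c s).
Proof.
move=> H e /H[d [d0 Hd]]; exists d; split => // K u v uv nov S.
apply: le_lt_trans (Hd K u v uv nov S); apply: ler_sum => k _.
by rewrite -opprD normrN.
Qed.

Lemma AConB {V : normedModType R} a b (c c' : R -> V) : ACon a b c -> ACon a b c' ->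
  ACon a b (fun s => c s - c' s).
Proof. by move=> ? ?; apply: AConD => //; exact: AConN. Qed.

Lemma ACon_sub {V : normedModType R} a b a' b' (c : R -> V) : a <= a' -> b' <= b ->
  ACon a b c -> ACon a' b' c.
Proof.
move=> aa bb H e /H[d [d0 Hd]]; exists d; split => // K u v uv nov S.
by apply: Hd => // k; have [? [? ?]] := uv k; repeat split; lra.
Qed.

(** For [|s| <= 1] the function [s * c_j + psi] has a nonnegative derivative almost everywhere, so
    it grows by [AC_ge]; the values [s = 1] and [s = -1] bound the increment of each coordinate,
    which is enough for the sup norm. *)
Lemma AC_mean_value n (c : R -> 'rV[R]_n) (psi : R -> R) (a b : R) N : a <= b ->
  ACon a b c -> @ACon R R^o a b psi -> null N ->
  (forall t, a < t < b -> ~ N t -> exists v w,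
     [/\ is_derive t 1 c v, is_derive t 1 (psi : R -> R^o) w & `|v| <= w]) ->
  `|c b - c a| <= psi b - psi a.
Proof.
move=> ab acc acp nN H.
have key (s : R) j : `|s| <= 1 -> s * c a 0 j + psi a <= s * c b 0 j + psi b.
  move=> s1.
  have acs : @ACon R R^o a b (fun t => s * c t 0 j).
    move=> e /(ACon_coord j acc)[d [d0 Hd]]; exists d; split => // K u v uv nov S.
    apply: le_lt_trans (Hd K u v uv nov S); apply: ler_sum => k _.
    by rewrite -mulrBr normrM ler_piMl.
  apply: (@AC_ge _ (fun t => s * c t 0 j + psi t) a b N) => //.
    exact: (@AConD R^o).
  move=> t tab Nt e e0; have [v [w [/is_derive_coord/(_ j) dc dp vw]]] := H t tab Nt.
  have : is_derive t 1 ((fun t => s *: (c t 0 j : R^o) + psi t) : R -> R^o) (s *: v 0 j + w).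
    exact: is_deriveD.
  move=> /is_derive_approx/(_ e e0)[d d0 Hd]; exists d => // h /andP[h0 hd].
  have := Hd h; rewrite ger0_norm // => /(_ hd); rewrite ler_norml => /andP[+ _].
  have : 0 <= h * (s * v 0 j + w).
    apply: mulr_ge0 => //; have : `|s * v 0 j| <= w.
      by apply: le_trans vw; apply: le_trans (rV_coord_le v j); rewrite normrM ler_piMl.
    by rewrite ler_norml => /andP[? _]; lra.
  rewrite /GRing.scale /=; lra.
have pp : 0 <= psi b - psi a.
  rewrite subr_ge0; apply: (@AC_ge _ psi a b N) => //.
  move=> t tab Nt e e0; have [v [w [_ /is_derive_approx/(_ e e0)[d d0 Hd] vw]]] := H t tab Nt.
  exists d => // h /andP[h0 hd].
  have := Hd h; rewrite ger0_norm // => /(_ hd); rewrite ler_norml => /andP[+ _].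
  have : 0 <= h * w by apply: mulr_ge0 => //; exact: le_trans vw.
  rewrite /GRing.scale /=; lra.
apply: rV_norm_le => // j; rewrite !mxE ler_norml.
have := key 1 j; have := key (-1) j; rewrite normrN normr1 lexx => /(_ isT) ? /(_ isT) ?.
apply/andP; split; lra.
Qed.

Lemma AC_lips n (c : R -> 'rV[R]_n) (M a b : R) N : 0 <= M -> ACon a b c -> null N ->
  (forall t, a < t < b -> ~ N t -> exists2 v, is_derive t 1 c v & `|v| <= M) ->
  lips M a b c.
Proof.
move=> M0 acc nN H; apply: lips_le => s t as_ st tb.
have lin : @lips R^o M s t (fun r => M * r).
  by move=> x y _ _; rewrite -mulrBr normrM (ger0_norm M0).
have := @AC_mean_value n c (fun r => M * r) s t N st _ (lips_AC lin) nN.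
rewrite -mulrBr; apply; first exact: ACon_sub acc.
move=> r /andP[sr rt] Nr; have [|v dv vM] := H r _ Nr; first by apply/andP; split; lra.
exists v, M; split => //.
have : is_derive r 1 (fun r : R => M *: (r : R^o)) (M *: 1) by exact: is_deriveZ.
by rewrite [_ *: 1]mulr1.
Qed.

(** Bielecki's weight. Its derivative is [2 * L] times itself, so that integrating [L * expw] costs
    only half of the weight: this is the contraction factor in Gronwall's inequality and in the
    Picard iteration. *)
Definition expw (L a t : R) : R := expR (2 * L * (t - a)).

Lemma expw_gt0 L a t : 0 < expw L a t. Proof. exact: expR_gt0. Qed.

Lemma expw_ge1 L a t : 0 <= L -> a <= t -> 1 <= expw L a t.
Proof. by move=> L0 at_; rewrite -expR0 ler_expR !mulr_ge0 // subr_ge0. Qed.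

Lemma expw_mono L a s t : 0 <= L -> s <= t -> expw L a s <= expw L a t.
Proof. by move=> L0 st; rewrite ler_expR ler_wpM2l ?mulr_ge0 //; lra. Qed.

Lemma is_derive_expw (L a t : R) : is_derive t (1:R) (expw L a : R -> R^o) (2 * L * expw L a t).
Proof.
have d1 : is_derive t 1 (fun t : R => (2 * L) *: (t - a : R^o)) ((2 * L) *: (1 - 0)).
  by apply: is_deriveZ.
have := @is_derive1_comp R expR (fun t : R => 2 * L * (t - a)) t _ _ (is_derive_expR _) d1.
move=> D; apply: (is_derive_eq D).
by rewrite subr0 [_ *: 1]mulr1 mulrC.
Qed.

Lemma lips_expw L a b : 0 <= L -> @lips R^o (2 * L * expw L a b) a b (expw L a).
Proof.
move=> L0; apply: lips_le => s t as_ st tb.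
have Ec : {within `[s, t], continuous (expw L a)}.
  apply: continuous_subspaceT => x; apply: differentiable_continuous.
  by apply/derivable1_diffP; case: (is_derive_expw L a x).
have [x] := @MVT_segment R (expw L a) (fun t => 2 * L * expw L a t) s t st
  (fun x _ => is_derive_expw L a x) Ec.
rewrite in_itv /= => /andP[sx xt] ->; rewrite normrM.
rewrite [X in _ * X]ger0_norm ?subr_ge0 // ler_wpM2r ?subr_ge0 //.
rewrite ger0_norm; last by rewrite !mulr_ge0 // ltW // expw_gt0.
by rewrite ler_wpM2l ?mulr_ge0 //; apply: expw_mono => //; lra.
Qed.

(* The constant [2 e^{2L(b-a)}] comes from the sup of [|c t| e^{-2L(t-a)}], which the
   differential inequality bounds by half of itself plus the data. *)
Lemma gronwall n (c : R -> 'rV[R]_n) (M L e a b : R) N : 0 <= L -> 0 <= e -> a <= b ->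
  lips M a b c -> null N ->
  (forall t, a < t < b -> ~ N t -> exists2 v, is_derive t 1 c v & `|v| <= L * `|c t| + e) ->
  forall t, a <= t <= b -> `|c t| <= 2 * expR (2 * L * (b - a)) * (`|c a| + e * (b - a)).
Proof.
move=> L0 e0 ab lc nN H.
pose E := expw L a.
have E1 t : a <= t -> 1 <= E t by exact: expw_ge1.
have Ep t : 0 < E t := expw_gt0 _ _ _.
have Emono s t : s <= t -> E s <= E t by exact: expw_mono.
have dE (t : R) : is_derive t 1 (E : R -> R^o) (2 * L * E t) := is_derive_expw _ _ _.
have lipE : @lips R^o (2 * L * E b) a b E by exact: lips_expw.
pose S := [set r | exists2 t, a <= t <= b & r = `|c t| / E t].
have Sub : has_ubound S.
  exists (`|c a| + `|M| * (b - a)) => _ [t /andP[at_ tb] ->].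
  rewrite ler_pdivrMr //; apply: (@le_trans _ _ (`|c a| + `|M| * (b - a))); last first.
    by rewrite ler_peMr ?E1 // addr_ge0 // mulr_ge0 // subr_ge0.
  have -> : c t = c a + (c t - c a) by rewrite addrC subrK.
  apply: le_trans (ler_normD _ _) _; rewrite lerD2l.
  apply: (le_trans (lc _ _ _ _)); rewrite ?at_ ?lexx ?tb //.
  rewrite (ger0_norm (_ : 0 <= t - a)) ?subr_ge0 //.
  apply: (@le_trans _ _ (`|M| * (t - a))).
    by rewrite ler_wpM2r ?subr_ge0 // ler_norm.
  by rewrite ler_wpM2l //; lra.
pose A := sup S.
have cA t : a <= t <= b -> `|c t| <= A * E t.
  by move=> tab; rewrite -ler_pdivrMr //; apply: ub_le_sup => //; exists t.
have A0 : 0 <= A.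
  apply: le_trans (_ : `|c a| / E a <= A); first by rewrite divr_ge0 // ltW.
  by apply: ub_le_sup => //; exists a; rewrite ?lexx ?ab.
have main t : a <= t <= b -> `|c t| <= `|c a| + A / 2 * E t + e * (b - a).
  move=> /andP[at_ tb].
  pose psi r := (A / 2) * E r + e * r.
  have : `|c t - c a| <= psi t - psi a.
    apply: (@AC_mean_value n c psi a t N) => //.
    - by apply: lips_AC => x y /andP[? ?] /andP[? ?]; apply: lc; apply/andP; split; lra.
    - have l1 : @lips R^o (A / 2 * (2 * L * E b)) a t (fun r => A / 2 * E r).
        move=> x y /andP[? ?] /andP[? ?]; rewrite -mulrBr normrM ger0_norm; last lra.
        by rewrite -[leRHS]mulrA ler_wpM2l ?lipE //; [lra|apply/andP; split; lra|apply/andP; split; lra].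
      have l2 : @lips R^o e a t (fun r => e * r).
        by move=> x y _ _; rewrite -mulrBr normrM (ger0_norm e0).
      exact: (@AConD R^o _ _ _ _ (lips_AC l1) (lips_AC l2)).
    - move=> r /andP[ar rt] Nr; have [|v dv vM] := H r _ Nr; first by apply/andP; split; lra.
      exists v, ((A / 2) * (2 * L * E r) + e); split => //.
      + have : is_derive r 1 (fun r : R => (A / 2) *: (E r : R^o) + e *: (r : R^o))
          ((A / 2) *: (2 * L * E r) + e *: 1).
          by apply: is_deriveD; apply: is_deriveZ.
        by rewrite [e *: 1]mulr1.
      + apply: le_trans vM _; rewrite lerD2r.
        have -> : A / 2 * (2 * L * E r) = L * (A * E r) by field.
        by rewrite ler_wpM2l // cA //; apply/andP; split; lra.
  have -> : psi t - psi a = A / 2 * E t - A / 2 * E a + e * (t - a) by rewrite /psi; ring.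
  have : 0 <= A / 2 * E a by apply: mulr_ge0; [lra|exact: ltW].
  have : e * (t - a) <= e * (b - a) by rewrite ler_wpM2l //; lra.
  have : `|c t| <= `|c a| + `|c t - c a|.
    by rewrite -{1}(subrK (c a) (c t)) addrC ler_normD.
  lra.
have AA : A <= `|c a| + A / 2 + e * (b - a).
  apply: ge_sup; first by exists (`|c a| / E a), a; rewrite ?lexx ?ab.
  move=> _ [t tab ->]; rewrite ler_pdivrMr //.
  apply: le_trans (main t tab) _.
  have : 0 <= `|c a| + e * (b - a) by rewrite addr_ge0 // mulr_ge0 // subr_ge0.
  have : 1 <= E t by apply: E1; case/andP: tab.
  by move=> E1' P0; have := ler_peMr P0 E1'; lra.
move=> t tab; apply: le_trans (cA t tab) _.
have E2 : E t <= expR (2 * L * (b - a)) by apply: Emono; case/andP: tab.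
have A2 : A <= 2 * (`|c a| + e * (b - a)) by lra.
apply: le_trans (_ : 2 * (`|c a| + e * (b - a)) * expR (2 * L * (b - a)) <= _).
  apply: ler_pM => //; exact: ltW.
by rewrite -!mulrA [X in _ * X]mulrC.
Qed.

End Derivatives.

(** * Integrals and Caratheodory equations *)

Section NullSets.
Context {R : realType}.

(** The push-forward of the Lebesgue measure under a translation gives half-open intervals their
    length, hence is the Lebesgue measure by uniqueness. Reflections are treated alike. *)
Lemma null_shift (N : set R) (t0 : R) : null N -> null [set t | N (t - t0)].
Proof.
move=> [A [mA A0 NA]].
have mf : measurable_fun [set: measurableTypeR R] (fun t : R => t - t0 : measurableTypeR R).
  by apply: measurable_funB => //; exact: measurable_id.
exists ((fun t => t - t0) @^-1` A); split; last by move=> t /NA.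
  by rewrite -[X in measurable X]setTI; exact: mf.
pose nu := measure_function_pushforward__canonical__measure_function_Measure
   (@lebesgue_measure R) mf.
have := @lebesgue_measure_unique R nu _ A mA; rewrite /= /pushforward => <- //.
move=> X [[x y] _ <-] /=; rewrite /pushforward /=.
have -> : (fun t : R => t - t0) @^-1` `]x, y] = `]x + t0, y + t0]%classic.
  by apply/seteqP; split => t /=; rewrite !in_itv /= => /andP[? ?]; apply/andP; split; lra.
by rewrite !lebesgue_measure_itv /= !lte_fin ltrD2r -!EFinB; case: ifP => // _;
  congr (_%:E); ring.
Qed.


Lemma null_reflect (N : set R) (t0 : R) : null N -> null [set t | N (t0 - t)].
Proof.
move=> [A [mA A0 NA]].
have mf : measurable_fun [set: measurableTypeR R] (fun t : R => t0 - t : measurableTypeR R).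
  by apply: measurable_funB => //; exact: measurable_id.
exists ((fun t => t0 - t) @^-1` A); split; last by move=> t /NA.
  by rewrite -[X in measurable X]setTI; exact: mf.
pose nu := measure_function_pushforward__canonical__measure_function_Measure
   (@lebesgue_measure R) mf.
have := @lebesgue_measure_unique R nu _ A mA; rewrite /= /pushforward => <- //.
move=> X [[x y] _ <-] /=; rewrite /pushforward /=.
have -> : (fun t : R => t0 - t) @^-1` `]x, y] = `[t0 - y, t0 - x[%classic.
  by apply/seteqP; split => t /=; rewrite !in_itv /= => /andP[? ?]; apply/andP; split; lra.
rewrite !lebesgue_measure_itv /= !lte_fin ltrD2l ltrN2 -!EFinB; case: ifP => // _.
by congr (_%:E); ring.
Qed.

Import HBNNSimple.

Local Notation mu := (@lebesgue_measure R).
Local Notation nnint f := (ereal_sup [set sintegral mu h |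
  h in [set h : {nnsfun (measurableTypeR R) >-> R} | forall x, ((h x)%:E <= f x)%E]]).

(** Measurability of the integrands is not assumed, so the comparison is made on the simple
    functions below [f]: restricting one to the complement of [A] keeps its integral and puts it
    below [g]. *)
Lemma nnintegral_ae_le (f g : R -> \bar R) (A : set R) :
  measurable A -> mu A = 0%E -> (forall x, (0 <= g x)%E) ->
  (forall x, ~ A x -> f x = g x) -> (nnint f <= nnint g)%E.
Proof.
move=> mA A0 g0 fg.
apply: ge_ereal_sup => _ [h hf <-].
have mAc : measurable (~` A) by exact: measurableC.
have e1 : (\int[mu]_x (EFin \o h) x = \int[mu]_(x in setT `\` A) (EFin \o h) x)%E.
  apply: ge0_negligible_integral => //.
    exact/measurable_EFinP.
  by move=> x _; rewrite lee_fin.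
have e3 := integral_nnsfun mu mAc h.
have e4 : sintegral mu h = sintegral mu (h \_ (~` A)).
  by rewrite -integral_nnsfun// -setTD -e1 integralT_nnsfun.
rewrite e4 (mrestrict h mAc); apply: ereal_sup_ubound; exists (proj_nnsfun h mAc) => //= x.
rewrite mindicE; case: (boolP (x \in ~` A)) => [/set_mem Ax|_]; last by rewrite mulr0.
by rewrite mulr1 -fg.
Qed.

Lemma integral_ae_eq (D : set R) (f g : R -> \bar R) (A : set R) :
  measurable A -> mu A = 0%E -> (forall x, D x -> ~ A x -> f x = g x) ->
  (\int[mu]_(x in D) f x = \int[mu]_(x in D) g x)%E.
Proof.
move=> mA A0 fg; rewrite /integral.
have fgD x : ~ A x -> (f \_ D) x = (g \_ D) x.
  by move=> Ax; rewrite /patch; case: ifPn => // /set_mem Dx; exact: fg.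
congr (_ - _)%E; apply/le_anti/andP; split; apply: (@nnintegral_ae_le _ _ A) => //;
  try (by move=> x; rewrite ?funepos_ge0 ?funeneg_ge0);
  by move=> x Ax; rewrite ?funepos.unlock ?funeneg.unlock fgD.
Qed.

End NullSets.

(** * Primitives of bounded measurable functions *)

Section Primitives.
Context {R : realType}.
Local Notation mu := (@lebesgue_measure R).

(** The integrand is cut off to [[a, b]] and integrated from [-oo], the form in which the
    fundamental theorem of calculus applies; the cut-off makes the primitive vanish at [a]. *)
Lemma scalar_primitive (h : R -> R) (M a b : R) : a <= b -> 0 <= M ->
  measurable_fun setT h -> (forall s, a <= s <= b -> `|h s| <= M) ->
  exists2 H : R -> R, @lips R R^o M a b H /\
     (forall t, a <= t <= b -> H t = Rintegral mu `[a, t] h) &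
     exists2 N, null N & forall t, a < t < b -> ~ N t -> is_derive t (1:R) (H : R -> R^o) (h t).
Proof.
move=> ab M0 mh hM.
pose f := h \_ `[a, b].
have mf : measurable_fun setT f by apply/measurable_restrict => //; exact: measurable_funS mh.
have fM x : `|f x| <= M.
  rewrite /f /patch; case: ifPn => [/set_mem /=|_]; last by rewrite normr0.
  by rewrite in_itv /= => /hM.
have intab : mu.-integrable `[a, b] (EFin \o h).
  apply: measurable_bounded_integrable => //.
  - by rewrite /= lebesgue_measure_itv /=; case: ifP => // _; rewrite -EFinB ltry.
  - exact: measurable_funS mh.
  - exists M; split; first exact: num_real.
    by move=> x Mx y /=; rewrite in_itv /= => /hM /le_trans; apply; exact: ltW.
have intf : mu.-integrable setT (EFin \o f).
  by rewrite -restrict_EFin; apply/(integrable_mkcond _ _).1.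
have int_all (D : set R) : measurable D -> mu.-integrable D (EFin \o f).
  by move=> mD; apply: integrableS intf.
have locf : locally_integrable setT f by apply: integrable_locally.
have := @FTC1Ny R f (fun y => int_all _ (measurable_itv _)) locf.
set H := fun x => _ => /= -[N0 [mN0 N00 HN]].
exists H; last first.
  exists N0; first by exists N0; split.
  move=> t /andP[at_ tb] Nt.
  have [d1 d2] : derivable H t 1 /\ derive1 H t = f t.
    by apply: contrapT => C; apply: Nt; apply: HN.
  have ft : f t = h t by rewrite /f /patch mem_set//= in_itv /= !ltW.
  by rewrite -ft -d2 derive1E; apply: DeriveDef.
have diff s t : s <= t -> H t - H s = \int[mu]_(x in `]s, t]) f x.
  by move=> st; apply: Rintegral_itvB => //; exact: int_all.
split.
- apply: lips_le => s t as_ st tb.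
  rewrite diff //; apply: le_trans (le_normr_Rintegral _ _) _ => //; first exact: int_all.
  apply: le_trans (_ : \int[mu]_(x in `]s, t]) M <= _).
    apply: le_Rintegral => //.
    - exact: (integrable_norm (int_all _ _)).
    - apply: measurable_bounded_integrable => //.
      + by rewrite /= lebesgue_measure_itv /=; case: ifP => // _; rewrite -EFinB ltry.
      + exists M; split; first exact: num_real.
        by move=> x Mx y _ /=; rewrite (ger0_norm M0) ltW.
  rewrite Rintegral_cst //= lebesgue_measure_itv /= lte_fin.
  by case: ltP => // ts; rewrite /= mulr0 mulr_ge0 // subr_ge0.
- move=> t /andP[at_ tb].
  have -> : H t = H a + \int[mu]_(x in `]a, t]) f x by rewrite -diff // addrC subrK.
  have -> : H a = 0.
    rewrite /H (_ : Rintegral _ _ _ = \int[mu]_(x in `]-oo, a]) 0).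
      by rewrite Rintegral_cst // mul0r.
    congr (fine _); apply: (@integral_ae_eq R _ _ _ [set a]) => //.
      by rewrite lebesgue_measure_set1.
    move=> x /=; rewrite in_itv /= => xa /eqP xna; rewrite /f /patch.
    case: ifPn => // /set_mem /=; rewrite in_itv /= => /andP[ax _].
    by move: xna; rewrite eq_le xa ax.
  rewrite add0r.
  have -> : \int[mu]_(x in `[a, t]) h x = \int[mu]_(x in `]a, t]) h x.
    apply/esym/Rintegral_itv_obnd_cbnd; apply: integrableS intab => // x /=.
    by rewrite !in_itv /= => /andP[? ?]; apply/andP; split; lra.
  apply: eq_Rintegral => x /set_mem /=; rewrite in_itv /= => /andP[ax xt].
  by rewrite /f /patch mem_set //= in_itv /=; apply/andP; split; lra.
Qed.

End Primitives.

(** * Successive approximations for Caratheodory equations *)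

Section Picard.
Context {R : realType}.

Lemma maxr_lip (c a b : R) : `|Num.max c a - Num.max c b| <= `|a - b|.
Proof.
wlog ab : a b / a <= b.
  by move=> H; have [/H//|/ltW/H] := leP a b; rewrite distrC (distrC b).
rewrite distrC (distrC a) !ger0_norm ?subr_ge0 //; last by rewrite ge_max !le_max lexx ab orbT.
by rewrite lerBlDr addr_maxr ge_max !le_max subrK lexx orbT andbT lerDr subr_ge0 ab.
Qed.

Lemma minr_lip (c a b : R) : `|Num.min c a - Num.min c b| <= `|a - b|.
Proof.
wlog ab : a b / a <= b.
  by move=> H; have [/H//|/ltW/H] := leP a b; rewrite distrC (distrC b).
rewrite distrC (distrC a) !ger0_norm ?subr_ge0 //; last by rewrite le_min !ge_min lexx ab orbT.
by rewrite lerBlDr addr_minr le_min !ge_min subrK lexx orbT andbT lerDr subr_ge0 ab.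
Qed.

(** Projection onto [[a, b]]. Composing with it turns data known on an interval into total data
    without losing Lipschitz bounds. *)
Definition clampR (a b t : R) : R := Num.max a (Num.min t b).

Lemma clampR_in a b t : a <= b -> a <= clampR a b t <= b.
Proof. by move=> ab; rewrite /clampR le_max lexx ge_max ab ge_min lexx orbT. Qed.

Lemma clampR_id a b t : a <= t <= b -> clampR a b t = t.
Proof. by move=> /andP[at_ tb]; rewrite /clampR min_l // max_r. Qed.

Lemma clampR_lip a b s t : a <= b -> `|clampR a b s - clampR a b t| <= `|s - t|.
Proof.
move=> _; apply: le_trans (maxr_lip _ _ _) _; rewrite (minC s) (minC t); exact: minr_lip.
Qed.

Lemma lips_continuous {T V : normedModType R} L (c : T -> V) :
  (forall s t, `|c s - c t| <= L * `|s - t|) -> continuous c.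
Proof.
move=> H t; apply/cvgrPdist_le => e e0.
have L1 : 0 < `|L| + 1 by rewrite ltr_wpDl.
apply/nbhs_ballP; exists (e / (`|L| + 1)); first by rewrite /= divr_gt0.
move=> s /=; rewrite -ball_normE /= => /ltW; rewrite ler_pdivlMr // => st.
apply: le_trans st; apply: le_trans (H _ _) _; rewrite mulrC ler_wpM2l //.
by apply: le_trans (ler_norm _) _; lra.
Qed.

Lemma lips_clamp_continuous {V : normedModType R} L a b (c : R -> V) : a <= b ->
  lips L a b c -> continuous (c \o clampR a b).
Proof.
move=> ab H; apply: (@lips_continuous R^o V `|L|) => s t /=.
apply: le_trans (H _ _ (clampR_in _ ab) (clampR_in _ ab)) _.
apply: le_trans (_ : `|L| * `|clampR a b s - clampR a b t| <= _).
  by rewrite ler_wpM2r // ler_norm.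
by rewrite ler_wpM2l // clampR_lip.
Qed.

Lemma null_bigcup n (N : 'I_n -> set R) : (forall j, null (N j)) ->
  null (\bigcup_(j in [set: 'I_n]) N j).
Proof.
move=> nN; pose N' (k : nat) := if insub k is Some j then N j else set0.
apply: (@nullS R _ (\bigcup_k N' k)).
  by move=> t [j _ Nt]; exists j => //; rewrite /N' valK.
apply: negligible_bigcup => k; rewrite /N'; case: insub => [j|]; first exact: nN.
exact: negligible_set0.
Qed.


Lemma vector_primitive n (h : R -> 'rV[R]_n) (M a b : R) : a <= b -> 0 <= M ->
  (forall j, measurable_fun setT (fun s => h s 0 j)) ->
  (forall s, a <= s <= b -> `|h s| <= M) ->
  exists2 H : R -> 'rV[R]_n, lips M a b H /\ H a = 0 &
    exists2 N, null N & forall t, a < t < b -> ~ N t -> is_derive t (1:R) H (h t).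
Proof.
move=> ab M0 mh hM.
have /choice[H] : forall j, exists Hj : R -> R, @lips R R^o M a b Hj /\
  exists2 N, null N & forall t, a < t < b -> ~ N t -> is_derive t (1:R) (Hj : R -> R^o) (h t 0 j).
  move=> j; have [|Hj [? _] ?] := @scalar_primitive R (fun s => h s 0 j) M a b ab M0 (mh j).
    by move=> s /hM; apply: le_trans; exact: rV_coord_le.
  by exists Hj.
move=> HH; have /choice[N HN] : forall j, exists N, null N /\
    forall t, a < t < b -> ~ N t -> is_derive t (1:R) (H j : R -> R^o) (h t 0 j).
  by move=> j; have [_ [N ? ?]] := HH j; exists N.
have nN : null (\bigcup_(j in [set: 'I_n]) N j).
  by apply: null_bigcup => j; case: (HN j).
exists (fun t => \row_j (H j t - H j a)).
  split; last by apply/rowP => j; rewrite !mxE subrr.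
  move=> s t st tt; apply: rV_norm_le; first by rewrite mulr_ge0.
  by move=> j; rewrite !mxE opprB addrA subrK; exact: (HH j).1.
exists (\bigcup_(j in [set: 'I_n]) N j) => // t tab Nt; apply/is_derive_coord => j.
have -> : (fun s => (\row_j0 (H j0 s - H j0 a)) 0 j) = (fun s => H j s - H j a).
  by apply/funext => s; rewrite mxE.
rewrite -[h t 0 j]subr0; apply: is_deriveB.
by apply: (HN j).2 => // Nj; apply: Nt; exists j.
Qed.

Lemma geom_small (C e : R) : 0 < e -> exists k : nat, C / 2 ^+ k < e.
Proof.
move=> e0; exists (Num.bound (`|C| / e)).
have ke : `|C| / e < (Num.bound (`|C| / e))%:R.
  by rewrite archi_boundP // divr_ge0 // ltW.
rewrite ltr_pdivrMr ?exprn_gt0 //.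
apply: le_lt_trans (ler_norm _) _; move: ke; rewrite ltr_pdivrMr // => ke.
apply: lt_le_trans ke _; rewrite mulrC ler_wpM2l //; first exact: ltW.
by rewrite -natrX ler_nat ltnW // ltn_expl.
Qed.

Lemma le_geom (x y C : R) : (forall k : nat, x <= y + C / 2 ^+ k) -> x <= y.
Proof.
move=> H; apply/ler_addgt0Pr => e e0.
have [k /ltW ke] := geom_small C e0.
by apply: le_trans (H k) _; rewrite lerD2l.
Qed.

Lemma geom_limit {V : completeNormedModType R} (x : nat -> V) K :
  (forall k, `|x k.+1 - x k| <= K / 2 ^+ k) ->
  exists l, forall k, `|x k - l| <= 2 * K / 2 ^+ k.
Proof.
move=> H.
have K0 : 0 <= K by have := H 0%N; rewrite expr0 divr1; apply: le_trans.
have main k m : `|x k - x (m + k)%N| <= 2 * K / 2 ^+ k - 2 * K / 2 ^+ (m + k).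
  elim: m => [|m IH]; first by rewrite add0n !subrr normr0.
  have -> : x k - x (m.+1 + k)%N = (x k - x (m + k)%N) - (x (m + k).+1 - x (m + k)%N).
    by rewrite opprB addrA subrK.
  apply: le_trans (ler_normB _ _) _.
  have := H (m + k)%N; rewrite addSn exprS.
  set u := 2 ^+ (m + k); have u0 : u != 0 by rewrite /u expf_neq0.
  have -> : 2 * K / (2 * u) = K / u by field; rewrite u0.
  move: IH; have -> : 2 * K / u = K / u + K / u by field; rewrite u0.
  lra.
have le2 k m : `|x k - x (m + k)%N| <= 2 * K / 2 ^+ k.
  apply: le_trans (main k m) _; rewrite gerBl divr_ge0 //; first by rewrite mulr_ge0.
have : cvgn x.
  apply: cauchy_cvg; apply: cauchy_exP => e e0.
  have [k ke] := geom_small (2 * K) e0.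
  exists (x k), k => // m /= km; rewrite -ball_normE /=.
  by apply: le_lt_trans ke; rewrite -(subnK km); exact: le2.
move=> /cvg_ex[l xl]; exists l => k; apply/ler_addgt0Pr => e e0.
have /cvgrPdist_le/(_ _ e0)[m _ Hm] := xl.
have := Hm (m + k)%N (leq_addr _ _).
have := le2 k m.
have -> : x k - l = (x k - x (m + k)%N) - (l - x (m + k)%N) by rewrite opprB addrA subrK.
by move=> h1 h2; apply: le_trans (ler_normB _ _) _; exact: lerD.
Qed.

Lemma geom_limit_rV n (x : nat -> 'rV[R]_n) K :
  (forall k, `|x k.+1 - x k| <= K / 2 ^+ k) ->
  exists l, forall k, `|x k - l| <= 2 * K / 2 ^+ k.
Proof.
move=> H; have K0 : 0 <= K by have := H 0%N; rewrite expr0 divr1; apply: le_trans.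
have /choice[l Hl] : forall j, exists l : R, forall k, `|x k 0 j - l| <= 2 * K / 2 ^+ k.
  move=> j; apply: (@geom_limit R^o) => k; apply: le_trans (H k).
  by apply: le_trans (rV_coord_le _ j); rewrite !mxE.
exists (\row_j l j) => k; apply: rV_norm_le; first by rewrite divr_ge0 // mulr_ge0.
by move=> j; rewrite !mxE.
Qed.

Lemma lips_mulr (K a b k : R) (f : R -> R) :
  @lips R R^o K a b f -> @lips R R^o (`|k| * K) a b (fun s => k * f s).
Proof. by move=> H s t sab tab; rewrite -mulrBr normrM -mulrA ler_wpM2l // H. Qed.

Lemma is_derive_scale (k : R) (f : R -> R) (t v : R) :
  is_derive t (1:R) (f : R -> R^o) v -> is_derive t (1:R) (fun s => k * f s : R^o) (k * v).
Proof. by move=> H; have : is_derive t 1 (k *: (f : R -> R^o)) (k *: v) by apply: is_deriveZ. Qed.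

(** Measured with the weight [expw], each iteration halves the increment, which gives the geometric
    bound [D] and a limit on the whole interval at once, without restricting its length. *)
Lemma picard n (G : R -> 'rV[R]_n -> 'rV[R]_n) (L M a b : R) (x0 : 'rV[R]_n) :
  0 <= L -> 0 <= M -> a <= b ->
  (forall t x x', `|G t x - G t x'| <= L * `|x - x'|) ->
  (forall t, `|G t 0| <= M) ->
  (forall c : R -> 'rV[R]_n, continuous c ->
     forall j, measurable_fun setT (fun t => G t (c t) 0 j)) ->
  exists c : R -> 'rV[R]_n, exists M' : R, [/\ 0 <= M', lips M' a b c, c a = x0 &
    exists2 N, null N & forall t, a < t < b -> ~ N t -> is_derive t (1:R) c (G t (c t))].
Proof.
move=> L0 M0 ab lipG boundG measG.
have growG t x : `|G t x| <= M + L * `|x|.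
  have -> : G t x = G t 0 + (G t x - G t 0) by rewrite addrC subrK.
  apply: le_trans (ler_normD _ _) _; apply: lerD => //.
  by apply: le_trans (lipG _ _ _) _; rewrite subr0.
have lips_bound K (c : R -> 'rV[R]_n) : 0 <= K -> lips K a b c ->
    forall t, a <= t <= b -> `|c t| <= `|c a| + K * (b - a).
  move=> K0 lc t /andP[at_ tb]; have -> : c t = c a + (c t - c a) by rewrite addrC subrK.
  apply: le_trans (ler_normD _ _) _; rewrite lerD2l.
  apply: le_trans (lc _ _ _ _) _; rewrite ?at_ ?lexx //.
  by rewrite ger0_norm ?subr_ge0 // ler_wpM2l //; lra.
have step (c : R -> 'rV[R]_n) K : 0 <= K -> lips K a b c -> exists2 c' : R -> 'rV[R]_n,
    c' a = x0 /\ lips (M + L * (`|c a| + K * (b - a))) a b c' &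
    exists2 N, null N & forall t, a < t < b -> ~ N t -> is_derive t (1:R) c' (G t (c t)).
  move=> K0 lc.
  have cc := lips_clamp_continuous ab lc.
  have M'0 : 0 <= M + L * (`|c a| + K * (b - a)).
    by rewrite addr_ge0 // mulr_ge0 // addr_ge0 // mulr_ge0 // subr_ge0.
  have [|H [lH Ha] [N nN HN]] := @vector_primitive n (fun t => G t (c (clampR a b t)))
     (M + L * (`|c a| + K * (b - a))) a b ab M'0 (measG _ cc).
    move=> s sab; apply: le_trans (growG _ _) _; rewrite lerD2l ler_wpM2l //.
    by rewrite clampR_id //; exact: lips_bound.
  exists (fun t => x0 + H t).
    rewrite Ha addr0; split=> // s t sab tab.
    by rewrite opprD addrACA subrr add0r; exact: lH.
  exists N => // t tab Nt.
  rewrite -[G t (c t)]add0r; apply: is_deriveD.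
  have := HN t tab Nt; rewrite clampR_id //.
  by case/andP: tab => ? ?; apply/andP; split; exact: ltW.
(* The iterate carries its own Lipschitz constant, so that being a legitimate argument of the next
   step is a property of the pair. *)
pose P (ck : (R -> 'rV[R]_n) * R) (c'k : (R -> 'rV[R]_n) * R) :=
  0 <= ck.2 /\ lips ck.2 a b ck.1 -> [/\ 0 <= c'k.2, lips c'k.2 a b c'k.1, c'k.1 a = x0 &
   exists2 N, null N & forall t, a < t < b -> ~ N t -> is_derive t (1:R) c'k.1 (G t (ck.1 t))].
have /choice[F FP] : forall ck, exists c'k, P ck c'k.
  move=> [c K]; have [[K0 lc]|C] := pselect (0 <= K /\ lips K a b c); last first.
    by exists (c, K) => /C.
  have [c' [c'a lc'] HN] := step c K K0 lc.
  exists (c', M + L * (`|c a| + K * (b - a))) => _; split => //=.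
  by rewrite addr_ge0 // mulr_ge0 // addr_ge0 // mulr_ge0 // subr_ge0.
pose X k := iter k F ((fun=> x0), 0).
have X0 : 0 <= (X 0%N).2 /\ lips (X 0%N).2 a b (X 0%N).1.
  by split => //= s t _ _; rewrite subrr normr0 mul0r.
have XP k : 0 <= (X k).2 /\ lips (X k).2 a b (X k).1.
  elim: k => // k IH; by have [] := FP _ IH.
have Xa k : (X k).1 a = x0.
  by case: k => // k; have [] := FP _ (XP k).
have XD k : exists2 N, null N & forall t, a < t < b -> ~ N t ->
    is_derive t (1:R) (X k.+1).1 (G t ((X k).1 t)).
  by have [] := FP _ (XP k).
pose E := expw L a.
have Ep t : 0 < E t := expw_gt0 _ _ _.
have E1 t : a <= t -> 1 <= E t by exact: expw_ge1.
pose K := (X 1%N).2 * (b - a).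
have K0 : 0 <= K by rewrite mulr_ge0 ?(XP 1%N).1 // subr_ge0.
have D k t : a <= t <= b -> `|(X k.+1).1 t - (X k).1 t| <= K / 2 ^+ k * E t.
  elim: k t => [|k IH] t tab.
    rewrite expr0 divr1 -[X in X - _](subrK x0) /=.
    have -> : F (fun=> x0, 0) = X 1%N by [].
    rewrite addrK -(Xa 1%N); apply: le_trans (_ : K <= _); last first.
      by rewrite ler_peMr // E1 //; case/andP: tab.
    case/andP: tab => at_ tb.
    apply: le_trans ((XP 1%N).2 _ _ _ _) _; rewrite ?at_ ?lexx //.
    rewrite ger0_norm ?subr_ge0 // /K ler_wpM2l ?(XP 1%N).1 //; lra.
  case/andP: tab => at_ tb.
  have [N1 nN1 HN1] := XD k.+1; have [N2 nN2 HN2] := XD k.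
  pose psi s := K / 2 ^+ k.+1 * E s.
  have := @AC_mean_value R n (fun s => (X k.+2).1 s - (X k.+1).1 s) psi a t (N1 `|` N2) at_.
  have sub c K' : lips K' a b c -> @lips R 'rV[R]_n K' a t c.
    by move=> lc x y /andP[? ?] /andP[? ?]; apply: lc; apply/andP; split; lra.
  rewrite !Xa subrr subr0 => H; apply: le_trans (H _ _ _ _) _ => {H}.
  - by apply: AConB; apply: lips_AC; apply: sub; exact: (XP _).2.
  - apply/lips_AC/(lips_mulr (K := 2 * L * expw L a t)).
    exact: lips_expw.
  - exact: nullU.
  - move=> s /andP[as_ st] Ns; exists (G s ((X k.+1).1 s) - G s ((X k).1 s)),
      (K / 2 ^+ k.+1 * (2 * L * E s)); split.
    + have sab : a < s < b by apply/andP; split; lra.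
      by apply: is_deriveB; [apply: HN1 => // Nt; apply: Ns; left|
                             apply: HN2 => // Nt; apply: Ns; right].
    + exact: is_derive_scale (is_derive_expw L a s).
    + apply: le_trans (lipG _ _ _) _.
      have := IH s; have -> : a <= s <= b by apply/andP; split; lra.
      move=> /(_ isT) /(ler_wpM2l L0) /le_trans; apply.
      rewrite exprS; have u0 : 2 ^+ k != 0 :> R by rewrite expf_neq0.
      rewrite le_eqVlt; apply/orP; left; apply/eqP; field; rewrite u0 //.
  - by rewrite gerBl mulr_ge0 ?divr_ge0 // ltW.
pose K' := K * E b.
have K'0 : 0 <= K' by rewrite mulr_ge0 // ltW.
have /choice[c cP] : forall t, exists l, a <= t <= b ->
    forall k, `|(X k).1 t - l| <= 2 * K' / 2 ^+ k.
  move=> t; have [tab|C] := pselect (a <= t <= b); last by exists 0.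
  have [|l Hl] := @geom_limit_rV n (fun k => (X k).1 t) K'; last by exists l.
  move=> k; apply: le_trans (D k t tab) _.
  rewrite /K' mulrAC ler_pM2r ?invr_gt0 ?exprn_gt0 // ler_wpM2l //.
  by apply: expw_mono => //; case/andP: tab.
pose B := `|x0| + 4 * K'.
have XB k t : a <= t <= b -> `|(X k).1 t| <= B.
  move=> tab; have := cP t tab k; have := cP t tab 0%N; rewrite expr0 divr1 /= => h0 hk.
  have hk2 : `|(X k).1 t - c t| <= 2 * K'.
    apply: le_trans hk _; rewrite ler_pdivrMr ?exprn_gt0 //.
    by apply: ler_peMr; [rewrite mulr_ge0|rewrite exprn_ege1 // ler1n].
  have -> : (X k).1 t = x0 + (((X k).1 t - c t) - (x0 - c t)).
    by apply/rowP => j; rewrite !mxE; ring.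
  apply: le_trans (ler_normD _ _) _; rewrite /B lerD2l.
  apply: le_trans (ler_normB _ _) _; lra.
pose M' := M + L * B.
have M'0 : 0 <= M' by rewrite addr_ge0 // mulr_ge0 // addr_ge0 // mulr_ge0.
have XL k : lips M' a b (X k.+1).1.
  have [N nN HN] := XD k; apply: (@AC_lips R n _ _ _ _ N) => //.
    by apply: lips_AC; exact: (XP k.+1).2.
  move=> t tab Nt; exists (G t ((X k).1 t)); first exact: HN.
  apply: le_trans (growG _ _) _; rewrite lerD2l ler_wpM2l // XB //.
  by case/andP: tab => ? ?; apply/andP; split; exact: ltW.
have cL : lips M' a b c.
  move=> s t sab tab; apply: (@le_geom _ _ (4 * K')) => k.
  have := XL k s t sab tab; have := cP s sab k.+1; have := cP t tab k.+1.
  rewrite exprS; have u0 : 2 ^+ k != 0 :> R by rewrite expf_neq0.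
  have -> : 2 * K' / (2 * 2 ^+ k) = K' / 2 ^+ k by field; rewrite u0.
  have -> : 4 * K' / 2 ^+ k = 4 * (K' / 2 ^+ k) by field; rewrite u0.
  have -> : c s - c t = ((X k.+1).1 s - (X k.+1).1 t) - ((X k.+1).1 s - c s) + ((X k.+1).1 t - c t).
    by rewrite opprB; apply/rowP => j; rewrite !mxE; ring.
  move=> h1 h2 h3; apply: le_trans (ler_normD _ _) _.
  have := ler_normB ((X k.+1).1 s - (X k.+1).1 t) ((X k.+1).1 s - c s).
  have : 0 <= K' / 2 ^+ k by rewrite divr_ge0.
  lra.
(* Derivatives do not pass to the uniform limit [c]. One more step from [c] gives a curve [z] with
   derivative [G t (c t)], and comparison with the iterates shows that [z] is [c]. *)
have [z [za zL] [N nN HN]] := step c M' M'0 cL.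
have ca : c a = x0.
  apply/esym/eqP; rewrite -subr_eq0 -normr_le0; apply: (@le_geom _ _ (2 * K')) => k.
  by rewrite add0r -(Xa k); apply: cP; rewrite lexx.
have zc t : a <= t <= b -> z t = c t.
  move=> tab; case/andP: (tab) => at_ tb.
  apply/eqP; rewrite -subr_eq0 -normr_le0; apply: (@le_geom _ _ (2 * K' * (1 + L * (b - a)))) => k.
  have [N' nN' HN'] := XD k.
  have zX : `|z t - (X k.+1).1 t| <= L * (2 * K' / 2 ^+ k) * (b - a).
    have := @AC_mean_value R n (fun s => z s - (X k.+1).1 s)
       (fun s => L * (2 * K' / 2 ^+ k) * s) a t (N `|` N') at_.
    have sub c' K'' : lips K'' a b c' -> @lips R 'rV[R]_n K'' a t c'.
      by move=> lc x y /andP[? ?] /andP[? ?]; apply: lc; apply/andP; split; lra.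
    rewrite za Xa subrr subr0 => H; apply: le_trans (H _ _ _ _) _ => {H}.
    - by apply: AConB; apply: lips_AC; apply: sub; [exact: zL|exact: XL].
    - apply: (@lips_AC _ R^o `|L * (2 * K' / 2 ^+ k)|) => x y _ _.
      by rewrite -mulrBr normrM.
    - exact: nullU.
    - move=> s /andP[as_ st] Ns; exists (G s (c s) - G s ((X k).1 s)), (L * (2 * K' / 2 ^+ k)).
      have sab : a < s < b by apply/andP; split; lra.
      split.
      + by apply: is_deriveB; [apply: HN => // Nt; apply: Ns; left|
                             apply: HN' => // Nt; apply: Ns; right].
      + by have := is_derive_scale (L * (2 * K' / 2 ^+ k)) (is_derive_id s (1:R)); rewrite mulr1.
      + apply: le_trans (lipG _ _ _) _; rewrite ler_wpM2l // distrC cP //.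
        by apply/andP; split; lra.
    - rewrite -mulrBr ler_wpM2l //; last lra.
      by rewrite mulr_ge0 // divr_ge0 // mulr_ge0.
  have := cP t tab k.+1.
  have -> : z t - c t = (z t - (X k.+1).1 t) + ((X k.+1).1 t - c t) by rewrite addrA subrK.
  rewrite exprS; have u0 : 2 ^+ k != 0 :> R by rewrite expf_neq0.
  have -> : 2 * K' / (2 * 2 ^+ k) = K' / 2 ^+ k by field; rewrite u0.
  have : 0 <= K' / 2 ^+ k by rewrite divr_ge0.
  have -> : 0 + 2 * K' * (1 + L * (b - a)) / 2 ^+ k =
    2 * (K' / 2 ^+ k) + L * (2 * K' / 2 ^+ k) * (b - a) by field; rewrite u0.
  move=> h1 h2; apply: le_trans (ler_normD _ _) _; lra.
exists c, M'; split => //; exists N => // t tab Nt.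
exact: (is_derive_eq_itv tab zc (HN t tab Nt)).
Qed.
End Picard.

(** * A surjectivity theorem of Brouwer type *)

Section Kuhn.
Variable I : choiceType.
Variable p : nat.
Variable lab : I -> (I -> nat) -> 'F_2.
Implicit Types (J ks : seq I) (v w : I -> nat) (phi : (I -> nat) -> 'F_2).

Definition upd v j (a : nat) : I -> nat := fun i => if i == j then a else v i.
Definition bump1 v j := upd v j (v j).+1.

Lemma addF2 (x : 'F_2) : x + x = 0.
Proof. by apply: addrr_pchar2; exact: pchar_Fp. Qed.

Lemma upd_comm v i j a b : i != j -> upd (upd v i a) j b = upd (upd v j b) i a.
Proof.
move=> ij; apply/funext => k; rewrite /upd.
by case: (eqVneq k j) => [->|//]; rewrite eq_sym (negPf ij).
Qed.

Lemma upd_upd v i a b : upd (upd v i a) i b = upd v i b.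
Proof. by apply/funext => k; rewrite /upd; case: (k == i). Qed.

Lemma upd_eq v i a : upd v i a i = a. Proof. by rewrite /upd eqxx. Qed.

Lemma upd_neq v i j a : i != j -> upd v j a i = v i.
Proof. by move=> /negPf ij; rewrite /upd ij. Qed.

Lemma bump1_comm v i j : i != j -> bump1 (bump1 v i) j = bump1 (bump1 v j) i.
Proof.
move=> ij; rewrite /bump1 upd_comm // upd_neq ?[j == i]eq_sym //.
by rewrite [upd v j _ i]upd_neq.
Qed.

(** Forward difference in direction [j]; modulo 2 it carries no sign. *)
Definition coboundary j phi : (I -> nat) -> 'F_2 := fun v => phi v + phi (bump1 v j).

(* The cup product of the coboundaries of the labels, evaluated on the sum of the Kuhn
   simplices of the cube [v + {0,1}^J], modulo 2. *)
Fixpoint cup ks J : (I -> nat) -> 'F_2 :=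
  if ks is k :: ks' then
    fun v => \sum_(j <- J) coboundary j (fun w => lab k w * cup ks' (rem j J) w) v
  else fun=> 1.

(** Every unordered pair of distinct indices occurs twice. *)
Lemma sum_sym_pairs (F : I -> I -> 'F_2) J : uniq J -> (forall i j, F i j = F j i) ->
  \sum_(j <- J) \sum_(i <- rem j J) F i j = 0.
Proof.
move=> uJ symF.
under eq_big_seq => j jJ do rewrite (rem_filter j uJ) big_filter.
elim: J uJ => [|k J IH] /=; first by rewrite big_nil.
move=> /andP[kJ uJ]; rewrite big_cons big_cons /= eqxx /=.
under [X in _ + X = _]eq_big_seq => j jJ.
  have kj : k != j by apply: contraNneq kJ => ->.
  rewrite big_cons /= kj; over.
rewrite big_split /= IH // addr0.
rewrite [X in X + _](_ : _ = \sum_(i <- J) F i k); last first.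
  rewrite big_seq_cond [RHS]big_seq; apply: eq_bigl => i /=.
  case: (boolP (i \in J)) => //= iJ.
  by apply: contraNneq kJ => <-.
under [X in _ + X = _]eq_bigr do rewrite symF.
exact: addF2.
Qed.

Lemma coboundary_comm i j phi v : i != j ->
  coboundary i (coboundary j phi) v = coboundary j (coboundary i phi) v.
Proof.
by move=> ij; rewrite /coboundary (bump1_comm _ ij) addrACA.
Qed.

Lemma coboundary_sum j (r : seq I) (F : I -> (I -> nat) -> 'F_2) v :
  coboundary j (fun w => \sum_(i <- r) F i w) v = \sum_(i <- r) coboundary j (F i) v.
Proof. by rewrite /coboundary big_split. Qed.

Lemma rem_comm i j J : uniq J -> rem i (rem j J) = rem j (rem i J).
Proof.
move=> uJ; rewrite !(rem_filter _ (rem_uniq _ uJ)) !(rem_filter _ uJ) -!filter_predI.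
by apply: eq_filter => k /=; rewrite andbC.
Qed.

(** The square of the coboundary vanishes: after one label is split off, mixed second differences
    appear, and they are symmetric in the two directions. *)
Lemma cup_closed ks J v : uniq J -> \sum_(j <- J) coboundary j (cup ks (rem j J)) v = 0.
Proof.
move=> uJ; case: ks => [|k ks] /=.
  by rewrite big1 // => j _; rewrite /coboundary addF2.
under eq_bigr do rewrite coboundary_sum.
pose F i j := if i == j then 0 else
  coboundary j (coboundary i (fun w => lab k w * cup ks (rem i (rem j J)) w)) v.
rewrite -[RHS](@sum_sym_pairs F J uJ) => [|i j]; last first.
  rewrite /F eq_sym; case: eqVneq => // ij.
  by rewrite coboundary_comm // rem_comm.
apply: eq_bigr => j _; apply: eq_big_seq => i.
by rewrite mem_rem_uniq // inE => /andP[/negPf ij _]; rewrite /F ij.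
Qed.

(** Leibniz rule: the difference of [lab k] times a cochain splits into the difference of the label
    times the shifted cochain and the label times a coboundary, and the latter terms sum to zero by
    [cup_closed]. Only differences of labels remain. *)
Lemma cup_local k ks J v : uniq J -> cup (k :: ks) J v =
  \sum_(j <- J) (lab k v + lab k (bump1 v j)) * cup ks (rem j J) (bump1 v j).
Proof.
move=> uJ; transitivity (\sum_(j <- J) (lab k v + lab k (bump1 v j)) * cup ks (rem j J) (bump1 v j)
  + lab k v * \sum_(j <- J) coboundary j (cup ks (rem j J)) v); last first.
  by rewrite cup_closed // mulr0 addr0.
rewrite mulr_sumr -big_split /=; apply: eq_bigr => j _; rewrite /coboundary.
set a := lab k v; set b := lab _ _; set c := cup _ _ v; set d := cup _ _ _.
have -> : (a + b) * d + a * (c + d) = a * c + b * d + (a * d + a * d) by ring.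
by rewrite addF2 addr0.
Qed.

Definition cube J v w := forall i, w i = v i \/ (i \in J /\ w i = (v i).+1).

Lemma cube_bump J v j w : uniq J -> j \in J -> cube (rem j J) (bump1 v j) w -> cube J v w.
Proof.
move=> uJ jJ H i; have := H i; rewrite /bump1 /upd; case: eqVneq => [->|ij].
  rewrite mem_rem_uniq // !inE eqxx /= => -[->|[]//]; by right.
by move=> [->|[/mem_rem iJ ->]]; [left|right].
Qed.

(** By [cup_local] every summand contains, sooner or later, a difference of the label [k] between
    two vertices of the cube. *)
Lemma cup_const ks J v k : uniq J -> k \in ks ->
  (forall w w', cube J v w -> cube J v w' -> lab k w = lab k w') -> cup ks J v = 0.
Proof.
elim: ks J v => // l ks IH J v uJ; rewrite inE => kks H.
rewrite cup_local //; apply: big1_seq => j /= jJ.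
have c0 : cube J v v by left.
have c1 : cube J v (bump1 v j).
  by move=> i; rewrite /bump1 /upd; case: eqVneq => [->|ij]; [right|left].
move: kks => /predU1P[<-|kks].
  by rewrite (H _ _ c1 c0) addF2 mul0r.
rewrite IH ?mulr0 ?rem_uniq // => w w' cw cw'.
by apply: H; apply: (cube_bump uJ jJ).
Qed.

Definition Sum1 j phi v := \sum_(a < p) phi (upd v j a).

Lemma Sum1_comm i j phi v : i != j -> Sum1 i (Sum1 j phi) v = Sum1 j (Sum1 i phi) v.
Proof.
move=> ij; rewrite /Sum1 exchange_big; apply: eq_bigr => a _; apply: eq_bigr => b _.
by rewrite upd_comm.
Qed.

Lemma Sum1_coboundary j phi v :
  Sum1 j (coboundary j phi) v = phi (upd v j 0%N) + phi (upd v j p).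
Proof.
rewrite /Sum1 /coboundary; under eq_bigr do rewrite /bump1 upd_upd upd_eq.
elim: p => [|k IH]; first by rewrite big_ord0 addF2.
rewrite big_ord_recr /= IH -addrA; congr (_ + _).
by rewrite addrA addF2 add0r.
Qed.

Definition SumJ J phi := foldr Sum1 phi J.

Lemma SumJ_inner j J phi : uniq J -> j \in J -> SumJ J phi = SumJ (rem j J) (Sum1 j phi).
Proof.
elim: J => // k J IH /= /andP[kJ uJ]; rewrite inE; case: eqVneq => [->|jk] /=.
  move=> _; elim: J kJ {uJ IH} => //= i J IH; rewrite inE negb_or => /andP[ki kJ].
  by rewrite -IH //; apply/funext => v; rewrite Sum1_comm.
by move=> jJ; rewrite IH.
Qed.

Lemma SumJ_add J phi psi v : SumJ J (fun w => phi w + psi w) v = SumJ J phi v + SumJ J psi v.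
Proof.
elim: J v => //= j J IH v; rewrite /Sum1 -big_split; apply: eq_bigr => a _; exact: IH.
Qed.

Lemma SumJ_sum J (r : seq I) (F : I -> (I -> nat) -> 'F_2) v :
  SumJ J (fun w => \sum_(i <- r) F i w) v = \sum_(i <- r) SumJ J (F i) v.
Proof.
elim: r => [|i r IH].
  rewrite big_nil; under eq_fun do rewrite big_nil.
  by elim: J v => //= j J IH v; rewrite /Sum1 big1.
rewrite big_cons -IH -SumJ_add; congr (SumJ _ _ _); apply/funext => w.
by rewrite big_cons.
Qed.

Lemma SumJ_eq J phi psi v : (forall w, (forall i, i \notin J -> w i = v i) ->
    (forall i, i \in J -> (w i < p)%N) -> phi w = psi w) -> SumJ J phi v = SumJ J psi v.
Proof.
elim: J v => [|j J IH] v H /=; first by apply: H.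
apply: eq_bigr => a _; apply: IH => w wv wp; apply: H => i.
  rewrite inE negb_or => /andP[ij iJ]; by rewrite wv // upd_neq.
rewrite inE; case: (boolP (i \in J)) => [/wp //|iJ]; rewrite orbF => /eqP ->.
have [jJ|jJ] := boolP (j \in J); first exact: wp.
by rewrite wv // upd_eq.
Qed.

Lemma SumJ0 J v : SumJ J (fun=> 0) v = 0.
Proof. by elim: J v => //= j J IH v; rewrite /Sum1 big1. Qed.

Lemma SumJ_upd J k a phi v : k \notin J ->
  SumJ J (fun w => phi (upd w k a)) v = SumJ J phi (upd v k a).
Proof.
elim: J v => //= j J IH v; rewrite inE negb_or => /andP[kj kJ].
by apply: eq_bigr => b _; rewrite IH // upd_comm // eq_sym.
Qed.

Hypothesis lab0 : forall k v, v k = 0%N -> lab k v = 0.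
Hypothesis labp : forall k v, v k = p -> lab k v = 1.

(** Discrete Stokes formula: summing a difference in direction [j] leaves two opposite faces. For
    [j = k] the label [k] is 0 on one face and 1 on the other, which gives the sum of one dimension
    less. For [j != k] the label [j] is still among the factors and is constant on both faces, so
    nothing remains. *)
Lemma SumJ_cup J v : uniq J -> SumJ J (cup J J) v = 1.
Proof.
elim: J v => // k J IH v /= /andP[kJ uJ].
have uk : uniq (k :: J) by rewrite /= kJ.
rewrite -[LHS]/(SumJ (k :: J) (cup (k :: J) (k :: J)) v).
have -> : cup (k :: J) (k :: J) = fun w => \sum_(j <- k :: J)
  coboundary j (fun w => lab k w * cup J (rem j (k :: J)) w) w by [].
rewrite SumJ_sum big_cons big1_seq ?addr0.
  rewrite (@SumJ_inner k) ?mem_head //= eqxx.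
  rewrite -(IH (upd v k p) uJ) -SumJ_upd //; congr (SumJ _ _ _); apply/funext => w.
  by rewrite Sum1_coboundary lab0 ?upd_eq // mul0r add0r labp ?upd_eq // mul1r.
move=> j /= jJ.
have jk : j != k by apply: contraNneq kJ => <-.
pose phi := fun w => lab k w * cup J (rem j (k :: J)) w.
have face w a : (a = 0%N) \/ (a = p) -> cup J (rem j (k :: J)) (upd w j a) = 0.
  move=> a0p; apply: (@cup_const _ _ _ j); rewrite ?rem_uniq // => w1 w2 c1 c2.
  have wj w' : cube (rem j (k :: J)) (upd w j a) w' -> w' j = a.
    by move=> /(_ j); rewrite upd_eq mem_rem_uniq // !inE eqxx => -[|[]].
  by case: a0p => a0; [rewrite !lab0|rewrite !labp]; rewrite ?(wj w1) ?(wj w2).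
have E : Sum1 j (coboundary j phi) = fun=> 0.
  apply/funext => w; rewrite Sum1_coboundary /phi !face ?mulr0 ?addr0; auto.
have := @SumJ_inner j (k :: J) (coboundary j phi) uk.
rewrite inE jJ orbT => /(_ isT) H.
by transitivity (SumJ (k :: J) (coboundary j phi) v); [|rewrite H E SumJ0].
Qed.

(* Kuhn's lemma: the parity of the number of fully labelled simplices is odd. *)
Lemma kuhn J v : uniq J -> exists2 w : I -> nat,
  (forall i, i \in J -> (w i < p)%N) & forall k, k \in J ->
    exists w1 w2, [/\ cube J w w1, cube J w w2 & lab k w1 != lab k w2].
Proof.
move=> uJ; apply: contrapT => C.
have : SumJ J (cup J J) v = 0.
  rewrite -[RHS](SumJ0 J v); apply: SumJ_eq => w _ wp.
  have [k kJ H] : exists2 k, k \in J &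
      forall w1 w2, cube J w w1 -> cube J w w2 -> lab k w1 = lab k w2.
    apply: contrapT => C'; apply: C; exists w => // k kJ; apply: contrapT => C.
    apply: C'; exists k => // w1 w2 c1 c2; apply: contrapT => /eqP ne.
    by apply: C; exists w1, w2.
  exact: (cup_const uJ kJ).
by rewrite SumJ_cup // => /eqP; rewrite oner_eq0.
Qed.

End Kuhn.

(** * Continuity on a set and uniform continuity on compact sets *)

Section UniformContinuity.
Context {R : realType}.

(** Continuity within [K] in metric form, which composes and combines with estimates more easily
    than the subspace topology; [cont_onP] relates the two. *)
Definition cont_on {T V : normedModType R} (K : set T) (F : T -> V) :=
  forall x, K x -> forall e : R, 0 < e -> exists2 d : R, 0 < d &
    forall y, K y -> `|x - y| < d -> `|F x - F y| < e.

Lemma cont_onP {T V : normedModType R} (K : set T) (F : T -> V) :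
  {within K, continuous F} <-> cont_on K F.
Proof.
split.
- move=> /subspace_continuousP H x Kx e e0.
  have /cvgrPdist_lt/(_ _ e0) := H x Kx.
  rewrite near_withinE => /nbhs_ballP[d /= d0 Hd]; exists d => // y Ky xy.
  by apply: Hd => //; rewrite -ball_normE.
- move=> H; apply/subspace_continuousP => x Kx; apply/cvgrPdist_lt => e e0.
  have [d d0 Hd] := H x Kx e e0; rewrite near_withinE; apply/nbhs_ballP.
  by exists d => // y; rewrite -ball_normE /= => xy Ky; exact: Hd.
Qed.

Lemma compact_unif {T V : normedModType R} (K : set T) (F : T -> V) :
  compact K -> cont_on K F -> forall e : R, 0 < e -> exists2 d : R, 0 < d &
    forall x y, K x -> K y -> `|x - y| < d -> `|F x - F y| < e.
Proof.
move=> cK cF e e0.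
have e2 : 0 < e / 2 by lra.
have /compact_near_coveringP/near_covering_withinP nc := cK.
pose P (d : R) (x : T) := forall y, K y -> `|x - y| < d -> `|F x - F y| < e.
have Hd : \forall d \near (0:R)^'+, K `<=` P d.
  apply: nc => x Kx; have [r r0 Hr] := cF x Kx _ e2.
  near=> x' d => Kx' y Ky x'y.
  have xx' : `|x - x'| < r / 2.
    near: x'; apply/nbhs_ballP; exists (r / 2); first by rewrite /= divr_gt0.
    by move=> z; rewrite -ball_normE.
  have dr : d < r / 2 by near: d; apply: nbhs_right_lt; rewrite divr_gt0.
  have h1 : `|F x - F x'| < e / 2 by apply: Hr => //; lra.
  have h2 : `|F x - F y| < e / 2.
    apply: Hr => //; have -> : x - y = (x - x') + (x' - y) by rewrite addrA subrK.
    apply: le_lt_trans (ler_normD _ _) _; rewrite [r]splitr ltrD //; exact: lt_trans dr.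
  have -> : F x' - F y = (F x - F y) - (F x - F x') by rewrite opprB [RHS]addrC addrA subrK.
  by apply: le_lt_trans (ler_normB _ _) _; rewrite [e]splitr ltrD.
have [d [d0 H]] := filter_ex (filterI (nbhs_right_gt (0:R)) Hd).
by exists d => // x y Kx Ky; exact: H.
Unshelve. all: by end_near. Qed.

End UniformContinuity.

(** * The Poincare-Miranda theorem and maps close to the identity *)

Section Brouwer.
Context {R : realType}.
Variable n : nat.

Definition cube1 : set 'rV[R]_n := [set u | `|u| <= 1].

Lemma cube1_compact : compact cube1.
Proof.
apply: bounded_closed_compact.
  exists 1; split => // x x1 u /= u1; apply: le_trans u1 _; exact: ltW.
rewrite (_ : cube1 = (fun u : 'rV[R]_n => `|u|) @^-1` [set x | x <= 1]) //.
by apply: closed_comp => [x _|]; [exact: norm_continuous|exact: closed_le].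
Qed.

(* The grid point [w : 'I_n -> nat], [w i <= p], stands for the point with coordinates
   [2 w i / p - 1] of the cube, and the labels are the signs of the coordinates of [g]. *)
Lemma poincare_miranda_approx (g : 'rV[R]_n -> 'rV[R]_n) : cont_on cube1 g ->
  (forall u k, cube1 u -> u 0 k = -1 -> g u 0 k < 0) ->
  (forall u k, cube1 u -> u 0 k = 1 -> 0 < g u 0 k) ->
  forall e : R, 0 < e -> exists2 u, cube1 u & `|g u| <= e.
Proof.
move=> cg gneg gpos e e0.
have [d d0 Hd] := compact_unif cube1_compact cg e0.
(* The mesh [2 / p] is below the modulus of continuity [d], so [g] varies by less than [e] between
   the base vertex of a grid cube and any other vertex. *)
pose p := (Num.bound (2 / d)).+1.
have pd : 2 / d < p%:R.
  apply: lt_le_trans (_ : (Num.bound (2 / d))%:R <= _); last by rewrite ler_nat.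
  by rewrite archi_boundP // divr_ge0 // ltW.
have p0 : (0 : R) < p%:R by rewrite ltr0n.
have hd : 2 / p%:R < d by rewrite ltr_pdivrMr // mulrC -ltr_pdivrMr.
(* Clipping by [minn] keeps points with an index beyond [p] in the cube, so that the labels are
   defined on all integer points. *)
pose pt (w : 'I_n -> nat) : 'rV[R]_n := \row_i (2 * (minn (w i) p)%:R / p%:R - 1).
have ptc w : cube1 (pt w).
  apply: rV_norm_le => // i; rewrite mxE.
  have : ((minn (w i) p)%:R : R) / p%:R <= 1 by rewrite ler_pdivrMr // mul1r ler_nat geq_minr.
  have : 0 <= ((minn (w i) p)%:R : R) / p%:R by rewrite divr_ge0.
  rewrite -mulrA ler_norml => ? ?; apply/andP; split; lra.
pose lab k w : 'F_2 := if 0 <= g (pt w) 0 k then 1 else 0.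
have lab0 k w : w k = 0%N -> lab k w = 0.
  move=> wk; rewrite /lab leNgt gneg // mxE wk min0n mulr0 mul0r sub0r //.
have labp k w : w k = p -> lab k w = 1.
  move=> wk; rewrite /lab ltW // gpos // mxE wk minnn -mulrA divff ?gt_eqF //; ring.
have [w wp Hw] := @kuhn 'I_n p lab lab0 labp (enum 'I_n) (fun=> 0%N) (enum_uniq _).
exists (pt w) => //; apply: rV_norm_le; first exact: ltW.
move=> k; have [|w1 [w2 [c1 c2 ne]]] := Hw k; first by rewrite mem_enum.
have near w' : cube (enum 'I_n) w w' -> `|g (pt w) 0 k - g (pt w') 0 k| < e.
  move=> c; apply: le_lt_trans (_ : `|g (pt w) - g (pt w')| < e).
    by apply: le_trans (rV_coord_le _ k); rewrite !mxE.
  apply: Hd => //; apply: le_lt_trans hd; apply: rV_norm_le; first by rewrite divr_ge0.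
  move=> i; rewrite !mxE; have wip := wp i (mem_enum _ _).
  case: (c i) => [->|[_ ->]]; first by rewrite subrr normr0 divr_ge0.
  rewrite !(minn_idPl _) //; last exact: ltnW.
  rewrite -[(w i).+1]addn1 natrD.
  have -> : 2 * (w i)%:R / p%:R - 1 - (2 * ((w i)%:R + 1%:R) / p%:R - 1) = - (2 / p%:R) :> R.
    by field; rewrite gt_eqF.
  by rewrite normrN ger0_norm // divr_ge0.
(* Distinct labels mean that coordinate [k] of [g] changes sign between [w1] and [w2], whose values
   are both within [e] of the value at [w]. *)
have := near _ c1; have := near _ c2; move: ne; rewrite /lab !ltr_norml.
case: (lerP 0 (g (pt w1) 0 k)) => ?; case: (lerP 0 (g (pt w2) 0 k)) => ?; rewrite ?eqxx // => _;
 move=> /andP[? ?] /andP[? ?]; rewrite ler_norml; apply/andP; split; lra.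
Qed.

(** The minimum of [|g|] on the compact cube is attained; a positive minimum contradicts the
    approximate zeros. *)
Lemma poincare_miranda (g : 'rV[R]_n -> 'rV[R]_n) : cont_on cube1 g ->
  (forall u k, cube1 u -> u 0 k = -1 -> g u 0 k < 0) ->
  (forall u k, cube1 u -> u 0 k = 1 -> 0 < g u 0 k) ->
  exists2 u, cube1 u & g u = 0.
Proof.
move=> cg gneg gpos.
have cg' : {within cube1, continuous (fun u => `|g u| : R^o)}.
  apply/cont_onP => x Kx e e0; have [d d0 Hd] := cg x Kx e e0.
  by exists d => // y Ky xy; apply: le_lt_trans (ler_dist_dist _ _) _; exact: Hd.
have [|u [/set_mem Ku Hu]] := @compact_EVT_min _ R (fun u => `|g u|) cube1 _ cube1_compact cg'.
  by exists 0; rewrite /cube1 /= normr0.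
exists u => //; apply/eqP; rewrite -normr_le0 leNgt; apply/negP => gu.
have [|v Kv gv] := poincare_miranda_approx cg gneg gpos (_ : 0 < `|g u| / 2); first lra.
by have := Hu v (mem_set Kv); lra.
Qed.

(** On the face where the coordinate [k] of [u] is 1 or -1, that coordinate of [Phi u] is within 1/2
    of the same value, hence [Phi - t] has the sign asked for by [poincare_miranda]. *)
Lemma brouwer_onto (Phi : 'rV[R]_n -> 'rV[R]_n) (t : 'rV[R]_n) : cont_on cube1 Phi ->
  (forall u, cube1 u -> `|Phi u - u| < 1 / 2) -> `|t| <= 1 / 2 ->
  exists2 u, cube1 u & Phi u = t.
Proof.
move=> cP near tle.
have [||| u Ku /eqP] := @poincare_miranda (fun u => Phi u - t).
- move=> x Kx e e0; have [d d0 Hd] := cP x Kx e e0; exists d => // y Ky xy.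
  by rewrite opprB addrA subrK; exact: Hd.
- move=> u k Ku uk.
  have := rV_coord_le t k; have := near u Ku; have := rV_coord_le (Phi u - u) k.
  rewrite !mxE uk => h1 h2 h3.
  have : `|Phi u 0 k - -1| < 1/2 by exact: le_lt_trans h2.
  have : `|t 0 k| <= 1/2 by exact: le_trans tle.
  by rewrite ltr_norml ler_norml => /andP[? ?] /andP[? ?]; lra.
- move=> u k Ku uk.
  have := rV_coord_le t k; have := near u Ku; have := rV_coord_le (Phi u - u) k.
  rewrite !mxE uk => h1 h2 h3.
  have : `|Phi u 0 k - 1| < 1/2 by exact: le_lt_trans h2.
  have : `|t 0 k| <= 1/2 by exact: le_trans tle.
  by rewrite ltr_norml ler_norml => /andP[? ?] /andP[? ?]; lra.
- by rewrite subr_eq0 => /eqP; exists u.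
Qed.

End Brouwer.

(** * Flows and iterated Lie brackets *)

Section Jacobian.
Context {R : realType}.

Lemma mx_entry_le m n (A : 'M[R]_(m, n)) i j : `|A i j| <= `|A|.
Proof.
rewrite [leRHS]/Num.norm /= mx_normrE.
exact: (le_bigmax (0:R) (fun i : 'I_m * 'I_n => `|A i.1 i.2|) (i, j)).
Qed.

Lemma mulmx_norm_le m n (x : 'rV[R]_m) (A : 'M[R]_(m, n)) : `|x *m A| <= m%:R * `|x| * `|A|.
Proof.
apply: rV_norm_le; first by rewrite !mulr_ge0.
move=> j; rewrite mxE; apply: le_trans (ler_norm_sum _ _ _) _.
apply: (@le_trans _ _ (\sum_(i < m) `|x| * `|A|)).
  by apply: ler_sum => i _; rewrite normrM ler_pM // ?rV_coord_le ?mx_entry_le.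
by rewrite sumr_const card_ord -[leLHS]mulr_natl mulrA.
Qed.

Lemma is_derive_dir_approx {V W : normedModType R} (F : V -> W) (x v : V) (w : W) :
  is_derive x v F w <->
  forall e : R, 0 < e -> exists2 d : R, 0 < d &
    forall h : R, `|h| <= d -> `|F (x + h *: v) - F x - h *: w| <= e * `|h|.
Proof.
have E : is_derive x v F w <-> is_derive (0:R) (1:R) (fun h : R => F (x + h *: v)) w.
  have Q : (fun h : R => h^-1 *: ((F \o shift x) (h *: v) - F x)) =
           (fun h : R => h^-1 *: (((fun h : R => F (x + h *: v)) \o shift 0) (h *: (1:R)) -
              F (x + 0 *: v))).
    by apply/funext => h /=; rewrite [h *: 1]mulr1 addr0 scale0r addr0 [h *: v + x]addrC.
  have Q1 : derivable F x v = derivable (fun h : R => F (x + h *: v)) (0:R) (1:R).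
    by rewrite /derivable Q.
  have Q2 : 'D_v F x = 'D_(1:R) (fun h : R => F (x + h *: v)) (0:R) by rewrite /derive Q.
  split => -[a b]; split; by [rewrite -Q1|rewrite -Q2|rewrite Q1|rewrite Q2].
rewrite E is_derive_approx; split => H e /H[d d0 Hd]; exists d => // h /Hd;
  by rewrite add0r scale0r addr0.
Qed.

Lemma is_derive_line {V W : normedModType R} (F : V -> W) (x v : V) (w : W) (s : R) :
  is_derive (x + s *: v) v F w -> is_derive s (1:R) (fun h : R => F (x + h *: v)) w.
Proof.
move=> /is_derive_dir_approx H; apply/is_derive_approx => e /H[d d0 Hd]; exists d => // h /Hd.
by rewrite scalerDl addrA.
Qed.

Lemma scalar_mvt (f df : R -> R) (a b M : R) :
  (forall s, Num.min a b <= s <= Num.max a b -> is_derive s (1:R) (f : R -> R^o) (df s)) ->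
  (forall s, Num.min a b <= s <= Num.max a b -> `|df s| <= M) -> `|f b - f a| <= M * `|b - a|.
Proof.
have main (u v : R) : u <= v -> (forall s, u <= s <= v -> is_derive s (1:R) (f : R -> R^o) (df s)) ->
  (forall s, u <= s <= v -> `|df s| <= M) -> `|f v - f u| <= M * `|v - u|.
  move=> uv D B.
  have fc : {within `[u, v], continuous f}.
    apply/continuous_in_subspaceT => x /set_mem /=; rewrite in_itv /= => xuv.
    by apply: differentiable_continuous; apply/derivable1_diffP; case: (D x xuv).
  have D' x : x \in `]u, v[ -> is_derive x 1 f (df x).
    by rewrite in_itv /= => /andP[? ?]; apply: D; rewrite !ltW.
  have [x] := MVT_segment uv D' fc; rewrite in_itv /= => xuv ->.
  by rewrite normrM ler_wpM2r // B.
move=> D B; have [ab|/ltW ba] := leP a b.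
  by apply: main => // s; move: (D s) (B s); rewrite min_l // max_r.
by rewrite distrC [in leRHS]distrC; apply: main => // s; move: (D s) (B s); rewrite min_r // max_l.
Qed.

(* Moving from [x] to [x'] one coordinate at a time stays in the box. *)
Lemma partials_lipschitz d n (F : 'rV[R]_d -> 'rV[R]_n) (g : 'I_d -> 'rV[R]_d -> 'rV[R]_n)
  (lo hi : 'rV[R]_d) (M : R) : 0 <= M ->
  (forall z : 'rV[R]_d, (forall i, lo 0 i <= z 0 i <= hi 0 i) ->
     forall j : 'I_d, is_derive z (ev j) F (g j z) /\ `|g j z| <= M) ->
  forall x x' : 'rV[R]_d, (forall i, lo 0 i <= x 0 i <= hi 0 i) -> (forall i, lo 0 i <= x' 0 i <= hi 0 i) ->
  `|F x' - F x| <= d%:R * M * `|x' - x|.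
Proof.
move=> M0 H x x' bx bx'.
pose mix k : 'rV[R]_d := \row_i (if (i < k)%N then x' 0 i else x 0 i).
have mixb k i : lo 0 i <= mix k 0 i <= hi 0 i by rewrite mxE; case: ifP.
have m0 : mix 0%N = x by apply/rowP => i; rewrite mxE.
have md : mix d = x' by apply/rowP => i; rewrite mxE ltn_ord.
have step (k : 'I_d) : `|F (mix k.+1) - F (mix k)| <= M * `|x' - x|.
  have mixS : mix k.+1 = mix k + (x' 0 k - x 0 k) *: ev k.
    apply/rowP => i; rewrite !mxE ltnS leq_eqVlt eqxx /=.
    case: (eqVneq i k) => [->|ik] /=; first by rewrite eqxx ltnn mulr1 addrC subrK.
    by rewrite -val_eqE /= in ik; rewrite (negPf ik) /= mulr0 addr0.
  apply: rV_norm_le; first by rewrite mulr_ge0.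
  move=> i; rewrite !mxE; pose z s := mix k + s *: ev k.
  have zb s : Num.min 0 (x' 0 k - x 0 k) <= s <= Num.max 0 (x' 0 k - x 0 k) ->
      forall j, lo 0 j <= z s 0 j <= hi 0 j.
    move=> hs j; have := bx j; have := bx' j; rewrite !mxE eqxx /=.
    case: (eqVneq j k) => [->|jk] /=; last by rewrite mulr0 addr0; case: ifP.
    rewrite ltnn mulr1 => /andP[? ?] /andP[? ?].
    move: hs; rewrite /Order.min /Order.max; case: ltP => ? /andP[? ?];
      apply/andP; split; lra.
  have := @scalar_mvt (fun s => F (z s) 0 i) (fun s => g k (z s) 0 i) 0 (x' 0 k - x 0 k) M.
  rewrite /z scale0r addr0 -mixS subr0 => mvt; apply: le_trans (mvt _ _) _.
  - move=> s /zb sb; have [D _] := H _ sb k.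
    by have /is_derive_coord := is_derive_line D.
  - move=> s /zb sb; have [_ D] := H _ sb k.
    exact: le_trans (rV_coord_le _ _) D.
  - by rewrite ler_wpM2l //; apply: le_trans (rV_coord_le _ k); rewrite !mxE.
have tel (k : nat) : (k <= d)%N -> `|F (mix k) - F (mix 0%N)| <= k%:R * M * `|x' - x|.
  elim: k => [|k IH] kd; first by rewrite subrr normr0 !mul0r.
  have -> : F (mix k.+1) - F (mix 0%N) = (F (mix k.+1) - F (mix k)) + (F (mix k) - F (mix 0%N)).
    by rewrite addrA subrK.
  apply: le_trans (ler_normD _ _) _.
  have -> : k.+1%:R * M * `|x' - x| = M * `|x' - x| + k%:R * M * `|x' - x|.
    by rewrite -natr1; ring.
  by apply: lerD; [exact: (step (Ordinal kd))|exact: IH (ltnW kd)].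
by have := tel d (leqnn d); rewrite m0 md.
Qed.

(** Row vectors are acted on from the right, so this is the transpose of the usual Jacobian matrix:
    the derivative in direction [v] is [v *m jac F x]. *)
Definition jac d n (F : 'rV[R]_d -> 'rV[R]_n) (x : 'rV[R]_d) : 'M[R]_(d, n) :=
  \matrix_(j, i) derive F x (ev j) 0 i.

Lemma row_jac d n (F : 'rV[R]_d -> 'rV[R]_n) x j : ev j *m jac F x = derive F x (ev j).
Proof. by rewrite -rowE; apply/rowP => i; rewrite !mxE. Qed.

Lemma is_derive_mulmx d n (J : 'M[R]_(d, n)) (x v : 'rV[R]_d) :
  is_derive x v (fun z => z *m J) (v *m J).
Proof.
apply/is_derive_dir_approx => e e0; exists 1 => // h _.
by rewrite mulmxDl -scalemxAl addrAC addrK subrr normr0 mulr_ge0 // ltW.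
Qed.

Lemma box_of_ball d (x z : 'rV[R]_d) r : 0 <= r ->
  (forall i, (x - const_mx r) 0 i <= z 0 i <= (x + const_mx r) 0 i) <-> `|z - x| <= r.
Proof.
move=> r0; split.
  move=> H; apply: rV_norm_le => // i; have := H i; rewrite !mxE ler_norml => /andP[? ?].
  by apply/andP; split; lra.
move=> H i; have := le_trans (rV_coord_le _ i) H; rewrite !mxE ler_norml => /andP[? ?].
by apply/andP; split; lra.
Qed.

Lemma closed_ball_compact d (x : 'rV[R]_d) r : compact [set z | `|z - x| <= r].
Proof.
apply: bounded_closed_compact.
  exists (`|x| + r); split; first exact: num_real.
  move=> u xu z /= zx; apply: le_trans (ltW xu).
  have -> : z = x + (z - x) by rewrite addrC subrK.
  by apply: le_trans (ler_normD _ _) _; rewrite lerD2l.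
rewrite (_ : [set z | _] = (fun z : 'rV[R]_d => `|z - x|) @^-1` [set s | s <= r]) //.
have cn : continuous (fun z : 'rV[R]_d => `|z - x| : R^o).
  apply: (@lips_continuous R 'rV[R]_d R^o 1) => u v; rewrite mul1r.
  by apply: le_trans (ler_dist_dist _ _) _; rewrite opprB addrA subrK.
by apply: closed_comp => [z _|]; [exact: cn|exact: closed_le].
Qed.

Lemma continuous_cont_on {T V : normedModType R} (K : set T) (F : T -> V) :
  continuous F -> cont_on K F.
Proof.
by move=> cF; apply/cont_onP; apply: continuous_subspaceT.
Qed.

Lemma compact_bounded {T V : normedModType R} (K : set T) (F : T -> V) :
  compact K -> cont_on K F -> exists2 M : R, 0 <= M & forall x, K x -> `|F x| <= M.
Proof.
move=> cK cF; have [K0|/set0P[x0 Kx0]] := eqVneq K set0.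
  by exists 0 => // x; rewrite K0.
have cF' : {within K, continuous (fun u => `|F u| : R^o)}.
  apply/cont_onP => x Kx e e0; have [d d0 Hd] := cF x Kx e e0.
  by exists d => // y Ky xy; apply: le_lt_trans (ler_dist_dist _ _) _; exact: Hd.
have [|u [/set_mem Ku Hu]] := @compact_EVT_max _ R (fun u => `|F u|) K _ cK cF'.
  by exists x0.
by exists `|F u| => // x Kx; apply/Hu/mem_set.
Qed.

Section C1.
Variables (d n : nat) (F : 'rV[R]_d -> 'rV[R]_n).
Hypothesis CF : isCk 1 F.

Lemma C1_derive (x : 'rV[R]_d) (j : 'I_d) : is_derive x (ev j) F (derive F x (ev j)).
Proof. by case: CF => _ /(_ j)[/(_ x)]; split. Qed.

Lemma C1_partial_cont (j : 'I_d) : continuous (fun x => derive F x (ev j)).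
Proof. by case: CF => _ /(_ j)[_ []]. Qed.

(** The partial derivatives are uniformly continuous on the ball of radius [r + 1], and
    [partials_lipschitz] is applied to [F] minus its linear part at [z]. One radius [rho] serves all
    base points of the ball. *)
Lemma C1_unif_diff (x0 : 'rV[R]_d) r eta : 0 < eta -> exists2 rho : R, 0 < rho &
  forall z z', `|z - x0| <= r -> `|z' - z| <= rho ->
    `|F z' - F z - (z' - z) *m jac F z| <= eta * `|z' - z|.
Proof.
move=> eta0.
have e0 : 0 < eta / (d%:R + 1) by rewrite divr_gt0 // ltr_wpDl.
have cont j := compact_unif (@closed_ball_compact d x0 (r + 1))
   (continuous_cont_on (K := [set z | `|z - x0| <= r + 1]) (@C1_partial_cont j)) e0.
have /choice[rho Hrho] : forall j, exists rho : R, 0 < rho /\ forall x y,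
    `|x - x0| <= r + 1 -> `|y - x0| <= r + 1 -> `|x - y| < rho ->
    `|derive F x (ev j) - derive F y (ev j)| < eta / (d%:R + 1).
  by move=> j; have [rho rho0 H] := cont j; exists rho.
exists (Num.min 1 (\big[Num.min/1]_j (rho j / 2))).
  rewrite lt_min ltr01 /=; apply/bigmin_gtP; split => // j _.
  by have [? _] := Hrho j; rewrite divr_gt0.
move=> z z' zr; rewrite le_min => /andP[zz1 /bigmin_geP[_ zzr]].
have key := @partials_lipschitz d n (fun y => F y - y *m jac F z)
   (fun j y => derive F y (ev j) - ev j *m jac F z) (z - const_mx `|z' - z|)
   (z + const_mx `|z' - z|) (eta / (d%:R + 1)) (ltW e0).
have -> : F z' - F z - (z' - z) *m jac F z = F z' - z' *m jac F z - (F z - z *m jac F z).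
  by rewrite mulmxBl !opprD !opprK addrACA.
apply: le_trans (key _ z z' _ _) _.
- move=> y /box_of_ball -/(_ (normr_ge0 _)) yz j; split.
    by apply: is_deriveB; [exact: C1_derive|exact: is_derive_mulmx].
  rewrite row_jac; apply: ltW; apply: (Hrho j).2.
  + have -> : y - x0 = (y - z) + (z - x0) by rewrite addrA subrK.
    by apply: le_trans (ler_normD _ _) _; lra.
  + lra.
  + have [r0 _] := Hrho j; have := zzr j isT; lra.
- by apply/box_of_ball => //; rewrite subrr normr0.
- by apply/box_of_ball.
- rewrite ler_wpM2r // mulrCA ler_piMr ?(ltW eta0) //.
  by rewrite ler_pdivrMr ?ltr_wpDl // mul1r lerDl.
Qed.

(** Strict differentiability: both points vary while the Jacobian stays frozen at [x0]. *)
Lemma C1_strict (x0 : 'rV[R]_d) eta : 0 < eta -> exists2 rho : R, 0 < rho &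
  forall z z', `|z - x0| <= rho -> `|z' - x0| <= rho ->
    `|F z' - F z - (z' - z) *m jac F x0| <= eta * `|z' - z|.
Proof.
move=> eta0.
have e0 : 0 < eta / (d%:R + 1) by rewrite divr_gt0 // ltr_wpDl.
have cont j := compact_unif (@closed_ball_compact d x0 1)
   (continuous_cont_on (K := [set z | `|z - x0| <= 1]) (@C1_partial_cont j)) e0.
have /choice[rho Hrho] : forall j, exists rho : R, 0 < rho /\ forall x y,
    `|x - x0| <= 1 -> `|y - x0| <= 1 -> `|x - y| < rho ->
    `|derive F x (ev j) - derive F y (ev j)| < eta / (d%:R + 1).
  by move=> j; have [rho rho0 H] := cont j; exists rho.
pose r := Num.min 1 (\big[Num.min/1]_j (rho j / 2)).
have r0 : 0 < r.
  rewrite lt_min ltr01 /=; apply/bigmin_gtP; split => // j _.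
  by have [? _] := Hrho j; rewrite divr_gt0.
have r1 : r <= 1 by rewrite ge_min lexx.
have rr j : r <= rho j / 2 by rewrite ge_min bigmin_le_cond ?orbT.
exists r => // z z' zr z'r.
have key := @partials_lipschitz d n (fun y => F y - y *m jac F x0)
   (fun j y => derive F y (ev j) - ev j *m jac F x0) (x0 - const_mx r)
   (x0 + const_mx r) (eta / (d%:R + 1)) (ltW e0).
have -> : F z' - F z - (z' - z) *m jac F x0 = F z' - z' *m jac F x0 - (F z - z *m jac F x0).
  by rewrite mulmxBl !opprD !opprK addrACA.
apply: le_trans (key _ z z' _ _) _.
- move=> y /box_of_ball -/(_ (ltW r0)) yz j; split.
    by apply: is_deriveB; [exact: C1_derive|exact: is_derive_mulmx].
  rewrite row_jac; apply: ltW; apply: (Hrho j).2.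
  + lra.
  + by rewrite subrr normr0.
  + have [? _] := Hrho j; have := rr j; lra.
- by apply/box_of_ball => //; exact: ltW.
- by apply/box_of_ball => //; exact: ltW.
- rewrite ler_wpM2r // mulrCA ler_piMr ?(ltW eta0) //.
  by rewrite ler_pdivrMr ?ltr_wpDl // mul1r lerDl.
Qed.

Lemma jac_bounded x0 r : exists2 M : R, 0 <= M & forall z, `|z - x0| <= r -> `|jac F z| <= M.
Proof.
have /choice[M HM] : forall j, exists M : R, 0 <= M /\ forall z, `|z - x0| <= r ->
    `|derive F z (ev j)| <= M.
  move=> j; have [M M0 H] := compact_bounded (@closed_ball_compact d x0 r)
   (continuous_cont_on (K := [set z | `|z - x0| <= r]) (@C1_partial_cont j)).
  by exists M.
exists (\sum_j M j); first by apply: sumr_ge0 => j _; case: (HM j).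
move=> z zr; rewrite [leLHS]/Num.norm /= mx_normrE; apply/bigmax_leP.
have s0 : 0 <= \sum_j M j by apply: sumr_ge0 => j _; case: (HM j).
split => // -[j i] _ /=; rewrite mxE.
apply: le_trans (rV_coord_le _ _) _; apply: le_trans ((HM j).2 z zr) _.
by rewrite (bigD1 j) //= lerDl; apply: sumr_ge0 => k _; case: (HM k).
Qed.

Lemma C1_lipschitz x0 r : exists2 L : R, 0 <= L &
  forall z z', `|z - x0| <= r -> `|z' - x0| <= r -> `|F z' - F z| <= L * `|z' - z|.
Proof.
have [M M0 HM] := jac_bounded x0 r.
exists (d%:R * M); first by rewrite mulr_ge0.
move=> z z' zr zr'; have r0 : 0 <= r by exact: le_trans zr.
apply: (@partials_lipschitz d n F (fun j y => derive F y (ev j)) (x0 - const_mx r)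
  (x0 + const_mx r)) => //; try exact/box_of_ball.
move=> y /box_of_ball -/(_ r0) yr j; split; first exact: C1_derive.
apply: rV_norm_le => // i; have := mx_entry_le (jac F y) j i; rewrite mxE => /le_trans; apply.
exact: HM.
Qed.

Lemma C1_derive_dir (x v : 'rV[R]_d) : is_derive x v F (v *m jac F x).
Proof.
apply/is_derive_dir_approx => e e0.
have e1 : 0 < e / (`|v| + 1) by rewrite divr_gt0 // ltr_wpDl.
have [rho rho0 H] := C1_unif_diff x 0 e1.
exists (rho / (`|v| + 1)); first by rewrite divr_gt0 // ltr_wpDl.
move=> h; rewrite ler_pdivlMr ?ltr_wpDl // => hr.
have hv : `|h *: v| <= `|h| * (`|v| + 1) by rewrite normrZ ler_wpM2l // lerDl.
have := H x (x + h *: v); rewrite subrr normr0 lexx => /(_ isT).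
have -> : x + h *: v - x = h *: v by rewrite addrAC subrr add0r.
move=> /(_ (le_trans hv hr)); rewrite -scalemxAl => /le_trans; apply.
rewrite mulrAC ler_pdivrMr ?ltr_wpDl // -mulrA ler_wpM2l //; exact: ltW.
Qed.

End C1.
End Jacobian.

(** * Local flows of C1 vector fields *)

Section Flows.
Context {R : realType}.

(** The form in which [picard] delivers solutions; it is stable under restriction and time reversal,
    and Lipschitz continuity is what Gronwall's inequality asks for. *)
Definition flow_arc d (F : 'rV[R]_d -> 'rV[R]_d) (C T : R) (c : R -> 'rV[R]_d) :=
  lips C 0 T c /\
  exists2 N, null N & forall t, 0 < t < T -> ~ N t -> is_derive t (1:R) c (F (c t)).

Lemma flow_arc_sub d (F : 'rV[R]_d -> 'rV[R]_d) C T T' c : T' <= T ->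
  flow_arc F C T c -> flow_arc F C T' c.
Proof.
move=> TT [lc [N nN HN]]; split.
  by move=> s t /andP[? ?] /andP[? ?]; apply: lc; apply/andP; split => //; lra.
by exists N => // t /andP[? ?]; apply: HN; apply/andP; split => //; lra.
Qed.

Lemma flow_arc_disp d (F : 'rV[R]_d -> 'rV[R]_d) C T c t : 0 <= t <= T -> flow_arc F C T c ->
  `|c t - c 0| <= C * t.
Proof.
move=> /andP[t0 tT] [lc _]; apply: le_trans (lc _ _ _ _) _; rewrite ?lexx ?t0 ?tT ?(le_trans t0) //.
by rewrite subr0 ger0_norm.
Qed.

Lemma flow_arc_gronwall d (F : 'rV[R]_d -> 'rV[R]_d) (D : set 'rV[R]_d) (L C C' T : R) c c' :
  0 <= L -> 0 <= T <= 1 -> (forall z z', D z -> D z' -> `|F z' - F z| <= L * `|z' - z|) ->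
  flow_arc F C T c -> flow_arc F C' T c' ->
  (forall t, 0 <= t <= T -> D (c t) /\ D (c' t)) ->
  forall t, 0 <= t <= T -> `|c' t - c t| <= 2 * expR (2 * L) * `|c' 0 - c 0|.
Proof.
move=> L0 /andP[T0 T1] LF [lc [N nN HN]] [lc' [N' nN' HN']] HD t tT.
have lcc : lips (C' + C) 0 T (fun s => c' s - c s).
  move=> u v uT vT; rewrite opprD addrACA -opprD mulrDl.
  by apply: le_trans (ler_normB _ _) _; apply: lerD; [exact: lc'|exact: lc].
have := @gronwall R d (fun s => c' s - c s) (C' + C) L 0 0 T (N `|` N') L0 (lexx _) T0 lcc.
move=> /(_ (nullU nN nN')) G; apply: le_trans (G _ t tT) _.
  move=> s sT Ns; exists (F (c' s) - F (c s)).
    by apply: is_deriveB; [apply: HN' => // ?; apply: Ns; right|apply: HN => // ?; apply: Ns; left].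
  have [] := HD s; first by case/andP: sT => ? ?; rewrite !ltW.
  by rewrite addr0; move=> ? ?; apply: LF.
rewrite mul0r addr0 subr0 ler_wpM2r // ler_wpM2l // ler_expR.
by rewrite ler_piMr // mulr_ge0.
Qed.

Lemma global_flow d (F : 'rV[R]_d -> 'rV[R]_d) (L M : R) : 0 <= L -> 0 <= M ->
  (forall z z', `|F z' - F z| <= L * `|z' - z|) -> (forall z, `|F z| <= M) ->
  exists phi : R -> 'rV[R]_d -> 'rV[R]_d, [/\ forall x, phi 0 x = x,
    forall x, flow_arc F M 1 (phi^~ x) &
    forall t x x', 0 <= t <= 1 -> `|phi t x' - phi t x| <= 2 * expR (2 * L) * `|x' - x|].
Proof.
move=> L0 M0 LF BF.
have /choice[phi Hphi] : forall x, exists c : R -> 'rV[R]_d, c 0 = x /\ flow_arc F M 1 c.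
  move=> x.
  have [||||c [M' [M'0 lc c0 [N nN HN]]]] := @picard R d (fun=> F) L M 0 1 x L0 M0.
  - exact: ler01.
  - by move=> _ z z'; exact: LF.
  - by [].
  - move=> c cc j; apply: continuous_measurable_fun.
    have cF : continuous F by apply: (lips_continuous (L := L)) => z z'; exact: LF.
    move=> t; apply: (@continuous_comp _ _ _ (F \o c) (fun z : 'rV[R]_d => z 0 j)).
      by apply: continuous_comp; [exact: cc|exact: cF].
    exact: coord_continuous.
  exists c; split => //; split; last by exists N.
  apply: (@AC_lips R d _ _ _ _ N) => //; first exact: lips_AC lc.
  by move=> t tT Nt; exists (F (c t)); first exact: HN.
exists (fun t x => phi x t); split.
- by move=> x; case: (Hphi x).
- by move=> x; case: (Hphi x).
- move=> t x x' tT; have [h1 h2] := Hphi x; have [h3 h4] := Hphi x'.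
  rewrite -[X in _ <= _ * `|_ - X|]h1 -[X in _ <= _ * `|X - _|]h3.
  apply: (flow_arc_gronwall (D := setT) L0 _ _ h2 h4) => //.
  by rewrite ler01 lexx.
Qed.

(** Nearest point in the ball of the sup norm, taken coordinate by coordinate. It is 1-Lipschitz, so
    composing a C1 field with it gives a bounded, globally Lipschitz field with the same values on
    the ball. *)
Definition clampv d (x0 : 'rV[R]_d) (r : R) (z : 'rV[R]_d) : 'rV[R]_d :=
  \row_i clampR (x0 0 i - r) (x0 0 i + r) (z 0 i).

Lemma clampv_ball d (x0 : 'rV[R]_d) r z : 0 <= r -> `|clampv x0 r z - x0| <= r.
Proof.
move=> r0; apply: rV_norm_le => // i; rewrite !mxE ler_norml.
have ab : x0 0 i - r <= x0 0 i + r by lra.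
by have /andP[? ?] := @clampR_in R _ _ (z 0 i) ab; apply/andP; split; lra.
Qed.

Lemma clampv_lip d (x0 : 'rV[R]_d) r z z' : 0 <= r -> `|clampv x0 r z - clampv x0 r z'| <= `|z - z'|.
Proof.
move=> r0; apply: rV_norm_le => // i; rewrite !mxE.
have ab : x0 0 i - r <= x0 0 i + r by lra.
apply: le_trans (clampR_lip _ _ ab) _.
by apply: le_trans (rV_coord_le _ i); rewrite !mxE.
Qed.

Lemma clampv_id d (x0 : 'rV[R]_d) r z : `|z - x0| <= r -> clampv x0 r z = z.
Proof.
move=> zr; apply/rowP => i; rewrite mxE clampR_id //.
have := le_trans (rV_coord_le _ i) zr; rewrite !mxE ler_norml => /andP[? ?].
by apply/andP; split; lra.
Qed.

(** [phi] is a total function of which only the behaviour near time 0 and near [x0] is specified;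
    the same [r] bounds the initial points and the lifespan. *)
Definition lflow d (F : 'rV[R]_d -> 'rV[R]_d) (phi : R -> 'rV[R]_d -> 'rV[R]_d) (x0 : 'rV[R]_d) :=
  exists r C : R, [/\ 0 < r <= 1, 0 <= C & forall x, `|x - x0| <= r ->
    phi 0 x = x /\ flow_arc F C r (phi^~ x)].

Lemma lflow_near d F phi (x0 : 'rV[R]_d) : lflow F phi x0 -> exists2 rho : R, 0 < rho &
  forall x1, `|x1 - x0| <= rho -> lflow F phi x1.
Proof.
move=> [r [C [/andP[r0 r1] C0 H]]]; exists (r / 2); first lra.
move=> x1 x1r; exists (r / 2), C; split => //; first by apply/andP; split; lra.
move=> x xr; have [|? a] := H x.
  have -> : x - x0 = (x - x1) + (x1 - x0) by rewrite addrA subrK.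
  by apply: le_trans (ler_normD _ _) _; lra.
by split => //; apply: flow_arc_sub a; lra.
Qed.

Lemma lflow_disp d F phi (x0 : 'rV[R]_d) : lflow F phi x0 -> exists rho C : R,
  [/\ 0 < rho <= 1, 0 <= C & forall x t, `|x - x0| <= rho -> 0 <= t <= rho -> `|phi t x - x| <= C * t].
Proof.
move=> [r [C [r01 C0 H]]]; exists r, C; split => // x t xr tr.
by have [e a] := H x xr; have := flow_arc_disp tr a; rewrite e.
Qed.

Lemma lflow_in_ball d F phi (x0 : 'rV[R]_d) (r' : R) : 0 < r' -> lflow F phi x0 ->
  exists r C : R, [/\ 0 < r <= 1, 0 <= C & forall x, `|x - x0| <= r ->
    [/\ phi 0 x = x, flow_arc F C r (phi^~ x) & forall t, 0 <= t <= r -> `|phi t x - x0| <= r']].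
Proof.
move=> r'0 [r [C [/andP[r0 r1] C0 H]]].
pose r2 := Num.min r (r' / (C + 1)).
have r2r : r2 <= r by rewrite ge_min lexx.
have r2r' : r2 * (C + 1) <= r' by rewrite -ler_pdivlMr ?ltr_wpDl // ge_min lexx orbT.
have r20 : 0 < r2 by rewrite lt_min r0 divr_gt0 // ltr_wpDl.
exists r2, C; split => //; first by rewrite r20 (le_trans r2r).
move=> x xr; have [e a] := H x (le_trans xr r2r); split => //; first exact: flow_arc_sub a.
move=> t /andP[t0 tr].
have tr' : 0 <= t <= r by rewrite t0 (le_trans tr).
have := flow_arc_disp tr' a; rewrite e => h.
have -> : phi t x - x0 = (phi t x - x) + (x - x0) by rewrite addrA subrK.
apply: le_trans (ler_normD _ _) _.
have : C * t <= C * r2 by rewrite ler_wpM2l.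
rewrite mulrDr mulr1 mulrC in r2r'; lra.
Qed.

Lemma clamped_lflow d (F : 'rV[R]_d -> 'rV[R]_d) phi (x0 x1 : 'rV[R]_d) (r M : R) :
  0 <= M -> `|x1 - x0| < r -> (forall x, phi 0 x = x) ->
  (forall x, flow_arc (fun z => F (clampv x0 r z)) M 1 (phi^~ x)) -> lflow F phi x1.
Proof.
move=> M0 x1r phi0 a; pose s := Num.min 1 ((r - `|x1 - x0|) / (M + 1)).
have s0 : 0 < s by rewrite lt_min ltr01 divr_gt0 ?subr_gt0 ?ltr_wpDl.
have s1 : s <= 1 by rewrite ge_min lexx.
have sM : s * (M + 1) <= r - `|x1 - x0| by rewrite -ler_pdivlMr ?ltr_wpDl // ge_min lexx orbT.
exists s, M; split => //; first by rewrite s0.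
move=> x xs; split => //; have [lc [N nN HN]] := flow_arc_sub s1 (a x).
split => //; exists N => // t ts Nt; rewrite -[phi t x](@clampv_id d x0 r).
  exact: HN.
case/andP: ts => t0 ts.
have := @flow_arc_disp d _ M 1 _ t _ (a x); rewrite (ltW t0) (ltW (lt_le_trans ts s1)) phi0.
move=> /(_ isT) h.
have -> : phi t x - x0 = (phi t x - x) + (x - x1) + (x1 - x0).
  by rewrite !addrA !subrK.
apply: le_trans (ler_normD _ _) _; have := ler_normD (phi t x - x) (x - x1).
have : M * t <= M * s by rewrite ler_wpM2l // ltW.
rewrite mulrDr mulr1 mulrC in sM; lra.
Qed.

Lemma lflow_exists d (F : 'rV[R]_d -> 'rV[R]_d) (x0 : 'rV[R]_d) : isCk 1 F ->
  exists phi, lflow F phi x0.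
Proof.
move=> CF; have [L L0 LF] := C1_lipschitz CF x0 1.
have [M M0 MF] := compact_bounded (@closed_ball_compact R d x0 1)
   (continuous_cont_on (K := [set z | `|z - x0| <= 1]) (CF.1)).
have [|| phi [phi0 a _]] := @global_flow d (fun z => F (clampv x0 1 z)) L M L0 M0.
- move=> z z'; apply: le_trans (LF _ _ _ _) _; rewrite ?clampv_ball //.
  by rewrite ler_wpM2l // clampv_lip.
- by move=> z; apply: MF; rewrite /= clampv_ball.
exists phi; apply: (@clamped_lflow d F phi x0 x0 1 M) => //.
by rewrite subrr normr0.
Qed.

Lemma continuous_oppv {T V : normedModType R} (F : T -> V) : continuous F ->
  continuous (fun x => - F x).
Proof.
move=> cF x; apply/cvgrPdist_le => e e0; have /cvgrPdist_le/(_ e e0) := cF x.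
by apply: filterS => y; rewrite -opprD normrN.
Qed.

Lemma isCk1N d n (F : 'rV[R]_d -> 'rV[R]_n) : isCk 1 F -> isCk 1 (fun x => - F x).
Proof.
move=> CF; split; first by apply: continuous_oppv; exact: CF.1.
move=> j; have dF x : is_derive x (ev j) (fun z => - F z) (- derive F x (ev j)).
  by apply: is_deriveN; exact: (C1_derive CF).
split; first by move=> x; case: (dF x).
have -> : (fun x => derive (fun z => - F z) x (ev j)) = fun x => - derive F x (ev j).
  by apply/funext => x; case: (dF x).
by split => //; apply: continuous_oppv; exact: (C1_partial_cont CF).
Qed.

Lemma flow_arc_reverse d (F : 'rV[R]_d -> 'rV[R]_d) C T c : flow_arc F C T c ->
  flow_arc (fun x => - F x) C T (fun s => c (T - s)).
Proof.
move=> [lc [N nN HN]]; split.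
  move=> s t /andP[? ?] /andP[? ?]; apply: le_trans (lc _ _ _ _) _.
  - by apply/andP; split; lra.
  - by apply/andP; split; lra.
  - by rewrite (_ : T - s - (T - t) = t - s) 1?distrC //; ring.
exists [set t | N (T - t)]; first exact: null_reflect.
move=> t /andP[t0 tT] Nt.
have /is_derive_approx D : is_derive (T - t) (1:R) c (F (c (T - t))).
  by apply: HN => //; apply/andP; split; lra.
apply/is_derive_approx => e /D[r r0 Hr]; exists r => // h hr.
have := Hr (- h); rewrite normrN => /(_ hr).
by rewrite scalerN scaleNr opprD addrA.
Qed.

(** The arc run backwards from [phi t x] is an arc of [- F], and so is the flow [phi'] issued from
    that point; Gronwall's inequality makes them coincide. *)
Lemma lflow_inverse d (F : 'rV[R]_d -> 'rV[R]_d) phi phi' (x0 : 'rV[R]_d) : isCk 1 F ->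
  lflow F phi x0 -> lflow (fun x => - F x) phi' x0 ->
  exists2 rho : R, 0 < rho & forall x t, `|x - x0| <= rho -> 0 <= t <= rho ->
    phi' t (phi t x) = x.
Proof.
move=> CF lf lf'; have [L L0 LF] := C1_lipschitz (isCk1N CF) x0 1.
have [r' [C' [/andP[r'0 r'1] C'0 H']]] := lflow_in_ball ltr01 lf'.
have [r [C [/andP[r0 r1] C0 H]]] := lflow_in_ball r'0 lf.
exists (Num.min r r'); first by rewrite lt_min r0.
move=> x t xr /andP[t0]; rewrite le_min => /andP[tr tr'].
have [|e a Ha] := H x; first by apply: le_trans xr _; rewrite ge_min lexx.
have [|e' a' Ha'] := H' (phi t x); first by apply: Ha; rewrite t0.
have b := flow_arc_reverse (flow_arc_sub tr a).
have b' := flow_arc_sub tr' a'.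
have := flow_arc_gronwall (D := [set z | `|z - x0| <= 1]) L0 _ LF b b'.
rewrite t0 (le_trans tr r1) e' subr0 subrr normr0 mulr0 => /(_ isT) G.
have := G _ t; rewrite subrr e lexx t0 => /(_ _ isT)/= K; apply/eqP; rewrite -subr_eq0 -normr_le0.
apply: K => s /andP[s0 st]; split => /=.
  apply: le_trans (Ha _ _) _ => //; by apply/andP; split; lra.
by apply: Ha'; apply/andP; split; lra.
Qed.

End Flows.

Ltac qlra := repeat match goal with H : _ |- _ => clear H end; lra.

(** * Expansions of maps near the identity and their commutators *)

Section NearIdentity.
Context {R : realType}.

(** The expansion [x + t^q B + o(t^q)] is uniform over base points near [x0] although the
    coefficient is frozen: this hides the continuity of the direction field at [x0]. *)
Definition near_id0 d (P : R -> 'rV[R]_d -> 'rV[R]_d) (q : nat) (B x0 : 'rV[R]_d) :=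
  forall eta : R, 0 < eta -> exists2 rho : R, 0 < rho & forall t x, 0 < t <= rho ->
    `|x - x0| <= rho -> `|P t x - x - t ^+ q *: B| <= eta * t ^+ q.

(** The map [P t - id - t^q J] is Lipschitz near [x0] with a constant [o(t^q)]: a first-order
    expansion of the differential, stated without differentiating. *)
Definition near_id1 d (P : R -> 'rV[R]_d -> 'rV[R]_d) (q : nat) (J : 'M[R]_d) (x0 : 'rV[R]_d) :=
  forall eta : R, 0 < eta -> exists2 rho : R, 0 < rho & forall t x x', 0 < t <= rho ->
    `|x - x0| <= rho -> `|x' - x0| <= rho ->
    `|P t x' - P t x - (x' - x) - t ^+ q *: ((x' - x) *m J)| <= eta * t ^+ q * `|x' - x|.

Definition right_inverse_near d (P P' : R -> 'rV[R]_d -> 'rV[R]_d) (x0 : 'rV[R]_d) :=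
  exists2 rho : R, 0 < rho & forall t x, 0 < t <= rho -> `|x - x0| <= rho -> P t (P' t x) = x.

Definition small_disp d (P : R -> 'rV[R]_d -> 'rV[R]_d) (x0 : 'rV[R]_d) :=
  exists rho C : R, [/\ 0 < rho, 0 <= C & forall t x, 0 <= t <= rho -> `|x - x0| <= rho ->
    `|P t x - x| <= C * t].

Lemma small_disp_ball d P (x0 : 'rV[R]_d) : small_disp P x0 -> forall r : R, 0 < r ->
  exists2 rho : R, 0 < rho & forall t x, 0 <= t <= rho -> `|x - x0| <= rho -> `|P t x - x0| <= r.
Proof.
move=> [rho [C [rho0 C0 H]]] r r0.
pose s := Num.min rho (r / (C + 1)).
have sr : s * (C + 1) <= r by rewrite -ler_pdivlMr ?ltr_wpDl // ge_min lexx orbT.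
exists s; first by rewrite lt_min rho0 divr_gt0 // ltr_wpDl.
move=> t x /andP[t0 ts] xs.
have srho : s <= rho by rewrite ge_min lexx.
have := H t x; rewrite t0 (le_trans ts srho) (le_trans xs srho) => /(_ isT isT) h.
have -> : P t x - x0 = (P t x - x) + (x - x0) by rewrite addrA subrK.
apply: le_trans (ler_normD _ _) _.
have : C * t <= C * s by rewrite ler_wpM2l.
rewrite mulrDr mulr1 mulrC in sr; lra.
Qed.

Lemma small_disp_comp d P Q (x0 : 'rV[R]_d) : small_disp P x0 -> small_disp Q x0 ->
  small_disp (fun t x => Q t (P t x)) x0.
Proof.
move=> hP [rho [C [rho0 C0 H]]]; have [s s0 Hs] := small_disp_ball hP rho0.
have [rho' [C' [rho'0 C'0 H']]] := hP.
exists (Num.min s (Num.min rho rho')), (C + C'); split; [by rewrite !lt_min s0 rho0|by rewrite addr_ge0|].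
move=> t x /andP[t0]; rewrite !le_min => /andP[ts /andP[tr tr']] /andP[xs /andP[xr xr']].
have -> : Q t (P t x) - x = (Q t (P t x) - P t x) + (P t x - x) by rewrite addrA subrK.
apply: le_trans (ler_normD _ _) _; rewrite mulrDl; apply: lerD.
  by apply: H; rewrite ?t0 //; apply: Hs; rewrite ?t0.
by apply: H'; rewrite ?t0.
Qed.

(* The commutator of [x + t^q1 R] and [x + t^q2 T]: in [P2 (P1 x) - P1 (P2 x)] all terms cancel
   except [t^(q1+q2) (DT R - DR T)]. *)
Lemma commutator_near_id d (P1 P2 P1' P2' : R -> 'rV[R]_d -> 'rV[R]_d) q1 q2 B1 B2
  (J1 J2 : 'M[R]_d) x0 : (0 < q1)%N -> (0 < q2)%N ->
  near_id0 P1 q1 B1 x0 -> near_id1 P1 q1 J1 x0 -> near_id0 P2 q2 B2 x0 -> near_id1 P2 q2 J2 x0 ->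
  right_inverse_near P1 P1' x0 -> right_inverse_near P2 P2' x0 ->
  small_disp P1 x0 -> small_disp P2 x0 -> small_disp P1' x0 -> small_disp P2' x0 ->
  near_id0 (fun t x => P2' t (P1' t (P2 t (P1 t x)))) (q1 + q2) (B1 *m J2 - B2 *m J1) x0.
Proof.
move=> q10 q20 n10 n11 n20 n21 [ri1 ri10 RI1] [ri2 ri20 RI2] sd1 sd2 sd1' sd2' eta eta0.
(* [b] bounds the displacements divided by [t^q1] and [t^q2], [k'] the Lipschitz constants of
   [P - id] divided by the same powers, [k] the sum of the errors in [D], [k''] the loss when [D] is
   compared with [u - x], and [M] the size of [D] divided by [t^(q1+q2)]. *)
pose b := `|B1| + `|B2| + 1.
pose k' := d%:R * `|J1| + d%:R * `|J2| + 1.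
pose k := 2 * b + k'.
pose k'' := k' * (2 + k').
pose B := B1 *m J2 - B2 *m J1.
have dJ1 : 0 <= d%:R * `|J1| by rewrite mulr_ge0.
have dJ2 : 0 <= d%:R * `|J2| by rewrite mulr_ge0.
have nB1 := normr_ge0 B1; have nB2 := normr_ge0 B2.
have b0 : 1 <= b by rewrite /b; lra.
have k'0 : 1 <= k' by rewrite /k'; lra.
have k0 : 1 <= k by rewrite /k; lra.
have k''0 : 1 <= k''.
  by apply: (le_trans k'0); rewrite /k'' ler_peMr //; lra.
pose M := `|B| + k.
have M0 : 1 <= M by rewrite /M; have := normr_ge0 B; lra.
pose e1 := Num.min 1 (eta / (2 * k)).
have e10 : 0 < e1 by rewrite lt_min ltr01 divr_gt0 //; lra.
have e11 : e1 <= 1 by rewrite ge_min lexx.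
have e1k : e1 * k <= eta / 2.
  have : e1 <= eta / (2 * k) by rewrite ge_min lexx orbT.
  rewrite ler_pdivlMr; last lra.
  lra.
have [r10 r100 H10] := n10 _ e10; have [r11 r110 H11] := n11 _ e10.
have [r20 r200 H20] := n20 _ e10; have [r21 r210 H21] := n21 _ e10.
have [r r0 rle] : exists2 r : R, 0 < r & forall y, y <= r ->
    [/\ y <= r10, y <= r11, y <= r20 & y <= r21] /\ (y <= ri1 /\ y <= ri2).
  exists (Num.min r10 (Num.min r11 (Num.min r20 (Num.min r21 (Num.min ri1 ri2))))).
    by rewrite !lt_min r100 r110 r200 r210 ri10 ri20.
  by move=> y; rewrite !le_min => /and5P[-> -> -> -> /andP[-> ->]].
have [s1 s10 S1] := small_disp_ball sd1 r0.
have [s2 s20 S2] := small_disp_ball sd2 r0.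
have sdu : small_disp (fun t x => P2' t (P1' t (P2 t (P1 t x)))) x0.
  by do 3! apply: small_disp_comp => //.
have sd21 : small_disp (fun t x => P2 t (P1 t x)) x0 by exact: small_disp_comp.
have sd121 : small_disp (fun t x => P1' t (P2 t (P1 t x))) x0 by apply: small_disp_comp.
have [s3 s30 S3] := small_disp_ball sd21 r0.
have [s4 s40 S4] := small_disp_ball sd121 r0.
have rs20 : 0 < Num.min r s2 by rewrite lt_min r0.
have [s5 s50 S5] := small_disp_ball sdu rs20.
pose s := Num.min r (Num.min s1 (Num.min s2 (Num.min s3 (Num.min s4 (Num.min s5
  (Num.min 1 (Num.min (1 / (2 * k'')) (eta / (4 * k'' * M))))))))).
exists s.
  have pk : 0 < k'' by exact: lt_le_trans ltr01 k''0.
  have pM : 0 < M by exact: lt_le_trans ltr01 M0.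
  have p2 : 0 < 2 * k'' by apply: mulr_gt0.
  have p4 : 0 < 4 * k'' * M by apply: mulr_gt0 => //; apply: mulr_gt0.
  by rewrite !lt_min r0 s10 s20 s30 s40 s50 ltr01 /= (divr_gt0 ltr01 p2) (divr_gt0 eta0 p4).
move=> t x /andP[t0]; rewrite !le_min.
move=> /and5P[tr ts1 ts2 ts3 /and5P[ts4 ts5 t1 tk tM]].
move=> /and5P[xr xs1 xs2 xs3 /and5P[xs4 xs5 _ _ _]].
have t0' := ltW t0.
have kE : k = 2 * b + (d%:R * `|J1| + d%:R * `|J2| + 1) by [].
have hJ1 : d%:R * `|J1| + 1 <= k' by rewrite /k'; move: dJ1 dJ2; qlra.
have hJ2 : d%:R * `|J2| + 1 <= k' by rewrite /k'; move: dJ1 dJ2; qlra.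
have k''E : k'' = k' * (2 + k') by [].
have ME : M = `|B| + k by [].
have hB1 : `|B1| + 1 <= b by rewrite /b; move: nB1 nB2; qlra.
have hB2 : `|B2| + 1 <= b by rewrite /b; move: nB1 nB2; qlra.
have pk : 0 < k'' by exact: lt_le_trans k''0.
have pM : 0 < M by exact: lt_le_trans M0.
have tk2 : t * k'' <= 1 / 2.
  by move: tk; rewrite ler_pdivlMr; [qlra|rewrite mulr_gt0].
have tM2 : t * k'' * (2 * M) <= eta / 2.
  by move: tM; rewrite ler_pdivlMr; [qlra|rewrite mulr_gt0 // mulr_gt0].
clear n10 n11 n20 n21 sd1 sd2 sd1' sd2' sdu sd21 sd121 tk tM s nB1 nB2.
clearbody k k' k'' M b e1.
have rb (z : 'rV[R]_d) := rle `|z - x0|.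
have [[t10 t11 t20 t21] [ti1 ti2]] := rle t tr.
have tpow q : (0 < q)%N -> t ^+ q <= t.
  by case: q => // q _; rewrite exprS ler_piMr // exprn_ile1.
set a := t ^+ q1; set c := t ^+ q2; rewrite exprD -/a -/c -/B.
have a0 : 0 < a by exact: exprn_gt0.
have c0 : 0 < c by exact: exprn_gt0.
have at_ : a <= t by exact: tpow.
have ct : c <= t by exact: tpow.
have [xr10 xr11 xr20 xr21] := (rb x xr).1.
set X1 := P1 t x; set X2 := P2 t x.
have X1r : `|X1 - x0| <= r by apply: S1; rewrite ?t0'.
have X2r : `|X2 - x0| <= r by apply: S2; rewrite ?t0'.
set u := P2' t (P1' t (P2 t X1)).
have /S5 : 0 <= t <= s5 by rewrite t0'.
move=> /(_ x xs5); rewrite -/X1 -/u le_min => /andP[ur us2].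
(* Applying [P2] and then [P1] to [u] undoes the last two maps, so [u] satisfies
   [P1 t (P2 t u) = P2 t (P1 t x)] and no expansion of the inverses enters. *)
have P2u : P2 t u = P1' t (P2 t X1).
  apply: RI2; rewrite ?t0 //; apply: (rb _ _).2.2; apply: S4; rewrite ?t0' //.
have P1P2u : P1 t (P2 t u) = P2 t X1.
  rewrite P2u; apply: RI1; rewrite ?t0 //; apply: (rb _ _).2.1; apply: S3; rewrite ?t0' //.
have P2ur : `|P2 t u - x0| <= r by apply: S2; rewrite ?t0'.
pose r1 := X1 - x; pose r2 := X2 - x.
have h10 : `|r1 - a *: B1| <= e1 * a by apply: H10; rewrite ?t0.
have h20 : `|r2 - c *: B2| <= e1 * c by apply: H20; rewrite ?t0.
have nr (z w : 'rV[R]_d) (y : R) : 0 < y -> `|z - y *: w| <= e1 * y -> `|w| + 1 <= b -> `|z| <= y * b.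
  move=> y0 zw wb; rewrite -(subrK (y *: w) z); apply: le_trans (ler_normD _ _) _.
  rewrite normrZ (gtr0_norm y0).
  have : e1 * y <= 1 * y by rewrite ler_wpM2r // ltW.
  have : y * (`|w| + 1) <= y * b by rewrite ler_wpM2l // ltW.
  move: zw; qlra.
have nr1 : `|r1| <= a * b by apply: nr h10 _.
have nr2 : `|r2| <= c * b by apply: nr h20 _.
have E1 : `|P2 t X1 - X2 - r1 - c *: (r1 *m J2)| <= e1 * c * (a * b).
  apply: le_trans (H21 t x X1 _ _ _) _; rewrite ?t0 //; first by case: (rb _ X1r).1.
  by rewrite ler_wpM2l // mulr_ge0 // ltW.
have E2 : `|P1 t X2 - X1 - r2 - a *: (r2 *m J1)| <= e1 * a * (c * b).
  apply: le_trans (H11 t x X2 _ _ _) _; rewrite ?t0 //; first by case: (rb _ X2r).1.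
  by rewrite ler_wpM2l // mulr_ge0 // ltW.
have F1 : `|c *: (r1 *m J2) - (a * c) *: (B1 *m J2)| <= c * (d%:R * (e1 * a) * `|J2|).
  have -> : c *: (r1 *m J2) - (a * c) *: (B1 *m J2) = c *: ((r1 - a *: B1) *m J2).
    by rewrite [in RHS]mulmxBl scalerBr -scalemxAl scalerA [c * a]mulrC.
  rewrite normrZ (gtr0_norm c0) ler_wpM2l ?(ltW c0) //.
  by apply: le_trans (mulmx_norm_le _ _) _; rewrite ler_wpM2r // ler_wpM2l.
have F2 : `|a *: (r2 *m J1) - (a * c) *: (B2 *m J1)| <= a * (d%:R * (e1 * c) * `|J1|).
  have -> : a *: (r2 *m J1) - (a * c) *: (B2 *m J1) = a *: ((r2 - c *: B2) *m J1).
    by rewrite [in RHS]mulmxBl scalerBr -scalemxAl scalerA.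
  rewrite normrZ (gtr0_norm a0) ler_wpM2l ?(ltW a0) //.
  by apply: le_trans (mulmx_norm_le _ _) _; rewrite ler_wpM2r // ler_wpM2l.
pose D := P2 t X1 - P1 t X2.
have ac0 : 0 < a * c by rewrite mulr_gt0.
have DB : `|D - (a * c) *: B| <= a * c * (e1 * k).
  have -> : D - (a * c) *: B = (P2 t X1 - X2 - r1 - c *: (r1 *m J2))
     - (P1 t X2 - X1 - r2 - a *: (r2 *m J1)) + (c *: (r1 *m J2) - (a * c) *: (B1 *m J2))
     - (a *: (r2 *m J1) - (a * c) *: (B2 *m J1)).
    rewrite /D /B scalerBr /r1 /r2.
    move: (c *: _) (a *: _) (_ *: (B1 *m _)) (_ *: (B2 *m _)) => v1 v2 v3 v4.
    by apply/rowP => i; rewrite !mxE; ring.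
  apply: le_trans (ler_normB _ _) _; apply: le_trans (lerD (ler_normD _ _) (lexx _)) _.
  apply: le_trans (lerD (lerD (ler_normB _ _) (lexx _)) (lexx _)) _.
  have -> : a * c * (e1 * k) = e1 * c * (a * b) + e1 * a * (c * b) + c * (d%:R * (e1 * a) * `|J2|)
     + a * (d%:R * (e1 * c) * `|J1|) + a * c * e1 by rewrite kE; ring.
  have : 0 <= a * c * e1 by rewrite mulr_ge0 // ltW.
  move: E1 E2 F1 F2; qlra.
have near (P : R -> 'rV[R]_d -> 'rV[R]_d) (y : R) J (z z' : 'rV[R]_d) : 0 < y ->
    `|P t z' - P t z - (z' - z) - y *: ((z' - z) *m J)| <= e1 * y * `|z' - z| ->
    d%:R * `|J| + 1 <= k' -> `|P t z' - P t z - (z' - z)| <= y * k' * `|z' - z|.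
  move=> y0 h Jk; rewrite -(subrK (y *: ((z' - z) *m J)) (P t z' - P t z - (z' - z))).
  apply: le_trans (ler_normD _ _) _; rewrite normrZ (gtr0_norm y0).
  have h1 : y * `|(z' - z) *m J| <= y * (d%:R * `|z' - z| * `|J|).
    by rewrite ler_wpM2l ?(ltW y0) // mulmx_norm_le.
  have h2 : y * `|z' - z| * (d%:R * `|J| + 1) <= y * `|z' - z| * k'.
    by rewrite ler_wpM2l // mulr_ge0 // ltW.
  have h3 : e1 * (y * `|z' - z|) <= 1 * (y * `|z' - z|).
    by rewrite ler_wpM2r // mulr_ge0 // ltW.
  move: h h1 h2 h3; qlra.
set U := `|u - x|; have U0 : 0 <= U by exact: normr_ge0.
have G2 : `|P2 t u - X2 - (u - x)| <= c * k' * U.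
  apply: (near P2 c J2) => //.
  by apply: H21; rewrite ?t0 //; case: (rb _ ur).1.
have nP2 : `|P2 t u - X2| <= (1 + k') * U.
  rewrite -(subrK (u - x) (P2 t u - X2)); apply: le_trans (ler_normD _ _) _.
  have : c * (k' * U) <= 1 * (k' * U).
    rewrite ler_wpM2r ?mulr_ge0 //; [exact: le_trans k'0|exact: le_trans ct t1].
  rewrite -/U; move: G2; qlra.
have G1 : `|P2 t X1 - P1 t X2 - (P2 t u - X2)| <= a * k' * ((1 + k') * U).
  rewrite -P1P2u; apply: le_trans (_ : _ <= a * k' * `|P2 t u - X2|) _.
    apply: (near P1 a J1) => //.
    by apply: H11; rewrite ?t0 //; [case: (rb _ X2r).1|case: (rb _ P2ur).1].
  by rewrite ler_wpM2l // mulr_ge0 ?(ltW a0) // (le_trans ler01 k'0).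
have k'p : 0 <= k' by exact: le_trans k'0.
have DU : `|D - (u - x)| <= t * k'' * U.
  have -> : D - (u - x) = (P2 t X1 - P1 t X2 - (P2 t u - X2)) + (P2 t u - X2 - (u - x)).
    by rewrite addrA subrK.
  apply: le_trans (ler_normD _ _) _.
  have : a * (k' * ((1 + k') * U)) <= t * (k' * ((1 + k') * U)).
    by rewrite ler_wpM2r // !mulr_ge0 // addr_ge0.
  have : c * (k' * U) <= t * (k' * U) by rewrite ler_wpM2r // mulr_ge0.
  rewrite k''E; move: G1 G2; qlra.
have nD : `|D| <= a * c * M.
  rewrite -(subrK ((a * c) *: B) D); apply: le_trans (ler_normD _ _) _.
  rewrite normrZ (gtr0_norm ac0) ME mulrDr.
  have : a * c * (e1 * k) <= a * c * k.
    by rewrite ler_wpM2l ?(ltW ac0) // ler_piMl // (le_trans ler01 k0).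
  move: DB; qlra.
(* [D - (u - x)] is at most [t * k''] times [|u - x|] itself, and [t * k'' <= 1/2] lets it be
   absorbed. *)
have U2 : U <= a * c * (2 * M).
  have : U <= `|D| + `|D - (u - x)|.
    have -> : U = `|D - (D - (u - x))| by rewrite subKr.
    exact: ler_normB.
  have : t * k'' * U <= 1 / 2 * U by rewrite ler_wpM2r.
  move: DU nD; qlra.
have -> : u - x - (a * c) *: B = (D - (a * c) *: B) - (D - (u - x)).
  by rewrite opprB [RHS]addrC addrA subrK.
apply: le_trans (ler_normB _ _) _.
have : t * k'' * U <= t * k'' * (a * c * (2 * M)).
  by rewrite ler_wpM2l // mulr_ge0 // (le_trans ler01 k''0).
have : a * c * (t * k'' * (2 * M)) <= a * c * (eta / 2) by rewrite ler_wpM2l // ltW.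
have : a * c * (e1 * k) <= a * c * (eta / 2) by rewrite ler_wpM2l // ltW.
move: DU DB; qlra.
Qed.

End NearIdentity.

(** * Expansions of a single flow *)

Section LeafAsymptotics.
Context {R : realType}.
Variables (d : nat) (F : 'rV[R]_d -> 'rV[R]_d) (phi : R -> 'rV[R]_d -> 'rV[R]_d) (x0 : 'rV[R]_d).
Hypothesis CF : isCk 1 F.
Hypothesis lf : lflow F phi x0.

Lemma lips_linear (v : 'rV[R]_d) a b : lips `|v| a b (fun s : R => s *: v).
Proof. by move=> s t _ _; rewrite -scalerBl normrZ mulrC. Qed.

Lemma is_derive_linear (v : 'rV[R]_d) (s : R) : is_derive s (1:R) (fun s : R => s *: v) v.
Proof.
apply/is_derive_approx => e e0; exists 1 => // h _.
by rewrite scalerDl addrAC addrK subrr normr0 mulr_ge0 // ltW.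
Qed.

Lemma lflow_near_id0 : near_id0 phi 1 (F x0) x0.
Proof.
move=> eta eta0; have [L L0 LF] := C1_lipschitz CF x0 1.
have r'0 : 0 < Num.min 1 (eta / (L + 1)) by rewrite lt_min ltr01 divr_gt0 // ltr_wpDl.
have [r [C [/andP[r0 r1] C0 H]]] := lflow_in_ball r'0 lf.
exists r => // t x /andP[t0 tr] xr; rewrite expr1.
have [e a Ha] := H x xr; have [lc [N nN HN]] := flow_arc_sub tr a.
have := @AC_mean_value R d (fun s => phi s x - s *: F x0) (fun s => eta * s) 0 t N (ltW t0).
rewrite e scale0r subr0 mulr0 subr0 addrAC; apply => //.
- by apply: AConB; [exact: lips_AC lc|apply: lips_AC; exact: lips_linear].
- apply: (@lips_AC _ R^o `|eta|) => u v _ _; by rewrite -mulrBr normrM.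
- move=> s st Ns; exists (F (phi s x) - F x0), eta; split.
  + by apply: is_deriveB; [exact: HN|exact: is_derive_linear].
  + by have := is_derive_scale eta (is_derive_id s (1:R)); rewrite mulr1.
  + case/andP: st => s0 st; have := Ha s; rewrite (ltW s0) (le_trans (ltW st) tr) le_min => /(_ isT) /andP[h1 h2].
    apply: le_trans (LF _ _ _ h1) _; first by rewrite subrr normr0.
    move: h2; rewrite ler_pdivlMr ?ltr_wpDl // => h2; apply: le_trans h2.
    by rewrite mulrC ler_wpM2l // lerDl.
Qed.

Lemma lflow_near_id1 : near_id1 phi 1 (jac F x0) x0.
Proof.
move=> eta eta0; have [L L0 LF] := C1_lipschitz CF x0 1.
pose K := 2 * expR (2 * L); have K0 : 0 < K by rewrite mulr_gt0 // expR_gt0.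
have e1 : 0 < eta / (2 * K) by rewrite divr_gt0 // mulr_gt0.
have [rho rho0 SD] := C1_strict CF x0 e1.
have r'0 : 0 < Num.min 1 rho by rewrite lt_min ltr01.
have [r [C [/andP[r0 r1] C0 H]]] := lflow_in_ball r'0 lf.
pose q := d%:R * (L * K) * `|jac F x0|; have q0 : 0 <= q by rewrite !mulr_ge0 // ltW.
have s0 : 0 < eta / (2 * (q + 1)) by rewrite divr_gt0 // mulr_gt0 // ltr_wpDl.
exists (Num.min r (eta / (2 * (q + 1)))); first by rewrite lt_min r0.
move=> t x x' /andP[t0]; rewrite !le_min => /andP[tr tq] /andP[xr _] /andP[x'r _].
have [e a Ha] := H x xr; have [e' a' Ha'] := H x' x'r.
have {}a := flow_arc_sub tr a; have {}a' := flow_arc_sub tr a'.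
have t01 : 0 <= t <= 1 by rewrite (ltW t0) (le_trans tr).
have ball s : 0 <= s <= t -> [/\ `|phi s x - x0| <= 1, `|phi s x' - x0| <= 1,
    `|phi s x - x0| <= rho & `|phi s x' - x0| <= rho].
  move=> /andP[s0' st]; have := Ha s; have := Ha' s.
  by rewrite s0' (le_trans st tr) !le_min => /(_ isT)/andP[-> ->] /(_ isT)/andP[-> ->].
have G s : 0 <= s <= t -> `|phi s x' - phi s x| <= K * `|x' - x|.
  move=> st; rewrite -[X in _ <= _ * `|_ - X|]e -[X in _ <= _ * `|X - _|]e'.
  have HD s' : 0 <= s' <= t -> [set z | `|z - x0| <= 1] (phi s' x) /\ [set z | `|z - x0| <= 1] (phi s' x').
    by move=> /ball[].
  exact: (flow_arc_gronwall (D := [set z | `|z - x0| <= 1]) L0 t01 LF a a' HD).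
have [lc [N nN HN]] := a; have [lc' [N' nN' HN']] := a'.
have dD s : 0 < s < t -> ~ (N `|` N') s ->
    is_derive s (1:R) (fun s => phi s x' - phi s x) (F (phi s x') - F (phi s x)).
  by move=> st Ns; apply: is_deriveB; [apply: HN' => // ?; apply: Ns; right|
    apply: HN => // ?; apply: Ns; left].
have acD : ACon 0 t (fun s => phi s x' - phi s x).
  by apply: AConB; [exact: lips_AC lc'|exact: lips_AC lc].
have lD : lips (L * (K * `|x' - x|)) 0 t (fun s => phi s x' - phi s x).
  apply: (@AC_lips R d _ _ _ _ (N `|` N')) => //; first by rewrite !mulr_ge0 // ltW.
    exact: nullU.
  move=> s st Ns; exists (F (phi s x') - F (phi s x)); first exact: dD.
  have st' : 0 <= s <= t by case/andP: st => ? ?; rewrite !ltW.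
  have [? ? _ _] := ball s st'.
  by apply: le_trans (LF _ _ _ _) _ => //; rewrite ler_wpM2l // G.
have := @AC_mean_value R d (fun s => phi s x' - phi s x - s *: ((x' - x) *m jac F x0))
  (fun s => eta * `|x' - x| * s) 0 t (N `|` N') (ltW t0).
rewrite expr1 e e' scale0r subr0 mulr0 subr0 addrAC mulrAC; apply => //.
- by apply: AConB => //; apply: lips_AC; exact: lips_linear.
- by apply: (@lips_AC _ R^o `|eta * `|x' - x| |) => u v _ _; rewrite -mulrBr normrM.
- exact: nullU.
move=> s st Ns; have st' : 0 <= s <= t by case/andP: st => ? ?; rewrite !ltW.
exists (F (phi s x') - F (phi s x) - (x' - x) *m jac F x0), (eta * `|x' - x|); split.
- by apply: is_deriveB; [exact: dD|exact: is_derive_linear].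
- by have := is_derive_scale (eta * `|x' - x|) (is_derive_id s (1:R)); rewrite mulr1.
have [_ _ b1 b2] := ball s st'.
set D := phi s x' - phi s x.
have -> : F (phi s x') - F (phi s x) - (x' - x) *m jac F x0 =
  (F (phi s x') - F (phi s x) - D *m jac F x0) + (D - (x' - x)) *m jac F x0.
  by rewrite [X in _ = _ + X]mulmxBl addrA subrK.
have h1 := SD _ _ b1 b2; rewrite -/D in h1.
have h2 : eta / (2 * K) * `|D| <= eta / 2 * `|x' - x|.
  have -> : eta / 2 * `|x' - x| = eta / (2 * K) * (K * `|x' - x|) by field; rewrite gt_eqF.
  by rewrite ler_wpM2l ?(ltW e1) // G.
have h3 : `|(D - (x' - x)) *m jac F x0| <= eta / 2 * `|x' - x|.
  apply: le_trans (mulmx_norm_le _ _) _.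
  have h4 : `|D - (x' - x)| <= L * (K * `|x' - x|) * t.
    have := lD s 0 st'; rewrite lexx (ltW t0) e e' subr0 => /(_ isT) /le_trans; apply.
    case/andP: st' => s0' st''; rewrite ger0_norm // ler_wpM2l // !mulr_ge0 // ltW //.
  apply: (@le_trans _ _ (d%:R * (L * (K * `|x' - x|) * t) * `|jac F x0|)).
    by rewrite ler_wpM2r // ler_wpM2l.
  have -> : d%:R * (L * (K * `|x' - x|) * t) * `|jac F x0| = (t * q) * `|x' - x|.
    by rewrite /q; ring.
  rewrite ler_wpM2r //; move: tq; rewrite ler_pdivlMr ?mulr_gt0 ?ltr_wpDl // => tq.
  by move: tq t0; clear; lra.
apply: le_trans (ler_normD _ _) _.
by move: h1 h2 h3; qlra.
Qed.

End LeafAsymptotics.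

(** * Words in the flows of signed fields *)

Section Words.
Context {R : realType}.
Notation flows d := (nat -> bool -> R -> 'rV[R]_d -> 'rV[R]_d).
Notation word := (seq (nat * bool)).

Definition signed d (F : nat -> 'rV[R]_d -> 'rV[R]_d) (j : nat) (b : bool) :=
  if b then F j else fun x => - F j x.

Definition winv (w : word) : word := rev [seq (l.1, ~~ l.2) | l <- w].

Definition wflow d (phi : flows d) (w : word) (t : R) (x : 'rV[R]_d) :=
  foldl (fun x l => phi l.1 l.2 t x) x w.

Lemma winvK w : winv (winv w) = w.
Proof.
rewrite /winv map_rev revK -map_comp; elim: w => //= -[j b] w IH.
by rewrite negbK [map _ _]IH.
Qed.

Lemma mem_winv w j : (j \in [seq l.1 | l <- winv w]) = (j \in [seq l.1 | l <- w]).
Proof. by rewrite /winv map_rev mem_rev -map_comp. Qed.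

Definition letter_flows d (F : nat -> 'rV[R]_d -> 'rV[R]_d) (phi : flows d) (J : pred nat) x0 :=
  forall j b, J j -> isCk 1 (F j) /\ lflow (signed F j b) (phi j b) x0.

Lemma small_disp_id d (x0 : 'rV[R]_d) : small_disp (fun _ x => x) x0.
Proof. by exists 1, 0; split => // t x _ _; rewrite subrr normr0 mul0r. Qed.

Lemma wflow_small_disp d F (phi : flows d) J x0 (w : word) : letter_flows F phi J x0 ->
  all J [seq l.1 | l <- w] -> small_disp (wflow phi w) x0.
Proof.
move=> lf; elim: w => [_|[j b] w IH /= /andP[Jj Jw]]; first exact: small_disp_id.
apply: (@small_disp_comp R d (phi j b) (wflow phi w) x0); last exact: IH.
have [rho [C [/andP[rho0 _] C0 H]]] := lflow_disp (lf j b Jj).2.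
by exists rho, C; split => // t x tr xr; exact: H.
Qed.

Lemma wflow_cat d (phi : flows d) w w' t x : wflow phi (w ++ w') t x = wflow phi w' t (wflow phi w t x).
Proof. by rewrite /wflow foldl_cat. Qed.

Lemma wflow_inverse d F (phi : flows d) J x0 (w : word) : letter_flows F phi J x0 ->
  all J [seq l.1 | l <- w] ->
  exists2 rho : R, 0 < rho & forall t x, 0 <= t <= rho -> `|x - x0| <= rho ->
    wflow phi (winv w) t (wflow phi w t x) = x.
Proof.
move=> lf; elim: w => [_|[j b] w IH]; first by exists 1.
move=> /= /andP[Jj Jw]; have [rho rho0 H] := IH Jw.
have [Cj lfj] := lf j b Jj; have [_ lfj'] := lf j (~~ b) Jj.
have sd : small_disp (phi j b) x0.
  have [s [C [/andP[s0 _] C0 Hs]]] := lflow_disp lfj.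
  by exists s, C; split => // t x tr xr; exact: Hs.
have [s s0 Hs] := small_disp_ball sd rho0.
have [r r0 Hr] : exists2 r : R, 0 < r & forall x t, `|x - x0| <= r -> 0 <= t <= r ->
    phi j (~~ b) t (phi j b t x) = x.
  case: b lfj lfj' {sd Hs} => /= l1 l2; first exact: (lflow_inverse Cj l1 l2).
  apply: (lflow_inverse (isCk1N Cj) l1).
  by rewrite (_ : (fun x => - - F j x) = F j) //; apply/funext => x; rewrite opprK.
exists (Num.min rho (Num.min s r)); first by rewrite !lt_min rho0 s0.
move=> t x /andP[t0]; rewrite !le_min => /and3P[t1 t2 t3] /and3P[x1 x2 x3].
rewrite /winv /= rev_cons -cats1 wflow_cat [X in wflow phi [:: _] t X]H ?t0 //.
  by rewrite /wflow /= Hr ?t0.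
by apply: Hs; rewrite ?t0.
Qed.

Lemma letter_flows_near d F (phi : flows d) (js : seq nat) x0 :
  letter_flows F phi (mem js) x0 ->
  exists2 rho : R, 0 < rho & forall x1, `|x1 - x0| <= rho -> letter_flows F phi (mem js) x1.
Proof.
elim: js => [|j js IH] lf; first by exists 1.
have [|rho rho0 H] := IH; first by move=> i b ij; apply: lf; rewrite /= inE; apply/orP; right.
have Jj : mem (j :: js) j by rewrite /= mem_head.
have [r r0 Hr] := lflow_near (lf j true Jj).2.
have [r' r'0 Hr'] := lflow_near (lf j false Jj).2.
exists (Num.min rho (Num.min r r')); first by rewrite !lt_min rho0 r0.
move=> x1; rewrite !le_min => /and3P[h1 h2 h3] i b; rewrite /= inE => /predU1P[->|ij].
  by split; [exact: (lf j b Jj).1|case: b; [exact: Hr|exact: Hr']].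
exact: H.
Qed.

End Words.

(** * Stability of the classes C^k and the tangent lift *)

Section SmoothClosure.
Context {R : realType}.

Lemma isCk_mono d (V : normedModType R) k (F : 'rV[R]_d -> V) : isCk k.+1 F -> isCk k F.
Proof.
elim: k F => [|k IH] F [cF H]; split => // j; split; first by case: (H j).
by apply: IH; case: (H j).
Qed.

Lemma isCk_is_derive d (V : normedModType R) k (F : 'rV[R]_d -> V) x j :
  isCk k.+1 F -> is_derive x (ev j) F (derive F x (ev j)).
Proof. by move=> [_ /(_ j)[/(_ x)]]. Qed.

Lemma isCkS d (V : normedModType R) k (F : 'rV[R]_d -> V) (F' : 'I_d -> 'rV[R]_d -> V) :
  continuous F -> (forall j x, is_derive x (ev j) F (F' j x)) -> (forall j, isCk k (F' j)) ->
  isCk k.+1 F.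
Proof.
move=> cF dF CF'; split => // j; split; first by move=> x; case: (dF j x).
by rewrite (_ : (fun x => _) = F' j) //; apply/funext => x; case: (dF j x).
Qed.

Lemma isCk_cst d (V : normedModType R) k (v : V) : isCk k (fun _ : 'rV[R]_d => v).
Proof.
elim: k v => [|k IH] v; first by split => //; exact: cst_continuous.
apply: (@isCkS d V k _ (fun _ _ => 0)) => //; exact: cst_continuous.

Qed.

Lemma continuous_addv (T V : normedModType R) (f g : T -> V) : continuous f -> continuous g ->
  continuous (fun x => f x + g x).
Proof. by move=> cf cg x; apply: cvgD; [exact: cf|exact: cg]. Qed.

Lemma continuous_mulv (T : normedModType R) (f g : T -> R^o) : continuous f -> continuous g ->
  continuous (fun x => f x * g x : R^o).
Proof. by move=> cf cg x; apply: cvgM; [exact: cf|exact: cg]. Qed.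

Lemma isCk_add d k (f g : 'rV[R]_d -> R^o) : isCk k f -> isCk k g -> isCk k (fun x => f x + g x : R^o).
Proof.
elim: k f g => [|k IH] f g Cf Cg.
  by split => //; apply: continuous_addv; [exact: Cf.1|exact: Cg.1].
apply: (@isCkS d R^o k _ (fun j x => derive f x (ev j) + derive g x (ev j))).
- by apply: continuous_addv; [exact: Cf.1|exact: Cg.1].
- by move=> j x; apply: is_deriveD; apply: isCk_is_derive; eassumption.
- by move=> j; apply: IH; [case: (Cf.2 j)|case: (Cg.2 j)].
Qed.

Lemma isCk_mul d k (f g : 'rV[R]_d -> R^o) : isCk k f -> isCk k g -> isCk k (fun x => f x * g x : R^o).
Proof.
elim: k f g => [|k IH] f g Cf Cg.
  by split => //; apply: continuous_mulv; [exact: Cf.1|exact: Cg.1].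
apply: (@isCkS d R^o k _ (fun j x => f x * derive g x (ev j) + g x * derive f x (ev j))).
- by apply: continuous_mulv; [exact: Cf.1|exact: Cg.1].
- move=> j x; have df := isCk_is_derive x j Cf; have dg := isCk_is_derive x j Cg.
  by have := @is_deriveM R _ f g x (ev j) _ _ df dg.
- move=> j; apply: isCk_add; apply: IH.
  + exact: isCk_mono.
  + by case: (Cg.2 j).
  + exact: isCk_mono.
  + by case: (Cf.2 j).
Qed.

Lemma isCk_sum d k (I : Type) (r : seq I) (f : I -> 'rV[R]_d -> R^o) :
  (forall i, isCk k (f i)) -> isCk k (fun x => \sum_(i <- r) f i x : R^o).
Proof.
move=> Cf; elim: r => [|i r IH].
  by rewrite (_ : (fun x => _) = fun=> 0); [exact: isCk_cst|apply/funext => x; rewrite big_nil].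
rewrite (_ : (fun x => _) = fun x => f i x + \sum_(i <- r) f i x).
  exact: isCk_add.
by apply/funext => x; rewrite big_cons.
Qed.

Lemma isCk_proj d k (i : 'I_d) : isCk k (fun x : 'rV[R]_d => x 0 i : R^o).
Proof.
have dp j x : is_derive x (ev j) (fun x : 'rV[R]_d => x 0 i : R^o) ((i == j)%:R).
  apply/is_derive_dir_approx => e e0; exists 1 => // h _.
  by rewrite !mxE eqxx /= /GRing.scale /= addrAC addrK subrr normr0 mulr_ge0 // ltW.
case: k => [|k]; first by split => //; move=> x; exact: coord_continuous.
apply: (@isCkS d R^o k _ (fun j _ => (i == j)%:R)) => //; last by move=> j; exact: isCk_cst.
by move=> x; exact: coord_continuous.
Qed.

Lemma continuous_coordP (T : normedModType R) n (F : T -> 'rV[R]_n) :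
  continuous F <-> forall j, continuous (fun x => F x 0 j : R^o).
Proof.
split.
  move=> cF j x; apply: (@continuous_comp _ _ _ F (fun v : 'rV[R]_n => v 0 j)); first exact: cF.
  exact: coord_continuous.
move=> H x; apply/cvgrPdist_lt => e e0.
have : \forall y \near x, forall j, `|F x 0 j - F y 0 j| < e.
  by apply: filter_forall => j; have /cvgrPdist_lt/(_ e e0) := H j x.
by apply: filterS => y Hy; apply: rV_norm_lt => // j; rewrite !mxE.
Qed.

Lemma is_derive_dir_coord d n (F : 'rV[R]_d -> 'rV[R]_n) (x v : 'rV[R]_d) (w : 'rV[R]_n) :
  is_derive x v F w <-> forall j, is_derive x v (fun x => F x 0 j : R^o) (w 0 j).
Proof.
split.
- move=> /is_derive_dir_approx H j; apply/is_derive_dir_approx => e /H[r r0 Hr].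
  exists r => // h /Hr; apply: le_trans.
  by apply: le_trans (rV_coord_le _ j); rewrite !mxE.
- move=> H; apply/is_derive_dir_approx => e e0.
  have /choice[r Hr] : forall j, exists r : R, 0 < r /\ forall h : R, `|h| <= r ->
      `|F (x + h *: v) 0 j - F x 0 j - h *: (w 0 j : R^o)| <= e * `|h|.
    by move=> j; have /is_derive_dir_approx/(_ e e0)[r r0 ?] := H j; exists r.
  exists (\big[Num.min/1]_j r j).
    by apply/bigmin_gtP; split => // j _; have [] := Hr j.
  move=> h /bigmin_geP[h1 hd]; apply: rV_norm_le; first by rewrite mulr_ge0 // ltW.
  by move=> j; rewrite !mxE; apply: (Hr j).2; apply: hd.
Qed.

Lemma isCk_coordP d n k (F : 'rV[R]_d -> 'rV[R]_n) :
  isCk k F <-> forall j, isCk k (fun x => F x 0 j : R^o).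
Proof.
elim: k F => [|k IH] F; split.
- by move=> [/continuous_coordP cF _] j; split.
- by move=> H; split => //; apply/continuous_coordP => j; exact: (H j).1.
- move=> CF i; apply: (@isCkS d R^o k _ (fun j x => derive F x (ev j) 0 i)).
  + exact: (continuous_coordP _).1 CF.1 i.
  + by move=> j x; have /is_derive_dir_coord := isCk_is_derive x j CF.
  + by move=> j; apply: (IH (fun x => derive F x (ev j))).1; case: (CF.2 j).
- move=> H; apply: (@isCkS d _ k _ (fun j x => \row_i derive (fun x => F x 0 i : R^o) x (ev j))).
  + by apply/continuous_coordP => j; exact: (H j).1.
  + move=> j x; apply/is_derive_dir_coord => i; rewrite mxE.
    exact: (isCk_is_derive x j (H i)).
  + move=> j; apply/IH => i.
    rewrite (_ : (fun x => _) = fun x => derive (fun x => F x 0 i : R^o) x (ev j)).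
      by case: ((H i).2 j).
    by apply/funext => x; rewrite mxE.
Qed.

Lemma is_derive_lsubmx d e (V : normedModType R) (F : 'rV[R]_d -> V) (z v : 'rV[R]_(d + e)) (w : V) :
  is_derive (lsubmx z) (lsubmx v) F w -> is_derive z v (fun z => F (lsubmx z)) w.
Proof.
move=> /is_derive_dir_approx H; apply/is_derive_dir_approx => eps /H[r r0 Hr].
exists r => // h /Hr; have -> // : lsubmx (z + h *: v) = lsubmx z + h *: lsubmx v.
by apply/rowP => i; rewrite !mxE.
Qed.

Lemma lsubmx_continuous d e : continuous (fun z : 'rV[R]_(d + e) => lsubmx z).
Proof.
apply: (lips_continuous (L := 1)) => s t; rewrite mul1r; apply: rV_norm_le => // j.
by apply: le_trans (rV_coord_le _ (lshift e j)); rewrite !mxE.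
Qed.

Lemma isCk_lsubmx d e (V : normedModType R) k (F : 'rV[R]_d -> V) :
  isCk k F -> isCk k (fun z : 'rV[R]_(d + e) => F (lsubmx z)).
Proof.
have cont (G : 'rV[R]_d -> V) : continuous G -> continuous (fun z : 'rV[R]_(d + e) => G (lsubmx z)).
  by move=> cG z; apply: continuous_comp; [exact: lsubmx_continuous|exact: cG].
elim: k F => [|k IH] F CF; first by split => //; apply: cont; exact: CF.1.
pose F' (j : 'I_(d + e)) (z : 'rV[R]_(d + e)) : V :=
  if fintype.split j is inl i then derive F (lsubmx z) (ev i) else 0.
apply: (@isCkS _ V k _ F').
- by apply: cont; exact: CF.1.
- move=> j z; apply: is_derive_lsubmx; rewrite /F'.
  case: (fintype.split_ordP j) => i ->.
    have -> : lsubmx (ev (lshift e i)) = ev i :> 'rV[R]_d.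
      by apply/rowP => l; rewrite !mxE /= eq_lshift.
    exact: (isCk_is_derive _ _ CF).
  have -> : lsubmx (ev (rshift d i)) = 0 :> 'rV[R]_d.
    by apply/rowP => l; rewrite !mxE /= eq_lrshift.
  exact: is_derive0.
- move=> j; rewrite /F'; case: (fintype.split j) => i; last exact: isCk_cst.
  by apply: (IH (fun x => derive F x (ev i))); case: (CF.2 i).
Qed.

(* The flow of the tangent lift is the differential of the flow of [F]. *)
Definition tangent d (F : 'rV[R]_d -> 'rV[R]_d) (z : 'rV[R]_(d + d)) : 'rV[R]_(d + d) :=
  row_mx (F (lsubmx z)) (rsubmx z *m jac F (lsubmx z)).

(** One class is lost: the second block is linear in the vector, with the partial derivatives of [F]
    as coefficients. *)
Lemma isCk_tangent d k (F : 'rV[R]_d -> 'rV[R]_d) : isCk k.+1 F -> isCk k (tangent F).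
Proof.
move=> CF; apply/isCk_coordP => j; case: (fintype.split_ordP j) => i ->.
- rewrite (_ : (fun x => _) = fun z => F (lsubmx z) 0 i); last first.
    by apply/funext => z; rewrite row_mxEl.
  apply: (@isCk_lsubmx d d R^o k (fun x => F x 0 i)).
  by apply: isCk_mono; move/isCk_coordP: CF.
- rewrite (_ : (fun x => _) = fun z : 'rV[R]_(d + d) => \sum_l z 0 (rshift d l) *
      (fun x => derive F x (ev l) 0 i) (lsubmx z)); last first.
    apply/funext => z; rewrite row_mxEr mxE; apply: eq_bigr => l _.
    by rewrite !mxE.
  apply: (@isCk_sum _ k) => l; apply: isCk_mul; first exact: isCk_proj.
  apply: (@isCk_lsubmx d d R^o k (fun x => derive F x (ev l) 0 i)).
  by have /isCk_coordP := (CF.2 l).2.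
Qed.

End SmoothClosure.

(** * The flow of the tangent lift *)

Section TangentFlow.
Context {R : realType}.

(* A directional derivative that is robust enough to be composed. *)
Definition dir_der d (P : 'rV[R]_d -> 'rV[R]_d) (x v w : 'rV[R]_d) :=
  forall e : R, 0 < e -> exists2 r : R, 0 < r & forall (h : R) x1, `|h| <= r ->
    `|x1 - x - h *: v| <= r * `|h| -> `|P x1 - P x - h *: w| <= e * `|h|.

Lemma dir_der_comp d (P Q : 'rV[R]_d -> 'rV[R]_d) x v w u :
  dir_der P x v w -> dir_der Q (P x) w u -> dir_der (Q \o P) x v u.
Proof.
move=> HP HQ e /HQ[r r0 Hr]; have [s s0 Hs] := HP r r0.
exists (Num.min r s); first by rewrite lt_min r0.
move=> h x1; rewrite le_min => /andP[hr hs] hx; apply: Hr => //; apply: Hs => //.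
by apply: le_trans hx _; rewrite ler_wpM2r // ge_min lexx orbT.
Qed.

Lemma dir_der_is_derive d (P : 'rV[R]_d -> 'rV[R]_d) x v w : dir_der P x v w -> is_derive x v P w.
Proof.
move=> H; apply/is_derive_dir_approx => e /H[r r0 Hr]; exists r => // h hr.
by apply: Hr => //; rewrite [x + _ - x]addrAC subrr add0r subrr normr0 mulr_ge0 // ltW.
Qed.

Lemma row_mx_norm_le k l (u : 'rV[R]_k) (v : 'rV[R]_l) (r : R) : `|u| <= r -> `|v| <= r -> `|row_mx u v| <= r.
Proof.
move=> ur vr; apply: rV_norm_le; first exact: le_trans ur.
move=> j; case: (fintype.split_ordP j) => i ->; rewrite ?row_mxEl ?row_mxEr.
- exact: le_trans (rV_coord_le _ _) ur.
- exact: le_trans (rV_coord_le _ _) vr.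
Qed.

Lemma lsubmx_norm_le k l (z : 'rV[R]_(k + l)) : `|lsubmx z| <= `|z|.
Proof. by apply: rV_norm_le => // j; rewrite mxE; exact: rV_coord_le. Qed.

Lemma rsubmx_norm_le k l (z : 'rV[R]_(k + l)) : `|rsubmx z| <= `|z|.
Proof. by apply: rV_norm_le => // j; rewrite mxE; exact: rV_coord_le. Qed.

(** The first block of an orbit of the lift is an arc of [F], hence the orbit of [x] by uniqueness.
    The second block solves the equation linearized along it, and Gronwall's inequality for
    [phi s x1 - phi s x - h *: V s] shows that it is the directional derivative. *)
Lemma tangent_flow d (F : 'rV[R]_d -> 'rV[R]_d) phi psi (x0 v0 : 'rV[R]_d) : isCk 1 F ->
  lflow F phi x0 -> lflow (tangent F) psi (row_mx x0 v0) ->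
  exists2 rho : R, 0 < rho & forall x v t, `|x - x0| <= rho -> `|v - v0| <= rho -> 0 <= t <= rho ->
    exists2 w, psi t (row_mx x v) = row_mx (phi t x) w & dir_der (phi t) x v w.
Proof.
move=> CF lf lf'.
have [L L0 LF] := C1_lipschitz CF x0 1.
have [Mj Mj0 MJ] := jac_bounded CF x0 1.
have [r [C [/andP[r0 r1] C0 H]]] := lflow_in_ball ltr01 lf.
have [r' [C' [/andP[r'0 r'1] C'0 H']]] := lflow_in_ball ltr01 lf'.
pose rho := Num.min (r / 2) r'.
have rhor : rho <= r / 2 by rewrite ge_min lexx.
have rhor' : rho <= r' by rewrite ge_min lexx orbT.
have rho0 : 0 < rho by rewrite lt_min r'0 andbT; lra.
exists rho => // x v t xr vr /andP[t0 tr].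
have t1 : t <= 1 by lra.
have tT : t <= r by lra.
have xr2 : `|x - x0| <= r by lra.
have [e a Ha] := H x xr2.
have zr : `|row_mx x v - row_mx x0 v0| <= r'.
  by rewrite opp_row_mx add_row_mx; apply: row_mx_norm_le; exact: le_trans rhor'.
have [e' a' Ha'] := H' _ zr.
have tT' : t <= r' by lra.
have {}a := flow_arc_sub tT a; have {}a' := flow_arc_sub tT' a'.
pose c s := lsubmx (psi s (row_mx x v)); pose V s := rsubmx (psi s (row_mx x v)).
have [lpsi [N' nN' HN']] := a'.
have ac : flow_arc F C' t c.
  split.
    move=> u u' ut u't; apply: le_trans (lpsi u u' ut u't).
    by rewrite /c -linearB; exact: lsubmx_norm_le.
  exists N' => // s st Ns; apply/is_derive_coord => j.
  have /is_derive_coord/(_ (lshift d j)) := HN' s st Ns; rewrite /tangent row_mxEl.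
  by rewrite (_ : (fun s0 => c s0 0 j) = fun s0 => psi s0 (row_mx x v) 0 (lshift d j)) //;
    apply/funext => s0; rewrite mxE.
have lV : lips C' 0 t V.
  move=> u u' ut u't; apply: le_trans (lpsi u u' ut u't).
  by rewrite /V -linearB; exact: rsubmx_norm_le.
have dV s : 0 < s < t -> ~ N' s -> is_derive s (1:R) V (V s *m jac F (c s)).
  move=> st Ns; apply/is_derive_coord => j.
  have /is_derive_coord/(_ (rshift d j)) := HN' s st Ns; rewrite /tangent row_mxEr.
  by rewrite (_ : (fun s0 => V s0 0 j) = fun s0 => psi s0 (row_mx x v) 0 (rshift d j)) //;
    apply/funext => s0; rewrite mxE.
have t01 : 0 <= t <= 1 by rewrite t0.
have cb s : 0 <= s <= t -> `|c s - x0| <= 1.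
  move=> /andP[s0 st]; have := Ha' s; rewrite s0 (le_trans st tT') => /(_ isT).
  apply: le_trans; rewrite -{1}(row_mxKl x0 v0) /c -linearB; exact: lsubmx_norm_le.
have phib s : 0 <= s <= t -> `|phi s x - x0| <= 1.
  by move=> /andP[s0 st]; apply: Ha; rewrite s0 (le_trans st).
have cphi s : 0 <= s <= t -> c s = phi s x.
  move=> st; apply/eqP; rewrite -subr_eq0 -normr_le0.
  have HD s' : 0 <= s' <= t -> [set z | `|z - x0| <= 1] (phi s' x) /\ [set z | `|z - x0| <= 1] (c s').
    by move=> s't; split; [exact: phib|exact: cb].
  have := flow_arc_gronwall (D := [set z | `|z - x0| <= 1]) L0 t01 LF a ac HD st.
  by rewrite /c e e' row_mxKl subrr normr0 mulr0.
have tt : 0 <= t <= t by rewrite t0 lexx.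
exists (V t); first by rewrite -(cphi t tt) /c /V hsubmxK.
move=> eps eps0.
(* [K] and [K2] are the Gronwall factors of the flow and of the linearized equation; [q * |h|]
   bounds the distance of the two orbits, and [del] keeps the second orbit in the ball where the
   estimates hold. *)
pose K := 2 * expR (2 * L); have K0 : 0 < K by rewrite mulr_gt0 // expR_gt0.
pose L' := d%:R * Mj; have L'0 : 0 <= L' by rewrite mulr_ge0.
pose K2 := 2 * expR (2 * L'); have K20 : 0 < K2 by rewrite mulr_gt0 // expR_gt0.
pose q := K * (`|v| + 1).
have q0 : 0 < q by rewrite mulr_gt0 // ltr_wpDl.
have eta0 : 0 < eps / (2 * K2 * q) by apply: divr_gt0 => //; apply: mulr_gt0 => //; apply: mulr_gt0.
have [rh rh0 UD] := C1_unif_diff CF x0 1 eta0.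
pose del := Num.min 1 (Num.min (eps / (2 * K2)) (Num.min (rh / q) (r / (2 * (`|v| + 1))))).
have d1 : del <= 1 by rewrite ge_min lexx.
have d2 : K2 * del <= eps / 2.
  have : del <= eps / (2 * K2) by rewrite !ge_min lexx ?orbT.
  by rewrite ler_pdivlMr; [qlra|exact: mulr_gt0].
have d3 : q * del <= rh.
  have : del <= rh / q by rewrite !ge_min lexx ?orbT.
  by rewrite ler_pdivlMr // mulrC.
have v1 : 0 < `|v| + 1 by rewrite ltr_wpDl.
have d4 : (`|v| + 1) * del <= r / 2.
  have : del <= r / (2 * (`|v| + 1)) by rewrite !ge_min lexx ?orbT.
  by rewrite ler_pdivlMr; [qlra|exact: mulr_gt0].
have del0 : 0 < del.
  by rewrite !lt_min ltr01 /=; apply/and3P; split; apply: divr_gt0 => //; apply: mulr_gt0.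
exists del => // h x1 hd hx.
have nx1 : `|x1 - x| <= (`|v| + 1) * `|h|.
  rewrite -(subrK (h *: v) (x1 - x)); apply: le_trans (ler_normD _ _) _.
  rewrite normrZ; have : del * `|h| <= 1 * `|h| by rewrite ler_wpM2r.
  by move: hx; qlra.
have x1r : `|x1 - x0| <= r.
  have -> : x1 - x0 = (x1 - x) + (x - x0) by rewrite addrA subrK.
  apply: le_trans (ler_normD _ _) _.
  have : (`|v| + 1) * `|h| <= (`|v| + 1) * del by rewrite ler_wpM2l // ltW.
  by move: nx1 d4 xr rhor; qlra.
have [e1 a1 Ha1] := H x1 x1r; have {}a1 := flow_arc_sub tT a1.
have phib1 s : 0 <= s <= t -> `|phi s x1 - x0| <= 1.
  by move=> /andP[s0 st]; apply: Ha1; rewrite s0 (le_trans st).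
have G s : 0 <= s <= t -> `|phi s x1 - phi s x| <= q * `|h|.
  move=> st; have HD s' : 0 <= s' <= t -> [set z | `|z - x0| <= 1] (phi s' x) /\ [set z | `|z - x0| <= 1] (phi s' x1).
    by move=> s't; split; [exact: phib|exact: phib1].
  have := flow_arc_gronwall (D := [set z | `|z - x0| <= 1]) L0 t01 LF a a1 HD st.
  by rewrite e e1 => /le_trans; apply; rewrite -/K /q -[leRHS]mulrA ler_wpM2l // ltW.
have [lc1 [N1 nN1 HN1]] := a1; have [lc [N nN HN]] := a.
have lh : lips (`|h| * C') 0 t (fun s => h *: V s).
  by move=> u u' ut u't; rewrite -scalerBr normrZ -mulrA ler_wpM2l // lV.
have lD : lips (C + C + `|h| * C') 0 t (fun s => phi s x1 - phi s x - h *: V s).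
  move=> u u' ut u't; have := lh u u' ut u't; have := lc u u' ut u't; have := lc1 u u' ut u't.
  have -> : phi u x1 - phi u x - h *: V u - (phi u' x1 - phi u' x - h *: V u') =
    (phi u x1 - phi u' x1) - (phi u x - phi u' x) - (h *: V u - h *: V u').
    by apply/rowP => j; rewrite !mxE; ring.
  move=> h1 h2 h3; apply: le_trans (ler_normB _ _) _.
  have := ler_normB (phi u x1 - phi u' x1) (phi u x - phi u' x).
  by move: h1 h2 h3; qlra.
have nq0 : 0 <= eps / (2 * K2 * q) * (q * `|h|).
  by apply: mulr_ge0; [exact: ltW|apply: mulr_ge0 => //; exact: ltW].
have := @gronwall R d (fun s => phi s x1 - phi s x - h *: V s) _ L' (eps / (2 * K2 * q) * (q * `|h|))
  0 t (N' `|` (N1 `|` N)) L'0 nq0 t0 lD (nullU nN' (nullU nN1 nN)).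
move=> /(_ _ t tt) Gr; apply: le_trans (Gr _) _.
- move=> s st Ns; have st' : 0 <= s <= t by case/andP: st => ? ?; rewrite !ltW.
  exists (F (phi s x1) - F (phi s x) - h *: (V s *m jac F (phi s x))).
    apply: is_deriveB.
      by apply: is_deriveB; [apply: HN1 => // ?; apply: Ns; right; left|
                             apply: HN => // ?; apply: Ns; right; right].
    by rewrite -(cphi s st'); apply: is_deriveZ; apply: dV => // ?; apply: Ns; left.
  set D := phi s x1 - phi s x - h *: V s.
  have -> : F (phi s x1) - F (phi s x) - h *: (V s *m jac F (phi s x)) = D *m jac F (phi s x) +
    (F (phi s x1) - F (phi s x) - (phi s x1 - phi s x) *m jac F (phi s x)).
    rewrite /D [X in _ = X + _]mulmxBl -scalemxAl.
    move: (_ *m _) (_ *: _) => w1 w2.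
    by apply/rowP => j; rewrite !mxE; ring.
  apply: le_trans (ler_normD _ _) _; apply: lerD.
    apply: le_trans (mulmx_norm_le _ _) _; rewrite mulrAC ler_wpM2r // ler_wpM2l // MJ //.
    exact: phib.
  apply: le_trans (UD _ _ (phib s st') _) _.
    apply: le_trans (G s st') _; apply: le_trans d3.
    by rewrite ler_wpM2l // ltW.
  by rewrite ler_wpM2l ?(ltW eta0) // G.
- rewrite e e1 subr0 /V e' row_mxKr.
  have E1 : expR (2 * L' * t) <= expR (2 * L') by rewrite ler_expR ler_piMr // mulr_ge0.
  have B1 : `|x1 - x - h *: v| + eps / (2 * K2 * q) * (q * `|h|) * t <= (del + eps / (2 * K2)) * `|h|.
    have -> : eps / (2 * K2 * q) * (q * `|h|) = eps / (2 * K2) * `|h|.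
      by field; rewrite !gt_eqF.
    rewrite [leRHS]mulrDl; apply: lerD => //; apply: ler_piMr => //; apply: mulr_ge0 => //.
    by apply/ltW/divr_gt0 => //; apply: mulr_gt0.
  apply: (@le_trans _ _ (K2 * ((del + eps / (2 * K2)) * `|h|))).
    apply: ler_pM; last exact: B1.
    - by apply: mulr_ge0 => //; exact: expR_ge0.
    - by apply: addr_ge0 => //; apply: mulr_ge0.
    - by rewrite ler_wpM2l.
  rewrite mulrA ler_wpM2r // mulrDr.
  have -> : K2 * (eps / (2 * K2)) = eps / 2 by field; rewrite gt_eqF.
  by move: d2; qlra.
Qed.

End TangentFlow.

(** * Asymptotics of bracket words *)

Section BracketAsymptotics.
Context {R : realType}.
Notation flows d := (nat -> bool -> R -> 'rV[R]_d -> 'rV[R]_d).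

Lemma tangentN d (F : 'rV[R]_d -> 'rV[R]_d) : isCk 1 F ->
  tangent (fun x => - F x) = fun z => - tangent F z.
Proof.
move=> CF; apply/funext => z; rewrite /tangent opp_row_mx -mulmxN; congr (row_mx _ (_ *m _)).
apply/matrixP => j i; rewrite !mxE.
have [_ ->] : is_derive (lsubmx z) (ev j) (fun x => - F x) (- derive F (lsubmx z) (ev j)).
  by apply: is_deriveN; exact: (C1_derive CF).
by rewrite mxE.
Qed.

Lemma wflow_tangent d F (phi : flows d) (psi : flows (d + d)) J x0 v0 w :
  letter_flows F phi J x0 -> letter_flows (fun j => tangent (F j)) psi J (row_mx x0 v0) ->
  all J [seq l.1 | l <- w] ->
  exists2 rho : R, 0 < rho & forall x v t, `|x - x0| <= rho -> `|v - v0| <= rho -> 0 <= t <= rho ->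
    exists2 u, wflow psi w t (row_mx x v) = row_mx (wflow phi w t x) u & dir_der (wflow phi w t) x v u.
Proof.
move=> lf lf'; elim: w => [_|[j b] w IH /= /andP[Jj Jw]].
  exists 1 => // x v t _ _ _; exists v => // e e0; by exists e.
have [rho rho0 H] := IH Jw.
have [Cj lfj] := lf j b Jj; have [CTj lfTj] := lf' j b Jj.
have Cs : isCk 1 (signed F j b) by rewrite /signed; case: (b); [exact: Cj|exact: isCk1N].
have lT : lflow (tangent (signed F j b)) (psi j b) (row_mx x0 v0).
  by move: lfTj; rewrite /signed; case: (b) => //; rewrite tangentN.
have [r r0 Hr] := tangent_flow Cs lfj lT.
have sd : small_disp (psi j b) (row_mx x0 v0).
  have [s [C [/andP[s0 _] C0 Hs]]] := lflow_disp lT.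
  by exists s, C; split => // t x tr xr; exact: Hs.
have [s s0 Hs] := small_disp_ball sd rho0.
exists (Num.min r (Num.min s rho)); first by rewrite !lt_min r0 s0.
move=> x v t; rewrite !le_min => /and3P[xr xs _] /and3P[vr vs _] /and4P[t0 tr ts trho].
have [|u pu du] := Hr x v t xr vr; first by rewrite t0.
have : `|psi j b t (row_mx x v) - row_mx x0 v0| <= rho.
  apply: Hs; first by rewrite t0.
  by rewrite opp_row_mx add_row_mx; apply: row_mx_norm_le.
rewrite pu opp_row_mx add_row_mx => nb.
have [|||u' pu' du'] := H (phi j b t x) u t.
- by have := lsubmx_norm_le (row_mx (phi j b t x - x0) (u - v0)); rewrite row_mxKl => /le_trans; apply.
- by have := rsubmx_norm_le (row_mx (phi j b t x - x0) (u - v0)); rewrite row_mxKr => /le_trans; apply.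
- by rewrite t0.
exists u'; first by rewrite -pu' -pu.
exact: (dir_der_comp du du').
Qed.

(** Letters act from the left, so a node is the map [P2' P1' P2 P1] whose leading coefficient is
    [DB2 B1 - DB1 B2], in agreement with the sign convention of [lie]. *)
Fixpoint bracket_word (b : fbr) : seq (nat * bool) :=
  match b with
  | FLeaf j => [:: (j, true)]
  | FNode b1 b2 => bracket_word b1 ++ bracket_word b2 ++ winv (bracket_word b1) ++ winv (bracket_word b2)
  end.

(** The class C^(b+k) unfolded along the tree, one derivative per level, which is the shape that the
    inductions follow. *)
Fixpoint bracket_class d (F : nat -> 'rV[R]_d -> 'rV[R]_d) (b : fbr) (k : nat) : Prop :=
  match b with
  | FLeaf j => isCk k (F j)
  | FNode b1 b2 => bracket_class F b1 k.+1 /\ bracket_class F b2 k.+1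
  end.

Lemma bracket_class_mono d (F : nat -> 'rV[R]_d -> 'rV[R]_d) b k :
  bracket_class F b k.+1 -> bracket_class F b k.
Proof.
elim: b k => [j|b1 IH1 b2 IH2] k /=; first exact: isCk_mono.
by move=> [h1 h2]; split; [exact: IH1|exact: IH2].
Qed.

Lemma bracket_class_leaf d (F : nat -> 'rV[R]_d -> 'rV[R]_d) b k j :
  bracket_class F b k -> j \in fleaves b -> isCk k (F j).
Proof.
elim: b k => [i|b1 IH1 b2 IH2] k /=; first by move=> Ck; rewrite inE => /eqP ->.
move=> [h1 h2]; rewrite mem_cat => /orP[jb|jb]; apply: isCk_mono; [exact: IH1 h1 jb|exact: IH2 h2 jb].
Qed.

Lemma bracket_class_tangent d (F : nat -> 'rV[R]_d -> 'rV[R]_d) b k :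
  bracket_class F b k.+1 -> bracket_class (fun j => tangent (F j)) b k.
Proof.
elim: b k => [j|b1 IH1 b2 IH2] k /=; first exact: isCk_tangent.
by move=> [h1 h2]; split; [exact: IH1|exact: IH2].
Qed.

Lemma bracket_word_leaves b : all (mem (fleaves b)) [seq l.1 | l <- bracket_word b].
Proof.
elim: b => [j|b1 IH1 b2 IH2] /=; first by rewrite mem_head.
have sub1 : all (mem (fleaves b1 ++ fleaves b2)) [seq l.1 | l <- bracket_word b1].
  by apply: sub_all IH1 => j /= jb; rewrite mem_cat jb.
have sub2 : all (mem (fleaves b1 ++ fleaves b2)) [seq l.1 | l <- bracket_word b2].
  by apply: sub_all IH2 => j /= jb; rewrite mem_cat jb orbT.
rewrite !map_cat !all_cat sub1 sub2 /=.
by apply/andP; split; apply/allP => j; rewrite mem_winv; apply/allP.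
Qed.

Lemma flength_gt0 b : (0 < flength b)%N.
Proof. by elim: b => //= b1 IH1 b2 IH2; rewrite /flength /= size_cat addn_gt0 [(_ < size _)%N]IH1. Qed.

Lemma flength_node b1 b2 : flength (FNode b1 b2) = (flength b1 + flength b2)%N.
Proof. by rewrite /flength /= size_cat. Qed.

Lemma near_id0_eq d (P Q : R -> 'rV[R]_d -> 'rV[R]_d) q B x0 :
  (forall t x, P t x = Q t x) -> near_id0 P q B x0 -> near_id0 Q q B x0.
Proof. by move=> PQ H e /H[r r0 Hr]; exists r => // t x; rewrite -PQ; exact: Hr. Qed.

(** Quantified over the dimension, since the induction applies it to tangent lifts in dimension
    [d + d]. The matrix [J] plays two parts: coefficient of the expansion of differences and
    derivative of the bracket field, the latter being what turns the commutator coefficient into a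
    Lie bracket. *)
Definition strict_asymptotics b := forall d (F : nat -> 'rV[R]_d -> 'rV[R]_d) (phi : flows d) x0,
  bracket_class F b 1 -> letter_flows F phi (mem (fleaves b)) x0 ->
  near_id0 (wflow phi (bracket_word b)) (flength b) (feval F b x0) x0 /\
  exists J, near_id1 (wflow phi (bracket_word b)) (flength b) J x0 /\
    forall v, is_derive x0 v (feval F b) (v *m J).

Lemma letter_flows_sub d (F : nat -> 'rV[R]_d -> 'rV[R]_d) phi (J J' : pred nat) x0 :
  (forall j, J' j -> J j) -> letter_flows F phi J x0 -> letter_flows F phi J' x0.
Proof. by move=> JJ H j b /JJ; exact: H. Qed.

(** Class 0 for the node is class 1 for its two branches, and only the branches are differentiated
    in [commutator_near_id]. *)
Lemma node_asymptotics b1 b2 : strict_asymptotics b1 -> strict_asymptotics b2 ->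
  forall d (F : nat -> 'rV[R]_d -> 'rV[R]_d) (phi : flows d) x0,
  bracket_class F (FNode b1 b2) 0 -> letter_flows F phi (mem (fleaves (FNode b1 b2))) x0 ->
  near_id0 (wflow phi (bracket_word (FNode b1 b2))) (flength (FNode b1 b2)) (feval F (FNode b1 b2) x0) x0.
Proof.
move=> S1 S2 d F phi x0 /= [C1 C2] lf.
have lf1 : letter_flows F phi (mem (fleaves b1)) x0.
  by apply: letter_flows_sub lf => j /= jb; rewrite mem_cat jb.
have lf2 : letter_flows F phi (mem (fleaves b2)) x0.
  by apply: letter_flows_sub lf => j /= jb; rewrite mem_cat jb orbT.
have [n10 [J1 [n11 D1]]] := S1 d F phi x0 C1 lf1.
have [n20 [J2 [n21 D2]]] := S2 d F phi x0 C2 lf2.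
have w1 := bracket_word_leaves b1; have w2 := bracket_word_leaves b2.
have w1' : all (mem (fleaves b1)) [seq l.1 | l <- winv (bracket_word b1)].
  by apply/allP => j; rewrite mem_winv; apply/allP.
have w2' : all (mem (fleaves b2)) [seq l.1 | l <- winv (bracket_word b2)].
  by apply/allP => j; rewrite mem_winv; apply/allP.
have ri w J (lfw : letter_flows F phi J x0) (aw : all J [seq l.1 | l <- winv w]) :
    right_inverse_near (wflow phi w) (wflow phi (winv w)) x0.
  have [r r0 Hr] := wflow_inverse lfw aw; exists r => // t x /andP[t0 tr] xr.
  by have := Hr t x; rewrite winvK (ltW t0) => ->.
have := commutator_near_id (flength_gt0 b1) (flength_gt0 b2) n10 n11 n20 n21 (ri _ _ lf1 w1')
  (ri _ _ lf2 w2') (wflow_small_disp lf1 w1) (wflow_small_disp lf2 w2)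
  (wflow_small_disp lf1 w1') (wflow_small_disp lf2 w2').
rewrite -flength_node.
have -> : feval F b1 x0 *m J2 - feval F b2 x0 *m J1 = lie (feval F b1) (feval F b2) x0.
  by rewrite /lie; case: (D2 (feval F b1 x0)) => _ ->; case: (D1 (feval F b2 x0)) => _ ->.
by apply: near_id0_eq => t x; rewrite !wflow_cat.
Qed.

(** Subtract the pointwise expansions at [x] and [x0] from the expansion of the difference and
    divide by [t^q]: what remains compares [B x - B x0] with [(x - x0) *m J], without [t]. *)
Lemma strict_derivative d (P : R -> 'rV[R]_d -> 'rV[R]_d) q (B : 'rV[R]_d -> 'rV[R]_d) J x0 rho :
  0 < rho -> (forall x, `|x - x0| <= rho -> near_id0 P q (B x) x) -> near_id1 P q J x0 ->
  forall v, is_derive x0 v B (v *m J).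
Proof.
move=> rho0 n0 n1.
have key eta : 0 < eta -> exists2 r : R, 0 < r & forall x, `|x - x0| <= r ->
    `|B x - B x0 - (x - x0) *m J| <= eta * `|x - x0|.
  move=> eta0; have [r r0 Hr] := n1 eta eta0.
  exists (Num.min rho r); first by rewrite lt_min rho0.
  move=> x; rewrite le_min => /andP[xrho xr]; apply/ler_addgt0Pr => e e0.
  have e2 : 0 < e / 2 by rewrite divr_gt0.
  have [s s0 Hs] := n0 x xrho _ e2.
  have x0rho : `|x0 - x0| <= rho by rewrite subrr normr0 ltW.
  have [s' s'0 Hs'] := n0 x0 x0rho _ e2.
  (* [t] is chosen after [x] and [e], so that the pointwise errors, which carry no factor
     [|x - x0|], add up to at most [e * t^q]. *)
  pose t := Num.min r (Num.min s s').
  have t0 : 0 < t by rewrite !lt_min r0 s0.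
  have tr : t <= r by rewrite ge_min lexx.
  have ts : t <= s by rewrite !ge_min lexx ?orbT.
  have ts' : t <= s' by rewrite !ge_min lexx ?orbT.
  have := Hr t x0 x; rewrite t0 tr subrr normr0 (ltW r0) xr => /(_ isT isT isT) h1.
  have := Hs t x; rewrite t0 ts subrr normr0 (ltW s0) => /(_ isT isT) h2.
  have := Hs' t x0; rewrite t0 ts' subrr normr0 (ltW s'0) => /(_ isT isT) h3.
  have tq : 0 < t ^+ q by exact: exprn_gt0.
  rewrite -(ler_pM2l tq) -[X in X * `|_| <= _](gtr0_norm tq) -normrZ.
  have -> : t ^+ q *: (B x - B x0 - (x - x0) *m J) =
    (P t x - P t x0 - (x - x0) - t ^+ q *: ((x - x0) *m J)) - (P t x - x - t ^+ q *: B x)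
    + (P t x0 - x0 - t ^+ q *: B x0).
    move: (_ *m J) => w; by apply/rowP => i; rewrite !mxE; ring.
  apply: le_trans (ler_normD _ _) _; apply: le_trans (lerD (ler_normB _ _) (lexx _)) _.
  by move: h1 h2 h3; qlra.
move=> v; apply/is_derive_dir_approx => e e0.
have v1 : 0 < `|v| + 1 by rewrite ltr_wpDl.
have [r r0 Hr] := key _ (divr_gt0 e0 v1).
exists (r / (`|v| + 1)); first by rewrite divr_gt0.
move=> h; rewrite ler_pdivlMr // => hr.
have xh : x0 + h *: v - x0 = h *: v by rewrite addrAC subrr add0r.
have hv : `|h *: v| <= `|h| * (`|v| + 1) by rewrite normrZ ler_wpM2l // lerDl.
have := Hr (x0 + h *: v); rewrite xh => /(_ (le_trans hv hr)).
rewrite -scalemxAl => /le_trans; apply.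
rewrite mulrAC ler_pdivrMr // -mulrA ler_wpM2l //; exact: ltW.
Qed.

Lemma letter_flows_exist d (F : nat -> 'rV[R]_d -> 'rV[R]_d) (J : pred nat) x0 :
  (forall j, J j -> isCk 1 (F j)) -> exists phi, letter_flows F phi J x0.
Proof.
move=> CF.
have /choice[phi Hphi] : forall jb : nat * bool, exists phi, J jb.1 -> lflow (signed F jb.1 jb.2) phi x0.
  move=> [j b] /=; have [Jj|Jj] := pselect (J j); last by exists (fun _ x => x) => /Jj.
  have [|phi Hphi] := @lflow_exists R d (signed F j b) x0; last by exists phi.
  by case: b; [|apply: isCk1N]; exact: CF.
by exists (fun j b => phi (j, b)) => j b Jj; split; [exact: CF|exact: (Hphi (j, b))].
Qed.

(** At a node of class 1 the tangent lifts form a node of class 0, so [node_asymptotics] expands the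
    lifted word at [(x0, ev j)]. Its second block is the [j]-th partial derivative of the word, and
    partial derivatives close to [ev j + t^q c_j] give the expansion of differences by
    [partials_lipschitz]. *)
Lemma strict_asymptotics_all b : strict_asymptotics b.
Proof.
elim: b => [j|b1 IH1 b2 IH2].
  move=> d F phi x0 /= CF lf; have [_ lfj] := lf j true (mem_head _ _).
  split; first exact: lflow_near_id0 CF lfj.
  by exists (jac (F j) x0); split; [exact: lflow_near_id1 CF lfj|move=> v; exact: C1_derive_dir].
set b := FNode b1 b2; move=> d F phi x0 Cb lf.
have star := node_asymptotics IH1 IH2.
have Cb0 := bracket_class_mono Cb.
have n0 := star d F phi x0 Cb0 lf.
split => //.
have aw := bracket_word_leaves b.
pose z0 j : 'rV[R]_(d + d) := row_mx x0 (ev j).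
have CT : bracket_class (fun j => tangent (F j)) b 0 := bracket_class_tangent Cb.
have CTleaf i : i \in fleaves b -> isCk 1 (tangent (F i)).
  move=> ib; apply: isCk_tangent; have [C1 C2] := Cb.
  move: ib; rewrite /= mem_cat => /orP[ib|ib]; [exact: bracket_class_leaf C1 ib|exact: bracket_class_leaf C2 ib].
(* The candidate for the [j]-th row of [J]: the second block of the bracket of the lifted fields at
   [(x0, ev j)]. *)
pose c j := rsubmx (feval (fun j => tangent (F j)) b (z0 j)).
have partial eta : 0 < eta -> exists2 rho : R, 0 < rho & forall (j : 'I_d) t x, 0 < t <= rho -> `|x - x0| <= rho ->
    exists2 u, is_derive x (ev j) (wflow phi (bracket_word b) t) u &
       `|u - ev j - t ^+ flength b *: c j| <= eta * t ^+ flength b.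
  move=> eta0.
  have /choice[rho Hrho] : forall j : 'I_d, exists rho : R, 0 < rho /\ forall t x, 0 < t <= rho ->
      `|x - x0| <= rho -> exists2 u, is_derive x (ev j) (wflow phi (bracket_word b) t) u &
       `|u - ev j - t ^+ flength b *: c j| <= eta * t ^+ flength b.
    move=> j; have [psi lpsi] := letter_flows_exist (z0 j) CTleaf.
    have [r r0 Hr] := star _ _ psi (z0 j) CT lpsi eta eta0.
    have [s s0 Hs] := wflow_tangent lf lpsi aw.
    exists (Num.min r s); split; first by rewrite lt_min r0.
    move=> t x /andP[t0]; rewrite !le_min => /andP[tr ts] /andP[xr xs].
    have [||u pu du] := Hs x (ev j) t xs; first by rewrite subrr normr0 ltW.
      by rewrite (ltW t0).
    exists u; first exact: dir_der_is_derive.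
    have nb : `|row_mx x (ev j) - z0 j| <= r.
      rewrite /z0 opp_row_mx add_row_mx subrr; apply: row_mx_norm_le => //.
      by rewrite normr0 ltW.
    have trs : 0 < t <= r by rewrite t0.
    have h := Hr t (row_mx x (ev j)) trs nb.
    apply: le_trans h; rewrite pu opp_row_mx add_row_mx.
    apply: le_trans (rsubmx_norm_le _).
    rewrite [rsubmx _](_ : _ = u - ev j - t ^+ flength b *: c j) //.
    by apply/rowP => i; rewrite mxE [LHS]mxE row_mxEr !mxE.
  exists (\big[Num.min/1]_j rho j).
    by apply/bigmin_gtP; split => // j _; have [] := Hrho j.
  move=> j t x /andP[t0 /bigmin_geP[_ tr]] /bigmin_geP[_ xr].
  by apply: (Hrho j).2; rewrite ?t0 ?tr ?xr.
pose J : 'M[R]_d := \matrix_(j, i) c j 0 i.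
have Jc (j : 'I_d) : ev j *m J = c j by rewrite -rowE; apply/rowP => i; rewrite !mxE.
have n1 : near_id1 (wflow phi (bracket_word b)) (flength b) J x0.
  move=> eta eta0.
  have e1 : 0 < eta / (d%:R + 1) by rewrite divr_gt0 // ltr_wpDl.
  have [rho rho0 Hrho] := partial _ e1; exists rho => // t x x' trho xrho x'rho.
  have t0 : 0 < t by case/andP: trho.
  have tq : 0 <= t ^+ flength b by rewrite ltW // exprn_gt0.
  have der (j : 'I_d) : exists g : 'rV[R]_d -> 'rV[R]_d, forall z, `|z - x0| <= rho ->
     is_derive z (ev j) (wflow phi (bracket_word b) t) (g z) /\
       `|g z - ev j - t ^+ flength b *: c j| <= eta / (d%:R + 1) * t ^+ flength b.
    have /choice[g Hg] : forall z, exists u, `|z - x0| <= rho ->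
       is_derive z (ev j) (wflow phi (bracket_word b) t) u /\
       `|u - ev j - t ^+ flength b *: c j| <= eta / (d%:R + 1) * t ^+ flength b.
      move=> z; have [zr|zr] := pselect (`|z - x0| <= rho); last by exists 0 => /zr.
      by have [u du nu] := Hrho j t z trho zr; exists u.
    by exists g.
  have /choice[g Hg] := der.
  have M0 : 0 <= eta / (d%:R + 1) * t ^+ flength b by rewrite mulr_ge0 // ltW.
  have := @partials_lipschitz R d d (fun z => wflow phi (bracket_word b) t z - z - t ^+ flength b *: (z *m J))
    (fun j z => g j z - ev j - t ^+ flength b *: c j) (x0 - const_mx rho) (x0 + const_mx rho) _ M0.
  move=> /(_ _ x x') PL.
  have -> : wflow phi (bracket_word b) t x' - wflow phi (bracket_word b) t x - (x' - x) -
     t ^+ flength b *: ((x' - x) *m J) = wflow phi (bracket_word b) t x' - x' - t ^+ flength b *: (x' *m J) -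
     (wflow phi (bracket_word b) t x - x - t ^+ flength b *: (x *m J)).
    rewrite mulmxBl; move: (x *m J) (x' *m J) => u u'.
    by apply/rowP => i; rewrite !mxE; ring.
  apply: le_trans (PL _ _ _) _.
  - move=> z /box_of_ball -/(_ (ltW rho0)) zr j; have [dg ng] := Hg j z zr; split => //.
    have dJ : is_derive z (ev j) (fun z => t ^+ flength b *: (z *m J)) (t ^+ flength b *: c j).
      by apply: is_deriveZ; rewrite -Jc; exact: is_derive_mulmx.
    exact: (is_deriveB (is_deriveB dg (is_derive_id z (ev j))) dJ).
  - by apply/box_of_ball => //; exact: ltW.
  - by apply/box_of_ball => //; exact: ltW.
  - rewrite ler_wpM2r // mulrA ler_wpM2r // mulrCA ler_piMr ?(ltW eta0) //.
    by rewrite ler_pdivrMr ?ltr_wpDl // mul1r lerDl.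
exists J; split => //.
(* The pointwise expansion holds at every base point near [x0] with the same flows; together with
   [near_id1] this identifies [J] as the derivative of the bracket field. *)
have [rho rho0 Hrho] := letter_flows_near lf.
apply: (strict_derivative rho0) n1 => x xr; apply: star => //; exact: Hrho.
Qed.

Lemma bracket_asymptotics d (F : nat -> 'rV[R]_d -> 'rV[R]_d) (phi : flows d) b x0 :
  (2 <= flength b)%N -> bracket_class F b 0 -> letter_flows F phi (mem (fleaves b)) x0 ->
  near_id0 (wflow phi (bracket_word b)) (flength b) (feval F b x0) x0.
Proof.
case: b => // b1 b2 _ Cb lf.
exact: (node_asymptotics (@strict_asymptotics_all b1) (@strict_asymptotics_all b2) Cb lf).
Qed.

(** [fdepth] follows the left branch whenever the letter occurs there; as the leaves are distinct, a
    letter of the right branch is never looked up on the left. *)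
Lemma bracket_class_fdepth d (F : nat -> 'rV[R]_d -> 'rV[R]_d) b k : uniq (fleaves b) ->
  (forall j, j \in fleaves b -> isCk (fdepth j b + k) (F j)) -> bracket_class F b k.
Proof.
elim: b k => [j|b1 IH1 b2 IH2] k /=; first by move=> _ H; exact: (H j (mem_head _ _)).
rewrite cat_uniq => /and3P[u1 dis u2] H; split.
- by apply: IH1 => // j jb; have := H j; rewrite mem_cat jb /= addnS => /(_ isT).
- apply: IH2 => // j jb; have := H j; rewrite mem_cat jb orbT.
  case: ifP => [jb1|_]; last by rewrite addnS => /(_ isT).
  by move/hasPn: dis => /(_ j jb); rewrite /= jb1.
Qed.

End BracketAsymptotics.

(** * The linearized flow along a reference *)

Section DotProduct.
Context {R : realType}.
Variable N : nat.
Implicit Types u v w : 'rV[R]_N.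

Lemma dotpC u v : dotp u v = dotp v u.
Proof. by apply: eq_bigr => i _; rewrite mulrC. Qed.

Lemma dotpDl u v w : dotp (u + v) w = dotp u w + dotp v w.
Proof. by rewrite -big_split; apply: eq_bigr => i _; rewrite !mxE mulrDl. Qed.

Lemma dotpZl (a : R) u v : dotp (a *: u) v = a * dotp u v.
Proof. by rewrite /dotp mulr_sumr; apply: eq_bigr => i _; rewrite !mxE mulrA. Qed.

Lemma dotpNl u v : dotp (- u) v = - dotp u v.
Proof. by rewrite -scaleN1r dotpZl mulN1r. Qed.

Lemma dotpBl u v w : dotp (u - v) w = dotp u w - dotp v w.
Proof. by rewrite dotpDl dotpNl. Qed.

Lemma dotpDr u v w : dotp u (v + w) = dotp u v + dotp u w.
Proof. by rewrite dotpC dotpDl !(dotpC _ u). Qed.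

Lemma dotpZr (a : R) u v : dotp u (a *: v) = a * dotp u v.
Proof. by rewrite dotpC dotpZl dotpC. Qed.

Lemma dotpNr u v : dotp u (- v) = - dotp u v.
Proof. by rewrite dotpC dotpNl dotpC. Qed.

Lemma dotpBr u v w : dotp u (v - w) = dotp u v - dotp u w.
Proof. by rewrite dotpDr dotpNr. Qed.

Lemma dotp0l v : dotp 0 v = 0.
Proof. by rewrite -(scale0r 0) dotpZl mul0r. Qed.

Lemma dotp0r v : dotp v 0 = 0.
Proof. by rewrite dotpC dotp0l. Qed.

Lemma dotp_mulmx u v : dotp u v = (u *m v^T) 0 0.
Proof. by rewrite mxE; apply: eq_bigr => i _; rewrite mxE. Qed.

Lemma dotp_suml (I : Type) (r : seq I) (F : I -> 'rV[R]_N) v :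
  dotp (\sum_(i <- r) F i) v = \sum_(i <- r) dotp (F i) v.
Proof.
by elim: r => [|i r IH]; rewrite ?big_nil ?dotp0l // !big_cons dotpDl IH.
Qed.

Lemma dotp_norm_le u v : `|dotp u v| <= N%:R * `|u| * `|v|.
Proof.
apply: le_trans (ler_norm_sum _ _ _) _.
apply: (@le_trans _ _ (\sum_(i < N) `|u| * `|v|)).
  by apply: ler_sum => i _; rewrite normrM ler_pM // rV_coord_le.
by rewrite sumr_const card_ord -[leLHS]mulr_natl mulrA.
Qed.

Lemma is_derive_dotp (c c' : R -> 'rV[R]_N) (t : R) v w :
  is_derive t (1:R) c v -> is_derive t (1:R) c' w ->
  is_derive t (1:R) (fun s => dotp (c s) (c' s) : R^o) (dotp v (c' t) + dotp (c t) w).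
Proof.
move=> /is_derive_coord dc /is_derive_coord dc'.
have -> : dotp v (c' t) + dotp (c t) w = \sum_i (c t 0 i * w 0 i + c' t 0 i * v 0 i).
  by rewrite addrC -big_split; apply: eq_bigr => i _ /=; rewrite [v 0 i * _]mulrC.
have -> : (fun s => dotp (c s) (c' s) : R^o) =
    \sum_i (fun s : R => c s 0 i * c' s 0 i : R^o).
  by apply/funext => s; rewrite fct_sumE.
have D i : is_derive t (1:R) (fun s : R => c s 0 i * c' s 0 i : R^o) (c t 0 i * w 0 i + c' t 0 i * v 0 i).
  exact: (@is_deriveM R R^o (fun s : R => c s 0 i : R^o) (fun s : R => c' s 0 i : R^o) t (1:R) _ _ (dc i) (dc' i)).
by have := is_derive_sum D.
Qed.

Lemma lips_dotp (c c' : R -> 'rV[R]_N) K K' B B' a b : 0 <= K -> 0 <= K' ->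
  lips K a b c -> lips K' a b c' ->
  (forall t, a <= t <= b -> `|c t| <= B) -> (forall t, a <= t <= b -> `|c' t| <= B') ->
  @lips R R^o (N%:R * (K * B' + B * K')) a b (fun s => dotp (c s) (c' s)).
Proof.
move=> K0 K'0 lc lc' cB cB' s t sab tab.
have -> : dotp (c s) (c' s) - dotp (c t) (c' t) = dotp (c s - c t) (c' s) + dotp (c t) (c' s - c' t).
  by rewrite dotpBl dotpBr; ring.
apply: le_trans (ler_normD _ _) _.
rewrite mulrDr mulrDl; apply: lerD; apply: le_trans (dotp_norm_le _ _) _; rewrite -!mulrA ler_wpM2l //.
  rewrite mulrA mulrAC; apply: ler_pM => //; [exact: lc|exact: cB'].
by apply: ler_pM => //; [exact: cB|exact: lc'].
Qed.

Lemma AC_const (h : R -> R) a b (E : set R) : a <= b -> @ACon R R^o a b h -> null E ->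
  (forall t, a < t < b -> ~ E t -> is_derive t (1:R) (h : R -> R^o) 0) -> h b = h a.
Proof.
move=> ab ac nE H.
have key (k : R -> R) : @ACon R R^o a b k ->
    (forall t, a < t < b -> ~ E t -> is_derive t (1:R) (k : R -> R^o) 0) -> k a <= k b.
  move=> ack dk; apply: (@AC_ge _ k a b E) => // t tab Et e e0.
  have /is_derive_approx/(_ e e0)[r r0 Hr] := dk t tab Et.
  exists r => // s /andP[s0 sr]; have := Hr s; rewrite ger0_norm // => /(_ sr).
  by rewrite scaler0 subr0 ler_norml => /andP[+ _]; clear; lra.
have k1 := key h ac H.
have := key (fun t => - h t) (AConN ac).
have H' t : a < t < b -> ~ E t -> is_derive t (1:R) (fun t => - h t : R^o) 0.
  by move=> tab Et; rewrite -oppr0; apply: is_deriveN; exact: H.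
by move=> /(_ H'); rewrite lerN2 => k2; apply/le_anti/andP.
Qed.

End DotProduct.

(** * Linear equations with measurable coefficients *)

Section LinearODE.
Context {R : realType}.
Variable N : nat.

Lemma linear_ode (A : R -> 'M[R]_N) (MA S : R) (x0 : 'rV[R]_N) : 0 <= MA -> 0 <= S ->
  (forall t, `|A t| <= MA) -> (forall i j, measurable_fun setT (fun t => A t i j)) ->
  exists c : R -> 'rV[R]_N, exists M' : R, [/\ 0 <= M', lips M' 0 S c, c 0 = x0 &
    exists2 E, null E & forall t, 0 < t < S -> ~ E t -> is_derive t (1:R) c (c t *m A t)].
Proof.
move=> MA0 S0 AM mA.
apply: (@picard R N (fun t x => x *m A t) (N%:R * MA) 0 0 S x0) => //.
- by rewrite mulr_ge0.
- move=> t x x'; rewrite -mulmxBl; apply: le_trans (mulmx_norm_le _ _) _.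
  by rewrite mulrAC ler_wpM2r // ler_wpM2l.
- by move=> t; rewrite mul0mx normr0.
- move=> c cc j.
  rewrite (_ : (fun t => _) = fun t => \sum_(k < N) c t 0 k * A t k j); last first.
    by apply/funext => t; rewrite mxE.
  apply: measurable_sum => k; apply: measurable_funM; last exact: mA.
  apply: continuous_measurable_fun => t.
  apply: (@continuous_comp _ _ _ c (fun z : 'rV[R]_N => z 0 k)); first exact: cc.
  exact: coord_continuous.
Qed.

End LinearODE.

(** * Flow and adjoint flow along the reference *)

Section Tube.
Context {R : realType}.
Variable N : nat.
Variables (S L M MA : R) (Gam : R -> 'rV[R]_N -> 'rV[R]_N) (xb : R -> 'rV[R]_N) (A : R -> 'M[R]_N).
Hypotheses (S0 : 0 < S) (L0 : 0 <= L) (M0 : 0 <= M) (MA0 : 0 <= MA).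
Hypothesis lipG : forall t x x', `|Gam t x - Gam t x'| <= L * `|x - x'|.
Hypothesis bndG : forall t x, `|Gam t x| <= M.
Hypothesis measG : forall c : R -> 'rV[R]_N, continuous c ->
  forall j, measurable_fun setT (fun t => Gam t (c t) 0 j).
Hypothesis lip_xb : lips M 0 S xb.
Hypothesis der_xb : exists2 E, null E & forall t, 0 < t < S -> ~ E t ->
  is_derive t (1:R) xb (Gam t (xb t)).
Hypothesis bndA : forall t, `|A t| <= MA.
Hypothesis measA : forall i j, measurable_fun setT (fun t => A t i j).
Hypothesis linG : forall e, 0 < e -> exists2 d, 0 < d & forall t x, 0 <= t <= S ->
  `|x - xb t| <= d -> `|Gam t x - Gam t (xb t) - (x - xb t) *m A t| <= e * `|x - xb t|.

(** The terminal value problem is solved forward after the change of time [t] to [S - t]. A single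
    [B] dominates the Lipschitz constants and the norms of all the solutions. *)
Lemma adjoint_exists : exists z : 'I_N -> R -> 'rV[R]_N, exists B : R,
  [/\ 0 <= B, forall j, z j S = ev j, forall j, lips B 0 S (z j),
      forall j t, 0 <= t <= S -> `|z j t| <= B &
      exists2 E, null E & forall t, 0 < t < S -> ~ E t -> forall j,
        is_derive t (1:R) (z j) (- (z j t *m (A t)^T))].
Proof.
have H j : exists z : R -> 'rV[R]_N, exists B : R, [/\ 0 <= B, z S = ev j, lips B 0 S z,
    forall t, 0 <= t <= S -> `|z t| <= B &
    exists2 E, null E & forall t, 0 < t < S -> ~ E t -> is_derive t (1:R) z (- (z t *m (A t)^T))].
  have [] := @linear_ode R N (fun t => (A (S - t))^T) MA S (ev j) MA0 (ltW S0).
  - move=> t; rewrite [leLHS]/Num.norm /= mx_normrE; apply: bigmax_le => // -[i k] _ /=.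
    by rewrite mxE; apply: le_trans (mx_entry_le _ _ _) (bndA _).
  - move=> i k; rewrite (_ : (fun t => _) = (fun t => A t k i) \o (fun t => S - t)).
      by apply: measurableT_comp => //; apply: measurable_funB => //; exact: measurable_id.
    by apply/funext => t; rewrite mxE.
  move=> c [B [B0 lc c0 [E nE HE]]].
  exists (fun t => c (S - t)), (B + (`|c 0| + B * S)); split => //.
  - by rewrite addr_ge0 // addr_ge0 // mulr_ge0 // ltW.
  - by rewrite subrr.
  - move=> s t /andP[? ?] /andP[? ?]; apply: le_trans (lc _ _ _ _) _; try by apply/andP; split; lra.
    rewrite (_ : S - s - (S - t) = t - s); last by ring.
    by rewrite distrC ler_wpM2r // lerDl addr_ge0 // mulr_ge0 // ltW.
  - move=> t /andP[t0 tS].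
    have l0 : `|c (S - t) - c 0| <= B * S.
      apply: le_trans (lc _ _ _ _) _; try by apply/andP; split; lra.
      by rewrite subr0 ler_wpM2l // ger0_norm; lra.
    have := ler_normD (c (S - t) - c 0) (c 0); rewrite subrK.
    by move: l0; lra.
  - exists [set t | E (S - t)]; first exact: null_reflect.
    move=> t /andP[t0 tS] Et; have d := HE (S - t).
    have {}d : is_derive (S - t) (1:R) c (c (S - t) *m (A t)^T).
      have := d _ Et; rewrite (_ : S - (S - t) = t); last by ring.
      by apply; apply/andP; split; lra.
    apply/is_derive_approx => e e0; have /is_derive_approx/(_ e e0)[r r0 Hr] := d.
    exists r => // h hr; have := Hr (- h); rewrite normrN => /(_ hr).
    rewrite (_ : S - t - h = S - (t + h)); last by ring.
    by rewrite scaleNr scalerN.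
have /choice[z Hz] := H.
have /choice[B HB] := Hz.
exists z, (\sum_j B j).
have Bj j : B j <= \sum_j B j.
  rewrite (bigD1 j) //= lerDl sumr_ge0 // => i _; by have [] := HB i.
have nE j : exists E, null E /\ forall t, 0 < t < S -> ~ E t -> is_derive t (1:R) (z j) (- (z j t *m (A t)^T)).
  by have [_ _ _ _ [E nE HE]] := HB j; exists E.
have /choice[E HE] := nE.
split.
- by rewrite sumr_ge0 // => i _; have [] := HB i.
- by move=> j; have [] := HB j.
- by move=> j; have [_ _ l _ _] := HB j; move=> s t hs ht; apply: le_trans (l _ _ hs ht) _; rewrite ler_wpM2r.
- by move=> j t tS; have [_ _ _ b _] := HB j; apply: le_trans (b _ tS) _.
- exists (\bigcup_(j in [set: 'I_N]) E j); first by apply: null_bigcup => j; have [] := HE j.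
  by move=> t tS Et j; apply: (HE j).2 => // Ej; apply: Et; exists j.
Qed.

Lemma flow_exists : exists Fl : R -> 'rV[R]_N -> R -> 'rV[R]_N,
  forall a x, 0 <= a <= S -> [/\ Fl a x a = x, lips M a S (Fl a x) &
    exists2 E, null E & forall t, a < t < S -> ~ E t ->
      is_derive t (1:R) (Fl a x) (Gam t (Fl a x t))].
Proof.
have H (ax : R * 'rV[R]_N) : exists c : R -> 'rV[R]_N, 0 <= ax.1 <= S -> [/\ c ax.1 = ax.2, lips M ax.1 S c &
    exists2 E, null E & forall t, ax.1 < t < S -> ~ E t -> is_derive t (1:R) c (Gam t (c t))].
  case: ax => a x /=; have [/andP[a0 aS]|] := boolP (0 <= a <= S); last by exists (fun _ => x).
  have [c [M' [M'0 lc ca [E nE HE]]]] := picard x L0 M0 aS lipG (fun t => bndG t 0) measG.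
  exists c => _; split => //; last by exists E.
  apply: (@AC_lips R N _ _ _ _ E) => //; first exact: lips_AC lc.
  by move=> t tS Et; exists (Gam t (c t)); [exact: HE|].
have /choice[F HF] := H.
by exists (fun a x => F (a, x)) => a x aS; have := HF (a, x) aS.
Qed.

Variable Fl : R -> 'rV[R]_N -> R -> 'rV[R]_N.
Hypothesis FlP : forall a x, 0 <= a <= S -> [/\ Fl a x a = x, lips M a S (Fl a x) &
    exists2 E, null E & forall t, a < t < S -> ~ E t ->
      is_derive t (1:R) (Fl a x) (Gam t (Fl a x t))].

Definition flowK : R := 2 * expR (2 * L * S).

Lemma flowK_ge1 : 1 <= flowK.
Proof.
have h : 0 <= 2 * L * S by rewrite !mulr_ge0 // ltW.
have := expR_ge1Dx (2 * L * S); rewrite /flowK; move: h; lra.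
Qed.

Lemma gron_diff (c c' : R -> 'rV[R]_N) (E : set R) a t : 0 <= a -> a <= t -> t <= S ->
  lips M a S c -> lips M a S c' -> null E ->
  (forall t, a < t < S -> ~ E t -> is_derive t (1:R) c (Gam t (c t))) ->
  (forall t, a < t < S -> ~ E t -> is_derive t (1:R) c' (Gam t (c' t))) ->
  `|c t - c' t| <= flowK * `|c a - c' a|.
Proof.
move=> a0 at_ tS lc lc' nE d d'.
have lcc : lips (M + M) a S (fun s => c s - c' s).
  move=> u v uT vT; rewrite opprD addrACA -opprD mulrDl.
  by apply: le_trans (ler_normB _ _) _; apply: lerD; [exact: lc|exact: lc'].
have := @gronwall R N (fun s => c s - c' s) (M + M) L 0 a S E L0 (lexx _) (le_trans at_ tS) lcc nE.
have H s : a < s < S -> ~ E s -> exists2 v, is_derive s (1:R) (fun s => c s - c' s) v & `|v| <= L * `|c s - c' s| + 0.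
  move=> sT Ns; exists (Gam s (c s) - Gam s (c' s)); last by rewrite addr0.
  by apply: is_deriveB; [exact: d|exact: d'].
move=> /(_ H t); rewrite at_ tS mul0r addr0 => /(_ isT) K; apply: le_trans K _.
rewrite ler_wpM2r // /flowK ler_wpM2l // ler_expR ler_wpM2l ?mulr_ge0 //.
by rewrite lerBlDr lerDl.
Qed.

(** Dependence on the initial time is included because the clock of a family varies with its
    parameter; up to the later of the two initial times an orbit moves by at most [M] times their
    distance. *)
Lemma flow_lip a a' x x' t : 0 <= a -> 0 <= a' -> a <= t -> a' <= t -> t <= S ->
  `|Fl a x t - Fl a' x' t| <= flowK * (`|x - x'| + M * `|a - a'|).
Proof.
wlog aa' : a a' x x' / a <= a'.
  move=> H a0 a'0 at_ a't tS; have [h|h] := leP a a'; first exact: H.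
  by rewrite distrC (distrC x) (distrC a); apply: H => //; exact: ltW.
move=> a0 a'0 at_ a't tS.
have aS : 0 <= a <= S by rewrite a0 (le_trans at_).
have a'S : 0 <= a' <= S by rewrite a'0 (le_trans a't).
have [ca lc [E nE HE]] := FlP x aS; have [ca' lc' [E' nE' HE']] := FlP x' a'S.
apply: le_trans (@gron_diff _ _ (E `|` E') _ _ a'0 a't tS (lips_sub aa' (lexx _) lc) lc' (nullU nE nE') _ _) _.
- move=> s /andP[s1 s2] Es; apply: HE; first by rewrite (le_lt_trans aa').
  by move=> h; apply: Es; left.
- by move=> s sS Es; apply: HE' => // h; apply: Es; right.
rewrite ler_wpM2l //; first by apply: le_trans flowK_ge1.
rewrite ca' (_ : Fl a x a' - x' = (x - x') + (Fl a x a' - x)); last by rewrite [RHS]addrC addrA subrK.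
apply: le_trans (ler_normD _ _) _; rewrite lerD2l distrC (distrC a) -{1}ca distrC.
by apply: lc; rewrite ?lexx ?aa' /= ?(le_trans at_ tS) ?(le_trans a't tS).
Qed.

Lemma flow_ref a x t : 0 <= a -> a <= t -> t <= S ->
  `|Fl a x t - xb t| <= flowK * `|x - xb a|.
Proof.
move=> a0 at_ tS; have aS : 0 <= a <= S by rewrite a0 (le_trans at_).
have [ca lc [E nE HE]] := FlP x aS; have [E' nE' HE'] := der_xb.
rewrite -{2}ca; apply: (@gron_diff _ _ (E `|` E') _ _ a0 at_ tS lc _ (nullU nE nE')).
- exact: lips_sub lip_xb.
- by move=> s sS Es; apply: HE => // h; apply: Es; left.
- move=> s /andP[s1 s2] Es; apply: HE'; first by rewrite (le_lt_trans a0).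
  by move=> h; apply: Es; right.
Qed.

Variables (z : 'I_N -> R -> 'rV[R]_N) (B : R).
Hypothesis B0 : 0 <= B.
Hypothesis lip_z : forall j, lips B 0 S (z j).
Hypothesis bnd_z : forall j t, 0 <= t <= S -> `|z j t| <= B.
Hypothesis der_z : exists2 E, null E & forall t, 0 < t < S -> ~ E t -> forall j,
        is_derive t (1:R) (z j) (- (z j t *m (A t)^T)).

(** Transport of [v] from time [t] to the final time by the linearized flow, read off from the
    adjoint solutions [z j], which end at [ev j] in the application; the forward variational
    equation is never solved. *)
Definition dco (t : R) (v : 'rV[R]_N) : 'rV[R]_N := \row_j dotp v (z j t).

Lemma dco_is_linear t : linear (dco t).
Proof. by move=> a u v; apply/rowP => j; rewrite !mxE dotpDl dotpZl. Qed.
HB.instance Definition _ t :=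
  GRing.isLinear.Build R 'rV[R]_N 'rV[R]_N _ (dco t) (dco_is_linear t).

Lemma dco_norm_le t v : 0 <= t <= S -> `|dco t v| <= N%:R * B * `|v|.
Proof.
move=> tS; apply: rV_norm_le => [|j]; first by rewrite !mulr_ge0.
rewrite mxE; apply: le_trans (dotp_norm_le _ _) _.
by rewrite -!mulrA ler_wpM2l // mulrC ler_wpM2r // bnd_z.
Qed.

Lemma dco_lip s t v : 0 <= s <= S -> 0 <= t <= S ->
  `|dco s v - dco t v| <= N%:R * B * `|v| * `|s - t|.
Proof.
move=> sS tS; apply: rV_norm_le => [|j]; first by rewrite !mulr_ge0.
rewrite !mxE -dotpBr; apply: le_trans (dotp_norm_le _ _) _.
rewrite -!mulrA ler_wpM2l // mulrCA ler_wpM2l //; exact: lip_z.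
Qed.

(* The adjoint transport of a deviation is a first integral of the linearized flow, hence is conserved up to second order. *)
Lemma dco_conserved e : 0 < e -> exists2 d, 0 < d & forall a x t,
  0 <= a -> a <= t -> t <= S -> `|x - xb a| <= d ->
  `|dco t (Fl a x t - xb t) - dco a (x - xb a)| <= e * `|x - xb a|.
Proof.
move=> e0; pose C := flowK * (N%:R * B) * S + 1.
have K1 := flowK_ge1; have K0 : 0 < flowK by exact: lt_le_trans K1.
have C0 : 0 < C by rewrite ltr_wpDl // !mulr_ge0 // ltW.
have [d d0 Hd] := linG (divr_gt0 e0 C0).
exists (d / flowK); first exact: divr_gt0.
move=> a x t a0 at_ tS xd.
have aS : 0 <= a <= S by rewrite a0 (le_trans at_).
have [ca lc [E nE HE]] := FlP x aS; have [E' nE' HE'] := der_xb; have [E2 nE2 HE2] := der_z.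
have lxb := lips_sub a0 (lexx S) lip_xb.
have lD : lips (M + M) a S (fun s => Fl a x s - xb s).
  move=> u v uT vT; rewrite opprD addrACA -opprD mulrDl.
  by apply: le_trans (ler_normB _ _) _; apply: lerD; [exact: lc|exact: lxb].
have dev s : a <= s <= S -> `|Fl a x s - xb s| <= flowK * `|x - xb a|.
  by case/andP => ? ?; exact: flow_ref.
pose w := e / C * (flowK * `|x - xb a|).
have w0 : 0 <= w by apply: mulr_ge0; [apply: divr_ge0; exact: ltW|apply: mulr_ge0 => //; exact: ltW].
apply: (@le_trans _ _ (N%:R * B * w * t - N%:R * B * w * a)); last first.
  have Na : 0 <= `|x - xb a| by [].
  rewrite -mulrBr; apply: (@le_trans _ _ (N%:R * B * w * S)).
    apply: ler_wpM2l; last by move: a0 tS; lra.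
    by apply: mulr_ge0; [exact: mulr_ge0|exact: w0].
  rewrite (_ : _ * S = e * (`|x - xb a| * ((flowK * (N%:R * B) * S) / C))); last by rewrite /w; ring.
  by rewrite ler_wpM2l ?(ltW e0) // ler_piMr // ler_pdivrMr // mul1r /C lerDl.
have psiAC : @ACon R R^o a t (fun s => N%:R * B * w * s).
  apply: (@lips_AC _ R^o (N%:R * B * w)) => u v _ _.
  by rewrite -mulrBr normrM ger0_norm //; apply: mulr_ge0 => //; exact: mulr_ge0.
rewrite -{2}ca.
apply: (@AC_mean_value R N (fun s => dco s (Fl a x s - xb s)) (fun s => N%:R * B * w * s) a t
  (E `|` E' `|` E2) at_ _ psiAC); first 1 last.
- by apply: nullU => //; exact: nullU.
- move=> s /andP[as_ st] Es.
  have sS : 0 < s < S by rewrite (le_lt_trans a0) // (lt_le_trans st).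
  have d1 : is_derive s (1:R) (fun s => Fl a x s - xb s) (Gam s (Fl a x s) - Gam s (xb s)).
    apply: is_deriveB; first by apply: HE => [|h]; [rewrite as_ (lt_le_trans st)|apply: Es; left; left].
    by apply: HE' => // h; apply: Es; left; right.
  have d2 j : is_derive s (1:R) (z j) (- (z j s *m (A s)^T)) by apply: HE2 => // h; apply: Es; right.
  exists (dco s (Gam s (Fl a x s) - Gam s (xb s) - (Fl a x s - xb s) *m A s)), (N%:R * B * w); split.
  + apply/is_derive_coord => j.
    (* The adjoint equation cancels the linear part of the derivative of the deviation; only the
       linearization error is left, to be bounded by [linG]. *)
    have := is_derive_dotp d1 (d2 j).
    rewrite dotpNr (_ : dotp (Fl a x s - xb s) _ = dotp ((Fl a x s - xb s) *m A s) (z j s)); last first.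
      by rewrite [RHS]dotp_mulmx -mulmxA -[(A s) in RHS]trmxK -trmx_mul -dotp_mulmx.
    rewrite -dotpBl (_ : (fun s => dotp _ _) = (fun s => dco s (Fl a x s - xb s) 0 j)); last first.
      by apply/funext => r; rewrite mxE.
    by rewrite mxE.
  + by have := is_derive_scale (N%:R * B * w) (is_derive_id s (1:R)); rewrite mulr1.
  + have sS' : 0 <= s <= S by case/andP: sS => ? ?; rewrite !ltW.
    have ds : `|Fl a x s - xb s| <= flowK * `|x - xb a|.
      by apply: dev; rewrite ltW //=; case/andP: sS'.
    apply: le_trans (dco_norm_le _ sS') _; rewrite ler_wpM2l ?mulr_ge0 //.
    apply: le_trans (Hd _ _ sS' _) _.
      apply: le_trans ds _; rewrite mulrC -ler_pdivlMr //.
    by rewrite /w ler_wpM2l // ltW // divr_gt0.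
- have lcoord j : @lips R R^o (N%:R * ((M + M) * B + flowK * `|x - xb a| * B)) a t
      (fun s => dotp (Fl a x s - xb s) (z j s)).
    apply: lips_dotp => //; first by rewrite addr_ge0.
    + by move=> u v /andP[? ?] /andP[? ?]; apply: lD; apply/andP; split; lra.
    + exact: lips_sub (lip_z j).
    + by move=> s /andP[? ?]; apply: dev; apply/andP; split; lra.
    + by move=> s /andP[? ?]; apply: bnd_z; apply/andP; split; lra.
  apply: (@lips_AC _ _ (N%:R * ((M + M) * B + flowK * `|x - xb a| * B))) => u v uS vS.
  apply: rV_norm_le => [|j]; last by rewrite !mxE; exact: lcoord.
  by rewrite !mulr_ge0 // addr_ge0 // ?mulr_ge0 // ?addr_ge0 // ltW.
Qed.

End Tube.

(** * Variations and separation *)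

Section Separation.
Context {R : realType}.
Variable N : nat.
Implicit Types u v w : 'rV[R]_N.

Lemma dotp_ge0 v : 0 <= dotp v v.
Proof. by apply: sumr_ge0 => i _; rewrite -expr2 sqr_ge0. Qed.

Lemma sqr_norm_le_dotp v : `|v| ^+ 2 <= dotp v v.
Proof.
rewrite -[leRHS]sqr_sqrtr ?dotp_ge0 // ler_sqr ?nnegrE ?sqrtr_ge0 //.
apply: rV_norm_le => [|j]; first exact: sqrtr_ge0.
rewrite -sqrtr_sqr ler_wsqrtr // /dotp (bigD1 j) //= -expr2 lerDl.
by apply: sumr_ge0 => i _; rewrite -expr2 sqr_ge0.
Qed.

Lemma norm_le_enorm v : `|v| <= enorm v.
Proof.
by rewrite -(ler_sqr (x := `|v|)) ?nnegrE ?sqrtr_ge0 // sqr_sqrtr ?dotp_ge0 ?sqr_norm_le_dotp.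
Qed.

Lemma enorm_le_norm v : enorm v <= N%:R * `|v|.
Proof.
rewrite -(ler_sqr (x := enorm v)) ?nnegrE ?sqrtr_ge0 ?mulr_ge0 // sqr_sqrtr ?dotp_ge0 //.
apply: le_trans (ler_norm _) _; apply: le_trans (dotp_norm_le _ _) _.
rewrite exprMn -mulrA -expr2 ler_wpM2r ?sqr_ge0 // -natrX ler_nat.
by case: (N) => // k; rewrite expnS expn1 leq_pmulr.
Qed.

(* The nearest point of the closure of the cone to an outside point gives the normal. *)
Lemma cone_dense_or_separated (K : set 'rV[R]_N) : K 0 ->
  (forall u v, K u -> K v -> K (u + v)) -> (forall (a : R) v, 0 <= a -> K v -> K (a *: v)) ->
  (forall x (e : R), 0 < e -> exists2 k, K k & `|k - x| <= e) \/
  exists2 p, p != 0 & forall k, K k -> dotp p k <= 0.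
Proof.
move=> K0 KD KZ; have [|] := pselect (forall x (e : R), 0 < e -> exists2 k, K k & `|k - x| <= e); first by left.
move=> /existsNP[x /existsNP[e /not_implyP[e0 He]]]; right.
pose f (z : 'rV[R]_N) : R := dotp (z - x) (z - x).
(* Outside the ball of radius [r] the squared distance to [x] already exceeds its value at the
   vertex 0 of the cone, so a minimum on the compact part [X] is a minimum on the whole closure. *)
pose r := dotp x x + 1.
pose X := closure K `&` [set z : 'rV[R]_N | `|z - x| <= r].
have cX : compact X.
  by rewrite /X setIC; apply: compact_closedI; [exact: closed_ball_compact|exact: closed_closure].
have f0 : f 0 = dotp x x by rewrite /f sub0r dotpNl dotpNr opprK.
have r1 : 1 <= r by rewrite lerDr dotp_ge0.
have sq (a b : R) : 0 <= a -> 0 <= b -> a ^+ 2 <= b ^+ 2 -> a <= b.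
  by move=> a0 b0; rewrite ler_sqr ?nnegrE.
have X0 : X 0.
  split; first exact: subset_closure.
  apply: sq => //; first exact: le_trans ler01 r1.
  apply: le_trans (sqr_norm_le_dotp _) _; rewrite -/(f 0) f0.
  by apply: (@le_trans _ _ r); [rewrite lerDl|rewrite expr2 ler_peMr // (le_trans ler01 r1)].
have cf : continuous (f : 'rV[R]_N -> R^o).
  rewrite (_ : f = \sum_i (fun z : 'rV[R]_N => (z - x) 0 i * (z - x) 0 i : R^o)); last first.
    by apply/funext => z; rewrite fct_sumE.
  apply: (big_ind (fun h : 'rV[R]_N -> R^o => continuous h)) => [|g h|i _].
  - exact: cst_continuous.
  - exact: continuous_addv.
  have c1 : continuous (fun z : 'rV[R]_N => (z - x) 0 i : R^o).
    apply: (@lips_continuous _ _ _ 1) => y z; rewrite mul1r !mxE opprB addrA subrK.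
    by have := rV_coord_le (y - z) i; rewrite !mxE.
  exact: (continuous_mulv c1 c1).
have [k /set_mem Xk kmin] : exists2 k, k \in X & forall t, t \in X -> f k <= f t.
  apply: (@compact_EVT_min _ _ f X) => //; first by exists 0; exact: X0.
  exact: continuous_subspaceT.
have kmin' z : closure K z -> f k <= f z.
  move=> Kz; have [zr|zr] := leP `|z - x| r; first by apply: kmin; apply/mem_set; split.
  apply: (@le_trans _ _ (f 0)); first by apply: kmin; exact/mem_set.
  rewrite f0; apply: le_trans (sqr_norm_le_dotp _); apply: (@le_trans _ _ (r ^+ 2)).
    by apply: (@le_trans _ _ r); [rewrite lerDl|rewrite expr2 ler_peMr // (le_trans ler01 r1)].
  by rewrite ler_sqr ?nnegrE ?(le_trans ler01 r1) // ltW.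
have clP z : closure K z <-> forall d : R, 0 < d -> exists2 y, K y & `|y - z| < d.
  split.
    move=> Kz d d0; have [y [Ky /= zy]] := Kz _ (nbhsx_ballx z d d0).
    by exists y => //; rewrite distrC; move: zy; rewrite -ball_normE.
  move=> H B /nbhs_ballP[d /= d0 HB]; have [y Ky zy] := H d d0.
  by exists y; split => //; apply: HB; rewrite -ball_normE /= distrC.
exists (x - k).
  apply/eqP => /eqP; rewrite subr_eq0 => /eqP xk; apply: He.
  have [y Ky ky] := (clP k).1 Xk.1 e e0.
  by exists y => //; rewrite xk ltW.
move=> v Kv; rewrite leNgt; apply/negP => pos.
pose a := dotp v v + 1.
have a0 : 0 < a by rewrite ltr_wpDl // dotp_ge0.
(* A step of this length along [v] would decrease the squared distance to [x]; adding 1 to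
   [dotp v v] avoids a division by zero. *)
pose t := dotp (x - k) v / a.
have t0 : 0 < t by exact: divr_gt0.
have : f k <= f (k + t *: v).
  apply: kmin'; apply/clP => d d0; have [y Ky ky] := (clP k).1 Xk.1 d d0.
  exists (y + t *: v); first by apply: KD => //; apply: KZ => //; exact: ltW.
  by rewrite opprD addrACA subrr addr0.
have -> : f (k + t *: v) = f k - 2 * t * dotp (x - k) v + t * t * dotp v v.
  rewrite /f (_ : k + t *: v - x = (k - x) + t *: v); last by rewrite addrAC.
  rewrite -(opprB k x) dotpNl; move: (k - x) => y.
  by rewrite !(dotpDl, dotpDr, dotpZl, dotpZr) (dotpC v y); ring.
have -> : dotp (x - k) v = t * a by rewrite /t divfK // gt_eqF.
apply/negP; rewrite -ltNge.
have -> : f k - 2 * t * (t * a) + t * t * dotp v v = f k - t * t * (dotp v v + 2) by rewrite /a; ring.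
rewrite ltrBlDr ltrDl; apply: mulr_gt0; first exact: mulr_gt0.
by rewrite ltr_wpDl // dotp_ge0.
Qed.

End Separation.

(** * Properties of all small positive parameters *)

Section Small.
Context {R : realType}.

Definition ev0 (P : R -> Prop) := exists2 r : R, 0 < r & forall e, 0 < e < r -> P e.

Lemma ev0_and (P Q : R -> Prop) : ev0 P -> ev0 Q -> ev0 (fun e => P e /\ Q e).
Proof.
move=> [r r0 Hr] [r' r'0 Hr']; exists (Num.min r r'); first by rewrite lt_min r0.
move=> e /andP[e0]; rewrite lt_min => /andP[er er'].
by split; [apply: Hr; rewrite e0|apply: Hr'; rewrite e0].
Qed.

Lemma ev0_mono (P Q : R -> Prop) : (forall e, 0 < e -> P e -> Q e) -> ev0 P -> ev0 Q.
Proof. by move=> PQ [r r0 Hr]; exists r => // e /[dup] /andP[e0 _] /Hr; exact: PQ. Qed.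

Lemma ev0_small (K h : R) : 0 < h -> 0 <= K -> ev0 (fun e => K * e <= h).
Proof.
move=> h0 K0; have K1 : 0 < K + 1 by rewrite ltr_wpDl.
exists (h / (K + 1)); first exact: divr_gt0.
move=> e /andP[e0]; rewrite ltr_pdivlMr // => eh; apply: le_trans (ltW eh).
by rewrite mulrC ler_wpM2l ?(ltW e0) // lerDl.
Qed.

End Small.

(** * Algebra of functions continuous on a set *)

Section ContOn.
Context {R : realType} {T V : normedModType R}.
Variable K : set T.

Lemma cont_on_cst (v : V) : cont_on K (fun _ => v).
Proof. by move=> x _ e e0; exists 1 => // y _ _; rewrite subrr normr0. Qed.

Lemma cont_on_add (F G : T -> V) : cont_on K F -> cont_on K G -> cont_on K (fun x => F x + G x).
Proof.
move=> cF cG x Kx e e0; have e2 : 0 < e / 2 by rewrite divr_gt0.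
have [d d0 Hd] := cF x Kx _ e2; have [d' d'0 Hd'] := cG x Kx _ e2.
exists (Num.min d d'); first by rewrite lt_min d0.
move=> y Ky; rewrite lt_min => /andP[/(Hd y Ky) h /(Hd' y Ky) h'].
rewrite opprD addrACA (splitr e); apply: le_lt_trans (ler_normD _ _) _; exact: ltrD.
Qed.

Lemma cont_on_comp {W : normedModType R} (K' : set V) (F : T -> V) (G : V -> W) :
  cont_on K F -> (forall x, K x -> K' (F x)) -> cont_on K' G -> cont_on K (fun x => G (F x)).
Proof.
move=> cF FK cG x Kx e e0; have [d d0 Hd] := cG _ (FK x Kx) e e0.
have [d' d'0 Hd'] := cF x Kx d d0; exists d' => // y Ky xy.
by apply: Hd; [exact: FK|exact: Hd'].
Qed.

Lemma cont_on_scale (c : T -> R) (F : T -> V) : cont_on K (c : T -> R^o) -> cont_on K F ->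
  cont_on K (fun x => c x *: F x).
Proof.
move=> cc cF x Kx e e0.
have e2 : 0 < e / 2 by rewrite divr_gt0.
pose B := `|c x| + 1; have B0 : 0 < B by rewrite ltr_wpDl.
pose C := `|F x| + 1; have C0 : 0 < C by rewrite ltr_wpDl.
have [d d0 Hd] := cF x Kx _ (divr_gt0 e2 B0).
have [d1 d10 Hd1] := cc x Kx _ (divr_gt0 e2 C0).
have [d2 d20 Hd2] := cc x Kx _ (ltr01 : 0 < (1:R)).
exists (Num.min d (Num.min d1 d2)); first by rewrite !lt_min d0 d10.
move=> y Ky; rewrite !lt_min => /andP[/(Hd y Ky) h /andP[/(Hd1 y Ky) h1 /(Hd2 y Ky) h2]].
have -> : c x *: F x - c y *: F y = c y *: (F x - F y) + (c x - c y) *: F x.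
  by rewrite scalerBr scalerBl [RHS]addrC addrA subrK.
have cy : `|c y| <= B.
  rewrite /B -[c y](addrNK (c x)); apply: le_trans (ler_normD _ _) _.
  by rewrite addrC lerD2l distrC ltW.
apply: le_lt_trans (ler_normD _ _) _; rewrite !normrZ.
have e1 : `|c y| * `|F x - F y| < e / 2.
  apply: (@le_lt_trans _ _ (B * `|F x - F y|)); first by rewrite ler_wpM2r.
  by rewrite mulrC -ltr_pdivlMr.
have e3 : `|c x - c y| * `|F x| <= e / 2.
  apply: (@le_trans _ _ (`|c x - c y| * C)); first by rewrite ler_wpM2l // lerDl.
  by rewrite -ler_pdivlMr // ltW.
by rewrite (splitr e); apply: ltr_leD.
Qed.

Lemma cont_on_sum (I : Type) (r : seq I) (F : I -> T -> V) : (forall i, cont_on K (F i)) ->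
  cont_on K (fun x => \sum_(i <- r) F i x).
Proof.
move=> H; elim: r => [|i r IH].
  by rewrite (_ : (fun x => _) = fun _ => 0); [exact: cont_on_cst|apply/funext => x; rewrite big_nil].
rewrite (_ : (fun x => _) = fun x => F i x + \sum_(j <- r) F j x); first exact: cont_on_add.
by apply/funext => x; rewrite big_cons.
Qed.

Lemma cont_on_sub (K' : set T) (F : T -> V) : K' `<=` K -> cont_on K F -> cont_on K' F.
Proof.
by move=> KK cF x Kx e /(cF x (KK x Kx))[d d0 Hd]; exists d => // y Ky; apply: Hd; exact: KK.
Qed.

End ContOn.

(** * Families of variations and the separation argument *)

Section Families.
Context {R : realType}.
Variable N : nat.
Variables (S M BD KF eta0 : R) (xb : R -> 'rV[R]_N) (D : R -> 'rV[R]_N -> 'rV[R]_N).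
Variables (Fl : R -> 'rV[R]_N -> R -> 'rV[R]_N) (Reach : R -> R -> 'rV[R]_N -> Prop).
Hypotheses (S0 : 0 < S) (M0 : 0 <= M) (BD0 : 0 <= BD) (KF0 : 0 <= KF) (eta00 : 0 < eta0).
Hypothesis lip_xb : lips M 0 S xb.
Hypothesis Dlin : forall t (a : R) u v, D t (a *: u + v) = a *: D t u + D t v.
Hypothesis D_bnd : forall t v, 0 <= t <= S -> `|D t v| <= BD * `|v|.
Hypothesis D_lip : forall s t v, 0 <= s <= S -> 0 <= t <= S ->
  `|D s v - D t v| <= BD * `|v| * `|s - t|.
Hypothesis D_end : forall v, D S v = v.
Hypothesis Fl_lip : forall a a' x x' t, 0 <= a -> 0 <= a' -> a <= t -> a' <= t -> t <= S ->
  `|Fl a x t - Fl a' x' t| <= KF * (`|x - x'| + M * `|a - a'|).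
Hypothesis Fl_ref : forall a x t, 0 <= a -> a <= t -> t <= S ->
  `|Fl a x t - xb t| <= KF * `|x - xb a|.
Hypothesis D_cons : forall e, 0 < e -> exists2 d, 0 < d & forall a x t,
  0 <= a -> a <= t -> t <= S -> `|x - xb a| <= d ->
  `|D t (Fl a x t - xb t) - D a (x - xb a)| <= e * `|x - xb a|.
Hypothesis R0 : forall h, 0 < h -> Reach h 0 (xb 0).
Hypothesis R_mono : forall h h' t x, h <= h' -> Reach h t x -> Reach h' t x.
Hypothesis R_follow : forall h h' s t x, 0 <= s -> s <= t -> t <= S -> Reach h s x ->
  KF * `|x - xb s| <= h' -> h' <= eta0 -> Reach (h + h') t (Fl s x t).
Hypothesis R_skip : forall h e t x, 0 <= t -> 0 <= e -> t + e <= S -> Reach h t x ->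
  Reach (h + (1 + M) * e) (t + e) x.

Let D0 t : D t 0 = 0.
Proof. by have := Dlin t 1 0 0; rewrite !scale1r addr0 -[LHS]addr0 => /addrI/esym. Qed.
Let DD t u v : D t (u + v) = D t u + D t v.
Proof. by have := Dlin t 1 u v; rewrite !scale1r. Qed.
Let DZ t (a : R) u : D t (a *: u) = a *: D t u.
Proof. by have := Dlin t a u 0; rewrite !addr0 D0 addr0. Qed.
Let DB t u v : D t (u - v) = D t u - D t v.
Proof. by rewrite -scaleN1r DD DZ scaleN1r. Qed.

Notation cube := (cube1 (R := R) (n := N)).

(** For each parameter [u] there is a clock reading [tau u], late by at most [C * e], and a state
    [x u] whose deviation, transported to the final time, is [e *: l u] up to [h * e]. The same [h]
    bounds the distance between the actual trajectory and the reference. As [tau u <= S], all clocks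
    agree once [s = S]. *)
Record fam_at (C s : R) (l : 'rV[R]_N -> 'rV[R]_N) (h e : R) (tau : 'rV[R]_N -> R)
  (x : 'rV[R]_N -> 'rV[R]_N) : Prop := FamAt {
  fam_ct : cont_on cube (tau : _ -> R^o);
  fam_cx : cont_on cube x;
  fam_tau : forall u, cube u -> s <= tau u <= s + C * e /\ tau u <= S;
  fam_x : forall u, cube u -> `|x u - xb (tau u)| <= C * e;
  fam_D : forall u, cube u -> `|D (tau u) (x u - xb (tau u)) - e *: l u| <= h * e;
  fam_R : forall u, cube u -> Reach h (tau u) (x u) }.

(** [C] is chosen before [h], and [e] after it: the deviation is of order [e] with a fixed constant,
    while its first-order error is [o(e)]. *)
Definition fam s l := exists2 C, 0 <= C & forall h, 0 < h -> ev0 (fun e => exists tau x, fam_at C s l h e tau x).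

Lemma fam_zero : fam 0 (fun _ => 0).
Proof.
exists 0 => // h h0; exists 1 => // e /andP[e0 _]; exists (fun _ => 0), (fun _ => xb 0); split.
- exact: cont_on_cst.
- exact: cont_on_cst.
- by move=> u _; rewrite mul0r addr0 lexx ltW.
- by move=> u _; rewrite subrr normr0 mul0r.
- by move=> u _; rewrite subrr D0 scaler0 subrr normr0 mulr_ge0 // ltW.
- by move=> u _; exact: R0.
Qed.

(** Following the reference flow from [tau u] to the common time [s'] synchronizes the clocks and
    keeps the transported deviation, by [D_cons]; the case [s = s'] is trivial, and otherwise a
    small [e] puts all clocks before [s']. *)
Lemma fam_follow s s' l : 0 <= s -> s <= s' -> s' <= S -> fam s l -> fam s' l.
Proof.
move=> s0; rewrite le_eqVlt => /orP[/eqP -> //|ss'] s'S [C C0 HC].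
exists (KF * C); first exact: mulr_ge0.
move=> h h0.
have C1 : 0 < C + 1 by rewrite ltr_wpDl.
have h1 : 0 < h / 2 / (C + 1) by rewrite !divr_gt0.
have h2 : 0 < h / 2 by rewrite divr_gt0.
have [d d0 Hd] := D_cons h1.
have H1 := ev0_and (HC _ h2) (ev0_small d0 C0).
have m0 : 0 < Num.min (h / 2) eta0 by rewrite lt_min h2.
have H2 := ev0_and (ev0_small m0 (mulr_ge0 KF0 C0)) (ev0_small (etrans (subr_gt0 _ _) ss') C0).
apply: ev0_mono (ev0_and H1 H2) => e e0 [[[tau [x [ct cx Ht Hx HD HR]]] ed] [eh es]].
exists (fun _ => s'), (fun u => Fl (tau u) (x u) s').
have t0 u : cube u -> 0 <= tau u by move=> /Ht[/andP[h3 _] _]; exact: le_trans h3.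
have ts u : cube u -> tau u <= s'.
  by move=> /Ht[/andP[_ h3] _]; apply: le_trans h3 _; rewrite addrC -lerBrDr.
split.
- exact: cont_on_cst.
- move=> u Ku r r0.
  have q0 : 0 < r / 2 / (KF + 1) by rewrite !divr_gt0 // ltr_wpDl.
  have q1 : 0 < r / 2 / ((KF + 1) * (M + 1)) by rewrite !divr_gt0 // mulr_gt0 // ltr_wpDl.
  have [d1 d10 Hd1] := cx u Ku _ q0; have [d2 d20 Hd2] := ct u Ku _ q1.
  exists (Num.min d1 d2); first by rewrite lt_min d10.
  move=> v Kv; rewrite lt_min => /andP[/(Hd1 v Kv) a1 /(Hd2 v Kv) a2].
  apply: le_lt_trans (Fl_lip _ _ (t0 u Ku) (t0 v Kv) (ts u Ku) (ts v Kv) s'S) _.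
  have K1 : 0 < KF + 1 by rewrite ltr_wpDl.
  have M1 : 0 < M + 1 by rewrite ltr_wpDl.
  apply: (@le_lt_trans _ _ ((KF + 1) * (`|x u - x v| + (M + 1) * `|tau u - tau v|))).
    apply: ler_pM => //; first by rewrite addr_ge0 // mulr_ge0.
      by rewrite lerDl.
    by rewrite lerD2l ler_wpM2r // lerDl.
  rewrite mulrDr mulrA (splitr r); apply: ltrD; rewrite mulrC -ltr_pdivlMr //; exact: mulr_gt0.
- by move=> u Ku; rewrite lexx s'S /= lerDl mulr_ge0 ?mulr_ge0 // ltW.
- move=> u Ku; apply: le_trans (Fl_ref _ (t0 u Ku) (ts u Ku) s'S) _.
  by rewrite -mulrA ler_wpM2l // Hx.
- move=> u Ku; have Hu := Hx u Ku.
  have a1 := Hd _ _ _ (t0 u Ku) (ts u Ku) s'S (le_trans Hu ed); have a2 := HD u Ku.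
  rewrite -[D _ _](addrNK (D (tau u) (x u - xb (tau u)))) -addrA.
  apply: le_trans (ler_normD _ _) _; rewrite (splitr h) mulrDl lerD //.
  apply: le_trans a1 _; apply: (@le_trans _ _ (h / 2 / (C + 1) * ((C + 1) * e))).
    rewrite ler_wpM2l ?(ltW h1) //; apply: le_trans Hu _.
    by rewrite ler_wpM2r ?(ltW e0) // lerDl.
  by rewrite mulrA divfK // gt_eqF.
- move=> u Ku; move: eh; rewrite le_min => /andP[eh ee].
  apply: (R_mono (h := h / 2 + KF * C * e)); first by rewrite {2}(splitr h) lerD2l.
  apply: (R_follow (t0 u Ku) (ts u Ku) s'S (HR u Ku)) => //.
  by apply: le_trans (ler_wpM2l KF0 (Hx u Ku)) _; rewrite mulrA.
Qed.

Definition weight (c : 'rV[R]_N -> R) := cont_on cube (c : _ -> R^o) /\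
  exists2 Cc, 0 <= Cc & forall u, cube u -> 0 <= c u <= Cc.

(** A direction counts as a variation if it can be superposed on every family at [s] with every
    continuous nonnegative weight; this closure property is what lets finitely many variations be
    combined, including several at one time. *)
Definition variation s k := 0 <= s <= S /\ forall l c, weight c -> fam s l ->
  fam s (fun u => l u + c u *: k).

(* [I e x] is the endpoint of an admissible arc issuing from [x], inserted while the reference clock stands still. *)
Definition insertable (s : R) (v : 'rV[R]_N) := exists2 I : R -> 'rV[R]_N -> 'rV[R]_N,
  (forall h, 0 < h -> exists2 r, 0 < r & forall e x h' t, 0 <= e <= r -> `|x - xb s| <= r ->
     `|I e x - x - e *: v| <= h * e /\ (0 <= t <= S -> Reach h' t x -> Reach (h' + h) t (I e x))) &
  exists2 r, 0 < r & forall e x, 0 <= e <= r -> `|x - xb s| <= r -> forall h, 0 < h ->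
    exists2 d, 0 < d & forall e' x', 0 <= e' <= r -> `|x' - xb s| <= r ->
      `|e - e'| < d -> `|x - x'| < d -> `|I e x - I e' x'| < h.

(** The arc of size [e * c u] is inserted at the reading [tau u], not at [s]; since [tau u - s] is
    at most [C * e], the discrepancy between the two transports is of second order. *)
Lemma variation_insert s v : 0 <= s <= S -> insertable s v -> variation s (D s v).
Proof.
move=> sS [I HI [r1 r10 HIc]]; split => // l c [cc [Cc Cc0 Hc]] [C C0 HC].
have [s0 sS'] := andP sS.
pose V := `|v| + 1.
have V0 : 0 < V by rewrite ltr_wpDl.
exists (C + Cc * V); first by rewrite addr_ge0 // mulr_ge0 // ltW.
move=> h h0.
(* [Q] is such that an insertion error [h / Q] per unit of arc costs at most [h / 3] after transport
   with the weight [c]. *)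
pose Q := 3 * ((BD + 1) * (Cc + 1)).
have Q0 : 0 < Q by rewrite !mulr_gt0 // ltr_wpDl.
pose h1 := Num.min (Num.min 1 (h / 2)) (h / Q).
have h10 : 0 < h1 by rewrite !lt_min ltr01 !divr_gt0.
have h11 : h1 <= 1 by rewrite !ge_min lexx.
have h1h : h1 <= h / 2 by rewrite !ge_min lexx orbT.
have h1Q : h1 <= h / Q by rewrite !ge_min lexx orbT.
have h3 : 0 < h / 3 by rewrite divr_gt0.
have [r r0 Hr] := HI h1 h10.
pose rr := Num.min r r1.
have rr0 : 0 < rr by rewrite lt_min r0.
have hh : 0 < Num.min (h / 3) (h / 2) by rewrite lt_min !divr_gt0.
have B1 : 0 <= BD * V * C * Cc by rewrite !mulr_ge0 // ltW.
have H1 := ev0_and (HC _ hh) (ev0_small rr0 Cc0).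
have H2 := ev0_and (ev0_small rr0 (addr_ge0 C0 (mulr_ge0 M0 C0))) (ev0_small h3 B1).
apply: ev0_mono (ev0_and H1 H2) => e e0 [[[tau [x [ct cx Ht Hx HD HR]]] ec] [ex eh]].
have e0' := ltW e0.
pose E u := e * c u.
have E0 u : cube u -> 0 <= E u <= rr.
  move=> Ku; have /andP[c0 cC] := Hc u Ku; rewrite mulr_ge0 //=.
  by apply: le_trans ec; rewrite /E mulrC ler_wpM2r.
have EC u : cube u -> E u <= Cc * e.
  by move=> Ku; have /andP[c0 cC] := Hc u Ku; rewrite /E mulrC ler_wpM2r.
have tS u : cube u -> 0 <= tau u <= S.
  by move=> Ku; have [/andP[a1 _] ->] := Ht u Ku; rewrite (le_trans s0 a1).
have ts u : cube u -> `|tau u - s| <= C * e.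
  move=> Ku; have [/andP[a1 a2] _] := Ht u Ku.
  by rewrite ger0_norm ?subr_ge0 // lerBlDl.
have xs u : cube u -> `|x u - xb s| <= rr.
  move=> Ku; apply: le_trans ex.
  rewrite -[x u](addrNK (xb (tau u))) -addrA mulrDl; apply: le_trans (ler_normD _ _) _.
  apply: lerD; first exact: Hx.
  by apply: le_trans (lip_xb _ _) _ => //; [exact: tS|rewrite -mulrA ler_wpM2l // ts].
have lr a : a <= rr -> a <= r by rewrite le_min => /andP[].
have lr1 a : a <= rr -> a <= r1 by rewrite le_min => /andP[].
have Hu u h' : cube u -> `|I (E u) (x u) - x u - E u *: v| <= h1 * E u /\
    (Reach h' (tau u) (x u) -> Reach (h' + h1) (tau u) (I (E u) (x u))).
  move=> Ku; have /andP[a1 a2] := E0 u Ku.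
  have [||b1 b2] := Hr (E u) (x u) h' (tau u); [by rewrite a1 lr|by apply: lr; exact: xs|].
  by split => // ?; apply: b2 => //; exact: tS.
exists tau, (fun u => I (E u) (x u)); split => //.
- move=> u Ku q q0; have /andP[a1 a2] := E0 u Ku.
  have [||d d0 Hd] := HIc (E u) (x u) _ _ q q0; [by rewrite a1 lr1|by apply: lr1; exact: xs|].
  have [d1 d10 Hd1] := cc u Ku _ (divr_gt0 d0 e0); have [d2 d20 Hd2] := cx u Ku _ d0.
  exists (Num.min d1 d2); first by rewrite lt_min d10.
  move=> u' Ku'; rewrite lt_min => /andP[/(Hd1 u' Ku') b1 /(Hd2 u' Ku') b2].
  have /andP[a1' a2'] := E0 u' Ku'.
  apply: Hd => //; [by rewrite a1' lr1|by apply: lr1; exact: xs|].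
  by rewrite /E -mulrBr normrM ger0_norm // mulrC -ltr_pdivlMr.
- move=> u Ku; have [/andP[a1 a2] ->] := Ht u Ku; split=> //; rewrite a1 /=.
  by apply: le_trans a2 _; rewrite lerD2l ler_wpM2r // lerDl mulr_ge0 // ltW.
- move=> u Ku; have [b1 _] := Hu u 0 Ku; have /andP[a1 a2] := E0 u Ku.
  rewrite (_ : I (E u) (x u) - xb (tau u) =
    (x u - xb (tau u)) + ((I (E u) (x u) - x u - E u *: v) + E u *: v)); last first.
    by rewrite subrK [RHS]addrC addrA subrK.
  apply: le_trans (ler_normD _ _) _; rewrite mulrDl; apply: lerD; first exact: Hx.
  apply: le_trans (ler_normD _ _) _; rewrite normrZ (ger0_norm a1).
  apply: (@le_trans _ _ (E u * V)).
    rewrite /V mulrDr mulr1 [leRHS]addrC lerD2r; apply: le_trans b1 _.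
    by rewrite ler_piMl.
  by rewrite [leRHS]mulrAC ler_wpM2r ?(ltW V0) // EC.
- move=> u Ku; have [b1 _] := Hu u 0 Ku; have /andP[a1 a2] := E0 u Ku.
  have b2 : `|D (tau u) (x u - xb (tau u)) - e *: l u| <= h / 3 * e.
    by apply: le_trans (HD u Ku) _; rewrite ler_wpM2r // ge_min lexx.
  rewrite (_ : D (tau u) (I (E u) (x u) - xb (tau u)) - e *: (l u + c u *: D s v) =
    (D (tau u) (x u - xb (tau u)) - e *: l u) +
    (D (tau u) (I (E u) (x u) - x u - E u *: v) + E u *: (D (tau u) v - D s v))); last first.
    rewrite !DB DZ /E scalerDr !scalerA; move: (D _ _) (D _ _) (D _ _) (D _ _) (D _ _) (l u) => w1 w2 w3 w4 w5 w6.
    by apply/rowP => j; rewrite !mxE; ring.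
  rewrite (_ : h * e = h / 3 * e + (h / 3 * e + h / 3 * e)); last by field.
  apply: le_trans (ler_normD _ _) _; apply: lerD => //.
  apply: le_trans (ler_normD _ _) _; apply: lerD.
    apply: le_trans (D_bnd _ (tS u Ku)) _; apply: le_trans (ler_wpM2l BD0 b1) _.
    apply: (@le_trans _ _ ((BD + 1) * (h / Q * ((Cc + 1) * e)))).
      apply: ler_pM => //; [by rewrite mulr_ge0 // ltW|by rewrite lerDl|].
      apply: ler_pM => //; [exact: ltW|].
      by apply: le_trans (EC u Ku) _; rewrite ler_wpM2r // lerDl.
    rewrite (_ : (BD + 1) * _ = h / 3 * e) // /Q; field.
    by rewrite !gt_eqF // ltr_wpDl.
  rewrite normrZ (ger0_norm a1); apply: (@le_trans _ _ (Cc * e * (BD * V * (C * e)))).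
    apply: ler_pM => //; first exact: EC.
    apply: le_trans (D_lip _ (tS u Ku) sS) _; apply: ler_pM => //; first by rewrite mulr_ge0.
      by rewrite ler_wpM2l // lerDl.
    exact: ts.
  rewrite [leLHS](_ : _ = BD * V * C * Cc * e * e); last by ring.
  by rewrite ler_wpM2r.
- move=> u Ku; have [_ b2] := Hu u (h / 2) Ku.
  apply: (R_mono (h := h / 2 + h1)); first by rewrite {2}(splitr h) lerD2l.
  by apply: b2; apply: R_mono (HR u Ku); rewrite ge_min lexx orbT.
Qed.

(** The clock advances by [e * c u] while the state stays, so the reference moves away by
    [e * c u *: w] to first order and the deviation changes by the opposite vector. *)
Lemma variation_skip s w : 0 < s < S -> is_derive s (1:R) xb w -> variation s (- D s w).
Proof.
move=> /andP[s0 sS] /is_derive_approx dw.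
have sS' : 0 <= s <= S by rewrite !ltW.
split => // l c [cc [Cc Cc0 Hc]] [C C0 HC].
exists (C + (Cc + M * Cc)); first by rewrite !addr_ge0 // mulr_ge0.
move=> h h0.
pose C2 := C + Cc.
have C20 : 0 <= C2 by rewrite addr_ge0.
have h4 : 0 < h / 4 by rewrite divr_gt0.
pose h1 := h / 4 / (2 * ((BD + 1) * (C2 + 1))).
have h10 : 0 < h1 by rewrite divr_gt0 // !mulr_gt0 // ltr_wpDl.
have [d d0 Hd] := dw h1 h10.
have hh : 0 < Num.min (h / 4) (h / 2) by rewrite lt_min !divr_gt0.
have h2 : 0 < h / 2 by rewrite divr_gt0.
have B1 : 0 <= BD * C * Cc by rewrite !mulr_ge0.
have B2 : 0 <= Cc * (BD * `|w| * C2) by rewrite !mulr_ge0.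
have B3 : 0 <= (1 + M) * Cc by rewrite mulr_ge0 // addr_ge0.
have sS2 : 0 < S - s by rewrite subr_gt0.
have H1 := ev0_and (HC _ hh) (ev0_and (ev0_small d0 C20) (ev0_small sS2 C20)).
have H2 := ev0_and (ev0_small h4 B1) (ev0_and (ev0_small h4 B2) (ev0_small h2 B3)).
apply: ev0_mono (ev0_and H1 H2) =>
  e e0 [[[tau [x [ct cx Ht Hx HD HR]]] [ed es]] [e1 [e2 e3]]].
have e0' := ltW e0.
pose E u := e * c u.
have E0 u : cube u -> 0 <= E u by move=> Ku; have /andP[c0 cC] := Hc u Ku; rewrite mulr_ge0.
have EC u : cube u -> E u <= Cc * e.
  by move=> Ku; have /andP[c0 cC] := Hc u Ku; rewrite /E mulrC ler_wpM2r.
have ts u : cube u -> 0 <= tau u - s <= C * e.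
  by move=> Ku; have [/andP[a1 a2] _] := Ht u Ku; rewrite subr_ge0 a1 lerBlDl.
have ts2 u : cube u -> 0 <= tau u + E u - s <= C2 * e.
  move=> Ku; have /andP[a1 a2] := ts u Ku; have := EC u Ku; have := E0 u Ku.
  by rewrite addrAC /C2 mulrDl => ? ?; rewrite addr_ge0 //= lerD.
have ts1 u : cube u -> tau u - s <= C2 * e.
  move=> Ku; have /andP[_ a2] := ts u Ku; apply: le_trans a2 _.
  by rewrite ler_wpM2r // lerDl.
have tS2 u : cube u -> 0 <= tau u + E u <= S.
  move=> Ku; have /andP[a1 a2] := ts2 u Ku; apply/andP; split.
    by apply: le_trans (ltW s0) _; rewrite -subr_ge0.
  by rewrite -(lerD2r (- s)); apply: le_trans a2 es.
have tS u : cube u -> 0 <= tau u <= S.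
  by move=> Ku; have [/andP[a1 _] ->] := Ht u Ku; rewrite (le_trans (ltW s0) a1).
exists (fun u => tau u + E u), x; split => //.
- apply: (cont_on_add ct) => u Ku q q0.
  have [d1 d10 Hd1] := cc u Ku _ (divr_gt0 q0 e0); exists d1 => // u' Ku' /(Hd1 u' Ku') b1.
  by rewrite /E -mulrBr normrM ger0_norm // mulrC -ltr_pdivlMr.
- move=> u Ku; have /andP[a1 a2] := ts2 u Ku; have /andP[_ ->] := tS2 u Ku; split => //.
  rewrite -subr_ge0 a1 /= -lerBlDl; apply: le_trans a2 _.
  by rewrite ler_wpM2r // /C2 lerD2l lerDl mulr_ge0.
- move=> u Ku; rewrite (_ : x u - xb (tau u + E u) =
    (x u - xb (tau u)) + (xb (tau u) - xb (tau u + E u))); last by rewrite addrA subrK.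
  apply: le_trans (ler_normD _ _) _; rewrite mulrDl; apply: lerD; first exact: Hx.
  apply: le_trans (lip_xb (tS u Ku) (tS2 u Ku)) _.
  rewrite opprD addrA subrr sub0r normrN ger0_norm ?E0 //.
  apply: (@le_trans _ _ (M * (Cc * e))); first by rewrite ler_wpM2l // EC.
  by rewrite mulrDl -mulrA lerDr mulr_ge0.
- move=> u Ku.
  have b2 : `|D (tau u) (x u - xb (tau u)) - e *: l u| <= h / 4 * e.
    by apply: le_trans (HD u Ku) _; rewrite ler_wpM2r // ge_min lexx.
  pose t := tau u; pose t' := tau u + E u.
  pose err := xb t' - xb t - E u *: w.
  (* [xb] is known to be differentiable at [s] only, whereas the readings [t] and [t'] lie merely
     near [s]: both are expanded at [s] and subtracted. *)
  have He : `|err| <= 2 * (h1 * (C2 * e)).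
    have g1 := Hd (t - s); have g2 := Hd (t' - s).
    have /andP[i1 i2] := ts u Ku; have /andP[j1 j2] := ts2 u Ku; have i3 := ts1 u Ku.
    rewrite (ger0_norm i1) in g1; rewrite (ger0_norm j1) in g2.
    have {}g1 := g1 (le_trans i3 ed); have {}g2 := g2 (le_trans j2 ed).
    rewrite !(addrC s) !subrK in g1 g2.
    rewrite (_ : err = (xb t' - xb s - (t' - s) *: w) - (xb t - xb s - (t - s) *: w)); last first.
      rewrite /err /t' /t; move: (xb (tau u + E u)) (xb (tau u)) (xb s) => w1 w2 w3.
      by apply/rowP => j; rewrite !mxE; ring.
    apply: le_trans (ler_normB _ _) _; rewrite mulr2n mulrDl mul1r.
    apply: lerD.
      by apply: le_trans g2 _; rewrite ler_wpM2l // ltW.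
    by apply: le_trans g1 _; rewrite ler_wpM2l // ltW.
  rewrite (_ : D t' (x u - xb t') - e *: (l u + c u *: - D s w) =
    (D t (x u - xb t) - e *: l u) + ((D t' (x u - xb t) - D t (x u - xb t)) +
     (- D t' err - E u *: (D t' w - D s w)))); last first.
    rewrite /err !DB DZ -/t -/t' /E scalerDr !scalerA.
    move: (D t' _) (D t' _) (D t' _) (D t' _) (D t _) (D t _) (D s _) (l u) => w1 w2 w3 w4 w5 w6 w7 w8.
    by apply/rowP => j; rewrite !mxE; ring.
  rewrite (_ : h * e = h / 4 * e + (h / 4 * e + (h / 4 * e + h / 4 * e))); last by field.
  apply: le_trans (ler_normD _ _) _; apply: lerD => //.
  apply: le_trans (ler_normD _ _) _; apply: lerD.
    apply: le_trans (D_lip _ (tS2 u Ku) (tS u Ku)) _.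
    rewrite addrAC subrr add0r (ger0_norm (E0 u Ku)).
    apply: (@le_trans _ _ (BD * (C * e) * (Cc * e))).
      apply: ler_pM => //; [by rewrite mulr_ge0|exact: E0|by rewrite ler_wpM2l // Hx|exact: EC].
    rewrite [leLHS](_ : _ = BD * C * Cc * e * e); last by ring.
    by rewrite ler_wpM2r.
  apply: le_trans (ler_normB _ _) _; apply: lerD.
    rewrite normrN; apply: le_trans (D_bnd _ (tS2 u Ku)) _.
    apply: (@le_trans _ _ ((BD + 1) * (2 * (h1 * ((C2 + 1) * e))))).
      apply: ler_pM => //; first by rewrite lerDl.
      apply: le_trans He _; rewrite ler_wpM2l // ler_wpM2l ?(ltW h10) //.
      by rewrite ler_wpM2r // lerDl.
    rewrite (_ : (BD + 1) * _ = h / 4 * e) // /h1; field.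
    by rewrite !gt_eqF // ltr_wpDl.
  rewrite normrZ (ger0_norm (E0 u Ku)).
  apply: (@le_trans _ _ (Cc * e * (BD * `|w| * (C2 * e)))).
    apply: ler_pM => //; [exact: E0|exact: EC|].
    apply: le_trans (D_lip _ (tS2 u Ku) sS') _; rewrite ler_wpM2l ?mulr_ge0 //.
    by have /andP[j1 j2] := ts2 u Ku; rewrite ger0_norm.
  rewrite [leLHS](_ : _ = Cc * (BD * `|w| * C2) * e * e); last by ring.
  by rewrite ler_wpM2r.
- move=> u Ku.
  apply: (R_mono (h := h / 2 + (1 + M) * E u)).
    rewrite {2}(splitr h) lerD2l; apply: le_trans e3; rewrite -mulrA ler_wpM2l ?addr_ge0 //.
    exact: EC.
  have /andP[t0 _] := tS u Ku; have /andP[_ t1] := tS2 u Ku.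
  apply: R_skip => //; first exact: E0.
  by apply: R_mono (HR u Ku); rewrite ge_min lexx orbT.
Qed.

Lemma weight_scale (a : R) c : 0 <= a -> weight c -> weight (fun u => a * c u).
Proof.
move=> a0 [cc [Cc Cc0 Hc]]; split.
  by apply: (@cont_on_scale _ _ R^o _ (fun _ => a)) => //; exact: cont_on_cst.
exists (a * Cc); first exact: mulr_ge0.
by move=> u /Hc/andP[c0 cC]; rewrite mulr_ge0 //= ler_wpM2l.
Qed.

Lemma variation_scale s (a : R) k : 0 <= a -> variation s k -> variation s (a *: k).
Proof.
move=> a0 [sS H]; split => // l c wc fl.
have := H l _ (weight_scale a0 wc) fl; congr fam; apply/funext => u.
by rewrite scalerA mulrC.
Qed.

Lemma fam_path (T : eqType) (st : T -> R) (k : T -> 'rV[R]_N) (c : T -> 'rV[R]_N -> R) (r : seq T) :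
  (forall x, x \in r -> variation (st x) (k x)) -> (forall x, weight (c x)) ->
  forall s l, 0 <= s <= S -> path <=%O s [seq st x | x <- r] -> fam s l ->
  fam S (fun u => l u + \sum_(x <- r) c x u *: k x).
Proof.
move=> Hv Hw; elim: r Hv => [|x r IH] Hv s l /andP[s0 sS] /=.
  move=> _ fl; have := fam_follow s0 sS (lexx S) fl; congr fam.
  by apply/funext => u; rewrite big_nil addr0.
move=> /andP[sx px] fl; have [xS Hx] := Hv x (mem_head _ _).
have xS1 : st x <= S by case/andP: xS.
have := IH _ _ _ xS px (Hx _ _ (Hw x) (fam_follow s0 sx xS1 fl)).
move=> H; have := H (fun y yr => Hv y (mem_behead (s := x :: r) yr)); congr fam.
by apply/funext => u; rewrite big_cons addrA.
Qed.

(** The variations are performed in the order of their times, with the reference flow in between;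
    equal times are allowed. *)
Lemma fam_sum (T : eqType) (st : T -> R) (k : T -> 'rV[R]_N) (c : T -> 'rV[R]_N -> R) (r : seq T) :
  (forall x, x \in r -> variation (st x) (k x)) -> (forall x, weight (c x)) ->
  fam S (fun u => \sum_(x <- r) c x u *: k x).
Proof.
move=> Hv Hw; pose leT (x y : T) := st x <= st y.
have pr : perm_eq (sort leT r) r by rewrite perm_sort.
have Hv' x : x \in sort leT r -> variation (st x) (k x) by rewrite mem_sort; exact: Hv.
have p : path <=%O (0:R) [seq st x | x <- sort leT r].
  have so : sorted leT (sort leT r) by apply: sort_sorted => x y; exact: le_total.
  rewrite path_min_sorted; first by rewrite sorted_map.
  by apply/allP => y /mapP[x xr ->]; have [/andP[]] := Hv' x xr.
have S00 : 0 <= (0:R) <= S by rewrite lexx ltW.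
have := fam_path Hv' Hw S00 p fam_zero; congr fam.
by apply/funext => u; rewrite add0r (perm_big _ pr).
Qed.

(** Positive and negative parts of the coordinates. Cones admit nonnegative weights only, so [u] is
    written as a conic combination of the axes and their opposites with Lipschitz coefficients
    ([hinge_sum]). *)
Definition hinge (jb : 'I_N * bool) (u : 'rV[R]_N) : R :=
  Num.max 0 (if jb.2 then u 0 jb.1 else - u 0 jb.1).

Definition axis (jb : 'I_N * bool) : 'rV[R]_N := if jb.2 then ev jb.1 else - ev jb.1.

Lemma hinge_lip jb u v : `|hinge jb u - hinge jb v| <= `|u - v|.
Proof.
apply: le_trans (maxr_lip _ _ _) _; have := rV_coord_le (u - v) jb.1; rewrite !mxE.
by case: jb.2 => //; rewrite -opprD normrN.
Qed.

Lemma hinge_weight jb : weight (hinge jb).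
Proof.
split.
  move=> u _ e e0; exists e => // v _; apply: le_lt_trans; exact: hinge_lip.
exists 1 => // u Ku; rewrite /hinge le_max lexx /= ge_max ler01 /=.
have /ler_normlP[h1 h2] := le_trans (rV_coord_le u jb.1) Ku.
by case: jb.2.
Qed.

Lemma hinge_sum u : \sum_jb hinge jb u *: axis jb = u.
Proof.
rewrite -(pair_bigA _ (fun j b => hinge (j, b) u *: axis (j, b))) /=.
rewrite [RHS]row_sum_delta; apply: eq_bigr => j _.
rewrite big_bool /hinge /axis /= scalerN -scalerBl; congr (_ *: _).
by rewrite !maxEle; case: ifP; case: ifP => ? ?; lra.
Qed.

(* If the tangent directions of the reachable set and of [Q] filled the whole space, a fixed point argument would produce a reachable point lying below [Q]. *)
Lemma separation (Q K2 : set 'rV[R]_N) (e : 'rV[R]_N) : boltyanski Q (xb S) K2 ->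
  (forall x kap, 0 < kap -> Reach eta0 S x -> Q (x + kap *: e) -> False) ->
  exists p, [/\ p != 0, forall s k, variation s k -> dotp p k <= 0 &
    forall k, K2 k -> 0 <= dotp p k].
Proof.
move=> [m [Cc [L [V [F [[[C0 CZ] Cconv] nV [cF FQ] [F0 HF] K2E]]]]]] noR.
have CD u v : Cc u -> Cc v -> Cc (u + v).
  move=> Cu Cv; have h : 0 <= (1 / 2 : R) <= 1 by apply/andP; split; lra.
  have := CZ 2 _ (ler0n _ _) (Cconv u v _ Cu Cv h); congr Cc.
  by rewrite scalerDr !scalerA; congr (_ + _); rewrite -[RHS]scale1r; congr (_ *: _); lra.
(* Conic combinations of variations minus directions of the approximating cone. The preimage [w] is
   recorded, not only [w *m L], because the map [F] into [Q] has to be evaluated at it. *)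
pose K := [set k | exists l : seq (R * 'rV[R]_N), exists2 w, Cc w &
   (forall x, x \in l -> variation x.1 x.2) /\ k = \sum_(x <- l) x.2 - w *m L].
have K_0 : K 0 by exists [::], 0 => //; split => //; rewrite big_nil mul0mx subrr.
have K_D u v : K u -> K v -> K (u + v).
  move=> [l [w Cw [Hl ->]]] [l' [w' Cw' [Hl' ->]]]; exists (l ++ l'), (w + w'); first exact: CD.
  split; last by rewrite big_cat /= mulmxDl opprD addrACA.
  by move=> x; rewrite mem_cat => /orP[]; [exact: Hl|exact: Hl'].
have K_Z (a : R) v : 0 <= a -> K v -> K (a *: v).
  move=> a0 [l [w Cw [Hl ->]]]; exists [seq (x.1, a *: x.2) | x <- l], (a *: w); first exact: CZ.
  split; last by rewrite big_map scalerBr scaler_sumr -scalemxAl.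
  by move=> x /mapP[y /Hl Hy ->] /=; exact: variation_scale.
have [dense|[p p0 Hp]] := cone_dense_or_separated K_0 K_D K_Z; last first.
  exists p; split => //.
    move=> s k Hk; apply: Hp; exists [:: (s, k)], 0 => //; split.
      by move=> x; rewrite inE => /eqP ->.
    by rewrite big_seq1 mul0mx subr0.
  move=> k; rewrite K2E => -[v Cv <-]; rewrite -oppr_le0 -dotpNr; apply: Hp.
  by exists [::], v => //; split => //; rewrite big_nil sub0r.
exfalso.
(* Each of the [2 N] signed axes is approximated within [d0], which adds up to an error of at most
   1/4 on the cube. *)
pose d0 : R := 1 / 8 / (N%:R + 1).
have N1 : 0 < N%:R + 1 :> R by rewrite ltr_wpDl.
have d00 : 0 < d0 by rewrite !divr_gt0.
have H jb : exists lw : seq (R * 'rV[R]_N) * 'rV[R]_m, [/\ Cc lw.2,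
    forall x, x \in lw.1 -> variation x.1 x.2 &
    `|\sum_(x <- lw.1) x.2 - lw.2 *m L - axis jb| <= d0].
  have [k [l [w Cw [Hl ->]]] Hk] := dense (axis jb) d0 d00.
  by exists (l, w).
have /choice[lw Hlw] := H.
pose ops := [seq (x, jb) | jb <- enum {: 'I_N * bool}, x <- (lw jb).1].
have Hops y : y \in ops -> variation y.1.1 y.1.2.
  by move=> /allpairsPdep[jb [x [_ xl ->]]] /=; have [_ + _] := Hlw jb; exact.
pose l u := \sum_(y <- ops) hinge y.2 u *: y.1.2.
have lE u : l u = \sum_jb hinge jb u *: \sum_(x <- (lw jb).1) x.2.
  rewrite /l /ops big_allpairs_dep big_enum /=; apply: eq_bigr => jb _.
  by rewrite scaler_sumr.
have faml : fam S l := fam_sum (st := fun y => y.1.1) (k := fun y => y.1.2)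
  (c := fun y => hinge y.2) Hops (fun y => hinge_weight y.2).
pose w u := \sum_jb hinge jb u *: (lw jb).2.
have hinge0 jb u : 0 <= hinge jb u by rewrite le_max lexx.
have Cw u : Cc (w u).
  by apply: (big_ind Cc) => // jb _; apply: CZ => //; have [] := Hlw jb.
pose Wb := \sum_jb `|(lw jb).2|.
have hinge1 jb u : cube u -> hinge jb u <= 1.
  move=> Ku; rewrite /hinge ge_max ler01 /=.
  have /ler_normlP[h1 h2] := le_trans (rV_coord_le u jb.1) Ku; by case: jb.2.
have wB u : cube u -> `|w u| <= Wb.
  move=> Ku; apply: le_trans (ler_norm_sum _ _ _) _; apply: ler_sum => jb _.
  by rewrite normrZ (ger0_norm (hinge0 _ _)) ler_piMl // hinge1.
have Wb0 : 0 <= Wb by apply: sumr_ge0.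
have near_l u : cube u -> `|l u - w u *m L - u| <= 1 / 4.
  move=> Ku; rewrite lE -{3}(hinge_sum u) /w mulmx_suml -!sumrB.
  apply: le_trans (ler_norm_sum _ _ _) _.
  apply: (@le_trans _ _ (\sum_(jb : 'I_N * bool) d0)).
    apply: ler_sum => jb _; rewrite -scalemxAl -!scalerBr normrZ (ger0_norm (hinge0 _ _)).
    by have [_ _ h] := Hlw jb; apply: le_trans h; rewrite ler_piMl // hinge1.
  rewrite sumr_const card_prod card_ord card_bool -[leLHS]mulr_natr natrM /d0.
  rewrite [leLHS](_ : _ = 1 / 4 * (N%:R / (N%:R + 1))); last by field; rewrite gt_eqF.
  by rewrite ler_piMr // ler_pdivrMr // mul1r lerDl.
have [C0' _ Hfam] := faml.
pose B := m%:R * Wb.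
have B0 : 0 <= B by rewrite mulr_ge0.
have q0 : 0 < 1 / 16 / (B + 1) :> R by rewrite !divr_gt0 // ltr_wpDl.
have [r [r0 Hr]] := HF _ q0.
have /nbhs_ballP[r2 /= r20 Hr2] := nV.
have hm : 0 < Num.min (1 / 16) eta0 by rewrite lt_min divr_gt0.
have r'0 : 0 < r / 2 by rewrite divr_gt0.
have r2'0 : 0 < r2 / 2 by rewrite divr_gt0.
have [q q00 Hq] := ev0_and (Hfam _ hm) (ev0_and (ev0_small r'0 B0) (ev0_small r2'0 Wb0)).
pose ep := q / 2.
have ep0 : 0 < ep by rewrite divr_gt0.
have [|[tau [x [ct cx Ht Hx HD HR]]] [er er2]] := Hq ep.
  by rewrite ep0 ltr_pdivrMr // mulr_natr mulr2n ltrDl.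
have tauS u : cube u -> tau u = S.
  by move=> /Ht[/andP[h1 _] h2]; apply/le_anti/andP.
have VC u : cube u -> (V `&` Cc) (ep *: w u).
  move=> Ku; split; last by apply: CZ => //; exact: ltW.
  apply: Hr2; rewrite -ball_normE /= sub0r normrN normrZ (gtr0_norm ep0).
  apply: le_lt_trans (_ : r2 / 2 < r2); last by rewrite ltr_pdivrMr // mulr_natr mulr2n ltrDl.
  by apply: le_trans er2; rewrite mulrC ler_wpM2r ?(ltW ep0) // wB.
pose y u := F (ep *: w u).
have enw u : cube u -> enorm (ep *: w u) <= B * ep.
  move=> Ku; apply: le_trans (enorm_le_norm _) _; rewrite normrZ (gtr0_norm ep0) /B -mulrA.
  by rewrite ler_wpM2l // mulrC ler_wpM2r ?(ltW ep0) // wB.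
have yD u : cube u -> `|y u - xb S - ep *: (w u *m L)| <= 1 / 16 * ep.
  move=> Ku; apply: le_trans (norm_le_enorm _) _; rewrite scalemxAl.
  apply: le_trans (Hr _ (VC u Ku) _) _.
    apply: le_lt_trans (enw u Ku) _; apply: le_lt_trans er _.
    by rewrite ltr_pdivrMr // mulr_natr mulr2n ltrDl.
  apply: (@le_trans _ _ (1 / 16 / (B + 1) * ((B + 1) * ep))).
    rewrite ler_wpM2l ?(ltW q0) //; apply: le_trans (enw u Ku) _.
    by rewrite ler_wpM2r ?(ltW ep0) // lerDl.
  by rewrite mulrA divfK // gt_eqF // ltr_wpDl.
have xD u : cube u -> `|x u - xb S - ep *: l u| <= 1 / 16 * ep.
  move=> Ku; have := HD u Ku; rewrite tauS // D_end => h; apply: le_trans h _.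
  by rewrite ler_wpM2r ?(ltW ep0) // ge_min lexx.
(* Rescaled gap between the reachable point and the point of [Q] for the same parameter. It differs
   from the identity by at most 1/8 from the two remainders and 1/4 from the approximation of the
   axes, hence by less than 1/2. *)
pose Phi u := ep^-1 *: (x u - y u).
have epn : ep != 0 by rewrite gt_eqF.
have PhiC : cont_on cube Phi.
  apply: cont_on_scale; first exact: cont_on_cst.
  apply: cont_on_add => //.
  apply: (@cont_on_comp _ _ _ _ _ setT y (fun v => - v)) => //; last first.
    by move=> v _ h h0; exists h => // v' _; rewrite -opprD normrN.
  apply: (@cont_on_comp _ _ _ _ _ (V `&` Cc) (fun u => ep *: w u) F) => //; last first.
    exact/cont_onP.
  apply: cont_on_scale; first exact: cont_on_cst.
  apply: cont_on_sum => jb; apply: cont_on_scale; first by have [] := hinge_weight jb.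
  exact: cont_on_cst.
have PhiN u : cube u -> `|Phi u - u| < 1 / 2.
  move=> Ku; rewrite (_ : Phi u - u = ep^-1 *: ((x u - xb S - ep *: l u) -
     (y u - xb S - ep *: (w u *m L))) + (l u - w u *m L - u)); last first.
    rewrite /Phi; move: (w u *m L) (l u) (x u) (y u) => w1 w2 w3 w4.
    by apply/rowP => j; rewrite !mxE; field; rewrite gt_eqF.
  apply: le_lt_trans (ler_normD _ _) _.
  have h1 : `|ep^-1 *: ((x u - xb S - ep *: l u) - (y u - xb S - ep *: (w u *m L)))| <= 1 / 8.
    rewrite normrZ ger0_norm ?invr_ge0 ?(ltW ep0) // mulrC ler_pdivrMr //.
    apply: le_trans (ler_normB _ _) _; rewrite (_ : 1 / 8 * ep = 1 / 16 * ep + 1 / 16 * ep); last by field.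
    by apply: lerD; [exact: xD|exact: yD].
  by move: h1 (near_l u Ku); lra.
(* A solution of [Phi u = - kap *: e] is a reachable point which, moved by [ep * kap] along [e],
   lies in [Q]; this is what the hypothesis excludes, and [kap] is small enough for
   [brouwer_onto]. *)
pose kap := 1 / 2 / (`|e| + 1).
have e1 : 0 < `|e| + 1 by rewrite ltr_wpDl.
have kap0 : 0 < kap by rewrite !divr_gt0.
have [|u Ku Hu] := @brouwer_onto R N Phi (- (kap *: e)) PhiC PhiN.
  rewrite normrN normrZ (gtr0_norm kap0) /kap mulrAC -mulrA ler_piMr //.
  by rewrite ler_pdivrMr // mul1r lerDl.
apply: (noR (x u) (ep * kap)); first exact: mulr_gt0.
  by have := HR u Ku; rewrite tauS //; apply: R_mono; rewrite ge_min lexx orbT.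
rewrite (_ : x u + _ = y u); first by apply: FQ; exact: VC.
have : ep *: Phi u = x u - y u by rewrite /Phi scalerA mulfV // scale1r.
rewrite Hu scalerN scalerA => h; apply/eqP; rewrite addrC -subr_eq0 -addrA -h subrr; by [].
Qed.

End Families.

(** * Trajectories, insertions and the maximum principle *)

Section System.
Context {R : realType}.
Variables N d : nat.
Variables (UU : set 'rV[R]_d) (G : 'rV[R]_N -> 'rV[R]_d -> 'rV[R]_N).

Definition measv (u : R -> 'rV[R]_d) := forall i, measurable_fun setT (fun t => u t 0 i).

(** The control is total, measurable and admissible at every time, so that shifting and
    concatenating controls raises no question about null sets or about values outside [[0, T]]. *)
Definition traj (T : R) (X : R -> 'rV[R]_N) (u : R -> 'rV[R]_d) :=
  [/\ 0 <= T, forall t, UU (u t), measv u, exists2 L, 0 <= L & lips L 0 T X &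
   exists2 E, null E & forall t, 0 < t < T -> ~ E t -> is_derive t (1:R) X (G (X t) (u t))].

Definition catf {V : Type} (T : R) (X X' : R -> V) (t : R) := if t <= T then X t else X' (t - T).

Lemma measv_cat T u u' : measv u -> measv u' -> measv (catf T u u').
Proof.
move=> mu mu' i.
rewrite (_ : (fun t => _) = fun t => if t <= T then u t 0 i else u' (t - T) 0 i); last first.
  by apply/funext => t; rewrite /catf; case: ifP.
apply: measurable_fun_ifT => //.
- exact: measurable_fun_ler.
- apply: (measurableT_comp (mu' i)); apply: measurable_funB => //; exact: measurable_id.
Qed.

Lemma traj_cat T T' X X' u u' : traj T X u -> traj T' X' u' -> X T = X' 0 ->
  traj (T + T') (catf T X X') (catf T u u').
Proof.
move=> [T0 Uu mu [L L0 lX] [E nE HE]] [T'0 Uu' mu' [L' L'0 lX'] [E' nE' HE']] XX.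
split.
- exact: addr_ge0.
- by move=> t; rewrite /catf; case: ifP.
- exact: measv_cat.
- exists (L + L'); first exact: addr_ge0.
  have main s t : 0 <= s -> s <= t -> t <= T + T' ->
      `|catf T X X' s - catf T X X' t| <= (L + L') * `|s - t|.
    move=> s0 st tT; rewrite /catf mulrDl.
    have a0 : 0 <= L * `|s - t| by rewrite mulr_ge0.
    have a0' : 0 <= L' * `|s - t| by rewrite mulr_ge0.
    case: (leP s T) => sT; case: (leP t T) => tT'.
    + by apply: ler_wpDr => //; apply: lX; apply/andP; split; lra.
    + rewrite (_ : X s - X' (t - T) = (X s - X T) + (X' 0 - X' (t - T))); last by rewrite XX addrA subrK.
      apply: le_trans (ler_normD _ _) _; apply: lerD.
        apply: le_trans (lX _ _ _ _) _; try by apply/andP; split; lra.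
        by rewrite ler_wpM2l // !ler0_norm; lra.
      apply: le_trans (lX' _ _ _ _) _; try by apply/andP; split; lra.
      by rewrite ler_wpM2l // !ler0_norm; lra.
    + by move: (lt_le_trans sT (le_trans st tT')); rewrite ltxx.
    + apply: ler_wpDl => //; rewrite (_ : s - t = (s - T) - (t - T)); last by ring.
      by apply: lX'; apply/andP; split; lra.
  move=> s t /andP[s0 sT] /andP[t0 tT]; have [st|st] := leP s t; first exact: main.
  by rewrite distrC (distrC s); apply: main => //; exact: ltW.
- exists (E `|` [set t | E' (t - T)] `|` [set T]).
    by apply: nullU; [apply: nullU => //; exact: null_shift|exact: null_set1].
  move=> t /andP[t0 tT] Et.
  have [tlT|Tt|tE] := ltgtP t T.
  + rewrite {2 3}/catf ltW //; apply: (@is_derive_eq_itv _ _ X _ 0 T) => //.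
    * by rewrite t0.
    * by move=> s /andP[_ sT]; rewrite /catf sT.
    * by apply: HE; [rewrite t0|move=> h; apply: Et; left; left].
  + rewrite {2 3}/catf leNgt Tt /=.
    apply: (@is_derive_eq_itv _ _ (fun t => X' (t - T)) _ T (T + T')) => //.
    * by rewrite Tt.
    * move=> s /andP[Ts _]; rewrite /catf; case: (leP s T) => // sT.
      by rewrite (_ : s = T) ?subrr //; apply/le_anti/andP.
    * apply: is_derive_shift_arg; apply: HE'; first by apply/andP; split; lra.
      by move=> h; apply: Et; left; right.
  + by exfalso; apply: Et; right.
Qed.

Definition arc_to (h : R) (x x' : 'rV[R]_N) := exists T X u,
  [/\ traj T X u, X 0 = x, X T = x', T <= h & forall t, 0 <= t <= T -> `|X t - x| <= h].

Lemma arc_to_refl h x u : UU u -> 0 <= h -> arc_to h x x.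
Proof.
move=> Uu h0; exists 0, (fun _ => x), (fun _ => u); split => //; last by move=> t _; rewrite subrr normr0.
split => //.
- by exists 0 => // s t _ _; rewrite subrr normr0 mul0r.
- exists set0; first exact: nullS (sub0set _) (null_set1 0).
  by move=> t /andP[t0 t0'] _; move: (lt_trans t0 t0'); rewrite ltxx.
Qed.

Lemma arc_to_cat h h' x x' x'' : arc_to h x x' -> arc_to h' x' x'' -> arc_to (h + h') x x''.
Proof.
move=> [T [X [u [tr X0 XT Th Hh]]]] [T' [X' [u' [tr' X'0 X'T T'h Hh']]]].
have T0 : 0 <= T by case: tr. have T'0 : 0 <= T' by case: tr'.
exists (T + T'), (catf T X X'), (catf T u u'); split.
- by apply: traj_cat => //; rewrite XT.
- by rewrite /catf T0.
(* In the first case [T + T' <= T], so [T' = 0] and the endpoint is read on the first arc. *)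
- rewrite /catf; case: leP => [h0|_]; last by rewrite addrC addKr.
  have T'E : T' = 0 by lra.
  by rewrite T'E addr0 XT -X'0 -X'T T'E.
- exact: lerD.
- move=> t /andP[t0 tT]; rewrite /catf; case: (leP t T) => tT'.
    apply: le_trans (Hh _ _) _; first by rewrite t0.
    have : `|X' 0 - x'| <= h' by apply: Hh'; rewrite lexx.
    by rewrite X'0 subrr normr0 => ?; rewrite lerDl.
  rewrite (_ : X' (t - T) - x = (X T - x) + (X' (t - T) - x')); last by rewrite XT [RHS]addrC addrA subrK.
  apply: le_trans (ler_normD _ _) _; apply: lerD; first by apply: Hh; rewrite T0 lexx.
  by apply: Hh'; apply/andP; split; lra.
Qed.

End System.

(** * Measurability along measurable curves *)

Section Measurability.
Context {R : realType}.

Lemma rat_approx n (x : 'rV[R]_n) (e : R) : 0 < e ->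
  exists a : 'rV[rat]_n, forall i, `|x 0 i - ratr (a 0 i)| < e.
Proof.
move=> e0.
have H i : exists a : rat, `|x 0 i - ratr a| < e.
  have /rat_in_itvoo[a] : x 0 i - e < x 0 i + e by lra.
  by rewrite in_itv /= => /andP[h1 h2]; exists a; rewrite ltr_norml; apply/andP; split; lra.
have /choice[a Ha] := H.
by exists (\row_i a i) => i; rewrite mxE.
Qed.

Lemma measurable_box n (p : R -> 'rV[R]_n) (a : 'rV[rat]_n) (r : R) : measv p ->
  measurable [set t | forall i, `|p t 0 i - ratr (a 0 i)| < r].
Proof.
move=> mp; rewrite (_ : [set t | _] = \bigcap_(i in [set: 'I_n])
    ((fun t => p t 0 i) @^-1` `]ratr (a 0 i) - r, ratr (a 0 i) + r[)).
  apply: fin_bigcap_measurable => // i _; rewrite -[X in measurable X]setTI.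
  by apply: mp => //; exact: measurable_itv.
apply/seteqP; split => t /=.
  by move=> H i _ /=; have := H i; rewrite in_itv /= ltr_norml => /andP[? ?]; apply/andP; split; lra.
by move=> H i; have := H i I; rewrite /= in_itv /= ltr_norml => /andP[? ?]; apply/andP; split; lra.
Qed.

(* Strict superlevel sets are countable unions of preimages of rational boxes. *)
Lemma measurable_cont_on_comp n d (K : set ('rV[R]_n * 'rV[R]_d)) (F : 'rV[R]_n * 'rV[R]_d -> R^o)
  (p : R -> 'rV[R]_n) (u : R -> 'rV[R]_d) : cont_on K F -> measv p -> measv u ->
  (forall t, K (p t, u t)) -> measurable_fun setT (fun t => F (p t, u t) : R).
Proof.
move=> cF mp mu Kpu _; apply: (measurability _ (RGenOInfty.measurableE R)) => //.
move=> _ [_ [y -> <-]]; rewrite setTI.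
pose box (i : 'rV[rat]_n * 'rV[rat]_d * nat) : set ('rV[R]_n * 'rV[R]_d) :=
  [set q : 'rV[R]_n * 'rV[R]_d | (forall j, `|q.1 0 j - ratr (i.1.1 0 j)| < i.2.+1%:R^-1) /\
           (forall j, `|q.2 0 j - ratr (i.1.2 0 j)| < i.2.+1%:R^-1)].
rewrite (_ : _ @^-1` _ = \bigcup_i [set t | box i (p t, u t) /\
   (forall q, K q -> box i q -> y < F q)]); last first.
  apply/seteqP; split => t /=.
    rewrite in_itv /= andbT => yF.
    have y0 : 0 < F (p t, u t) - y by rewrite subr_gt0.
    have [r r0 Hr] := cF _ (Kpu t) _ y0.
    have r2 : 0 < r / 2 by rewrite divr_gt0.
    pose k := Num.trunc (r / 2)^-1.
    have k0 : 0 < k.+1%:R^-1 :> R by rewrite invr_gt0.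
    have kr : k.+1%:R^-1 < r / 2 :> R.
      by rewrite -[ltRHS]invrK ltf_pV2 ?posrE ?invr_gt0 //; exact: truncnS_gt.
    have [a Ha] := rat_approx (p t) k0; have [b Hb] := rat_approx (u t) k0.
    exists (a, b, k) => //; split => // -[q1 q2] Kq [/= H1 H2].
    have [//|yq] := ltP y (F (q1, q2)).
    have : `|F (p t, u t) - F (q1, q2)| < F (p t, u t) - y.
      apply: Hr => //.
      have near m (x z : 'rV[R]_m) (w : 'rV[rat]_m) : (forall j, `|x 0 j - ratr (w 0 j)| < k.+1%:R^-1) ->
          (forall j, `|z 0 j - ratr (w 0 j)| < k.+1%:R^-1) -> `|x - z| < r.
        move=> Hx Hz; apply: rV_norm_lt => // j; rewrite !mxE.
        rewrite (_ : x 0 j - z 0 j = (x 0 j - ratr (w 0 j)) - (z 0 j - ratr (w 0 j))); last by ring.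
        by apply: le_lt_trans (ler_normB _ _) _; move: kr (Hx j) (Hz j); move: (k.+1%:R^-1) `|_| `|_| => a1 a2 a3; lra.
      by rewrite prod_normE /= gt_max (near _ _ _ a) // (near _ _ _ b).
    by rewrite ltr_norml => /andP[_ h]; lra.
  by move=> [i _ [bi Hi]]; rewrite in_itv /= andbT; apply: Hi.
apply: countable_bigcupT_measurable => [|i]; first exact: countableP.
have [H|H] := pselect (forall q, K q -> box i q -> y < F q).
  rewrite (_ : [set t | _] = [set t | forall j, `|p t 0 j - ratr (i.1.1 0 j)| < i.2.+1%:R^-1] `&`
     [set t | forall j, `|u t 0 j - ratr (i.1.2 0 j)| < i.2.+1%:R^-1]).
    by apply: measurableI; exact: measurable_box.
  by apply/seteqP; split => t /=; [case|move=> ?; split].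
by rewrite (_ : [set t | _] = set0) //; apply/seteqP; split => t //= [].
Qed.

Lemma measv_continuous n (c : R -> 'rV[R]_n) : continuous c -> measv c.
Proof.
move=> cc j; apply: continuous_measurable_fun => t.
apply: (@continuous_comp _ _ _ c (fun z : 'rV[R]_n => z 0 j)); first exact: cc.
exact: coord_continuous.
Qed.

End Measurability.

(** * Control systems with C1 dynamics and compact controls *)

Section SmoothSystem.
Context {R : realType}.
Variables n N d : nat.
Variables (UU : set 'rV[R]_d) (Pm : 'M[R]_(N, n)).
Variables (Fc : 'I_N -> 'rV[R]_n -> 'rV[R]_d -> R) (dF : 'I_N -> 'I_n -> 'rV[R]_n -> 'rV[R]_d -> R).
Hypothesis cU : compact UU.
Hypothesis Pn : forall x : 'rV[R]_N, `|x *m Pm| <= `|x|.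
Hypothesis cF : forall i, cont_on [set yu : 'rV[R]_n * 'rV[R]_d | UU yu.2] (fun yu => Fc i yu.1 yu.2 : R^o).
Hypothesis cdF : forall i j, cont_on [set yu : 'rV[R]_n * 'rV[R]_d | UU yu.2] (fun yu => dF i j yu.1 yu.2 : R^o).
Hypothesis derF : forall i j y u, UU u -> is_derive y (ev j) (fun y => Fc i y u : R^o) (dF i j y u).

(** The dynamics sees the state only through its projection [x *m Pm], and smoothness is assumed in
    the projected variable only. In the application the clock [y0] and the accumulated cost are the
    invisible components. *)
Definition sysG (x : 'rV[R]_N) (u : 'rV[R]_d) : 'rV[R]_N := \row_i Fc i (x *m Pm) u.
Definition sysJ (y : 'rV[R]_n) (u : 'rV[R]_d) : 'M[R]_(n, N) := \matrix_(j, i) dF i j y u.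
Definition sysA (x : 'rV[R]_N) (u : 'rV[R]_d) : 'M[R]_N := Pm *m sysJ (x *m Pm) u.

Let bK (y0 : 'rV[R]_n) r := [set y : 'rV[R]_n | `|y - y0| <= r] `*` UU.
Let bKc y0 r : compact (bK y0 r).
Proof. by apply: compact_setX => //; exact: closed_ball_compact. Qed.
Let bKs y0 r : bK y0 r `<=` [set yu : 'rV[R]_n * 'rV[R]_d | UU yu.2].
Proof. by move=> [y u] []. Qed.

Lemma bounded_on_ball (F : 'rV[R]_n -> 'rV[R]_d -> R) y0 r :
  cont_on [set yu : 'rV[R]_n * 'rV[R]_d | UU yu.2] (fun yu => F yu.1 yu.2 : R^o) ->
  exists2 M : R, 0 <= M & forall y u, `|y - y0| <= r -> UU u -> `|F y u| <= M.
Proof.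
move=> cF'; have [M M0 HM] := compact_bounded (@bKc y0 r) (cont_on_sub (@bKs y0 r) cF').
by exists M => // y u yr Uu; exact: (HM (y, u)).
Qed.

(** The sum of finitely many nonnegative bounds dominates each of them. *)
Lemma uniform_family (I : finType) (P : I -> R -> Prop) :
  (forall i M M', M <= M' -> P i M -> P i M') -> (forall i, exists2 M : R, 0 <= M & P i M) ->
  exists2 M : R, 0 <= M & forall i, P i M.
Proof.
move=> mono H; have H' i : exists M : R, 0 <= M /\ P i M by have [M ? ?] := H i; exists M.
have /choice[M HM] := H'; exists (\sum_i M i); first by apply: sumr_ge0 => i _; have [] := HM i.
move=> i; apply: (mono _ (M i)); last by have [] := HM i.
by rewrite (bigD1 i) //= lerDl sumr_ge0 // => k _; have [] := HM k.
Qed.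

Lemma sysG_bounded x0 r : exists2 M : R, 0 <= M & forall x u, `|x - x0| <= r -> UU u -> `|sysG x u| <= M.
Proof.
have [|i|M M0 HM] := @uniform_family _ (fun i M => forall y u, `|y - x0 *m Pm| <= r -> UU u -> `|Fc i y u| <= M).
- by move=> i M M' MM H y u yr Uu; apply: le_trans MM; exact: H.
- exact: bounded_on_ball.
exists M => // x u xr Uu; apply: rV_norm_le => // i; rewrite mxE; apply: HM => //.
by rewrite -mulmxBl; apply: le_trans xr.
Qed.

Lemma sysJ_bounded y0 r : exists2 M : R, 0 <= M & forall y u, `|y - y0| <= r -> UU u ->
  forall i j, `|dF i j y u| <= M.
Proof.
have [|[i j]|M M0 HM] := @uniform_family ('I_N * 'I_n)%type
   (fun ij M => forall y u, `|y - y0| <= r -> UU u -> `|dF ij.1 ij.2 y u| <= M).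
- by move=> i M M' MM H y u yr Uu; apply: le_trans MM; exact: H.
- exact: bounded_on_ball.
by exists M => // y u yr Uu i j; exact: (HM (i, j)).
Qed.

Lemma sysA_bounded x0 r : exists2 M : R, 0 <= M & forall x u, `|x - x0| <= r -> UU u -> `|sysA x u| <= M.
Proof.
have [M M0 HM] := sysJ_bounded (x0 *m Pm) r.
exists (\sum_(j < n) `|Pm| * M); first by apply: sumr_ge0 => j _; rewrite mulr_ge0.
move=> x u xr Uu; rewrite [leLHS]/Num.norm /= mx_normrE; apply: bigmax_le => [|[k i] _ /=].
  by apply: sumr_ge0 => j _; rewrite mulr_ge0.
rewrite mxE; apply: le_trans (ler_norm_sum _ _ _) _; apply: ler_sum => j _.
rewrite normrM !mxE ler_pM ?mx_entry_le // HM //.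
by rewrite -mulmxBl; apply: le_trans xr.
Qed.

Let rowF u y : 'rV[R]_N := \row_i Fc i y u.

Let derRow y u j : UU u -> is_derive y (ev j) (rowF u) (\row_i dF i j y u).
Proof.
move=> Uu; apply/is_derive_dir_coord => i; rewrite mxE.
have := derF i j y Uu; congr is_derive; apply/funext => z; by rewrite mxE.
Qed.

Lemma sysG_lip x0 r : exists2 L : R, 0 <= L & forall x x' u, `|x - x0| <= r -> `|x' - x0| <= r ->
  UU u -> `|sysG x u - sysG x' u| <= L * `|x - x'|.
Proof.
have [M M0 HM] := sysJ_bounded (x0 *m Pm) r.
exists (n%:R * M); first exact: mulr_ge0.
move=> x x' u xr x'r Uu.
pose y0 := x0 *m Pm.
have box (z : 'rV[R]_N) : `|z - x0| <= r -> forall i, (y0 - const_mx r) 0 i <= (z *m Pm) 0 i <= (y0 + const_mx r) 0 i.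
  move=> xx i; have := le_trans (rV_coord_le ((z - x0) *m Pm) i) (le_trans (Pn _) xx).
  by rewrite mulmxBl -/y0 !mxE ler_norml => /andP[? ?]; apply/andP; split; lra.
have r0 : 0 <= r by exact: le_trans xr.
have := @partials_lipschitz R n N (rowF u) (fun j y => \row_i dF i j y u) (y0 - const_mx r) (y0 + const_mx r) M M0.
move=> H; rewrite distrC (distrC x); apply: le_trans (H _ _ _ (box x xr) (box x' x'r)) _.
  move=> z Hz j; split; first exact: derRow.
  apply: rV_norm_le => // i; rewrite mxE; apply: HM => //; apply: rV_norm_le => // k.
  by have := Hz k; rewrite !mxE ler_norml => /andP[? ?]; apply/andP; split; lra.
by rewrite ler_wpM2l ?mulr_ge0 // -mulmxBl.
Qed.

Lemma sysG_lin x0 r e : 0 < e -> exists2 del : R, 0 < del & forall x x' u, `|x' - x0| <= r ->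
  UU u -> `|x - x'| <= del -> `|sysG x u - sysG x' u - (x - x') *m sysA x' u| <= e * `|x - x'|.
Proof.
move=> e0; have e1 : 0 < e / (n%:R + 1) by rewrite divr_gt0 // ltr_wpDl.
have unif ij := compact_unif (@bKc (x0 *m Pm) (r + 1)) (cont_on_sub (@bKs (x0 *m Pm) (r + 1)) (cdF ij.1 ij.2)) e1.
(* The modulus of continuity is recorded as the inverse of a bound [M], so that a common one for all
   entries is supplied by [uniform_family]. *)
have H (ij : 'I_N * 'I_n) : exists2 M : R, 0 <= M & 0 < M /\
    (forall p q, bK (x0 *m Pm) (r + 1) p -> bK (x0 *m Pm) (r + 1) q -> `|p - q| < M^-1 ->
       `|dF ij.1 ij.2 p.1 p.2 - dF ij.1 ij.2 q.1 q.2| < e / (n%:R + 1)).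
  have [del del0 Hdel] := unif ij; exists del^-1; rewrite ?invr_ge0 ?invr_gt0 ?ltW //; split => //.
  by move=> p q Kp Kq; rewrite invrK; exact: Hdel.
have [|M M0 HM] := uniform_family _ H.
  move=> ij M M' MM [M0 HM]; have M'0 := lt_le_trans M0 MM; split => // p q Kp Kq pq; apply: HM => //.
  by apply: lt_le_trans pq _; rewrite lef_pV2 ?posrE.
pose del : R := Num.min 1 ((M + 1)^-1 / 2).
have M1 : 0 < M + 1 by rewrite ltr_wpDl.
have del0 : 0 < del by rewrite lt_min ltr01 divr_gt0 // invr_gt0.
have del1 : del <= 1 by rewrite ge_min lexx.
exists del => // x x' u x'r Uu xx.
pose y := x *m Pm; pose y' := x' *m Pm; pose h := `|y - y'|.
have hx : h <= `|x - x'| by rewrite /h -mulmxBl.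
have hd : h <= del by exact: le_trans xx.
have h0 : 0 <= h by rewrite /h.
have y'r : `|y' - x0 *m Pm| <= r by rewrite -mulmxBl; apply: le_trans x'r.
have Hg (z : 'rV[R]_n) : (forall i, (y' - const_mx h) 0 i <= z 0 i <= (y' + const_mx h) 0 i) -> `|z - y'| <= h.
  move=> Hz; apply: rV_norm_le => // i.
  by have := Hz i; rewrite !mxE ler_norml => /andP[? ?]; apply/andP; split; lra.
have := @partials_lipschitz R n N (fun z => rowF u z - z *m sysJ y' u)
  (fun j z => \row_i dF i j z u - ev j *m sysJ y' u) (y' - const_mx h) (y' + const_mx h) (e / (n%:R + 1)) (ltW e1).
move=> HL; rewrite (_ : sysG x u - sysG x' u - (x - x') *m sysA x' u =
   (rowF u y - y *m sysJ y' u) - (rowF u y' - y' *m sysJ y' u)); last first.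
  rewrite /sysA mulmxA mulmxBl -/y -/y' mulmxBl /sysG -/y -/y'.
  by apply/rowP => i; rewrite !mxE; ring.
apply: le_trans (HL _ y' y _ _) _.
- move=> z /Hg Hz j; split.
    by apply: is_deriveB; [exact: derRow|exact: is_derive_mulmx].
  apply: rV_norm_le => [|i]; first exact: ltW.
  rewrite -rowE !mxE; apply: ltW.
  have [Mp Hu] := HM (i, j); apply: (Hu (z, u) (y', u)).
  + split => //=; rewrite (_ : z - x0 *m Pm = (z - y') + (y' - x0 *m Pm)); last by rewrite addrA subrK.
    by apply: le_trans (ler_normD _ _) _; move: Hz hd del1 y'r; lra.
  + by split => //=; move: y'r; lra.
  + rewrite prod_normE /= subrr normr0 gt_max invr_gt0 Mp andbT.
    apply: le_lt_trans Hz _; apply: le_lt_trans hd _.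
    apply: (@le_lt_trans _ _ ((M + 1)^-1 / 2)); first by rewrite ge_min lexx orbT.
    apply: (@lt_trans _ _ (M + 1)^-1); first by rewrite ltr_pdivrMr // ltr_pMr ?invr_gt0 //; lra.
    by rewrite ltf_pV2 ?posrE // ltrDl.
- by move=> i; rewrite !mxE; apply/andP; split; lra.
- move=> i; have := rV_coord_le (y - y') i; rewrite -/h !mxE ler_norml => /andP[? ?].
  by apply/andP; split; lra.
rewrite -/h; apply: (@le_trans _ _ (n%:R * (e / (n%:R + 1)) * `|x - x'|)).
  by rewrite ler_wpM2l // mulr_ge0 // ltW.
rewrite ler_wpM2r // mulrCA ler_piMr ?(ltW e0) // ler_pdivrMr ?mul1r ?lerDl //.
Qed.

Lemma measv_proj (c : R -> 'rV[R]_N) : continuous c -> measv (fun t => c t *m Pm).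
Proof.
move=> cc; apply: measv_continuous => t; apply: (@continuous_comp _ _ _ c (fun z : 'rV[R]_N => z *m Pm)); first exact: cc.
apply: (@lips_continuous _ _ _ 1) => x y; rewrite mul1r -mulmxBl; exact: Pn.
Qed.

Lemma sysG_measurable (c : R -> 'rV[R]_N) u : continuous c -> measv u -> (forall t, UU (u t)) ->
  measv (fun t => sysG (c t) (u t)).
Proof.
move=> cc mu Uu i; rewrite (_ : (fun t => _) = fun t => Fc i (c t *m Pm) (u t)); last first.
  by apply/funext => t; rewrite mxE.
exact: (measurable_cont_on_comp (cF i) (measv_proj cc) mu Uu).
Qed.

Lemma sysA_measurable (c : R -> 'rV[R]_N) u : continuous c -> measv u -> (forall t, UU (u t)) ->
  forall i j, measurable_fun setT (fun t => sysA (c t) (u t) i j).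
Proof.
move=> cc mu Uu i j.
rewrite (_ : (fun t => _) = fun t => \sum_k Pm i k * dF j k (c t *m Pm) (u t)); last first.
  by apply/funext => t; rewrite mxE; apply: eq_bigr => k _; rewrite mxE.
apply: measurable_sum => k; apply: measurable_funM => //.
exact: (measurable_cont_on_comp (cdF j k) (measv_proj cc) mu Uu).
Qed.

End SmoothSystem.

(** * Reachable points close to the reference *)

Section Reach.
Context {R : realType}.
Variables N d : nat.
Variables (UU : set 'rV[R]_d) (G : 'rV[R]_N -> 'rV[R]_d -> 'rV[R]_N).
Variables (S M : R) (xb : R -> 'rV[R]_N).
Hypotheses (S0 : 0 < S) (M0 : 0 <= M) (lip_xb : lips M 0 S xb).

(* [reach h tau x]: a trajectory ends at [x] while a clock running over the reference ends at [tau], the whole trajectory being [h]-close to the reference. *)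
Definition reach (h tau : R) (x : 'rV[R]_N) := exists T X u,
  [/\ traj UU G T X u, X 0 = xb 0, X T = x &
    [/\ `|T - tau| <= h, `|x - xb tau| <= h &
      forall t, 0 <= t <= T -> exists2 c, 0 <= c <= S & `|t - c| <= h /\ `|X t - xb c| <= h]].

Lemma reach_mono h h' t x : h <= h' -> reach h t x -> reach h' t x.
Proof.
move=> hh [T [X [u [tr X0 XT [Tt xt HX]]]]]; exists T, X, u; split => //; split; try exact: le_trans hh.
by move=> r /HX[c cS [h1 h2]]; exists c => //; split; exact: le_trans hh.
Qed.

Lemma reach_start h u : UU u -> 0 < h -> reach h 0 (xb 0).
Proof.
move=> Uu h0; have [T [X [v [tr X0 XT Th HX]]]] := arc_to_refl G (xb 0) Uu (lexx 0).
have T0 : 0 <= T by case: tr.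
exists T, X, v; split => //; split.
- by rewrite subr0 ger0_norm // (le_trans Th) // ltW.
- by rewrite subrr normr0 ltW.
- move=> t tT; exists 0; first by rewrite lexx ltW.
  split; last by apply: le_trans (HX t tT) _; exact: ltW.
  by case/andP: tT => t0 tT; rewrite subr0 ger0_norm //; lra.
Qed.

Lemma reach_ext h h' s t x T' X' u' : reach h' s x -> traj UU G T' X' u' -> X' 0 = x ->
  `|T' + s - t| <= h -> `|X' T' - xb t| <= h' + h -> 0 <= h ->
  (forall r, 0 <= r <= T' -> exists2 c, 0 <= c <= S & `|r + s - c| <= h /\ `|X' r - xb c| <= h' + h) ->
  reach (h' + h) t (X' T').
Proof.
move=> [T [X [u [tr X0 XT [Ts xs HX]]]]] tr' X'0 T't X't h0 HX'.
have T0 : 0 <= T by case: tr. have T'0 : 0 <= T' by case: tr'.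
exists (T + T'), (catf T X X'), (catf T u u'); split.
- by apply: traj_cat => //; rewrite XT.
- by rewrite /catf T0.
- rewrite /catf; case: leP => [h1|_]; last by rewrite addrC addKr.
  have T'E : T' = 0 by lra.
  by rewrite T'E addr0 XT -X'0.
split => //.
- rewrite (_ : T + T' - t = (T - s) + (T' + s - t)); last by ring.
  by apply: le_trans (ler_normD _ _) _; exact: lerD.
- move=> r /andP[r0 rT]; rewrite /catf; case: (leP r T) => rT'.
    have [|c cS [h1 h2]] := HX r; first by rewrite r0.
    by exists c => //; split; apply: ler_wpDr.
  have [|c cS [h1 h2]] := HX' (r - T); first by apply/andP; split; lra.
  exists c => //; split => //.
  rewrite (_ : r - c = (T - s) + (r - T + s - c)); last by ring.
  by apply: le_trans (ler_normD _ _) _; exact: lerD.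
Qed.

Lemma reach_arc h h' t x x' : 0 <= t <= S -> reach h' t x -> arc_to UU G h x x' -> reach (h' + h) t x'.
Proof.
move=> tS rx [T [X [u [tr X0 XT Th HX]]]].
have T0 : 0 <= T by case: tr.
have h0 : 0 <= h by exact: le_trans Th.
have xt : `|x - xb t| <= h' by case: rx => [? [? [? [_ _ _ []]]]].
have dev r : 0 <= r <= T -> `|X r - xb t| <= h' + h.
  move=> rT; rewrite (_ : X r - xb t = (x - xb t) + (X r - x)); last by rewrite [RHS]addrC addrA subrK.
  by apply: le_trans (ler_normD _ _) _; apply: lerD => //; exact: HX.
rewrite -XT; apply: (reach_ext rx tr X0) => //.
- by rewrite addrK ger0_norm.
- by apply: dev; rewrite T0 lexx.
- move=> r rT; exists t => //; split; last exact: dev.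
  by rewrite addrK; case/andP: rT => r0 rT; rewrite ger0_norm // (le_trans rT).
Qed.

(** The trajectory is unchanged; only the reading moves, which costs [e] in time and [M * e] in
    space. *)
Lemma reach_skip h e t x : 0 <= t -> 0 <= e -> t + e <= S -> reach h t x ->
  reach (h + (1 + M) * e) (t + e) x.
Proof.
move=> t0 e0 teS [T [X [u [tr X0 XT [Tt xt HX]]]]].
have Me : 0 <= M * e by exact: mulr_ge0.
exists T, X, u; split => //; split.
- rewrite opprD addrA; apply: le_trans (ler_normB _ _) _; rewrite (ger0_norm e0); lra.
- rewrite (_ : x - xb (t + e) = (x - xb t) + (xb t - xb (t + e))); last by rewrite addrA subrK.
  apply: le_trans (ler_normD _ _) _; apply: lerD => //.
  apply: le_trans (lip_xb _ _) _; try by apply/andP; split; lra.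
  rewrite opprD addrA subrr sub0r normrN (ger0_norm e0); lra.
- move=> r /HX[c cS [h1 h2]]; exists c => //; have : 0 <= (1 + M) * e by rewrite mulr_ge0 // addr_ge0.
  by move=> ?; split; apply: ler_wpDr.
Qed.

Variables (ub : R -> 'rV[R]_d) (eta0 KF : R) (Gam : R -> 'rV[R]_N -> 'rV[R]_N)
  (Fl : R -> 'rV[R]_N -> R -> 'rV[R]_N).
Hypotheses (Uub : forall t, UU (ub t)) (mub : measv ub) (KF0 : 0 <= KF).
Hypothesis GamE : forall t x, 0 <= t <= S -> `|x - xb t| <= eta0 -> Gam t x = G x (ub t).
Hypothesis FlP : forall a x, 0 <= a <= S -> [/\ Fl a x a = x, lips M a S (Fl a x) &
    exists2 E, null E & forall t, a < t < S -> ~ E t ->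
      is_derive t (1:R) (Fl a x) (Gam t (Fl a x t))].
Hypothesis Fl_ref : forall a x t, 0 <= a -> a <= t -> t <= S ->
  `|Fl a x t - xb t| <= KF * `|x - xb a|.

(** As long as the deviation stays below [eta0], the modified field [Gam] agrees with the true
    dynamics under [ub], so its orbit is a genuine trajectory. *)
Lemma reach_follow h h' s t x : 0 <= s -> s <= t -> t <= S -> reach h s x ->
  KF * `|x - xb s| <= h' -> h' <= eta0 -> reach (h + h') t (Fl s x t).
Proof.
move=> s0 st tS rx xh' he.
have sS : 0 <= s <= S by rewrite s0 (le_trans st).
have [Fs lF [E nE HE]] := FlP x sS.
have h'0 : 0 <= h' by apply: le_trans xh'; rewrite mulr_ge0.
have h0 : 0 <= h by case: rx => [? [? [? [_ _ _ [+ _ _]]]]]; exact: le_trans.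
have dev r : s <= r <= t -> `|Fl s x r - xb r| <= h'.
  move=> /andP[sr rt]; apply: le_trans (Fl_ref _ s0 sr (le_trans rt tS)) xh'.
have tr : traj UU G (t - s) (fun r => Fl s x (s + r)) (fun r => ub (s + r)).
  split.
  - by rewrite subr_ge0.
  - by move=> r.
  - move=> i; apply: (measurableT_comp (mub i)); apply: measurable_funD => //; exact: measurable_id.
  - exists M => // a b /andP[a0 at_] /andP[b0 bt].
    rewrite (_ : a - b = (s + a) - (s + b)); last by ring.
    by apply: lF; apply/andP; split; lra.
  - exists [set r | E (r - (- s))]; first exact: null_shift.
    move=> r /andP[r0 rt] Er; rewrite /= opprK addrC in Er.
    rewrite -GamE; [|by apply/andP; split; lra|]; last first.
      by apply: le_trans he; apply: dev; apply/andP; split; lra.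
    rewrite (_ : (fun r => Fl s x (s + r)) = fun r => Fl s x (r - (- s))); last first.
      by apply/funext => a; rewrite opprK addrC.
    apply: is_derive_shift_arg; rewrite opprK (addrC r); apply: HE => //.
    by apply/andP; split; lra.
rewrite (_ : Fl s x t = (fun r => Fl s x (s + r)) (t - s)); last by rewrite /= addrC subrK.
apply: (reach_ext rx tr) => //=.
- by rewrite addr0.
- by rewrite subrK subrr normr0.
- rewrite (addrC s) subrK; apply: ler_wpDl => //; apply: dev; by rewrite lexx andbT.
- move=> r /andP[r0 rt]; exists (s + r); first by apply/andP; split; lra.
  split; first by rewrite (addrC r) subrr normr0.
  by apply: ler_wpDl => //; apply: dev; apply/andP; split; lra.
Qed.

Lemma insertable_arcs s v (I : R -> 'rV[R]_N -> 'rV[R]_N) :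
  (forall h, 0 < h -> exists2 r, 0 < r & forall e x, 0 <= e <= r -> `|x - xb s| <= r ->
     `|I e x - x - e *: v| <= h * e /\ arc_to UU G h x (I e x)) ->
  (exists2 r, 0 < r & forall e x, 0 <= e <= r -> `|x - xb s| <= r -> forall h, 0 < h ->
    exists2 d, 0 < d & forall e' x', 0 <= e' <= r -> `|x' - xb s| <= r ->
      `|e - e'| < d -> `|x - x'| < d -> `|I e x - I e' x'| < h) ->
  insertable S xb reach s v.
Proof.
move=> H1 H2; exists I => // h h0; have [r r0 Hr] := H1 h h0; exists r => // e x h' t er xr.
have [a b] := Hr e x er xr; split => // tS rx; exact: reach_arc rx b.
Qed.

Variables (c0 : 'rV[R]_N) (r0 L : R).
Hypothesis L0 : 0 <= L.
Hypothesis bndG : forall x u, `|x - c0| <= r0 -> UU u -> `|G x u| <= M.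
Hypothesis lipG : forall x x' u, `|x - c0| <= r0 -> `|x' - c0| <= r0 -> UU u ->
  `|G x u - G x' u| <= L * `|x - x'|.
Hypothesis tube : forall t, 0 <= t <= S -> `|xb t - c0| <= r0 - 1.

(** The field is clamped to the ball around [c0] to have a global flow. The tube keeps a margin 1
    from the boundary of that ball, so short arcs issued near [xb s] do not feel the clamping. *)
Lemma insert_const s u : 0 <= s <= S -> UU u -> insertable S xb reach s (G (xb s) u).
Proof.
move=> sS Uu.
have r00 : 0 <= r0 by have := tube sS; have := normr_ge0 (xb s - c0); lra.
have [|z|phi [phi0 arc lip]] := @global_flow R N (fun x => G (clampv c0 r0 x) u) L M L0 M0.
- move=> z z'; apply: le_trans (lipG _ _ Uu) _; try exact: clampv_ball.
  by rewrite ler_wpM2l // clampv_lip.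
- by apply: bndG => //; exact: clampv_ball.
have K0 : 0 <= 2 * expR (2 * L) :> R by rewrite mulr_ge0 // expR_ge0.
have lphi x t t' : 0 <= t <= 1 -> 0 <= t' <= 1 -> `|phi t x - phi t' x| <= M * `|t - t'|.
  by move=> ? ?; have [l _] := arc x; exact: l.
have inb x t : `|x - xb s| <= 1 / 2 -> 0 <= t <= 1 -> M * t <= 1 / 2 -> `|phi t x - c0| <= r0.
  move=> xs t01 Mt.
  have h1 : `|phi t x - x| <= M * t by have := flow_arc_disp t01 (arc x); rewrite phi0.
  rewrite (_ : phi t x - c0 = (phi t x - x) + ((x - xb s) + (xb s - c0))); last by rewrite !addrA !subrK.
  apply: le_trans (ler_normD _ _) _; apply: le_trans (lerD h1 (ler_normD _ _)) _.
  by move: (tube sS); lra.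
apply: (@insertable_arcs s _ phi); last first.
  exists 1 => // e x e1 _ h h0; pose C := M + 2 * expR (2 * L) + 1.
  have C0 : 0 < C by rewrite ltr_wpDl // addr_ge0.
  exists (h / C); first exact: divr_gt0.
  move=> e' x' e'1 _ ee xx.
  rewrite (_ : phi e x - phi e' x' = (phi e x - phi e' x) + (phi e' x - phi e' x')); last by rewrite addrA subrK.
  apply: le_lt_trans (ler_normD _ _) _.
  apply: le_lt_trans (lerD (lphi _ _ _ e1 e'1) (lip _ _ _ e'1)) _.
  apply: (@le_lt_trans _ _ ((M + 2 * expR (2 * L)) * (h / C))).
    by rewrite [leRHS]mulrDl; apply: lerD; rewrite ler_wpM2l // ltW.
  by rewrite mulrCA gtr_pMr // ltr_pdivrMr // mul1r /C ltrDl.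
(* [Q] dominates 1, [M] and [L * (M + 1)], and [r] makes each of these, multiplied by [r], at most
   half of [h] and at most 1/2. *)
move=> h h0; pose Q := (L + 1) * (M + 1) + 1.
have M1 : 0 < M + 1 by rewrite ltr_wpDl.
have L1 : 0 < L + 1 by rewrite ltr_wpDl.
have Q0 : 0 < Q by rewrite ltr_wpDl // mulr_ge0 // ltW.
have Q1 : 1 <= Q by rewrite lerDr mulr_ge0 // ltW.
pose r := Num.min (h / (2 * Q)) (1 / (2 * Q)).
have Q2 : 0 < 2 * Q by rewrite mulr_gt0.
have r'0 : 0 < r by rewrite lt_min !divr_gt0.
have rh : r * (2 * Q) <= h by rewrite -ler_pdivlMr // ge_min lexx.
have r1 : r * (2 * Q) <= 1 by rewrite -ler_pdivlMr // ge_min lexx orbT.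
have rQ (a : R) : 0 <= a -> a <= Q -> a * r <= 1 / 2 /\ a * r <= h / 2.
  move=> a0 aQ; have : a * r <= Q * r by rewrite ler_wpM2r // ltW.
  have rE : r * (2 * Q) = 2 * (Q * r) by ring.
  by move: rh r1; rewrite rE => ? ? ?; split; lra.
have MQ : M <= Q.
  have h1 : 0 <= L * (M + 1) by rewrite mulr_ge0 // ltW.
  by rewrite /Q mulrDl; lra.
exists r => // e x /andP[e0 er] xr.
have [b1 b1'] := rQ _ M0 MQ.
have [b2 b2'] := rQ 1 ler01 Q1.
have e1 : e <= 1 by lra.
have Mte t : 0 <= t <= e -> M * t <= M * r by case/andP => _ te; rewrite ler_wpM2l // (le_trans te).
have inb' t : 0 <= t <= e -> `|phi t x - c0| <= r0.
  move=> /[dup] te /Mte h1; case/andP: te => t0 te; apply: inb; [lra|by apply/andP; split; lra|lra].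
have disp t : 0 <= t <= e -> `|phi t x - x| <= M * t.
  by case/andP=> t0 te; rewrite -{2}(phi0 x); apply: flow_arc_disp (arc x); apply/andP; split; lra.
have [lx [E nE HE]] := arc x.
have der t : 0 < t < e -> ~ E t -> is_derive t (1:R) (phi^~ x) (G (phi t x) u).
  move=> /andP[t0 te] Et; rewrite -(clampv_id (inb' t _)); last by apply/andP; split; lra.
  by apply: HE => //; apply/andP; split; lra.
split.
  have := @AC_mean_value R N (fun t => phi t x - t *: G (xb s) u) (fun t => h * t) 0 e E e0.
  rewrite phi0 scale0r subr0 mulr0 subr0 addrAC; apply => //.
  - apply: AConB; last by apply: lips_AC; exact: lips_linear.
    exact: lips_AC (lips_sub (lexx _) e1 lx).
  - by apply: (@lips_AC _ R^o `|h|) => a b _ _; rewrite -mulrBr normrM.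
  - move=> t te Et; exists (G (phi t x) u - G (xb s) u), h; split.
    + by apply: is_deriveB; [exact: der|exact: is_derive_linear].
    + by have := is_derive_scale h (is_derive_id t (1:R)); rewrite mulr1.
    + have te' : 0 <= t <= e by case/andP: te => ? ?; rewrite !ltW.
      apply: le_trans (lipG (inb' t te') _ Uu) _; first by have := tube sS; lra.
      apply: (@le_trans _ _ (L * ((M + 1) * r))).
        rewrite ler_wpM2l // (_ : phi t x - xb s = (phi t x - x) + (x - xb s)); last by rewrite addrA subrK.
        apply: le_trans (ler_normD _ _) _; rewrite mulrDl mul1r lerD //.
        by apply: le_trans (disp t te') (Mte t te').
      rewrite mulrA; have LQ : L * (M + 1) <= Q.
        have : L * (M + 1) <= (L + 1) * (M + 1) by rewrite ler_wpM2r ?lerDl // ltW.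
        by rewrite /Q; lra.
      by have [|_] := rQ _ _ LQ; [rewrite mulr_ge0 // ltW|lra].
exists e, (phi^~ x), (fun _ => u); split => //.
- split => //.
  + by exists M => //; exact: lips_sub (lexx _) e1 lx.
  + by exists E.
- lra.
- by move=> t te; apply: le_trans (disp t te) _; have := Mte t te; lra.
Qed.

End Reach.

(** * Roots of the duration *)

Section Roots.
Context {R : realType}.

Definition rootn (q : nat) (e : R) : R := e `^ (q%:R^-1).

Lemma rootn_ge0 q e : 0 <= rootn q e.
Proof. exact: powR_ge0. Qed.

Lemma rootnK q e : (0 < q)%N -> 0 <= e -> rootn q e ^+ q = e.
Proof.
move=> q0 e0; rewrite -powR_mulrn ?powR_ge0 // -powRrM mulVf ?powRr1 //.
by rewrite pnatr_eq0 -lt0n.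
Qed.

Lemma pow_superadditive q (a b : R) : (0 < q)%N -> 0 <= a -> 0 <= b -> a ^+ q + b ^+ q <= (a + b) ^+ q.
Proof.
case: q => // q _ a0 b0; elim: q => [|q IH]; first by rewrite !expr1.
rewrite !(exprS _ q.+1); apply: (@le_trans _ _ ((a + b) * (a ^+ q.+1 + b ^+ q.+1))).
  rewrite mulrDl !mulrDr; move: (exprn_ge0 q.+1 a0) (exprn_ge0 q.+1 b0) => h1 h2.
  have := mulr_ge0 a0 h2; have := mulr_ge0 b0 h1; lra.
by rewrite ler_wpM2l // addr_ge0.
Qed.

(** If the roots differed by at least [h], superadditivity of the [q]-th power would separate their
    powers by at least [h ^+ q]. *)
Lemma rootn_holder q (e e' h : R) : (0 < q)%N -> 0 <= e -> 0 <= e' -> 0 < h ->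
  `|e - e'| < h ^+ q -> `|rootn q e - rootn q e'| < h.
Proof.
move=> q0; wlog ee : e e' / rootn q e' <= rootn q e.
  move=> H e0 e'0 h0 eh; have [?|?] := leP (rootn q e') (rootn q e); first exact: H.
  by rewrite distrC; apply: H => //; [exact: ltW|rewrite distrC].
move=> e0 e'0 h0 eh; rewrite ger0_norm ?subr_ge0 //.
rewrite ltNge; apply/negP => hr; move: eh; apply/negP; rewrite -leNgt.
apply: le_trans (ler_norm _).
have d0 : 0 <= rootn q e - rootn q e' by rewrite subr_ge0.
have := pow_superadditive q0 d0 (rootn_ge0 q e'); rewrite subrK !rootnK // => h1.
have h2 : h ^+ q <= (rootn q e - rootn q e') ^+ q by apply: lerXn2r; rewrite ?nnegrE ?(ltW h0).
by move: h1 h2; move: (_ ^+ q) (_ ^+ q) => a b; lra.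
Qed.

End Roots.

Lemma is_derive_curve_mulmx {R : realType} n k (c : R -> 'rV[R]_n) (J : 'M[R]_(n, k)) (t : R) v :
  is_derive t (1:R) c v -> is_derive t (1:R) (fun s => c s *m J) (v *m J).
Proof.
move=> /is_derive_approx H; apply/is_derive_approx => e e0.
have K0 : 0 < n%:R * `|J| + 1 by rewrite ltr_wpDl // mulr_ge0.
have [d d0 Hd] := H _ (divr_gt0 e0 K0); exists d => // h /Hd hd.
rewrite -mulmxBl scalemxAl -mulmxBl; apply: le_trans (mulmx_norm_le _ _) _.
rewrite mulrAC; apply: le_trans (ler_wpM2l _ hd) _; first by rewrite mulr_ge0.
rewrite mulrA ler_wpM2r // mulrCA ler_piMr ?(ltW e0) // ler_pdivrMr // mul1r lerDl //.
Qed.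

(** * Insertion of words *)

Section Words.
Context {R : realType}.
Variable n : nat.
Variables (F : nat -> 'rV[R]_n -> 'rV[R]_n) (phi : nat -> bool -> R -> 'rV[R]_n -> 'rV[R]_n) (J : pred nat) (x0 : 'rV[R]_n).
Hypothesis lf : letter_flows F phi J x0.

Lemma letter_lip j b : J j -> exists r C : R, [/\ 0 < r, 0 <= C & forall t t' x x',
  0 <= t <= r -> 0 <= t' <= r -> `|x - x0| <= r -> `|x' - x0| <= r ->
  `|phi j b t x - phi j b t' x'| <= C * (`|t - t'| + `|x - x'|)].
Proof.
move=> Jj; have [CF lfl] := lf b Jj.
have CF' : isCk 1 (signed F j b) by rewrite /signed; case: (b); [exact: CF|apply: isCk1N; exact: CF].
have [L L0 LF] := C1_lipschitz CF' x0 1.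
have [r [C [/andP[r0 r1] C0 H]]] := lflow_in_ball ltr01 lfl.
have K0 : 0 <= 2 * expR (2 * L) :> R by rewrite mulr_ge0 // expR_ge0.
exists r, (C + 2 * expR (2 * L)); split => //; first exact: addr_ge0.
move=> t t' x x' tr t'r xr x'r.
have [p0 a in1] := H x xr; have [p0' a' in1'] := H x' x'r.
rewrite (_ : phi j b t x - phi j b t' x' = (phi j b t x - phi j b t' x) + (phi j b t' x - phi j b t' x'));
  last by rewrite addrA subrK.
apply: le_trans (ler_normD _ _) _; rewrite mulrDl.
have h1 : `|phi j b t x - phi j b t' x| <= C * `|t - t'| by have [l _] := a; exact: l.
have r01 : 0 <= r <= 1 by rewrite ltW.
have h2 : `|phi j b t' x - phi j b t' x'| <= 2 * expR (2 * L) * `|x - x'|.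
  have := @flow_arc_gronwall R n (signed F j b) [set z | `|z - x0| <= 1] L C C r _ _ L0 r01 _ a' a _ t' t'r.
  rewrite p0 p0'; apply.
  - by move=> z z' z1 z'1; exact: LF.
  - by move=> s sr; split; [exact: in1'|exact: in1].
apply: lerD; [apply: le_trans h1 _|apply: le_trans h2 _]; rewrite ler_wpM2l //.
  by rewrite lerDl.
by rewrite lerDr.
Qed.

Lemma wflow_lip w : all J [seq l.1 | l <- w] -> exists r C : R, [/\ 0 < r, 0 <= C & forall t t' x x',
  0 <= t <= r -> 0 <= t' <= r -> `|x - x0| <= r -> `|x' - x0| <= r ->
  `|wflow phi w t x - wflow phi w t' x'| <= C * (`|t - t'| + `|x - x'|)].
Proof.
elim: w => [_|[j b] w IH /= /andP[Jj Jw]].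
  by exists 1, 1; split => // t t' x x' _ _ _ _; rewrite mul1r lerDr.
have [r [C [r0 C0 H]]] := letter_lip b Jj; have [r' [C' [r'0 C'0 H']]] := IH Jw.
have sd : small_disp (phi j b) x0.
  by apply: (wflow_small_disp (w := [:: (j, b)]) lf); rewrite /= Jj.
have [s s0 Hs] := small_disp_ball sd r'0.
exists (Num.min s (Num.min r r')), (C' * (1 + C)); split; rewrite ?lt_min ?s0 ?r0 // ?mulr_ge0 ?addr_ge0 //.
move=> t t' x x'; rewrite !le_min => /andP[t0 /andP[ts /andP[tr tr']]] /andP[t'0 /andP[t's /andP[t'r t'r']]].
move=> /andP[xs /andP[xr xr']] /andP[x's /andP[x'r x'r']].
apply: le_trans (H' _ _ _ _ _ _ _ _) _; rewrite ?t0 ?t'0 //.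
- by apply: Hs; rewrite ?t0.
- by apply: Hs; rewrite ?t'0.
have h := H t t' x x'; rewrite t0 tr t'0 t'r in h; have {}h := h isT isT xr x'r.
rewrite -mulrA ler_wpM2l // mulrDl mul1r.
by apply: lerD => //; rewrite lerDl.
Qed.

Variables (N d : nat) (UU : set 'rV[R]_d) (G : 'rV[R]_N -> 'rV[R]_d -> 'rV[R]_N).
Variables (Pm : 'M[R]_(N, n)) (Em : 'M[R]_(n, N)).
Hypotheses (EP : Em *m Pm = 1%:M) (Pn : forall x : 'rV[R]_N, `|x *m Pm| <= `|x|)
  (En : forall y : 'rV[R]_n, `|y *m Em| <= `|y|).
Variable u0 : 'rV[R]_d.
Hypothesis UU0 : UU u0.
Hypothesis ctl : forall j b, J j -> exists2 u, UU u & forall x, G x u = signed F j b (x *m Pm) *m Em.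

(** The word acts on the projected variable, and its displacement is carried back to the full state;
    all other components stay put, in accordance with [ctl]. *)
Definition wmove (w : seq (nat * bool)) (t : R) (x : 'rV[R]_N) :=
  x + (wflow phi w t (x *m Pm) - x *m Pm) *m Em.

Lemma wmove_proj w t x : wmove w t x *m Pm = wflow phi w t (x *m Pm).
Proof. by rewrite mulmxDl -mulmxA EP mulmx1 addrC subrK. Qed.

Lemma letter_arc j b h : J j -> 0 < h -> exists2 r, 0 < r & forall t x, 0 <= t <= r ->
  `|x *m Pm - x0| <= r -> arc_to UU G h x (wmove [:: (j, b)] t x).
Proof.
move=> Jj h0; have [_ [r [C [/andP[r0 r1] C0 H]]]] := lf b Jj; have [u Uu Hu] := ctl b Jj.
have C1 : 0 < C + 1 by rewrite ltr_wpDl.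
exists (Num.min r (h / (C + 1))); first by rewrite lt_min r0 divr_gt0.
move=> t x; rewrite !le_min => /andP[t0 /andP[tr th]] /andP[xr _].
have [p0 a] := H _ xr; have [la [E nE HE]] := flow_arc_sub tr a.
have th' : (C + 1) * t <= h by rewrite mulrC -ler_pdivlMr.
have Ct : 0 <= C * t by exact: mulr_ge0.
exists t, (fun s => wmove [:: (j, b)] s x), (fun _ => u); split => //.
- split => //.
  + exists C => // s s' ss s's; rewrite /wmove opprD addrACA subrr add0r -mulmxBl.
    apply: le_trans (En _) _; rewrite /= opprB addrA subrK; exact: la.
  + exists E => // s st Es; rewrite Hu wmove_proj /=.
    rewrite (_ : (fun s => _) = fun s => (x - x *m Pm *m Em) + phi j b s (x *m Pm) *m Em); last first.
      by apply/funext => s'; rewrite /wmove /= mulmxBl addrA addrAC.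
    rewrite -[X in is_derive _ _ _ X]add0r; apply: is_deriveD.
    by apply: is_derive_curve_mulmx; exact: HE.
- by rewrite /wmove /= p0 subrr mul0mx addr0.
- by move: th'; rewrite mulrDl mul1r; lra.
- move=> s /andP[s0 st]; rewrite /wmove addrC addKr; apply: le_trans (En _) _ => /=.
  have := flow_arc_disp (t := s) _ a; rewrite p0 s0 (le_trans st tr) => /(_ isT) h1.
  apply: le_trans h1 _; apply: le_trans (ler_wpM2l C0 st) _.
  by move: th'; rewrite mulrDl mul1r; lra.
Qed.

Lemma word_arc w h : all J [seq l.1 | l <- w] -> 0 < h -> exists2 r, 0 < r & forall t x, 0 <= t <= r ->
  `|x *m Pm - x0| <= r -> arc_to UU G h x (wmove w t x).
Proof.
elim: w h => [h _ h0|[j b] w IH h /= /andP[Jj Jw] h0].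
  exists 1 => // t x _ _; rewrite /wmove /= subrr mul0mx addr0; apply: arc_to_refl UU0 _; exact: ltW.
have h2 : 0 < h / 2 by rewrite divr_gt0.
have [r r0 H] := letter_arc b Jj h2; have [r' r'0 H'] := IH _ Jw h2.
have sd : small_disp (phi j b) x0.
  by apply: (wflow_small_disp (w := [:: (j, b)]) lf); rewrite /= Jj.
have [s s0 Hs] := small_disp_ball sd r'0.
exists (Num.min s (Num.min r r')); first by rewrite !lt_min s0 r0.
move=> t x; rewrite !le_min => /andP[t0 /andP[ts /andP[tr tr']]] /andP[xs /andP[xr xr']].
rewrite (splitr h) (_ : wmove ((j, b) :: w) t x = wmove w t (wmove [:: (j, b)] t x)); last first.
  have E y : wmove w t y = y + (wflow phi w t (y *m Pm) - y *m Pm) *m Em by [].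
  rewrite E wmove_proj /wmove /= -addrA -mulmxDl; congr (_ + _ *m _).
  by rewrite [RHS]addrC addrA subrK.
apply: arc_to_cat (H t x _ xr) (H' _ _ _ _); rewrite ?t0 //.
by rewrite wmove_proj /=; apply: Hs; rewrite ?t0.
Qed.

(** The word runs for the time [rootn q e], whose [q]-th power is [e]; the Hölder modulus of the
    root gives the continuity in [e] that insertable arcs must have. *)
Lemma insert_word S M xb s (w : seq (nat * bool)) q v : lips M 0 S xb -> 0 <= s <= S -> xb s *m Pm = x0 ->
  all J [seq l.1 | l <- w] -> (0 < q)%N -> near_id0 (wflow phi w) q v x0 ->
  insertable S xb (reach UU G S xb) s (v *m Em).
Proof.
move=> lxb sS xs Jw q0 Hn.
have Pd x : `|x *m Pm - x0| <= `|x - xb s| by rewrite -xs -mulmxBl; exact: Pn.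
have [rl [C [rl0 C0 Hl]]] := wflow_lip Jw.
have sd := wflow_small_disp lf Jw.
have [rs [Cs [rs0 Cs0 Hs]]] := sd.
have small (r e : R) : 0 < r -> 0 <= e <= r ^+ q -> 0 <= rootn q e <= r.
  move=> r0 /andP[e0 er]; rewrite rootn_ge0 /= leNgt; apply/negP => rr.
  have : r ^+ q < rootn q e ^+ q by rewrite ltrXn2r -?lt0n // ltW.
  by rewrite rootnK // ltNge er.
apply: (@insertable_arcs _ _ _ UU G S xb s _ (fun e x => wmove w (rootn q e) x)).
- move=> h h0; have [ra ra0 Ha] := word_arc Jw h0; have [rn rn0 Hr] := Hn h h0.
  pose r := Num.min ra (Num.min rn rs).
  have r0 : 0 < r by rewrite !lt_min ra0 rn0.
  exists (Num.min (r ^+ q) r); first by rewrite lt_min r0 exprn_gt0.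
  move=> e x /andP[e0]; rewrite !le_min => /andP[erq _] /andP[_ /andP[xa /andP[xn xss]]].
  have /andP[t0] : 0 <= rootn q e <= r by apply: small => //; rewrite e0.
  rewrite !le_min => /andP[ta /andP[tn ts]].
  split; last by apply: Ha; [rewrite t0|exact: le_trans (Pd _) _].
  rewrite /wmove [x + _]addrC addrK scalemxAl -mulmxBl; apply: le_trans (En _) _.
  (* Time zero is treated apart because [near_id0] speaks of positive times only. *)
  have [te|te] := eqVneq (rootn q e) 0.
    have e0' : e = 0 by rewrite -(rootnK q0 e0) te expr0n gtn_eqF.
    rewrite te e0' scale0r mulr0 subr0.
    have := Hs 0 (x *m Pm); rewrite lexx (ltW rs0) mulr0; apply => //; exact: le_trans (Pd _) _.
  rewrite -{2 3}(rootnK q0 e0); apply: Hr; first by rewrite lt_neqAle eq_sym te t0.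
  exact: le_trans (Pd _) _.
- have rq0 : 0 < rl ^+ q by rewrite exprn_gt0.
  exists (Num.min (rl ^+ q) rl); first by rewrite lt_min rl0 rq0.
  move=> e x /andP[e0]; rewrite !le_min => /andP[erq _] /andP[_ xr] h h0.
  (* With [y = h / K], the Lipschitz bound of the word contributes [2 * C * y] and the two remaining
     differences less than [3 * y]; the value of [K] leaves one [y] to spare, which makes the
     inequality strict. *)
  pose K := 2 * (C + 1) + 2.
  have K0 : 0 < K by rewrite /K; lra.
  have hK : 0 < h / K by rewrite divr_gt0.
  exists (Num.min ((h / K) ^+ q) (h / K)); first by rewrite lt_min hK exprn_gt0.
  move=> e' x' /andP[e'0]; rewrite !le_min => /andP[e'rq _] /andP[_ x'r]; rewrite !lt_min.
  move=> /andP[ee _] /andP[_ xx].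
  have tt := rootn_holder q0 e0 e'0 hK ee.
  have h1 : `|wflow phi w (rootn q e) (x *m Pm) - wflow phi w (rootn q e') (x' *m Pm)| <=
      C * (`|rootn q e - rootn q e'| + `|x *m Pm - x' *m Pm|).
    by apply: Hl; [apply: small => //; rewrite e0|apply: small => //; rewrite e'0|
      exact: le_trans (Pd _) _|exact: le_trans (Pd _) _].
  have h2 : `|x *m Pm - x' *m Pm| <= `|x - x'| by rewrite -mulmxBl.
  rewrite (_ : wmove w (rootn q e) x - wmove w (rootn q e') x' = (x - x') +
     ((wflow phi w (rootn q e) (x *m Pm) - wflow phi w (rootn q e') (x' *m Pm)) - (x *m Pm - x' *m Pm)) *m Em); last first.
    rewrite /wmove opprD addrACA -mulmxBl; congr (_ + _ *m _).
    move: (wflow phi w (rootn q e) _) => y1; move: (wflow phi w (rootn q e') _) => y2; move: (x *m Pm) (x' *m Pm) => y3 y4.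
    by apply/rowP => i; rewrite !mxE; ring.
  apply: le_lt_trans (ler_normD _ _) _.
  apply: le_lt_trans (lerD (lexx _) (le_trans (En _) (ler_normB _ _))) _.
  apply: (@le_lt_trans _ _ (K * (h / K) - h / K)); last first.
    by rewrite mulrCA mulfV ?gt_eqF // mulr1 ltrBlDr ltrDl.
  have h3 : C * (`|rootn q e - rootn q e'| + `|x *m Pm - x' *m Pm|) <= C * (h / K + h / K).
    by rewrite ler_wpM2l // lerD // ltW // (le_lt_trans h2).
  have h4 := le_trans h1 h3; move: h2 h4 xx hK; move: (h / K) => y; rewrite /K.
  move: `|_ *m Pm - _| => a; move: `|wflow _ _ _ _ - _| => b; move: `|x - x'| => c h2 h4 xx y0.
  rewrite (_ : _ - y = C * (y + y) + y + y + y); last by ring.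
  by move: h4; move: (C * _) => z; lra.
Qed.

End Words.

(** * A maximum principle with insertable directions *)

Section MaximumPrinciple.
Context {R : realType}.
Variables n N d : nat.
Variables (UU : set 'rV[R]_d) (Pm : 'M[R]_(N, n)).
Variables (Fc : 'I_N -> 'rV[R]_n -> 'rV[R]_d -> R) (dF : 'I_N -> 'I_n -> 'rV[R]_n -> 'rV[R]_d -> R).
Hypothesis cU : compact UU.
Hypothesis Pn : forall x : 'rV[R]_N, `|x *m Pm| <= `|x|.
Hypothesis cF : forall i, cont_on [set yu : 'rV[R]_n * 'rV[R]_d | UU yu.2] (fun yu => Fc i yu.1 yu.2 : R^o).
Hypothesis cdF : forall i j, cont_on [set yu : 'rV[R]_n * 'rV[R]_d | UU yu.2] (fun yu => dF i j yu.1 yu.2 : R^o).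
Hypothesis derF : forall i j y u, UU u -> is_derive y (ev j) (fun y => Fc i y u : R^o) (dF i j y u).
Let G := sysG Pm Fc.

(** Stated for an arbitrary set [Q] that reachable points cannot enter after a move along [e]. The
    optimality of the reference is used only through this exclusion, and the bracket directions only
    through [insertable]. *)
Lemma maximum_principle (S Mx eta0 : R) (xb : R -> 'rV[R]_N) (ub : R -> 'rV[R]_d)
    (Q K2 : set 'rV[R]_N) (e : 'rV[R]_N) :
  0 < S -> 0 <= Mx -> 0 < eta0 <= 1 -> (forall t, UU (ub t)) -> measv ub -> lips Mx 0 S xb ->
  (exists2 E, null E & forall t, 0 < t < S -> ~ E t -> is_derive t (1:R) xb (G (xb t) (ub t))) ->
  boltyanski Q (xb S) K2 ->
  (forall x kap, 0 < kap -> reach UU G S xb eta0 S x -> Q (x + kap *: e) -> False) ->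
  exists p : R -> 'rV[R]_N, [/\ p S != 0,
    exists B, lips B 0 S p,
    exists2 E, null E & forall t, 0 < t < S -> ~ E t ->
      is_derive t (1:R) p (- (p t *m (sysA Pm dF (xb t) (ub t))^T)) /\ 0 <= dotp (p t) (G (xb t) (ub t)),
    forall s v, 0 <= s <= S -> insertable S xb (reach UU G S xb) s v -> dotp (p s) v <= 0 &
    (forall k, K2 k -> 0 <= dotp (p S) k) /\
    (forall s u, 0 <= s <= S -> UU u -> dotp (p s) (G (xb s) u) <= 0)].
Proof.
move=> S0 Mx0 /andP[eta00 eta01] Uub mub lxb [Eb nEb HEb] bol noR.
(* The reference stays within [Mx * S] of its start; the extra 1 is the margin in which, as
   [eta0 <= 1], nearby trajectories do not meet the clamping of [Gam]. *)
pose c0 := xb 0; pose r0 := Mx * S + 1.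
have tube t : 0 <= t <= S -> `|xb t - c0| <= r0 - 1.
  move=> /andP[t0 tS]; rewrite /r0 addrK; apply: le_trans (lxb _ _ _ _) _; rewrite ?lexx ?t0 ?(ltW S0) //.
  by rewrite subr0 ger0_norm // ler_wpM2l.
have r01 : 1 <= r0 by rewrite lerDr mulr_ge0 // ltW.
have r00 : 0 <= r0 by exact: le_trans r01.
have tube' t : 0 <= t <= S -> `|xb t - c0| <= r0 by move=> /tube; lra.
have [MG MG0 HMG] := sysG_bounded cU Pn cF c0 r0.
have [L L0 HL] := sysG_lip cU Pn cdF derF c0 r0.
have [MA MA0 HMA] := sysA_bounded cU Pn cdF c0 r0.
pose M := Mx + MG.
have M0 : 0 <= M by exact: addr_ge0.
have lip_xb : lips M 0 S xb.
  by move=> s t hs ht; apply: le_trans (lxb s t hs ht) _; rewrite ler_wpM2r // lerDl.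
have bndG x u : `|x - c0| <= r0 -> UU u -> `|G x u| <= M.
  by move=> hx hu; apply: le_trans (HMG x u hx hu) _; rewrite lerDr.
pose Gam t x := G (clampv c0 r0 x) (ub t).
have lipGam t x x' : `|Gam t x - Gam t x'| <= L * `|x - x'|.
  apply: le_trans (HL _ _ _ _ _ (Uub t)) _; try exact: clampv_ball.
  by rewrite ler_wpM2l // clampv_lip.
have bndGam t x : `|Gam t x| <= M by apply: bndG => //; exact: clampv_ball.
have measGam c : continuous c -> forall j, measurable_fun setT (fun t => Gam t (c t) 0 j).
  move=> cc; apply: (sysG_measurable Pn cF (c := fun t => clampv c0 r0 (c t))) => // t.
  apply: (@continuous_comp _ _ _ c (clampv c0 r0)); first exact: cc.
  by apply: (@lips_continuous _ _ _ 1) => x y; rewrite mul1r clampv_lip.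
have der_xb : exists2 E, null E & forall t, 0 < t < S -> ~ E t -> is_derive t (1:R) xb (Gam t (xb t)).
  exists Eb => // t tS Et; rewrite /Gam clampv_id; first exact: HEb.
  by apply: tube'; case/andP: tS => ? ?; rewrite !ltW.
pose xbc t := xb (clampR 0 S t).
have cxbc : continuous xbc by exact: lips_clamp_continuous (ltW S0) lip_xb.
have cin t : 0 <= clampR 0 S t <= S by exact: clampR_in (ltW S0).
pose A t := sysA Pm dF (xbc t) (ub t).
have bndA t : `|A t| <= MA by apply: HMA => //; exact: tube'.
have measA i j : measurable_fun setT (fun t => A t i j) by exact: sysA_measurable.
have xbcE t : 0 <= t <= S -> xbc t = xb t by move=> tS; rewrite /xbc clampR_id.
have linGam h : 0 < h -> exists2 del, 0 < del & forall t x, 0 <= t <= S ->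
    `|x - xb t| <= del -> `|Gam t x - Gam t (xb t) - (x - xb t) *m A t| <= h * `|x - xb t|.
  move=> h0; have [del del0 Hdel] := sysG_lin cU Pn cdF derF c0 r0 h0.
  exists (Num.min del 1); first by rewrite lt_min del0 ltr01.
  move=> t x tS; rewrite le_min => /andP[xd x1]; rewrite /Gam /A xbcE // !clampv_id //; first exact: Hdel (tube' t tS) (Uub t) xd.
    exact: tube'.
  rewrite (_ : x - c0 = (x - xb t) + (xb t - c0)); last by rewrite addrA subrK.
  by apply: le_trans (ler_normD _ _) _; move: (tube t tS); lra.
have [Fl FlP] := flow_exists S L0 M0 lipGam bndGam measGam.
have [z [B [B0 zS lip_z bnd_z der_z]]] := adjoint_exists S0 MA0 bndA measA.
pose KF := flowK S L.
have KF0 : 0 <= KF by apply: le_trans (flowK_ge1 S0 L0).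
have Flr a x t := @flow_ref R N S L M Gam xb L0 lipGam lip_xb der_xb Fl FlP a x t.
have GamE t x : 0 <= t <= S -> `|x - xb t| <= eta0 -> Gam t x = G x (ub t).
  move=> tS xt; rewrite /Gam clampv_id // (_ : x - c0 = (x - xb t) + (xb t - c0)); last by rewrite addrA subrK.
  by apply: le_trans (ler_normD _ _) _; move: (tube t tS) xt eta01; lra.
pose Rc := reach UU G S xb.
have Dcons := dco_conserved S0 L0 M0 lipGam lip_xb der_xb linGam FlP B0 lip_z bnd_z der_z.
have BD0 : 0 <= N%:R * B by exact: mulr_ge0.
have Dend v : dco z S v = v.
  apply/rowP => j; rewrite mxE zS /dotp (bigD1 j) //= !mxE !eqxx mulr1 big1 ?addr0 // => i ij.
  by rewrite mxE eqxx (negbTE ij) mulr0.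
have Dlin t a u v : dco z t (a *: u + v) = a *: dco z t u + dco z t v.
  by apply/rowP => j; rewrite !mxE dotpDl dotpZl.
have Dbnd t v : 0 <= t <= S -> `|dco z t v| <= N%:R * B * `|v| by exact: dco_norm_le.
have Dlip s t v : 0 <= s <= S -> 0 <= t <= S -> `|dco z s v - dco z t v| <= N%:R * B * `|v| * `|s - t|.
  exact: dco_lip.
have Fll a a' x x' t : 0 <= a -> 0 <= a' -> a <= t -> a' <= t -> t <= S ->
    `|Fl a x t - Fl a' x' t| <= KF * (`|x - x'| + M * `|a - a'|).
  by move=> *; apply: flow_lip.
have Rstart h : 0 < h -> Rc h 0 (xb 0) by exact: reach_start (Uub 0).
have Rmono h h' t x : h <= h' -> Rc h t x -> Rc h' t x by exact: reach_mono.
have Rskip h h' t x : 0 <= t -> 0 <= h' -> t + h' <= S -> Rc h t x -> Rc (h + (1 + M) * h') (t + h') x.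
  exact: reach_skip.
have Rfollow h h' s t x : 0 <= s -> s <= t -> t <= S -> Rc h s x -> KF * `|x - xb s| <= h' ->
    h' <= eta0 -> Rc (h + h') t (Fl s x t).
  exact: (reach_follow M0 Uub mub KF0 GamE FlP Flr).
have [q [q0 Hq HK]] : exists q, [/\ q != 0, forall s k, variation S xb (dco z) Rc s k -> dotp q k <= 0 &
    forall k, K2 k -> 0 <= dotp q k].
  by apply: (@separation R N S M KF eta0 xb (dco z) Fl Rc) bol noR.
(* The normal at time [S] carried back by the adjoint solutions, so that [dotp (p t) v] is the
   normal tested on the transport of [v]. *)
pose p t := \sum_j q 0 j *: z j t.
have pE t v : dotp (p t) v = dotp q (dco z t v).
  rewrite /p dotp_suml; apply: eq_bigr => j _; by rewrite dotpZl mxE dotpC.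
have pS : p S = q.
  by rewrite /p [RHS]row_sum_delta; apply: eq_bigr => j _; rewrite zS.
have varI s v : 0 <= s <= S -> insertable S xb Rc s v -> dotp (p s) v <= 0.
  move=> sS Iv; rewrite pE; apply: (Hq s).
  exact: (variation_insert (M := M) (BD := N%:R * B)).
exists p; split.
- by rewrite pS.
- exists (\sum_j `|q 0 j| * B) => s t sS tS; rewrite -sumrB mulr_suml.
  apply: le_trans (ler_norm_sum _ _ _) _; apply: ler_sum => j _.
  by rewrite -scalerBr normrZ -mulrA ler_wpM2l //; exact: lip_z.
- have [E nE HE] := der_z; have [E2 nE2 HE2] := der_xb.
  exists (E `|` E2); first exact: nullU.
  move=> t tS Et.
  have tS' : 0 <= t <= S by case/andP: tS => ? ?; rewrite !ltW.
  have dx := HE2 t tS (fun h => Et (or_intror h)).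
  split.
    have D j : is_derive t (1:R) (fun s => q 0 j *: z j s) (q 0 j *: - (z j t *m (A t)^T)).
      have Dz : is_derive t (1:R) (z j) (- (z j t *m (A t)^T)) by apply: HE => // h; apply: Et; left.
      by have := @is_deriveZ _ _ _ (z j) (q 0 j) t (1:R) _ Dz.
    have := is_derive_sum D; rewrite (_ : \sum_j (fun s => _) = p); last first.
      by apply/funext => s; rewrite fct_sumE.
    congr is_derive; rewrite /p mulmx_suml -sumrN; apply: eq_bigr => j _.
    by rewrite scalerN -scalemxAl /A xbcE.
  (* Skipping is a variation with direction minus the transported velocity, hence the sign; it is
     available at every time where [xb] has a derivative. *)
  rewrite pE -oppr_le0 -dotpNr; apply: (Hq t).
  apply: (variation_skip (M := M) (BD := N%:R * B)) => //.
  by have := dx; rewrite /Gam clampv_id //; exact: tube'.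
- exact: varI.
- split; first by move=> k Kk; rewrite pS; exact: HK.
  move=> s u sS Uu; apply: varI => //.
  exact: (insert_const M0 L0 bndG HL tube).
Qed.

End MaximumPrinciple.

(** * The space-time problem *)

Section LipschitzMaps.
Context {R : realType}.

Lemma cont_on_lip1 (T V : normedModType R) (K : set T) (F : T -> V) :
  (forall x y, `|F x - F y| <= `|x - y|) -> cont_on K F.
Proof. by move=> H x _ e e0; exists e => // y _; apply: le_lt_trans; exact: H. Qed.

Lemma continuous_lip1 (T V : normedModType R) (F : T -> V) :
  (forall x y, `|F x - F y| <= `|x - y|) -> continuous F.
Proof. by move=> H; apply: (@lips_continuous _ _ _ 1) => x y; rewrite mul1r. Qed.

Lemma const_mx_norm (a : R) : `|(const_mx a : 'rV[R]_1)| = `|a|.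
Proof.
apply/le_anti/andP; split.
  by apply: rV_norm_le => // j; rewrite mxE.
by have := rV_coord_le (const_mx a : 'rV[R]_1) 0; rewrite mxE.
Qed.

Lemma cont_on_row_mx (T : normedModType R) n m (K : set T) (F : T -> 'rV[R]_n) (F' : T -> 'rV[R]_m) :
  cont_on K F -> cont_on K F' -> cont_on K (fun x => row_mx (F x) (F' x)).
Proof.
move=> cF cF' x Kx e e0; have [d d0 Hd] := cF x Kx e e0; have [d' d'0 Hd'] := cF' x Kx e e0.
exists (Num.min d d'); first by rewrite lt_min d0.
move=> y Ky; rewrite lt_min => /andP[/(Hd y Ky) h /(Hd' y Ky) h'].
rewrite opp_row_mx add_row_mx; apply: rV_norm_lt => // j; rewrite mxE.
by case: fintype.splitP => k _; apply: le_lt_trans (rV_coord_le _ _) _.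
Qed.

Lemma cont_on_const_mx (T : normedModType R) (K : set T) (F : T -> R^o) :
  cont_on K F -> cont_on K (fun x => const_mx (F x) : 'rV[R]_1).
Proof.
move=> cF x Kx e /(cF x Kx)[d d0 Hd]; exists d => // y Ky /(Hd y Ky).
by rewrite (_ : const_mx _ - _ = const_mx (F x - F y)) ?const_mx_norm //; apply/rowP => j; rewrite !mxE.
Qed.

Lemma cont_on_coord (T : normedModType R) n (K : set T) (F : T -> 'rV[R]_n) j :
  cont_on K F -> cont_on K (fun x => F x 0 j : R^o).
Proof.
move=> cF x Kx e /(cF x Kx)[d d0 Hd]; exists d => // y Ky /(Hd y Ky).
by apply: le_lt_trans; have := rV_coord_le (F x - F y) j; rewrite !mxE.
Qed.

Lemma is_derive_row_mx n m m' (F : 'rV[R]_n -> 'rV[R]_m) (F' : 'rV[R]_n -> 'rV[R]_m') x v a b :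
  is_derive x v F a -> is_derive x v F' b -> is_derive x v (fun x => row_mx (F x) (F' x)) (row_mx a b).
Proof.
move=> /is_derive_dir_coord dF /is_derive_dir_coord dF'; apply/is_derive_dir_coord => j.
have [k ->|k ->] := fintype.split_ordP j.
  by rewrite row_mxEl; have := dF k; congr is_derive; apply/funext => y; rewrite row_mxEl.
by rewrite row_mxEr; have := dF' k; congr is_derive; apply/funext => y; rewrite row_mxEr.
Qed.

Lemma is_derive_const_mx n (F : 'rV[R]_n -> R) x v a : is_derive x v (F : _ -> R^o) a ->
  is_derive x v (fun x => const_mx (F x) : 'rV[R]_1) (const_mx a).
Proof.
move=> dF; apply/is_derive_dir_coord => j; rewrite mxE; have := dF; congr is_derive.
by apply/funext => y; rewrite mxE.
Qed.

End LipschitzMaps.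

(** * Controls as single vectors *)

Section Packing.
Context {R : realType}.
Variables m q : nat.

Definition pack (w0 : R) (w : 'rV[R]_m) (a : 'rV[R]_q) : 'rV[R]_((1 + m) + q) :=
  row_mx (row_mx (const_mx w0) w) a.
Definition pk_w0 (u : 'rV[R]_((1 + m) + q)) : R := (lsubmx (lsubmx u)) 0 0.
Definition pk_w (u : 'rV[R]_((1 + m) + q)) : 'rV[R]_m := rsubmx (lsubmx u).
Definition pk_a (u : 'rV[R]_((1 + m) + q)) : 'rV[R]_q := rsubmx u.

Lemma pack_w0 w0 w a : pk_w0 (pack w0 w a) = w0.
Proof. by rewrite /pk_w0 /pack !row_mxKl mxE. Qed.
Lemma pack_w w0 w a : pk_w (pack w0 w a) = w.
Proof. by rewrite /pk_w /pack row_mxKl row_mxKr. Qed.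
Lemma pack_a w0 w a : pk_a (pack w0 w a) = a.
Proof. by rewrite /pk_a /pack row_mxKr. Qed.

Lemma pk_w0_lip u v : `|pk_w0 u - pk_w0 v| <= `|u - v|.
Proof. by rewrite /pk_w0; have := rV_coord_le (u - v) (lshift q (lshift m 0)); rewrite !mxE. Qed.
Lemma pk_w_lip u v : `|pk_w u - pk_w v| <= `|u - v|.
Proof.
apply: rV_norm_le => // j; rewrite !mxE.
by have := rV_coord_le (u - v) (lshift q (rshift 1 j)); rewrite !mxE.
Qed.
Lemma pk_a_lip u v : `|pk_a u - pk_a v| <= `|u - v|.
Proof.
by apply: rV_norm_le => // j; rewrite !mxE; have := rV_coord_le (u - v) (rshift (1 + m) j); rewrite !mxE.
Qed.

Lemma pack_norm_le w0 w a r : `|w0| <= r -> `|w| <= r -> `|a| <= r -> `|pack w0 w a| <= r.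
Proof. by move=> *; do 2! apply: row_mx_norm_le => //; rewrite const_mx_norm. Qed.

Lemma packK u : pack (pk_w0 u) (pk_w u) (pk_a u) = u.
Proof.
rewrite /pack (_ : const_mx _ = lsubmx (lsubmx u)) ?hsubmxK //.
by apply/rowP => j; rewrite mxE ord1.
Qed.

End Packing.

(** * The state made of clock, position and cost *)

Section StateSplit.
Context {R : realType}.
Variable n : nat.

(** [projY] and [embY] below are the projection onto the position and the corresponding embedding;
    they are transposes of each other, which gives the adjoint equation its block form. *)
Definition state (z : 'rV[R]_(1 + n)) (c : R) : 'rV[R]_((1 + n) + 1) := row_mx z (const_mx c).
Definition projY : 'M[R]_((1 + n) + 1, n) := col_mx (col_mx 0 1%:M) 0.
Definition embY : 'M[R]_(n, (1 + n) + 1) := row_mx (row_mx 0 1%:M) 0.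

Lemma mul_projY (x : 'rV[R]_((1 + n) + 1)) : x *m projY = rsubmx (lsubmx x).
Proof.
rewrite -{1}(hsubmxK x) mul_row_col mulmx0 addr0 -{1}(hsubmxK (lsubmx x)) mul_row_col.
by rewrite mulmx0 add0r mulmx1.
Qed.

Lemma mul_embY (y : 'rV[R]_n) : y *m embY = row_mx (row_mx 0 y) 0.
Proof. by rewrite /embY !mul_mx_row !mulmx0 mulmx1. Qed.

Lemma embK : embY *m projY = 1%:M.
Proof. by rewrite /embY /projY !mul_row_col !mul0mx add0r mulmx1 addr0. Qed.

Lemma trmx_projY : projY^T = embY.
Proof. by rewrite /projY /embY !tr_col_mx !trmx0 trmx1. Qed.

Lemma projY_norm (x : 'rV[R]_((1 + n) + 1)) : `|x *m projY| <= `|x|.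
Proof.
rewrite mul_projY; apply: rV_norm_le => // j; rewrite !mxE.
exact: (rV_coord_le x (lshift 1 (rshift 1 j))).
Qed.

Lemma embY_norm (y : 'rV[R]_n) : `|y *m embY| <= `|y|.
Proof. by rewrite mul_embY; apply: row_mx_norm_le; [apply: row_mx_norm_le|]; rewrite ?normr0. Qed.

Lemma state_projY (y0 : R) (y : 'rV[R]_n) c : state (tx y0 y) c *m projY = y.
Proof. by rewrite mul_projY /state /tx row_mxKl row_mxKr. Qed.

Lemma state_split (x : 'rV[R]_((1 + n) + 1)) : x = state (tx ((lsubmx (lsubmx x)) 0 0) (rsubmx (lsubmx x))) ((rsubmx x) 0 0).
Proof.
rewrite /state /tx -[LHS]hsubmxK -{1}(hsubmxK (lsubmx x)); congr (row_mx (row_mx _ _) _).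
  by apply/rowP => j; rewrite [RHS]mxE ord1.
by apply/rowP => j; rewrite [RHS]mxE ord1.
Qed.

Lemma dotp_row_mx k l (a a' : 'rV[R]_k) (b b' : 'rV[R]_l) :
  dotp (row_mx a b) (row_mx a' b') = dotp a a' + dotp b b'.
Proof. by rewrite !dotp_mulmx tr_row_mx mul_row_col mxE. Qed.

Lemma dotp_const (a b : R) : dotp (const_mx a : 'rV[R]_1) (const_mx b) = a * b.
Proof. by rewrite /dotp big_ord1 !mxE. Qed.

Lemma dotp_state (p0 lam y0 c : R) (p y : 'rV[R]_n) :
  dotp (state (tx p0 p) lam) (state (tx y0 y) c) = p0 * y0 + dotp p y + lam * c.
Proof. by rewrite !dotp_row_mx !dotp_const. Qed.

End StateSplit.

Lemma continuous_enorm {R : realType} N : continuous (fun w : 'rV[R]_N => enorm w : R^o).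
Proof.
have cd : continuous (fun w : 'rV[R]_N => dotp w w : R^o).
  rewrite (_ : (fun w => _) = \sum_i (fun w : 'rV[R]_N => w 0 i * w 0 i : R^o)); last first.
    by apply/funext => w; rewrite fct_sumE.
  apply: (big_ind (fun h : 'rV[R]_N -> R^o => continuous h)) => [|g h|i _].
  - exact: cst_continuous.
  - exact: continuous_addv.
  have c1 : continuous (fun z : 'rV[R]_N => z 0 i : R^o).
    by apply: continuous_lip1 => x y; have := rV_coord_le (x - y) i; rewrite !mxE.
  exact: (continuous_mulv c1 c1).
move=> w; apply: (@continuous_comp _ _ _ (fun w : 'rV[R]_N => dotp w w) Num.sqrt); first exact: cd.
exact: sqrt_continuous.
Qed.

(** * The normalized control set and the velocity field *)

Section ControlSystem.
Context {R : realType}.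
Variables n m1 m2 q : nat.
Notation m := (m1 + m2)%N.
Variables (A : set 'rV[R]_q) (C1 : set 'rV[R]_m1) (C2 : set 'rV[R]_m2).
Variables (f : 'rV[R]_n -> 'rV[R]_q -> 'rV[R]_n) (g : 'I_m -> 'rV[R]_n -> 'rV[R]_n).
Variables (l0 : 'rV[R]_n -> 'rV[R]_q -> R) (hl1 : 'rV[R]_n -> R -> 'rV[R]_m -> R).
Hypotheses (cA : compact A) (clC1 : closed C1) (clC2 : closed C2).
Hypothesis hf : cont_xpartials A f.
Hypothesis hg : forall i, isCk 1 (g i).
Hypothesis hl0 : cont_xpartials A l0.
Hypothesis hhl : cont_xpartials [set u : R * 'rV[R]_m | 0 <= u.1 /\ Cset C1 C2 u.2]
    (fun x u => hl1 x u.1 u.2).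

Definition ctrl : set 'rV[R]_((1 + m) + q) := [set u | [/\ 0 <= pk_w0 u, Cset C1 C2 (pk_w u), A (pk_a u) &
  pk_w0 u + enorm (pk_w u) = 1]].

Lemma compact_ctrl : compact ctrl.
Proof.
have [B B0 HB] := compact_bounded cA (F := id) (cont_on_lip1 (fun x y => lexx _)).
apply: bounded_closed_compact.
  exists (1 + B); split; first exact: num_real.
  move=> r Br u [w00 Cw Aa w1]; rewrite -[u]packK; apply: le_trans (ltW Br).
  have e0 : 0 <= enorm (pk_w u) by exact: sqrtr_ge0.
  apply: pack_norm_le.
  - by rewrite ger0_norm //; lra.
  - by apply: le_trans (norm_le_enorm _) _; lra.
  - by apply: le_trans (HB _ Aa) _; lra.
rewrite (_ : ctrl = (@pk_w0 R m q @^-1` [set r | 0 <= r]) `&` ((lsubmx \o @pk_w R m q) @^-1` C1) `&`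
   ((rsubmx \o @pk_w R m q) @^-1` C2) `&` (@pk_a R m q @^-1` A) `&`
   ((fun u => pk_w0 u + enorm (pk_w u)) @^-1` [set 1])); last first.
  by apply/seteqP; split => u; [move=> [? [? ?] ? ?]; do 4! split => //|move=> [[[[? ?] ?] ?] ?]; split => //; split].
have c0 : continuous (@pk_w0 R m q : _ -> R^o) by apply: continuous_lip1; exact: pk_w0_lip.
have cw : continuous (@pk_w R m q) by apply: continuous_lip1; exact: pk_w_lip.
apply: closedI; [apply: closedI; [apply: closedI; [apply: closedI|]|]|].
- by apply: closed_comp => [u _|]; [exact: c0|exact: closed_ge].
- apply: closed_comp => [u _|//]; apply: continuous_lip1 => x y.
  apply: le_trans (pk_w_lip x y); apply: rV_norm_le => // j.
  by rewrite !mxE; have := rV_coord_le (pk_w x - pk_w y) (lshift m2 j); rewrite !mxE.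
- apply: closed_comp => [u _|//]; apply: continuous_lip1 => x y.
  apply: le_trans (pk_w_lip x y); apply: rV_norm_le => // j.
  by rewrite !mxE; have := rV_coord_le (pk_w x - pk_w y) (rshift m1 j); rewrite !mxE.
- apply: closed_comp => [u _|]; first by apply: continuous_lip1; exact: pk_a_lip.
  by apply: compact_closed => //; exact: norm_hausdorff.
- apply: closed_comp => [u _|]; last exact: closed_eq.
  apply: (@continuous_addv R _ R^o _ _ c0) => v.
  apply: (@continuous_comp _ _ _ (@pk_w R m q) (fun w => enorm w)); first exact: cw.
  exact: continuous_enorm.
Qed.

Definition velocity (y : 'rV[R]_n) (u : 'rV[R]_((1 + m) + q)) : 'rV[R]_((1 + n) + 1) :=
  state (tx (pk_w0 u) (dyn f g y (pk_w0 u) (pk_w u) (pk_a u)))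
        (le_cost l0 hl1 y (pk_w0 u) (pk_w u) (pk_a u)).

Definition dvel (j : 'I_n) (y : 'rV[R]_n) (u : 'rV[R]_((1 + m) + q)) : 'rV[R]_((1 + n) + 1) :=
  state (tx 0 (pk_w0 u *: derive (f^~ (pk_a u)) y (ev j) + \sum_(i < m) pk_w u 0 i *: derive (g i) y (ev j)))
        (derive (l0^~ (pk_a u)) y (ev j) * pk_w0 u + derive (fun y => hl1 y (pk_w0 u) (pk_w u)) y (ev j)).

Let KK := [set yu : 'rV[R]_n * 'rV[R]_((1 + m) + q) | ctrl yu.2].

Let c_w0 : cont_on KK (fun yu => pk_w0 yu.2 : R^o).
Proof.
apply: cont_on_lip1 => x y; apply: le_trans (pk_w0_lip _ _) _.
by rewrite prod_normE /= le_max lexx orbT.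
Qed.

Let c_w i : cont_on KK (fun yu => pk_w yu.2 0 i : R^o).
Proof.
apply: cont_on_lip1 => x y; apply: (@le_trans _ _ `|pk_w x.2 - pk_w y.2|).
  by have := rV_coord_le (pk_w x.2 - pk_w y.2) i; rewrite !mxE.
by apply: le_trans (pk_w_lip _ _) _; rewrite prod_normE /= le_max lexx orbT.
Qed.

Let c_a (V : normedModType R) (F : 'rV[R]_n -> 'rV[R]_q -> V) :
  {within [set xa : 'rV[R]_n * 'rV[R]_q | A xa.2], continuous (fun xa => F xa.1 xa.2)} ->
  cont_on KK (fun yu => F yu.1 (pk_a yu.2)).
Proof.
move=> /cont_onP cF.
apply: (@cont_on_comp _ _ _ _ _ _ (fun yu : 'rV[R]_n * 'rV[R]_((1 + m) + q) => (yu.1, pk_a yu.2)) (fun xa => F xa.1 xa.2) _ _ cF).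
  apply: cont_on_lip1 => x y; rewrite !prod_normE /= ge_max; apply/andP; split.
    by rewrite le_max lexx.
  by apply: le_trans (pk_a_lip _ _) _; rewrite le_max lexx orbT.
by move=> yu [].
Qed.

Let c_l (F : 'rV[R]_n -> R * 'rV[R]_m -> R^o) :
  {within [set xa : 'rV[R]_n * (R * 'rV[R]_m) | 0 <= xa.2.1 /\ Cset C1 C2 xa.2.2], continuous (fun xa => F xa.1 xa.2)} ->
  cont_on KK (fun yu => F yu.1 (pk_w0 yu.2, pk_w yu.2)).
Proof.
move=> cF; have {}cF := (@cont_onP R ('rV[R]_n * (R^o * 'rV[R]_m))%type R^o _ _).1 cF.
apply: (@cont_on_comp _ _ _ _ _ _ (fun yu : 'rV[R]_n * 'rV[R]_((1 + m) + q) =>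
   (yu.1, (pk_w0 yu.2, pk_w yu.2)) : 'rV[R]_n * (R^o * 'rV[R]_m)) (fun xa => F xa.1 xa.2) _ _ cF).
  apply: cont_on_lip1 => x y; rewrite !prod_normE /= !ge_max; apply/and3P; split.
  - by rewrite le_max lexx.
  - by apply: le_trans (pk_w0_lip _ _) _; rewrite le_max lexx orbT.
  - by apply: le_trans (pk_w_lip _ _) _; rewrite le_max lexx orbT.
by move=> yu [].
Qed.

Let c_x (V : normedModType R) (F : 'rV[R]_n -> V) : continuous F -> cont_on KK (fun yu => F yu.1).
Proof.
move=> cF; apply: (@cont_on_comp _ _ _ _ _ setT fst F) => //; last exact: continuous_cont_on.
by apply: cont_on_lip1 => x y; rewrite prod_normE /= le_max lexx.
Qed.

Lemma cont_vel : cont_on KK (fun yu => velocity yu.1 yu.2).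
Proof.
apply: cont_on_row_mx; [apply: cont_on_row_mx; first exact: cont_on_const_mx|].
  apply: cont_on_add; first by apply: cont_on_scale => //; apply: c_a; exact: hf.1.
  by apply: cont_on_sum => i; apply: cont_on_scale => //; apply: c_x; have [] := hg i.
apply: cont_on_const_mx; apply: (@cont_on_add _ _ R^o); last exact: (c_l hhl.1).
rewrite (_ : (fun yu => _) = fun yu => pk_w0 yu.2 *: (l0 yu.1 (pk_a yu.2) : R^o)); last first.
  by apply/funext => yu; rewrite /GRing.scale /= mulrC.
by apply: cont_on_scale => //; apply: (c_a (V := R^o)); exact: hl0.1.
Qed.

Lemma cont_dvel j : cont_on KK (fun yu => dvel j yu.1 yu.2).
Proof.
apply: cont_on_row_mx; [apply: cont_on_row_mx; first exact: cont_on_cst|].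
  apply: cont_on_add.
    by apply: cont_on_scale => //; apply: (c_a (F := fun x a => derive (f^~ a) x (ev j))); have [] := hf.2 j.
  apply: cont_on_sum => i; apply: cont_on_scale => //; apply: (c_x (F := fun x => derive (g i) x (ev j))).
  by have [_ /(_ j)[_ []]] := hg i.
apply: cont_on_const_mx; apply: (@cont_on_add _ _ R^o); last first.
  exact: (c_l (F := fun x u => derive (fun y => hl1 y u.1 u.2) x (ev j)) (hhl.2 j).2).
rewrite (_ : (fun yu => _) = fun yu => pk_w0 yu.2 *: (derive (l0^~ (pk_a yu.2)) yu.1 (ev j) : R^o)); last first.
  by apply/funext => yu; rewrite /GRing.scale /= mulrC.
by apply: cont_on_scale => //; apply: (c_a (V := R^o) (F := fun x a => derive (l0^~ a) x (ev j))); have [] := hl0.2 j.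
Qed.

Lemma is_derive_vel j y u : ctrl u -> is_derive y (ev j) (velocity^~ u) (dvel j y u).
Proof.
move=> [w00 Cw Aa _]; apply: is_derive_row_mx; first apply: is_derive_row_mx.
- apply: is_deriveD.
    by apply: is_deriveZ; apply/derivableP; exact: (hf.2 j).1.
  rewrite (_ : (fun x => \sum_i _) = \sum_i (fun x => pk_w u 0 i *: g i x)); last first.
    by apply/funext => x; rewrite fct_sumE.
  by apply: is_derive_sum => i; apply: is_deriveZ; exact: isCk_is_derive (hg i).
- apply: is_derive_const_mx; apply: (@is_deriveD _ _ R^o).
    rewrite (_ : (fun y => _) = fun y => pk_w0 u *: (l0 y (pk_a u) : R^o)); last first.
      by apply/funext => x; rewrite /GRing.scale /= mulrC.
    rewrite mulrC; apply: (@is_deriveZ _ _ R^o); apply/derivableP; exact: (hl0.2 j).1.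
  by apply/derivableP; exact: ((hhl.2 j).1 y (pk_w0 u, pk_w u)).
Qed.

Lemma sysG_vel x u : sysG (@projY R n) (fun i y u => velocity y u 0 i) x u = velocity (x *m @projY R n) u.
Proof. by apply/rowP => i; rewrite mxE. Qed.

End ControlSystem.

(** * Approximating cone of the improving states *)

Section LiftedCone.
Context {R : realType}.

(** Approximating cones are defined with the Euclidean norm, whereas all the estimates here use the
    sup norm; equivalence of norms makes the two remainders the same notion. *)
Lemma littleo_enorm M N (D : set 'rV[R]_M) (E : 'rV[R]_M -> 'rV[R]_N) :
  (forall e : R, 0 < e -> exists d : R, 0 < d /\ forall v, D v -> enorm v < d -> enorm (E v) <= e * enorm v) <->
  (forall e : R, 0 < e -> exists d : R, 0 < d /\ forall v, D v -> `|v| < d -> `|E v| <= e * `|v|).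
Proof.
have pos k : 0 < k%:R + 1 :> R by rewrite ltr_wpDl.
have enM (v : 'rV[R]_M) : enorm v <= (M%:R + 1) * `|v|.
  by apply: le_trans (enorm_le_norm _) _; rewrite ler_wpM2r // lerDl.
split => H e e0.
  have [d [d0 Hd]] := H _ (divr_gt0 e0 (pos M)).
  exists (d / (M%:R + 1)); split; first exact: divr_gt0.
  move=> v Dv; rewrite ltr_pdivlMr // mulrC => vd.
  apply: le_trans (norm_le_enorm _) _; apply: le_trans (Hd v Dv (le_lt_trans (enM v) vd)) _.
  rewrite mulrAC ler_pdivrMr // -mulrA ler_wpM2l ?(ltW e0) // mulrC; exact: enM.
have [d [d0 Hd]] := H _ (divr_gt0 e0 (pos N)).
exists d; split => // v Dv vd; apply: le_trans (enorm_le_norm _) _.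
apply: (@le_trans _ _ ((N%:R + 1) * `|E v|)); first by rewrite ler_wpM2r // lerDl.
rewrite mulrC -ler_pdivlMr //; apply: le_trans (Hd v Dv (le_lt_trans (norm_le_enorm _) vd)) _.
rewrite mulrAC ler_wpM2r ?invr_ge0 ?(ltW (pos N)) // ler_wpM2l ?(ltW e0) //; exact: norm_le_enorm.
Qed.

Variables (n : nat) (Targ Gam : set 'rV[R]_(1 + n)) (Psi : 'rV[R]_(1 + n) -> R).
Variables (zb : 'rV[R]_(1 + n)) (cb : R).
Hypothesis CPsi : isCk 1 (Psi : _ -> R^o).

Definition better : set 'rV[R]_((1 + n) + 1) :=
  [set x | Targ (lsubmx x) /\ Psi (lsubmx x) + (rsubmx x) 0 0 <= Psi zb + cb].

(** The last component is the first-order change of cost that offsets the change of [Psi] along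
    [gam], diminished by a slack [r]; the slack later yields the sign of the cost multiplier. *)
Definition better_cone : set 'rV[R]_((1 + n) + 1) :=
  [set k | exists gam r, [/\ Gam gam, 0 <= r & k = state gam (- dotp gam (grad Psi zb) - r)]].

Let Psi1 (z : 'rV[R]_(1 + n)) : 'rV[R]_1 := const_mx (Psi z).
Let CPsi1 : isCk 1 Psi1.
Proof.
apply/isCk_coordP => j; rewrite (_ : (fun x => _) = (Psi : _ -> R^o)) //.
by apply/funext => x; rewrite mxE.
Qed.

Let jacE w : w *m jac Psi1 zb = const_mx (dotp w (grad Psi zb)).
Proof.
apply/rowP => j; rewrite !mxE; apply: eq_bigr => i _; rewrite !mxE; congr (_ * _).
have := is_derive_const_mx (isCk_is_derive zb i CPsi) => /(@derive_val _ _ _ _ _ _ _) ->.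
by rewrite mxE.
Qed.

(** The parameter gains a coordinate [r >= 0]. Over the point [F v] of the target the cost is set to
    the value that equals the reference total, minus [r]; the chain rule for [Psi] gives the linear
    part. *)
Lemma boltyanski_lift : boltyanski Targ zb Gam -> boltyanski better (state zb cb) better_cone.
Proof.
move=> [M [Cc [L [V [F [[[C0 CZ] Cconv] nV [cF FT] [F0 HF] GE]]]]]].
pose J := jac Psi1 zb.
exists (M + 1)%N, [set v | Cc (lsubmx v) /\ 0 <= (rsubmx v) 0 0],
  (col_mx (row_mx L (- (L *m J))) (row_mx 0 (- 1%:M))), [set v | V (lsubmx v)],
  (fun v => state (F (lsubmx v)) (cb + Psi zb - Psi (F (lsubmx v)) - (rsubmx v) 0 0)).
have LE (v : 'rV[R]_(M + 1)) : v *m col_mx (row_mx L (- (L *m J))) (row_mx 0 (- 1%:M)) =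
    state (lsubmx v *m L) (- dotp (lsubmx v *m L) (grad Psi zb) - (rsubmx v) 0 0).
  rewrite -{1}(hsubmxK v) mul_row_col !mul_mx_row mulmx0 add_row_mx addr0; congr row_mx.
  rewrite !mulmxN mulmx1 mulmxA jacE; apply/rowP => j; rewrite !mxE ord1; congr (_ - v _ _); exact: val_inj.
have l0 : lsubmx (0 : 'rV[R]_(M + 1)) = 0 by apply/rowP => j; rewrite !mxE.
have r0 : (rsubmx (0 : 'rV[R]_(M + 1))) 0 0 = 0 by rewrite !mxE.
have Fl0 : F (lsubmx (0 : 'rV[R]_(M + 1))) = zb by rewrite l0.
split.
- split; first split.
  + by rewrite /= l0 r0.
  + move=> t v t0 [Cv rv]; split; last by rewrite !mxE mulr_ge0 //; move: rv; rewrite !mxE.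
    rewrite (_ : lsubmx _ = t *: lsubmx v); first exact: CZ.
    by apply/rowP => j; rewrite !mxE.
  + move=> u v t [Cu ru] [Cv rv] t01; split.
      rewrite (_ : lsubmx _ = (1 - t) *: lsubmx u + t *: lsubmx v); first exact: Cconv.
      by apply/rowP => j; rewrite !mxE.
    move: ru rv; rewrite !mxE => ru rv; case/andP: t01 => t0 t1.
    by rewrite addr_ge0 // mulr_ge0 // subr_ge0.
- have cl : {for (0 : 'rV[R]_(M + 1)), continuous (@lsubmx R 1 M 1)}.
    apply: (@continuous_lip1 R) => x y; apply: le_trans (lsubmx_norm_le _).
    by apply: rV_norm_le => // j; have := rV_coord_le (lsubmx (x - y)) j; rewrite !mxE.
  by apply: cl; rewrite l0.
- split.
    apply/cont_onP.
    have cl : cont_on ([set v | V (lsubmx v)] `&` [set v : 'rV[R]_(M + 1) | Cc (lsubmx v) /\ 0 <= (rsubmx v) 0 0])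
        (fun v => F (lsubmx v)).
      apply: (@cont_on_comp _ _ _ _ _ (V `&` Cc) (fun v => lsubmx v) F).
      + apply: cont_on_lip1 => x y; apply: le_trans (lsubmx_norm_le _).
        by apply: rV_norm_le => // j; have := rV_coord_le (lsubmx (x - y)) j; rewrite !mxE.
      + by move=> v [Vv [Cv _]].
      + exact/cont_onP.
    apply: cont_on_row_mx => //; apply: cont_on_const_mx.
    rewrite (_ : (fun v => _) = fun v => (cb + Psi zb : R^o) + (-1) *: (Psi (F (lsubmx v)) + (rsubmx v) 0 0 : R^o)); last first.
      by apply/funext => v; rewrite /GRing.scale /= mulN1r opprD addrA.
    apply: cont_on_add; first exact: cont_on_cst.
    apply: cont_on_scale; first exact: cont_on_cst.
    apply: (@cont_on_add _ _ R^o).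
      apply: (@cont_on_comp _ _ _ _ _ setT (fun v => F (lsubmx v)) Psi) => //.
      by apply: continuous_cont_on; have [] := CPsi.
    apply: cont_on_lip1 => x y; apply: le_trans (rsubmx_norm_le _).
    by have := rV_coord_le (rsubmx (x - y)) 0; rewrite !mxE.
  move=> v [Vv [Cv rv]]; split; rewrite /state row_mxKl ?row_mxKr; first exact: FT.
  by rewrite [const_mx _ 0 0]mxE; move: rv; lra.
- split; first by rewrite Fl0 r0 subr0 addrK.
  apply/littleo_enorm => e e0; move/littleo_enorm: HF => HF.
  pose Q := ((1 + n)%:R * `|J| + 1).
  have Q0 : 0 < Q by rewrite ltr_wpDl // mulr_ge0.
  pose B := M%:R * `|L| + 1.
  have B0 : 0 <= M%:R * `|L| by rewrite mulr_ge0.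
  have e2 : 0 < e / 2 by rewrite divr_gt0.
  have h1 : 0 < Num.min 1 (e / 2 / Q) by rewrite lt_min ltr01 divr_gt0.
  have [d [d0 Hd]] := HF _ h1.
  have B10 : 0 < B by rewrite ltr_wpDl.
  have [rho rho0 Hrho] := C1_unif_diff CPsi1 zb 0 (divr_gt0 e2 B10).
  exists (Num.min d (rho / B)); split; first by rewrite lt_min d0 divr_gt0.
  move=> v [Vv [Cv rv]]; rewrite lt_min => /andP[vd vrho].
  set v1 := lsubmx v; have v1v : `|v1| <= `|v| := lsubmx_norm_le v.
  have E1 := Hd v1 (conj Vv Cv) (le_lt_trans v1v vd).
  have E1' : `|F v1 - zb - v1 *m L| <= `|v|.
    apply: le_trans E1 _; apply: le_trans (_ : 1 * `|v1| <= _); last by rewrite mul1r.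
    by rewrite ler_wpM2r // ge_min lexx.
  have E2 : `|F v1 - zb - v1 *m L| <= e / 2 / Q * `|v|.
    apply: le_trans E1 _; apply: ler_pM => //; first exact: ltW.
    by rewrite ge_min lexx orbT.
  have E3 : `|F v1 - zb| <= B * `|v|.
    rewrite -[F v1 - zb](addrNK (v1 *m L)) /B mulrDl mul1r addrC; apply: le_trans (ler_normD _ _) _.
    apply: lerD => //; apply: le_trans (mulmx_norm_le _ _) _.
    by rewrite mulrAC ler_wpM2l.
  have E4 : `|F v1 - zb| <= rho.
    by apply: le_trans E3 _; rewrite mulrC -ler_pdivlMr // ltW.
  have E5 : `|Psi1 (F v1) - Psi1 zb - (F v1 - zb) *m J| <= e / 2 * `|v|.
    apply: le_trans (Hrho zb (F v1) _ E4) _; first by rewrite subrr normr0.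
    apply: le_trans (ler_wpM2l (ltW (divr_gt0 e2 B10)) E3) _.
    by rewrite mulrA divfK // gt_eqF.
  rewrite LE -/v1 /state opp_row_mx add_row_mx opp_row_mx add_row_mx.
  apply: row_mx_norm_le.
    apply: le_trans E2 _; rewrite ler_wpM2r // ler_pdivrMr //.
    have Q1 : 1 <= Q by rewrite lerDr mulr_ge0.
    by apply: (@le_trans _ _ (e * 1)); [lra|rewrite ler_wpM2l // ltW].
  rewrite (_ : _ + _ = - (Psi1 (F v1) - Psi1 zb - (F v1 - zb) *m J) - (F v1 - zb - v1 *m L) *m J); last first.
    rewrite (mulmxBl (F v1 - zb)) !jacE; apply/rowP => j; rewrite !mxE; move: (v _ _) => a.
    by move: (dotp _ _) (dotp _ _) => b c; ring.
  apply: le_trans (ler_normB _ _) _; rewrite normrN [X in _ <= X * _]splitr mulrDl; apply: lerD => //.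
  apply: le_trans (mulmx_norm_le _ _) _.
  apply: (@le_trans _ _ (Q * `|F v1 - zb - v1 *m L|)).
    by rewrite mulrAC ler_wpM2r // lerDl.
  by rewrite mulrC -ler_pdivlMr // mulrAC.
- apply/seteqP; split => k.
    move=> [gam [r [Gg rr ->]]]; move: Gg; rewrite GE => -[v Cv <-].
    exists (row_mx v (const_mx r)); first by rewrite /= row_mxKl row_mxKr mxE.
    by rewrite LE row_mxKl row_mxKr mxE.
  move=> [v [Cv rv] <-]; exists (lsubmx v *m L), ((rsubmx v) 0 0); split => //.
  by rewrite GE; exists (lsubmx v).
Qed.

End LiftedCone.

(** * Null sets, product curves and extension of measurable data *)

Section Curves.
Context {R : realType}.
Local Notation mu := (@lebesgue_measure R).

Lemma not_null_itv (E : set R) (a b : R) : null E -> a < b -> exists2 t, a < t < b & ~ E t.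
Proof.
move=> [B [mB B0 EB]] ab; have [[t tab Et]|H] := pselect (exists2 t, a < t < b & ~ E t); first by exists t.
exfalso; have sub : `]a, b[%classic `<=` B.
  move=> t /=; rewrite in_itv /= => tab; apply: EB; apply: contrapT => Et; apply: H; by exists t.
have : (mu `]a, b[%classic <= mu B)%E by apply: le_measure; rewrite ?inE.
rewrite B0 lebesgue_measure_itv /= lte_fin ab -EFinB lee_fin; lra.
Qed.

Lemma ae_null (P : R -> Prop) : ae_R P -> exists N : set R,
  [/\ measurable N, mu N = 0%E & forall s, ~ N s -> P s].
Proof.
move=> [N [mN N0 PN]]; exists N; split => // s Ns; apply: contrapT => Ps; exact: Ns (PN s Ps).
Qed.

Lemma null_of (N : set R) : measurable N -> mu N = 0%E -> null N.
Proof. by move=> mN N0; exists N; split. Qed.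

Lemma ACon_row_mx n m a b (F : R -> 'rV[R]_n) (F' : R -> 'rV[R]_m) :
  ACon a b F -> ACon a b F' -> ACon a b (fun t => row_mx (F t) (F' t)).
Proof.
move=> aF aF' e e0; have e2 : 0 < e / 2 by rewrite divr_gt0.
have [d [d0 Hd]] := aF _ e2; have [d' [d'0 Hd']] := aF' _ e2.
exists (Num.min d d'); split; first by rewrite lt_min d0.
move=> K u v Hu Hn; rewrite lt_min => /andP[/(Hd _ _ _ Hu Hn) h /(Hd' _ _ _ Hu Hn) h'].
apply: (@le_lt_trans _ _ (\sum_(k < K) `|F (v k) - F (u k)| + \sum_(k < K) `|F' (v k) - F' (u k)|)); last first.
  by rewrite (splitr e); exact: ltrD.
rewrite -big_split; apply: ler_sum => k _ /=.
rewrite opp_row_mx add_row_mx; apply: row_mx_norm_le; [by rewrite lerDl|by rewrite lerDr].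
Qed.

Lemma ACon_const_mx a b (F : R -> R) : @ACon R R^o a b F -> ACon a b (fun t => const_mx (F t) : 'rV[R]_1).
Proof.
move=> aF e /aF[d [d0 Hd]]; exists d; split => // K u v Hu Hn /(Hd _ _ _ Hu Hn).
apply: le_lt_trans; apply: ler_sum => k _.
by rewrite (_ : const_mx _ - _ = const_mx (F (v k) - F (u k))) ?const_mx_norm //; apply/rowP => j; rewrite !mxE.
Qed.

Lemma is_derive_curve_row_mx n m (c : R -> 'rV[R]_n) (c' : R -> 'rV[R]_m) (t : R) v v' :
  is_derive t (1:R) c v -> is_derive t (1:R) c' v' ->
  is_derive t (1:R) (fun s => row_mx (c s) (c' s)) (row_mx v v').
Proof.
move=> /is_derive_coord dc /is_derive_coord dc'; apply/is_derive_coord => j.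
have [k ->|k ->] := fintype.split_ordP j.
  by rewrite row_mxEl; have := dc k; congr is_derive; apply/funext => s; rewrite row_mxEl.
by rewrite row_mxEr; have := dc' k; congr is_derive; apply/funext => s; rewrite row_mxEr.
Qed.

Lemma is_derive_curve_const_mx (c : R -> R) (t : R) v : is_derive t (1:R) (c : R -> R^o) v ->
  is_derive t (1:R) (fun s => const_mx (c s) : 'rV[R]_1) (const_mx v).
Proof.
move=> dc; apply/is_derive_coord => j; rewrite mxE; have := dc; congr is_derive.
by apply/funext => s; rewrite mxE.
Qed.

Lemma is_derive_curve_submx n m (c : R -> 'rV[R]_(n + m)) (t : R) v : is_derive t (1:R) c v ->
  is_derive t (1:R) (fun s => lsubmx (c s)) (lsubmx v) /\ is_derive t (1:R) (fun s => rsubmx (c s)) (rsubmx v).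
Proof.
move=> /is_derive_coord dc; split; apply/is_derive_coord => j; rewrite mxE.
  by have := dc (lshift m j); congr is_derive; apply/funext => s; rewrite mxE.
by have := dc (rshift n j); congr is_derive; apply/funext => s; rewrite mxE.
Qed.

Lemma ACon_bounded n (S : R) (F : R -> 'rV[R]_n) : ACon 0 S F -> exists2 B, 0 <= B &
  forall t, 0 <= t <= S -> `|F t| <= B.
Proof.
move=> aF; have cF : cont_on [set t : R^o | 0 <= t <= S] F.
  move=> x /andP[x0 xS] e /aF[d [d0 Hd]]; exists d => // y /andP[y0 yS].
  have main u v : 0 <= u -> u <= v -> v <= S -> v - u < d -> `|F u - F v| < e.
    move=> u0 uv vS vu; have := Hd 1 (fun _ => u) (fun _ => v); rewrite !big_ord1 => H; rewrite distrC; apply: H => //.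
    by move=> k l; rewrite !ord1.
  have [xy|yx] := leP x y.
    by move=> h; apply: main => //; move: h; rewrite distrC ger0_norm ?subr_ge0.
  move=> h; rewrite distrC; apply: main => //; first exact: ltW.
  by move: h; rewrite ger0_norm // subr_ge0 ltW.
have cS : compact [set t : R^o | 0 <= t <= S].
  rewrite (_ : [set t | _] = `[0, S]%classic); first exact: segment_compact.
  by apply/seteqP; split => t /=; rewrite in_itv.
by have [B B0 HB] := compact_bounded cS cF; exists B.
Qed.

Lemma measurable_Icc (S : R) : measurable (Icc S).
Proof.
rewrite (_ : Icc S = `[0, S]%classic); first exact: measurable_itv.
by apply/seteqP; split => t /=; rewrite in_itv.
Qed.

(** Sending every argument outside [B] to one fixed point gives a total measurable function that
    takes no new value when the point lies in [B]. *)
Lemma measurable_patch (D B : set R) (h : R -> R) t1 : measurable B -> B `<=` D -> measurable D ->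
  measurable_fun D h -> measurable_fun setT (fun t => h (if t \in B then t else t1)).
Proof.
move=> mB BD mD mh.
rewrite (_ : (fun t => _) = fun t => if t \in B then h t else h t1); last first.
  by apply/funext => t; case: ifP.
have mem : (fun t : R => t \in B) @^-1` [set true] = B.
  by apply/seteqP; split => t /=; [move=> /set_mem|move=> /mem_set].
apply: measurable_fun_if => //.
  by apply: (@measurable_fun_bool _ _ _ _ true); rewrite setTI mem.
by rewrite setTI mem; exact: measurable_funS mh.
Qed.

End Curves.

(** * From canonical processes to trajectories *)

Section Processes.
Context {R : realType}.
Variables n m1 m2 q : nat.
Notation m := (m1 + m2)%N.
Variables (A : set 'rV[R]_q) (C1 : set 'rV[R]_m1) (C2 : set 'rV[R]_m2).
Variables (f : 'rV[R]_n -> 'rV[R]_q -> 'rV[R]_n) (g : 'I_m -> 'rV[R]_n -> 'rV[R]_n).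
Variables (l0 : 'rV[R]_n -> 'rV[R]_q -> R) (hl1 : 'rV[R]_n -> R -> 'rV[R]_m -> R).
Variable xc : 'rV[R]_n.
Hypotheses (cA : compact A) (clC1 : closed C1) (clC2 : closed C2).
Hypothesis hf : cont_xpartials A f.
Hypothesis hg : forall i, isCk 1 (g i).
Hypothesis hl0 : cont_xpartials A l0.
Hypothesis hhl : cont_xpartials [set u : R * 'rV[R]_m | 0 <= u.1 /\ Cset C1 C2 u.2]
    (fun x u => hl1 x u.1 u.2).
Local Notation mu := (@lebesgue_measure R).
Local Notation UU := (ctrl A C1 C2).
Local Notation vel := (velocity f g l0 hl1).
Local Notation costf y u := (le_cost l0 hl1 y (pk_w0 u) (pk_w u) (pk_a u)).

Lemma vel_bounded y0 r : exists2 M, 0 <= M & forall y u, `|y - y0| <= r -> UU u -> `|vel y u| <= M.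
Proof.
have [M M0 HM] := compact_bounded (compact_setX (@closed_ball_compact R n y0 r) (compact_ctrl cA clC1 clC2))
  (cont_on_sub (K' := [set y | `|y - y0| <= r] `*` UU) (fun yu h => h.2) (cont_vel hf hg hl0 hhl)).
by exists M => // y u yr Uu; exact: (HM (y, u)).
Qed.

Lemma costf_le y u : `|costf y u| <= `|vel y u|.
Proof. by have := rV_coord_le (vel y u) (rshift (1 + n) 0); rewrite /velocity /state row_mxEr mxE. Qed.

Lemma running_cost (S : R) (y : R -> 'rV[R]_n) (u : R -> 'rV[R]_((1 + m) + q)) (L : R) :
  0 <= S -> lips L 0 S y -> (forall t, UU (u t)) -> measv u ->
  exists2 M, 0 <= M & exists2 H : R -> R,
    @lips R R^o M 0 S H /\ (forall t, 0 <= t <= S -> H t = Rintegral mu `[0, t] (fun s => costf (y s) (u s))) &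
    exists2 N, null N & forall t, 0 < t < S -> ~ N t -> is_derive t (1:R) (H : R -> R^o) (costf (y t) (u t)).
Proof.
move=> S0 ly Uu mu_u.
pose yc t := y (clampR 0 S t).
have cyc : continuous yc by exact: lips_clamp_continuous S0 ly.
have cin t : 0 <= clampR 0 S t <= S by exact: clampR_in S0.
have ycE t : 0 <= t <= S -> yc t = y t by move=> tS; rewrite /yc clampR_id.
have S00 : 0 <= (0:R) <= S by rewrite lexx.
have yb t : `|yc t - y 0| <= `|L| * S.
  have /andP[h1 h2] := cin t; apply: le_trans (ly _ _ (cin t) S00) _; rewrite subr0 (ger0_norm h1).
  apply: (@le_trans _ _ (`|L| * clampR 0 S t)); first by rewrite ler_wpM2r // ler_norm.
  by rewrite ler_wpM2l.
have [M M0 HM] := vel_bounded (y 0) (`|L| * S).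
have mh : measurable_fun setT (fun t => costf (yc t) (u t)).
  have cv := cont_on_coord (rshift (1 + n) 0) (cont_vel hf hg hl0 hhl).
  rewrite (_ : (fun t => _) = fun t => vel (yc t) (u t) 0 (rshift (1 + n) 0)); last first.
    by apply/funext => t; rewrite /velocity /state row_mxEr mxE.
  exact: (measurable_cont_on_comp cv (measv_continuous cyc) mu_u Uu).
have hM s : 0 <= s <= S -> `|costf (yc s) (u s)| <= M.
  by move=> _; apply: le_trans (costf_le _ _) _; exact: HM.
have [H [lH HE] [N nN HN]] := scalar_primitive S0 M0 mh hM.
exists M => //; exists H; last first.
  by exists N => // t tS Nt; rewrite -ycE; [exact: HN|case/andP: tS => ? ?; rewrite !ltW].
split => // t tS; rewrite HE //; apply: eq_Rintegral => s /set_mem; rewrite /= in_itv /= => /andP[s0 st].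
by rewrite ycE // s0 (le_trans st) //; case/andP: tS.
Qed.

(** The process is known almost everywhere, a trajectory asks for a control admissible everywhere;
    changing the control on a null set alters neither the equations nor the integral. The cost
    becomes a state component, and the normalization integrates to the formula for [beb]. *)
Lemma reference_exists Sb w0b wb alb y0b yb beb :
  canonical_process A C1 C2 f g xc Sb w0b wb alb y0b yb beb ->
  exists (ub : R -> 'rV[R]_((1 + m) + q)) (N0 : set R) (cb : R -> R) (M : R),
  [/\ 0 < Sb /\ 0 <= M, (forall t, UU (ub t)) /\ measv ub,
      null N0 /\ (forall s, Icc Sb s -> ~ N0 s -> ub s = pack (w0b s) (wb s) (alb s)) ,
      lips M 0 Sb (fun t => state (tx (y0b t) (yb t)) (cb t)) /\
      (exists2 E, null E & forall t, 0 < t < Sb -> ~ E t ->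
        is_derive t (1:R) (fun t => state (tx (y0b t) (yb t)) (cb t)) (vel (yb t) (ub t))) &
      [/\ cb 0 = 0,
        cb Sb = Rintegral mu (Icc Sb) (fun s => le_cost l0 hl1 (yb s) (w0b s) (wb s) (alb s)) &
        forall t, 0 <= t <= Sb -> beb t = t - y0b t]].
Proof.
move=> [[[S0 [mw0 [mw mal]] _ aeC _] [[y00 [yb0 be0]] [aY0 [aY aB]] aeD]] ae1].
have [N1 [mN1 N10 H1]] := ae_null aeC; have [N2 [mN2 N20 H2]] := ae_null ae1.
have [N3 [mN3 N30 H3]] := ae_null aeD.
pose N0 := N1 `|` N2.
have mN0 : measurable N0 by exact: measurableU.
have nN0 : null N0 by apply: nullU; exact: null_of.
have nN3 : null N3 by exact: null_of.
pose B := Icc Sb `\` N0.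
have mB : measurable B by apply: measurableD => //; exact: measurable_Icc.
(* A time at which the control is admissible and normalized; its value replaces the control at all
   other bad times and outside [[0, Sb]]. *)
have [t1 /andP[t10 t1S] Nt1] := not_null_itv nN0 S0.
have Bt1 : B t1 by split => //; rewrite /Icc /= !ltW.
pose sel t := if t \in B then t else t1.
have selB t : B (sel t) by rewrite /sel; case: ifP => [/set_mem|].
pose ub t := pack (w0b (sel t)) (wb (sel t)) (alb (sel t)).
have Uub t : UU (ub t).
  have [sS Ns] := selB t.
  have [w00 [Cw Aa]] := H1 _ (fun h => Ns (or_introl h)) sS.
  by split; rewrite ?pack_w0 ?pack_w ?pack_a //; exact: H2 (fun h => Ns (or_intror h)) sS.
have msel (h : R -> R) : measurable_fun (Icc Sb) h -> measurable_fun setT (fun t => h (sel t)).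
  move=> mh; have BI : B `<=` Icc Sb by move=> t [].
  exact: (@measurable_patch R (Icc Sb) B h t1 mB BI (measurable_Icc Sb) mh).
have mub : measv ub.
  move=> j; have [i ->|i ->] := fintype.split_ordP j; last first.
    by rewrite (_ : (fun t => _) = fun t => alb (sel t) 0 i); [exact: (msel (fun t => alb t 0 i))|apply/funext => t; rewrite row_mxEr].
  have [k ->|k ->] := fintype.split_ordP i.
    rewrite (_ : (fun t => _) = fun t => w0b (sel t)); first exact: msel.
    by apply/funext => t; rewrite !row_mxEl mxE.
  rewrite (_ : (fun t => _) = fun t => wb (sel t) 0 k); first exact: (msel (fun t => wb t 0 k)).
  by apply/funext => t; rewrite row_mxEl row_mxEr.
have ubE s : Icc Sb s -> ~ N0 s -> ub s = pack (w0b s) (wb s) (alb s).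
  by move=> sS Ns; rewrite /ub /sel; case: ifPn => // /negP; case; apply/mem_set.
have [By By0 HBy] := ACon_bounded aY.
have [MV MV0 HMV] := vel_bounded 0 By.
have nE : null (N0 `|` N3) by exact: nullU.
have itvW t : 0 < t < Sb -> 0 <= t <= Sb by case/andP => ? ?; rewrite !ltW.
have derz t : 0 < t < Sb -> ~ (N0 `|` N3) t ->
    is_derive t (1:R) (fun t => tx (y0b t) (yb t)) (lsubmx (vel (yb t) (ub t))).
  move=> tS Et; have [[d1 e1] [d2 e2] _] := H3 t (fun h => Et (or_intror h)) tS.
  rewrite /velocity /state row_mxKl ubE ?pack_w0 ?pack_w ?pack_a //; [|exact: itvW|by move=> h; apply: Et; left].
  have D1 : is_derive t (1:R) (y0b : R -> R^o) (w0b t) := DeriveDef d1 e1.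
  have D2 : is_derive t (1:R) yb (dyn f g (yb t) (w0b t) (wb t) (alb t)) := DeriveDef d2 e2.
  by apply: is_derive_curve_row_mx => //; exact: is_derive_curve_const_mx.
have velB t : 0 <= t <= Sb -> `|vel (yb t) (ub t)| <= MV.
  by move=> tS; apply: HMV => //; rewrite subr0; exact: HBy.
have lz : lips MV 0 Sb (fun t => tx (y0b t) (yb t)).
  apply: (@AC_lips R _ _ _ _ _ (N0 `|` N3)) => //.
    by apply: ACon_row_mx => //; exact: ACon_const_mx.
  move=> t tS Et; exists (lsubmx (vel (yb t) (ub t))); first exact: derz.
  by apply: le_trans (lsubmx_norm_le _) _; apply: velB; exact: itvW.
have ly : lips MV 0 Sb yb.
  move=> s t sS tS; apply: le_trans (lz s t sS tS); rewrite /tx opp_row_mx add_row_mx.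
  by have := rsubmx_norm_le (row_mx (const_mx (y0b s) - const_mx (y0b t) : 'rV[R]_1) (yb s - yb t)); rewrite row_mxKr.
have [Mc Mc0 [cb [lc cE] [N4 nN4 HN4]]] := running_cost (ltW S0) ly Uub mub.
exists ub, N0, cb, (MV + Mc); split.
- by split => //; exact: addr_ge0.
- by [].
- by [].
- split.
    move=> s t sS tS; rewrite /state opp_row_mx add_row_mx; apply: row_mx_norm_le.
      by apply: le_trans (lz s t sS tS) _; rewrite ler_wpM2r // lerDl.
    rewrite (_ : const_mx _ - _ = const_mx (cb s - cb t)); last by apply/rowP => j; rewrite !mxE.
    by rewrite const_mx_norm; apply: le_trans (lc s t sS tS) _; rewrite ler_wpM2r // lerDr.
  exists (N0 `|` N3 `|` N4); first exact: nullU.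
  move=> t tS Et; rewrite [X in is_derive _ _ _ X](_ : _ = row_mx (lsubmx (vel (yb t) (ub t))) (const_mx (costf (yb t) (ub t)))); last first.
    by rewrite /velocity /state row_mxKl.
  apply: is_derive_curve_row_mx; first by apply: derz => // h; apply: Et; left.
  by apply: is_derive_curve_const_mx; apply: HN4 => // h; apply: Et; right.
- split.
  + rewrite cE ?lexx ?ltW // set_itv1 /Rintegral integral_set1 //.
  + rewrite cE ?lexx ?ltW // (_ : `[0, Sb]%classic = Icc Sb); last first.
      by apply/seteqP; split => t /=; rewrite in_itv.
    rewrite /Rintegral; congr fine; apply: (@integral_ae_eq R _ _ _ N0) => //.
      by apply/negligibleP.
    by move=> s sS Ns; rewrite ubE // pack_w0 pack_w pack_a.
  + move=> t tS; pose h s := beb s - (s - y0b s).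
    have ach : @ACon R R^o 0 Sb h.
      apply: AConB => //; apply: AConB => //.
      by apply: (@lips_AC _ R^o 1) => u v _ _; rewrite mul1r.
    case/andP: (tS) => t0 tSb.
    have act := ACon_sub (lexx 0) tSb ach.
    have : h t = h 0.
      apply: (AC_const t0 act nE) => s /andP[s0 st] Es.
      have sS : 0 < s < Sb by rewrite s0 (lt_le_trans st).
      have [[d1 e1] _ [d3 e3]] := H3 s (fun h => Es (or_intror h)) sS.
      have w1 := H2 s (fun h => Es (or_introl (or_intror h))) (itvW s sS).
      rewrite (_ : 0 = enorm (wb s) - (1 - w0b s)); last by rewrite -w1; ring.
      have D1 : is_derive s (1:R) (y0b : R -> R^o) (w0b s) := DeriveDef d1 e1.
      have D3 : is_derive s (1:R) (beb : R -> R^o) (enorm (wb s)) := DeriveDef d3 e3.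
      by apply: is_deriveB => //; apply: is_deriveB.
    by rewrite /h be0 y00; lra.
Qed.

End Processes.

(** * Trajectories as competitors of the reference *)

Section Minimality.
Context {R : realType}.
Variables n m1 m2 q : nat.
Notation m := (m1 + m2)%N.
Variable Targ : set 'rV[R]_(1 + n).
Variables (A : set 'rV[R]_q) (C1 : set 'rV[R]_m1) (C2 : set 'rV[R]_m2).
Variables (f : 'rV[R]_n -> 'rV[R]_q -> 'rV[R]_n) (g : 'I_m -> 'rV[R]_n -> 'rV[R]_n).
Variables (l0 : 'rV[R]_n -> 'rV[R]_q -> R) (hl1 : 'rV[R]_n -> R -> 'rV[R]_m -> R).
Variables (Psi : 'rV[R]_(1 + n) -> R) (K : \bar R) (xc : 'rV[R]_n).
Hypotheses (cA : compact A) (clC1 : closed C1) (clC2 : closed C2).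
Hypothesis hf : cont_xpartials A f.
Hypothesis hg : forall i, isCk 1 (g i).
Hypothesis hl0 : cont_xpartials A l0.
Hypothesis hhl : cont_xpartials [set u : R * 'rV[R]_m | 0 <= u.1 /\ Cset C1 C2 u.2]
    (fun x u => hl1 x u.1 u.2).
Local Notation mu := (@lebesgue_measure R).
Local Notation UU := (ctrl A C1 C2).
Local Notation vel := (velocity f g l0 hl1).
Local Notation G := (sysG (@projY R n) (fun i y u => vel y u 0 i)).
Local Notation sy0 x := ((lsubmx (lsubmx x)) 0 0).
Local Notation sy x := (rsubmx (lsubmx x)).
Local Notation sc x := ((rsubmx x) 0 0).

Lemma sy0_le (x : 'rV[R]_((1 + n) + 1)) : `|sy0 x| <= `|x|.
Proof.
apply: le_trans (rV_coord_le _ _) _; apply: le_trans (lsubmx_norm_le _) _; exact: lsubmx_norm_le.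
Qed.

Lemma sy_le (x : 'rV[R]_((1 + n) + 1)) : `|sy x| <= `|x|.
Proof. by apply: le_trans (rsubmx_norm_le _) _; exact: lsubmx_norm_le. Qed.

Lemma sc_le (x : 'rV[R]_((1 + n) + 1)) : `|sc x| <= `|x|.
Proof. by apply: le_trans (rV_coord_le _ _) _; exact: rsubmx_norm_le. Qed.

(** Normalized controls make [t - y0] the right third coordinate. The cost component and the running
    integral have the same derivative almost everywhere and both start at 0, so they agree. *)
Lemma traj_process T X u : 0 < T -> traj UU G T X u -> X 0 = state (tx 0 xc) 0 ->
  process A C1 C2 f g xc T (fun t => pk_w0 (u t)) (fun t => pk_w (u t)) (fun t => pk_a (u t))
    (fun t => sy0 (X t)) (fun t => sy (X t)) (fun t => t - sy0 (X t)) /\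
  cost l0 hl1 Psi T (fun t => pk_w0 (u t)) (fun t => pk_w (u t)) (fun t => pk_a (u t))
    (fun t => sy0 (X t)) (fun t => sy (X t)) = Psi (lsubmx (X T)) + sc (X T).
Proof.
move=> T0 [_ Uu mu_u [L L0 lX] [E nE HE]] X0.
have X0y0 : sy0 (X 0) = 0 by rewrite X0 /state /tx !row_mxKl mxE.
have X0y : sy (X 0) = xc by rewrite X0 /state /tx row_mxKl row_mxKr.
have X0c : sc (X 0) = 0 by rewrite X0 /state row_mxKr mxE.
have ly0 : @lips R R^o L 0 T (fun t => sy0 (X t)).
  by move=> s t sT tT; apply: le_trans (lX s t sT tT); have := sy0_le (X s - X t); rewrite !mxE.
have ly : lips L 0 T (fun t => sy (X t)).
  move=> s t sT tT; apply: le_trans (lX s t sT tT).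
  by rewrite (_ : _ - _ = sy (X s - X t)) ?sy_le //; apply/rowP => j; rewrite !mxE.
have lc : @lips R R^o L 0 T (fun t => sc (X t)).
  by move=> s t sT tT; apply: le_trans (lX s t sT tT); have := sc_le (X s - X t); rewrite !mxE.
have der t : 0 < t < T -> ~ E t -> [/\ is_derive t (1:R) (fun s => sy0 (X s) : R^o) (pk_w0 (u t)),
    is_derive t (1:R) (fun s => sy (X s)) (dyn f g (sy (X t)) (pk_w0 (u t)) (pk_w (u t)) (pk_a (u t))) &
    is_derive t (1:R) (fun s => sc (X s) : R^o) (le_cost l0 hl1 (sy (X t)) (pk_w0 (u t)) (pk_w (u t)) (pk_a (u t)))].
  move=> tT Et; have := HE t tT Et; rewrite sysG_vel mul_projY.
  move=> /is_derive_curve_submx[/is_derive_curve_submx[d1 d2] d3].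
  split.
  - by have /is_derive_coord/(_ 0) := d1; rewrite /velocity /state /tx !row_mxKl mxE.
  - by move: d2; rewrite /velocity /state /tx row_mxKl row_mxKr.
  - by have /is_derive_coord/(_ 0) := d3; rewrite /velocity /state row_mxKr mxE.
have cwm (F : 'rV[R]_((1 + m) + q) -> R) j : (forall v, F v = v 0 j) -> measurable_fun (Icc T) (fun t => F (u t)).
  move=> FE; rewrite (_ : (fun t => _) = fun t => u t 0 j); last by apply/funext => t; rewrite FE.
  exact: measurable_funS (mu_u j).
have e0 (v : 'rV[R]_m) : 0 <= enorm v by exact: sqrtr_ge0.
split.
  split; split => //.
  - split; first by apply: (cwm (fun v => pk_w0 v) (lshift q (lshift m 0))) => v; rewrite /pk_w0 !mxE.
    split => i.
      by apply: (cwm (fun v => pk_w v 0 i) (lshift q (rshift 1 i))) => v; rewrite /pk_w !mxE.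
    by apply: (cwm (fun v => pk_a v 0 i) (rshift (1 + m) i)) => v; rewrite /pk_a !mxE.
  - have [B B0 HB] := compact_bounded cA (F := id) (cont_on_lip1 (fun x y => lexx _)).
    exists (1 + q%:R * B); apply: aeW => t _; have [w00 Cw Aa w1] := Uu t.
    have qB : 0 <= q%:R * B by rewrite mulr_ge0.
    have := e0 (pk_w (u t)) => ew; split; first by rewrite ger0_norm //; lra.
    split; first by lra.
    apply: le_trans (enorm_le_norm _) _; apply: (@le_trans _ _ (q%:R * B)); last by lra.
    by rewrite ler_wpM2l // HB.
  - by apply: aeW => t _; have [w00 Cw Aa w1] := Uu t.
  - by exists 1; split => //; apply: aeW => t _; have [_ _ _ ->] := Uu t.
  - by rewrite X0y0 X0y subrr.
  - split; first exact: (@lips_AC _ R^o _ _ _ _ ly0).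
    split; first exact: lips_AC ly.
    apply: AConB; last exact: (@lips_AC _ R^o _ _ _ _ ly0).
    by apply: (@lips_AC _ R^o 1) => a b _ _; rewrite mul1r.
  - apply: negligibleS nE => t /= /not_implyP[tT H]; apply: contrapT => Et; apply: H.
    have [d1 d2 d3] := der t tT Et; split.
    + by split; [case: d1|exact: derive_val].
    + by split; [case: d2|exact: derive_val].
    + have db : is_derive t (1:R) (fun s => s - sy0 (X s) : R^o) (enorm (pk_w (u t))).
        have [_ _ _ w1] := Uu t; rewrite (_ : enorm _ = 1 - pk_w0 (u t)); last by rewrite -w1; ring.
        exact: is_deriveB.
      by split; [case: db|exact: derive_val].
rewrite /cost (_ : tx _ _ = lsubmx (X T)); last first.
  rewrite /tx -[RHS]hsubmxK; congr row_mx; by apply/rowP => j; rewrite [LHS]mxE ord1.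
congr (_ + _).
have [Mc Mc0 [H [lH HE'] [N nN HN]]] := running_cost cA clC1 clC2 hf hg hl0 hhl (ltW T0) ly Uu mu_u.
have T01 : 0 <= T <= T by rewrite lexx ltW.
have := HE' T T01; rewrite (_ : `[0, T]%classic = Icc T); last by apply/seteqP; split => t /=; rewrite in_itv.
move=> <-.
have H0 : H 0 = 0 by rewrite HE' ?lexx ?ltW // set_itv1 /Rintegral integral_set1.
have : H T - sc (X T) = H 0 - sc (X 0).
  apply: (@AC_const R (fun t => H t - sc (X t)) 0 T (E `|` N) (ltW T0)).
  - by apply: AConB; [exact: (@lips_AC _ R^o _ _ _ _ lH)|exact: (@lips_AC _ R^o _ _ _ _ lc)].
  - exact: nullU.
  - move=> t tT Et; rewrite -(subrr (le_cost l0 hl1 (sy (X t)) (pk_w0 (u t)) (pk_w (u t)) (pk_a (u t)))).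
    have [_ _ d3] := der t tT (fun h => Et (or_introl h)).
    by apply: is_deriveB => //; apply: HN => // h; apply: Et; right.
rewrite H0 X0c; lra.
Qed.

(** A reachable point that is still in [better] after its cost has been raised by [kap] beats the
    reference by at least [kap]; being feasible and close to the reference, it contradicts
    minimality. *)
Lemma reach_not_better Sb w0b wb alb y0b yb beb cb M :
  canonical_process A C1 C2 f g xc Sb w0b wb alb y0b yb beb ->
  local_minimizer Targ A C1 C2 f g l0 hl1 Psi K xc Sb w0b wb alb y0b yb beb ->
  ((beb Sb)%:E < K)%E -> 0 <= M ->
  let xb t := state (tx (y0b t) (yb t)) (cb t) in
  lips M 0 Sb xb -> cb 0 = 0 ->
  cb Sb = Rintegral mu (Icc Sb) (fun s => le_cost l0 hl1 (yb s) (w0b s) (wb s) (alb s)) ->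
  (forall t, 0 <= t <= Sb -> beb t = t - y0b t) ->
  exists2 eta0, 0 < eta0 <= 1 & forall x kap, 0 < kap -> reach UU G Sb xb eta0 Sb x ->
    better Targ Psi (tx (y0b Sb) (yb Sb)) (cb Sb) (x + kap *: state 0 1) -> False.
Proof.
move=> [[[S0 _ _ _ _] [[y00 [yb0 _]] _ _]] _] [_ [d [d0 Hmin]]] bK M0 xb lxb cb0 cbS beE.
(* Half of the slack in the bound on [beb]: the final time and the final [y0] may each move by up to
   [k]. *)
have [k k0 Hk] : exists2 k : R, 0 < k & forall r : R, r <= beb Sb + 2 * k -> (r%:E <= K)%E.
  case: K bK => [r||] //.
    rewrite lte_fin => br; exists ((r - beb Sb) / 2); first by rewrite divr_gt0 // subr_gt0.
    by move=> r' h; rewrite lee_fin; lra.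
  by move=> _; exists 1 => // r _; rewrite leey.
(* With [a = (1 + 2 * M) * eta0], the components of the distance contribute [a], [n * a] and
   [a + eta0], and the final times differ by at most another [eta0]; [Z * eta0] covers the total. *)
pose Z := (n%:R + 3) * (1 + 2 * M) + 2.
have Z0 : 0 < Z by rewrite ltr_wpDl // mulr_ge0 // addr_ge0 // mulr_ge0.
pose eta0 := Num.min (Num.min 1 (Sb / 2)) (Num.min k (d / 2 / Z)).
have eta00 : 0 < eta0 by rewrite !lt_min ltr01 k0 !divr_gt0.
have [e1 e2] : eta0 <= 1 /\ eta0 <= Sb / 2.
  by split; rewrite /eta0; [rewrite !ge_min lexx|rewrite !ge_min lexx orbT].
have [e3 e4] : eta0 <= k /\ eta0 <= d / 2 / Z.
  by split; rewrite /eta0; rewrite !ge_min lexx ?orbT.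
exists eta0; first by rewrite eta00.
move=> x kap kap0 [T [X [u [tr X0 XT [TS xS tube]]]]] [Tx Jx].
have /ler_normlP[TS1 TS2] := TS.
have T0 : 0 < T by lra.
have X00 : X 0 = state (tx 0 xc) 0 by rewrite X0 /xb y00 yb0 cb0.
have [proc costE] := traj_process T0 tr X00.
have lx : lsubmx (x + kap *: state (0 : 'rV[R]_(1 + n)) 1) = lsubmx x.
  by rewrite linearD linearZ /= /state row_mxKl scaler0 addr0.
have rx : sc (x + kap *: state (0 : 'rV[R]_(1 + n)) 1) = sc x + kap.
  by rewrite linearD linearZ /= /state row_mxKr !mxE mulr1.
rewrite lx in Tx; rewrite lx rx in Jx.
have txE : tx (sy0 (X T)) (sy (X T)) = lsubmx x.
  rewrite XT /tx -[RHS]hsubmxK; congr row_mx; by apply/rowP => j; rewrite [LHS]mxE ord1.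
have TT : 0 <= T <= T by rewrite lexx ltW.
have SS : 0 <= Sb <= Sb by rewrite lexx ltW.
(* The trajectory is [eta0]-close to the reference at some reading [c], not at the same time; [c] is
   within [2 * eta0] of the time wanted, which costs [2 * M * eta0] along the reference. *)
have close s : 0 <= s -> `|X (Num.min s T) - xb (Num.min s Sb)| <= (1 + 2 * M) * eta0 /\
    `|Num.min s T - Num.min s Sb| <= eta0.
  move=> s0; set t := Num.min s T; set t' := Num.min s Sb.
  have tT : 0 <= t <= T by rewrite le_min s0 (ltW T0) ge_min lexx orbT.
  have t'S : 0 <= t' <= Sb by rewrite le_min s0 (ltW S0) ge_min lexx orbT.
  have tt' : `|t - t'| <= eta0.
    exact: le_trans (minr_lip _ _ _) TS.
  split => //; have [c cS [h1 h2]] := tube t tT.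
  have ct' : `|c - t'| <= 2 * eta0.
    rewrite (_ : c - t' = (c - t) + (t - t')); last by ring.
    by apply: le_trans (ler_normD _ _) _; rewrite (distrC c); lra.
  rewrite (_ : X t - xb t' = (X t - xb c) + (xb c - xb t')); last by rewrite addrA subrK.
  apply: le_trans (ler_normD _ _) _; rewrite mulrDl mul1r; apply: lerD => //.
  apply: le_trans (lxb c t' cS t'S) _; rewrite (mulrC 2) -mulrA; exact: ler_wpM2l.
have s0x t : sy0 (xb t) = y0b t by rewrite /xb /state /tx !row_mxKl mxE.
have sx t : sy (xb t) = yb t by rewrite /xb /state /tx row_mxKl row_mxKr.
have s0B (a b : 'rV[R]_((1 + n) + 1)) : sy0 (a - b) = sy0 a - sy0 b by rewrite !mxE.
have sB (a b : 'rV[R]_((1 + n) + 1)) : sy (a - b) = sy a - sy b by apply/rowP => j; rewrite !mxE.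
have beT : ((T - sy0 (X T))%:E <= K)%E.
  apply: Hk; rewrite beE //.
  have : `|sy0 (X T) - y0b Sb| <= eta0.
    by apply: le_trans xS; have := sy0_le (x - xb Sb); rewrite s0B s0x XT.
  by move=> /ler_normlP[h1 h2]; lra.
have feas : feasible Targ A C1 C2 f g K xc T (fun t => pk_w0 (u t)) (fun t => pk_w (u t)) (fun t => pk_a (u t))
    (fun t => sy0 (X t)) (fun t => sy (X t)) (fun t => t - sy0 (X t)).
  by split => //; rewrite txE.
have := Hmin _ _ _ _ _ _ _ feas.
rewrite costE XT /cost -cbS => H; have {}H : Psi (tx (y0b Sb) (yb Sb)) + cb Sb <= Psi (lsubmx x) + sc x.
  apply: H; exists ((n%:R + 3) * (1 + 2 * M) * eta0 + eta0); split.
    apply: (@le_lt_trans _ _ (Z * eta0)).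
      rewrite /Z [leRHS]mulrDl; lra.
    apply: (@le_lt_trans _ _ (d / 2)); last by rewrite ltr_pdivrMr // mulr_natr mulr2n ltrDl.
    by rewrite mulrC -ler_pdivlMr.
  move=> s s0; have [cl tt] := close s s0; move: cl tt; rewrite /zdist.
  set t := Num.min s T; set t' := Num.min s Sb; move=> cl tt.
  have t'S : 0 <= t' <= Sb by rewrite le_min s0 (ltW S0) ge_min lexx orbT.
  have h1 : `|sy0 (X t) - y0b t'| <= (1 + 2 * M) * eta0.
    by apply: le_trans cl; have := sy0_le (X t - xb t'); rewrite s0B s0x.
  have h2 : enorm (sy (X t) - yb t') <= n%:R * ((1 + 2 * M) * eta0).
    apply: le_trans (enorm_le_norm _) _; rewrite ler_wpM2l //; apply: le_trans cl.
    by have := sy_le (X t - xb t'); rewrite sB sx.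
  have h3 : `|t - sy0 (X t) - beb t'| <= eta0 + (1 + 2 * M) * eta0.
    rewrite beE // (_ : t - _ - _ = (t - t') - (sy0 (X t) - y0b t')); last by ring.
    by apply: le_trans (ler_normB _ _) _; exact: lerD.
  have sq (a b c : R) : Num.sqrt (a ^+ 2 + b ^+ 2 + c ^+ 2) <= `|a| + `|b| + `|c|.
    have p0 : 0 <= `|a| + `|b| + `|c| by rewrite !addr_ge0.
    rewrite -(ger0_norm p0) -sqrtr_sqr ler_wsqrtr //.
    rewrite -(real_normK (num_real a)) -(real_normK (num_real b)) -(real_normK (num_real c)).
    rewrite -subr_ge0 (_ : _ - _ = 2 * (`|a| * `|b| + `|a| * `|c| + `|b| * `|c|)); last by ring.
    by rewrite mulr_ge0 // !addr_ge0 // mulr_ge0.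
  apply: le_trans (sq _ _ _) _; rewrite [X in _ + X + _]ger0_norm ?sqrtr_ge0 //.
  apply: le_trans (lerD (lerD h1 h2) h3) _.
  have a0 : 0 <= (1 + 2 * M) * eta0 by rewrite mulr_ge0 ?addr_ge0 ?mulr_ge0 // ltW.
  rewrite (_ : (n%:R + 3) * (1 + 2 * M) * eta0 = n%:R * ((1 + 2 * M) * eta0) + 3 * ((1 + 2 * M) * eta0)); last by ring.
  by move: a0; move: ((1 + 2 * M) * eta0) => a; move: (n%:R * a) => b a0; lra.
by move: Jx H; lra.
Qed.

End Minimality.

(** * Small facts for the conclusions *)

Section FinalLemmas.
Context {R : realType}.

Lemma dotp_embY n (P : 'rV[R]_((1 + n) + 1)) (v : 'rV[R]_n) :
  dotp P (v *m @embY R n) = dotp (rsubmx (lsubmx P)) v.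
Proof.
by rewrite dotp_mulmx trmx_mul -trmx_projY trmxK mulmxA mul_projY -dotp_mulmx.
Qed.

Lemma enorm_ev N (i : 'I_N) : enorm (ev i : 'rV[R]_N) = 1.
Proof.
rewrite /enorm (_ : dotp _ _ = 1) ?sqrtr1 // /dotp (bigD1 i) //= !mxE !eqxx mulr1 big1 ?addr0 // => j ji.
by rewrite mxE eqxx (negbTE ji) mulr0.
Qed.

Lemma enormN N (v : 'rV[R]_N) : enorm (- v) = enorm v.
Proof. by rewrite /enorm dotpNl dotpNr opprK. Qed.

Lemma bracket_class_swap d (F : nat -> 'rV[R]_d -> 'rV[R]_d) b1 b2 k :
  bracket_class F (FNode b1 b2) k -> bracket_class F (FNode b2 b1) k.
Proof. by move=> []. Qed.

(** The opposite of a bracket field is again a bracket field of the same class, so the inequality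
    obtained from insertion becomes an equality. *)
Lemma feval_swap d (F : nat -> 'rV[R]_d -> 'rV[R]_d) b1 b2 x :
  feval F (FNode b2 b1) x = - feval F (FNode b1 b2) x.
Proof. by rewrite /= /lie opprB. Qed.

Lemma sup_zero (E : set R) : E !=set0 -> (forall x, E x -> x <= 0) ->
  (forall e : R, 0 < e -> exists2 x, E x & - e <= x) -> sup E = 0.
Proof.
move=> E0 Ele Enear; apply/le_anti/andP; split; first exact: ge_sup.
rewrite leNgt; apply/negP => s0.
have [x Ex] := Enear (- sup E / 2) ltac:(by rewrite divr_gt0 // oppr_gt0).
have : x <= sup E by apply: ub_le_sup => //; exists 0.
by lra.
Qed.

End FinalLemmas.

(** * Impulsive controls along the lines and insertion of brackets *)

Section Conclusions.
Context {R : realType}.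
Variables n m1 m2 q : nat.
Notation m := (m1 + m2)%N.
Variables (A : set 'rV[R]_q) (C1 : set 'rV[R]_m1) (C2 : set 'rV[R]_m2).
Variables (f : 'rV[R]_n -> 'rV[R]_q -> 'rV[R]_n) (g : 'I_m -> 'rV[R]_n -> 'rV[R]_n).
Variables (l0 : 'rV[R]_n -> 'rV[R]_q -> R) (hl1 : 'rV[R]_n -> R -> 'rV[R]_m -> R).
Hypotheses (lineC1 : forall (i : 'I_m1) (t : R), C1 (t *: ev i)) (C20 : C2 0).
Hypothesis hg : forall i, isCk 1 (g i).
Hypothesis hl10 : forall (x : 'rV[R]_n) (w : 'rV[R]_m), Cset C1 C2 w -> hl1 x 0 w = 0.
Local Notation UU := (ctrl A C1 C2).
Local Notation vel := (velocity f g l0 hl1).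
Local Notation G := (sysG (@projY R n) (fun i y u => vel y u 0 i)).

Lemma Ham_dotp (y p : 'rV[R]_n) (p0 lam : R) u :
  Ham f g l0 hl1 y p0 p 0 lam (pk_w0 u) (pk_w u) (pk_a u) = dotp (state (tx p0 p) (- lam)) (vel y u).
Proof. by rewrite dotp_state /Ham mul0r addr0 mulNr. Qed.

(** The value of [a] is immaterial to the motion and serves only to make the control admissible. *)
Definition axis_ctrl (a : 'rV[R]_q) (i : 'I_m1) (b : bool) : 'rV[R]_((1 + m) + q) :=
  pack 0 (if b then ev (lshift m2 i) else - ev (lshift m2 i)) a.

Lemma axis_ctrl_in a i b : A a -> UU (axis_ctrl a i b).
Proof.
move=> Aa.
have l1 : lsubmx (ev (lshift m2 i) : 'rV[R]_m) = ev i.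
  by apply/rowP => j; rewrite !mxE eqxx /= (inj_eq (@lshift_inj _ _)).
have r1 : rsubmx (ev (lshift m2 i) : 'rV[R]_m) = 0.
  by apply/rowP => j; rewrite !mxE eqxx /= eq_rlshift.
rewrite /axis_ctrl; split; rewrite ?pack_w0 ?pack_w ?pack_a //.
  case: b; split; rewrite ?l1 ?r1 // ?linearN /= ?l1 ?r1 ?oppr0 //.
    by have := lineC1 i 1; rewrite scale1r.
  by have := lineC1 i (-1); rewrite scaleN1r.
by rewrite add0r; case: b; rewrite ?enormN enorm_ev.
Qed.

(** This is where the vanishing of [hl1] at [w0 = 0] enters: the cost component of the velocity is
    zero, so a word in these controls displaces the position only. *)
Lemma vel_axis_ctrl y a i b : A a ->
  vel y (axis_ctrl a i b) = (if b then g (lshift m2 i) y else - g (lshift m2 i) y) *m @embY R n.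
Proof.
move=> Aa; have [_ Cw _ _] := axis_ctrl_in i b Aa.
have E : vel y (axis_ctrl a i b) = state (tx 0 (\sum_(k < m) (pk_w (axis_ctrl a i b)) 0 k *: g k y)) 0.
  rewrite /velocity /dyn /le_cost {1 2 4 5}/axis_ctrl pack_w0 scale0r add0r mulr0 add0r.
  by rewrite hl10.
rewrite E mul_embY /state /tx /axis_ctrl pack_w (_ : const_mx 0 = 0); last by apply/rowP => j; rewrite !mxE.
congr (row_mx (row_mx _ _) _).
rewrite (bigD1 (lshift m2 i)) //= big1 ?addr0 => [|k ki].
  by case: (b) => /=; rewrite !mxE !eqxx ?scale1r ?scaleN1r.
by case: (b) => /=; rewrite !mxE eqxx (negbTE ki) ?oppr0 scale0r.
Qed.

Lemma insert_bracket S M xb s b (F : nat -> 'rV[R]_n -> 'rV[R]_n) (a : 'rV[R]_q) :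
  A a -> lips M 0 S xb -> 0 <= s <= S -> (2 <= flength b)%N -> bracket_class F b 0 ->
  (forall j, j \in fleaves b -> exists i : 'I_m1, F j = g (lshift m2 i)) ->
  insertable S xb (reach UU G S xb) s (feval F b (xb s *m @projY R n) *m @embY R n).
Proof.
move=> Aa lxb sS lb Cb Fg.
have CF j : mem (fleaves b) j -> isCk 1 (F j) by move=> /Fg[i ->].
have [phi lf] := letter_flows_exist (xb s *m @projY R n) CF.
have [j0 j0b] : exists j0, j0 \in fleaves b.
  by move: lb; rewrite /flength; case: (fleaves b) => // j0 js _; exists j0; rewrite mem_head.
have [i0 _] := Fg j0 j0b.
apply: (@insert_word R n F phi (mem (fleaves b)) (xb s *m @projY R n) lf _ _ UU G (@projY R n) (@embY R n) (@embK R n)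
  (@projY_norm R n) (@embY_norm R n) _ (axis_ctrl_in i0 true Aa) _ S M xb s (bracket_word b) (flength b)) => //.
- move=> j c /Fg[i Fj]; exists (axis_ctrl a i c); first exact: axis_ctrl_in.
  by move=> x; rewrite sysG_vel vel_axis_ctrl // /signed Fj; case: c.
- exact: bracket_word_leaves.
- exact: ltn_trans lb.
- exact: bracket_asymptotics.
Qed.

End Conclusions.

Unset Implicit Arguments. Set Strict Implicit. Set Printing Implicit Defensive.

Theorem mainTheorem4 (R : realType) (n m1 m2 q : nat)
  (Targ : set 'rV[R]_(1 + n)) (A : set 'rV[R]_q)
  (C1 : set 'rV[R]_m1) (C2 : set 'rV[R]_m2)
  (f : 'rV[R]_n -> 'rV[R]_q -> 'rV[R]_n)
  (g : 'I_(m1 + m2) -> 'rV[R]_n -> 'rV[R]_n)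
  (l0 : 'rV[R]_n -> 'rV[R]_q -> R)
  (l1 : 'rV[R]_n -> 'rV[R]_(m1 + m2) -> R)
  (hl1 : 'rV[R]_n -> R -> 'rV[R]_(m1 + m2) -> R)
  (Psi : 'rV[R]_(1 + n) -> R) (K : \bar R) (xc : 'rV[R]_n) :
  (* standing hypotheses *)
  closed Targ -> Targ `<=` [set z | 0 <= (lsubmx z : 'rV[R]_1) 0 0] ->
  compact A ->
  is_cone C1 -> closed C1 -> (forall (i : 'I_m1) (t : R), C1 (t *: ev i)) ->
  is_cone C2 -> closed C2 -> no_line C2 ->
  cont_xpartials A f ->
  (forall i, isCk 1 (g i)) ->
  cont_xpartials A l0 ->
  (forall (x : 'rV[R]_n) (w0 : R) (w : 'rV[R]_(m1 + m2)), 0 <= w0 -> Cset C1 C2 w ->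
     (fun r => r * l1 x (r^-1 *: w)) @ within [set r : R | 0 < r] (nbhs w0)
       --> hl1 x w0 w) ->
  cont_xpartials [set u : R * 'rV[R]_(m1 + m2) | 0 <= u.1 /\ Cset C1 C2 u.2]
    (fun x u => hl1 x u.1 u.2) ->
  isCk 1 Psi ->
  (0 < K)%E ->
  (* additional hypothesis *)
  (forall (x : 'rV[R]_n) (w : 'rV[R]_(m1 + m2)), Cset C1 C2 w -> hl1 x 0 w = 0) ->
  forall (Sb : R) (w0b : R -> R) (wb : R -> 'rV[R]_(m1 + m2)) (alb : R -> 'rV[R]_q)
         (y0b : R -> R) (yb : R -> 'rV[R]_n) (beb : R -> R),
  canonical_process A C1 C2 f g xc Sb w0b wb alb y0b yb beb ->
  local_minimizer Targ A C1 C2 f g l0 hl1 Psi K xc Sb w0b wb alb y0b yb beb ->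
  ((beb Sb)%:E < K)%E ->
  forall Gam : set 'rV[R]_(1 + n),
  boltyanski Targ (tx (y0b Sb) (yb Sb)) Gam ->
  exists (p0 : R) (p : R -> 'rV[R]_n) (lam : R),
    [/\ ACon 0 Sb p /\ 0 <= lam,
        (* (i) *)
        (p0 != 0 \/ (exists s, Icc Sb s /\ p s != 0) \/ lam != 0) /\
        (0 < y0b Sb -> (exists s, Icc Sb s /\ p s != 0) \/ lam != 0),
        (* (ii) *)
        (exists qv, polar Gam qv /\
          tx p0 (p Sb) = - (lam *: grad Psi (tx (y0b Sb) (yb Sb))) - qv),
        (* (iii) *)
        ae_R (fun s => 0 < s < Sb -> derivable p s 1 /\
          derive p s 1 = - dHam_dx f g l0 hl1 (yb s) p0 (p s) 0 lam (w0b s) (wb s) (alb s)) /\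
        (* (iv) *)
        ae_R (fun s => Icc Sb s ->
          Ham f g l0 hl1 (yb s) p0 (p s) 0 lam (w0b s) (wb s) (alb s)
          = HamMax A C1 C2 f g l0 hl1 (yb s) p0 (p s) 0 lam) &
        (* (v), (vi), (vii) *)
        forall s, Icc Sb s ->
          [/\ HamMax A C1 C2 f g l0 hl1 (yb s) p0 (p s) 0 lam = 0,
              forall i : 'I_m1, dotp (p s) (g (lshift m2 i) (yb s)) = 0
            & forall B, frakB (fun i : 'I_m1 => g (lshift m2 i)) 0 B ->
                dotp (p s) (B (yb s)) = 0]].
Proof.
move=> _ _ cA coneC1 clC1 lineC1 coneC2 clC2 _ hf hg hl0 _ hhl CPsi _ hl10
  Sb w0b wb alb y0b yb beb can lmin bK Gam bol.
have [ub [N0 [cb [M [[S0 M0] [Uub mub] [nN0 ubE] [lxb dxb] [cb0 cbS beE]]]]]] :=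
  reference_exists cA clC1 clC2 hf hg hl0 hhl can.
have y00 : y0b 0 = 0 by case: can => [[_ [[? _] _ _]] _].
pose xb t := state (tx (y0b t) (yb t)) (cb t).
pose UU := ctrl A C1 C2.
pose v y u := velocity f g l0 hl1 y u.
pose G := sysG (@projY R n) (fun i y u => v y u 0 i).
have GE x u : G x u = v (x *m @projY R n) u by exact: sysG_vel.
have xbY t : xb t *m @projY R n = yb t by exact: state_projY.
have [eta0 eta01 noR] := reach_not_better cA clC1 clC2 hf hg hl0 hhl can lmin bK M0 lxb cb0 cbS beE.
have bol' := boltyanski_lift (cb Sb) CPsi bol.
have cU : compact UU by exact: compact_ctrl.
have cV i := cont_on_coord i (cont_vel hf hg hl0 hhl).
have cdV i j := cont_on_coord i (cont_dvel hf hg hl0 hhl j).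
have dV i j y u : UU u -> is_derive y (ev j) (fun y => v y u 0 i : R^o) (dvel f g l0 hl1 j y u 0 i).
  by move=> Uu; have /is_derive_dir_coord/(_ i) := is_derive_vel hf hg hl0 hhl j y Uu.
have dxb' : exists2 E, null E & forall t, 0 < t < Sb -> ~ E t -> is_derive t (1:R) xb (G (xb t) (ub t)).
  by have [E nE HE] := dxb; exists E => // t tS Et; rewrite GE xbY; exact: HE.
have [P [PS [B lP] [E nE HE] Hins [HK Hmax]]] := maximum_principle cU (@projY_norm R n) cV cdV dV S0 M0 eta01 Uub mub lxb
  dxb' bol' noR.
pose y0P t := (lsubmx (lsubmx (P t))) 0 0.
pose p t := rsubmx (lsubmx (P t)).
pose cP t := (rsubmx (P t)) 0 0.
(* The cost enters the Hamiltonian with a minus sign, hence [lam] is minus the cost component of the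
   adjoint curve. *)
pose p0 := y0P Sb; pose lam := - cP Sb.
have itvW t : 0 < t < Sb -> 0 <= t <= Sb by case/andP => ? ?; rewrite !ltW.
pose J t := sysJ (fun i j y u => dvel f g l0 hl1 j y u 0 i) (yb t) (ub t).
(* The dynamics depends on the position alone, so the right-hand side of the adjoint equation lives
   in the position block and the other two components of [P] are constant. *)
have derP t : 0 < t < Sb -> ~ E t -> is_derive t (1:R) P (row_mx (row_mx 0 (- (P t *m (J t)^T))) 0).
  move=> tS Et; have [d1 _] := HE t tS Et; move: d1.
  rewrite /sysA xbY -/(J t) trmx_mul trmx_projY mulmxA -mulNmx mul_embY; exact.
have lP0 : @lips R R^o B 0 Sb y0P.
  by move=> s t sS tS; apply: le_trans (lP s t sS tS); have := sy0_le (P s - P t); rewrite /y0P !mxE.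
have lPy : lips B 0 Sb p.
  move=> s t sS tS; apply: le_trans (lP s t sS tS).
  by rewrite (_ : p s - p t = rsubmx (lsubmx (P s - P t))) ?sy_le //; apply/rowP => j; rewrite !mxE.
have lPc : @lips R R^o B 0 Sb cP.
  by move=> s t sS tS; apply: le_trans (lP s t sS tS); have := sc_le (P s - P t); rewrite /cP !mxE.
have derPs t : 0 < t < Sb -> ~ E t -> [/\ is_derive t (1:R) (y0P : R -> R^o) 0,
    is_derive t (1:R) p (- (P t *m (J t)^T)) & is_derive t (1:R) (cP : R -> R^o) 0].
  move=> tS Et; have /is_derive_curve_submx[/is_derive_curve_submx[d1 d2] d3] := derP t tS Et.
  split.
  - by have /is_derive_coord/(_ 0) := d1; rewrite !row_mxKl mxE.
  - by move: d2; rewrite row_mxKl row_mxKr.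
  - by have /is_derive_coord/(_ 0) := d3; rewrite row_mxKr mxE.
have constP (h : R -> R) t : @lips R R^o B 0 Sb h ->
    (forall t, 0 < t < Sb -> ~ E t -> is_derive t (1:R) (h : R -> R^o) 0) -> 0 <= t <= Sb -> h Sb = h t.
  move=> lh dh /andP[t0 tS]; apply: (AC_const tS _ nE).
    exact: (ACon_sub t0 (lexx _) (@lips_AC _ R^o _ _ _ _ lh)).
  by move=> s /andP[ts sS]; apply: dh; rewrite (le_lt_trans t0).
have PE s : Icc Sb s -> P s = state (tx p0 (p s)) (- lam).
  move=> sS; rewrite {1}(state_split (P s)) -/(y0P s) -/(p s) -/(cP s) /lam opprK /p0.
  rewrite (constP y0P s lP0 _ sS); last by move=> t tS Et; have [] := derPs t tS Et.
  rewrite (constP cP s lPc _ sS) //; by move=> t tS Et; have [] := derPs t tS Et.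
have HamE s u : Icc Sb s -> Ham f g l0 hl1 (yb s) p0 (p s) 0 lam (pk_w0 u) (pk_w u) (pk_a u) = dotp (P s) (v (yb s) u).
  by move=> sS; rewrite PE // Ham_dotp.
have Hle s u : Icc Sb s -> UU u -> dotp (P s) (v (yb s) u) <= 0.
  by move=> sS Uu; have := Hmax s u sS Uu; rewrite -/G GE xbY.
have H0 t : 0 < t < Sb -> ~ E t -> dotp (P t) (v (yb t) (ub t)) = 0.
  move=> tS Et; have [_ h] := HE t tS Et; apply/le_anti/andP; split; last by move: h; rewrite -/G GE xbY.
  exact: Hle (itvW t tS) (Uub t).
have SS : Icc Sb Sb by rewrite /Icc /= lexx ltW.
have HM0 s : Icc Sb s -> HamMax A C1 C2 f g l0 hl1 (yb s) p0 (p s) 0 lam = 0.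
  move=> sS; apply: sup_zero.
  - exists (Ham f g l0 hl1 (yb s) p0 (p s) 0 lam (pk_w0 (ub 0)) (pk_w (ub 0)) (pk_a (ub 0))).
    by have [w00 Cw Aa w1] := Uub 0; exists (pk_w0 (ub 0), pk_w (ub 0)), (pk_a (ub 0)).
  - move=> _ [[w0 w] [a [[/= w00 [Cw w1]] Aa ->]]].
    have := HamE s (pack w0 w a) sS; rewrite pack_w0 pack_w pack_a => ->.
    by apply: Hle => //; split; rewrite ?pack_w0 ?pack_w ?pack_a.
  (* The Hamiltonian along the reference is known to vanish only at almost every time. For an
     arbitrary [s] the control of a good time [s'] near [s] is tested at [s]: by Lipschitz
     continuity of [P] and of the dynamics its value there is at least [- h]. *)
  - move=> h h0.
    have [L L0 HL] := sysG_lip cU (@projY_norm R n) cdV dV (xb 0) (M * Sb).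
    have [MG MG0 HMG] := sysG_bounded (Fc := fun i y u => v y u 0 i) cU (@projY_norm R n) cV (xb 0) (M * Sb).
    have inb t : 0 <= t <= Sb -> `|xb t - xb 0| <= M * Sb.
      move=> /andP[t0 tS]; apply: le_trans (lxb _ _ _ _) _; rewrite ?lexx ?t0 ?(ltW S0) //.
      by rewrite subr0 ger0_norm // ler_wpM2l.
    have PB t : 0 <= t <= Sb -> `|P t| <= `|P 0| + `|B| * Sb.
      move=> /andP[t0 tS]; rewrite -[P t](addrNK (P 0)) addrC; apply: le_trans (ler_normD _ _) _.
      rewrite lerD2l; apply: le_trans (lP _ _ _ _) _; rewrite ?lexx ?t0 ?(ltW S0) //.
      rewrite subr0 ger0_norm //; apply: (@le_trans _ _ (`|B| * t)); first by rewrite ler_wpM2r // ler_norm.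
      by rewrite ler_wpM2l.
    pose C := ((1 + n) + 1)%:R * `|B| * MG + ((1 + n) + 1)%:R * (`|P 0| + `|B| * Sb) * (L * M).
    have C0 : 0 <= C.
      by rewrite addr_ge0 // !mulr_ge0 // ?addr_ge0 // ?mulr_ge0 // ltW.
    have C1' : 0 < C + 1 by rewrite ltr_wpDl.
    pose dl := h / (C + 1); have dl0 : 0 < dl by rewrite divr_gt0.
    have [|s' /andP[]] := @not_null_itv R E (Num.max 0 (s - dl)) (Num.min Sb (s + dl)) nE.
      by case/andP: sS => s0 sS; rewrite lt_min !gt_max; apply/andP; split; apply/andP; split; lra.
    rewrite gt_max lt_min => /andP[s'0 s'1] /andP[s'S s'2] Es'.
    have s'I : 0 < s' < Sb by rewrite s'0.
    have sI : 0 <= s <= Sb by exact: sS.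
    have s'W := itvW s' s'I.
    exists (Ham f g l0 hl1 (yb s) p0 (p s) 0 lam (pk_w0 (ub s')) (pk_w (ub s')) (pk_a (ub s'))).
      by have [w00 Cw Aa w1] := Uub s'; exists (pk_w0 (ub s'), pk_w (ub s')), (pk_a (ub s')).
    rewrite HamE // -[dotp _ _]subr0 -(H0 s' s'I Es').
    have ss' : `|s - s'| <= dl by rewrite ler_norml; apply/andP; split; lra.
    rewrite -(xbY s) -(xbY s') -!GE.
    rewrite (_ : dotp (P s) (G (xb s) (ub s')) - _ = dotp (P s - P s') (G (xb s) (ub s')) +
       dotp (P s') (G (xb s) (ub s') - G (xb s') (ub s'))); last by rewrite dotpBl dotpBr; ring.
    have h1 : `|dotp (P s - P s') (G (xb s) (ub s'))| <= ((1 + n) + 1)%:R * `|B| * MG * `|s - s'|.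
      apply: le_trans (dotp_norm_le _ _) _; rewrite -!mulrA ler_wpM2l // [MG * _]mulrC mulrA.
      apply: ler_pM => //; last by apply: HMG; [exact: inb|exact: Uub].
      by apply: le_trans (lP s s' sI s'W) _; rewrite ler_wpM2r // ler_norm.
    have h2 : `|dotp (P s') (G (xb s) (ub s') - G (xb s') (ub s'))| <=
        ((1 + n) + 1)%:R * (`|P 0| + `|B| * Sb) * (L * M) * `|s - s'|.
      apply: le_trans (dotp_norm_le _ _) _; rewrite -!mulrA ler_wpM2l //.
      apply: ler_pM => //; first exact: PB.
      apply: le_trans (HL _ _ _ (inb s sI) (inb s' s'W) (Uub s')) _.
      by rewrite ler_wpM2l //; exact: lxb.
    have h3 : C * `|s - s'| <= h.
      apply: (@le_trans _ _ (C * dl)); first by rewrite ler_wpM2l.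
      by rewrite /dl mulrCA ler_piMr ?(ltW h0) // ler_pdivrMr // mul1r lerDl.
    move: h1 h2 h3; rewrite /C mulrDl => /ler_normlP[h1 _] /ler_normlP[h2 _] h3.
    by move: h1 h2 h3; lra.
have Aa0 : A (pk_a (ub 0)) by have [] := Uub 0.
have C20 : C2 0 by case: coneC2.
have pB s vv : Icc Sb s -> insertable Sb xb (reach UU G Sb xb) s (vv *m @embY R n) -> dotp (p s) vv <= 0.
  by move=> sS Iv; have := Hins s _ sS Iv; rewrite dotp_embY.
exists p0, p, lam; split.
- split; first exact: lips_AC lPy.
  have Gam0 : Gam 0.
    have [M' [Cc [L [V [F [[[Cc0 _] _] _ _ _ ->]]]]]] := bol.
    by exists 0 => //; rewrite mul0mx.
  (* The direction with [gam = 0] and slack 1, a pure decrease of cost, gives the sign of [lam]. *)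
  have := HK (state 0 (-1)); rewrite PE // dotp_row_mx dotp0r dotp_const add0r mulrN1 opprK; apply.
  by exists 0, 1; split => //; rewrite dotp0l oppr0 sub0r.
- have nz : ~ (p0 = 0 /\ p Sb = 0 /\ lam = 0).
    move=> [e1 [e2 e3]]; move/eqP: PS; apply; rewrite PE // e1 e2 e3 oppr0.
    by apply/rowP => j; rewrite !mxE; case: fintype.splitP => k _; rewrite !mxE //; case: fintype.splitP => k' _; rewrite !mxE.
  split.
    have [e1|e1] := eqVneq p0 0; last by left.
    have [e2|e2] := eqVneq (p Sb) 0; last by right; left; exists Sb.
    have [e3|e3] := eqVneq lam 0; last by right; right.
    by exfalso; apply: nz.
  (* If [p] and [lam] vanish identically, the Hamiltonian along the reference reduces to [p0 * w0];
     as [p0] is then nonzero, [w0] vanishes almost everywhere and [y0b] stays at 0. *)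
  move=> y0S; have [e3|] := eqVneq lam 0; last by right.
  left; apply: contrapT => np.
  have pz s : Icc Sb s -> p s = 0.
    by move=> sS; apply/eqP; apply: contrapT => /negP h; apply: np; exists s.
  have p0n : p0 != 0 by apply/eqP => e1; apply: nz; split => //; split => //; exact: pz.
  have [E1 nE1 HE1] := dxb.
  have w00 t : 0 < t < Sb -> ~ E t -> pk_w0 (ub t) = 0.
    move=> tS Et; have := H0 t tS Et; rewrite PE ?(itvW t tS) //; last exact: itvW.
    rewrite pz; last exact: itvW.
    rewrite e3 oppr0 /v /velocity dotp_state dotp0l mul0r !addr0 => /eqP.
    by rewrite mulf_eq0 (negbTE p0n) => /eqP.
  have : y0b Sb = y0b 0.
    have ly0b : @lips R R^o M 0 Sb y0b.
      move=> s t sS tS; apply: le_trans (lxb s t sS tS); have := sy0_le (xb s - xb t).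
      by rewrite /xb /state /tx !linearB /= !row_mxKl !mxE.
    apply: (@AC_const R y0b 0 Sb (E `|` E1) (ltW S0) (@lips_AC _ R^o _ _ _ _ ly0b)); first exact: nullU.
    move=> t tS Et; have /is_derive_curve_submx[/is_derive_curve_submx[/is_derive_coord/(_ 0) d1 _] _] := HE1 t tS (fun h => Et (or_intror h)).
    move: d1; rewrite /velocity /state /tx !row_mxKl mxE w00 //; last by move=> h; apply: Et; left.
    by congr is_derive; apply/funext => s; rewrite !row_mxKl mxE.
  by rewrite y00 => e; move: y0S; rewrite e ltxx.
- exists (- (lam *: grad Psi (tx (y0b Sb) (yb Sb))) - tx p0 (p Sb)); split.
    move=> gam Ggam.
    have : 0 <= dotp (P Sb) (state gam (- dotp gam (grad Psi (tx (y0b Sb) (yb Sb))) - 0)).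
      by apply: HK; exists gam, 0.
    rewrite PE // dotp_row_mx dotp_const subr0 mulrNN dotpBl dotpNl dotpZl (dotpC (grad _ _)); lra.
  by rewrite opprB addrC subrK.
- split.
  apply: negligibleS (nullU nE nN0) => s /= /not_implyP[sS H]; apply: contrapT => Es; apply: H.
  have sI := itvW s sS.
  have [_ d2 _] := derPs s sS (fun h => Es (or_introl h)).
  split; first by case: d2.
  rewrite derive_val; congr (- _); apply/rowP => j.
  have uE := ubE s sI (fun h => Es (or_intror h)).
  rewrite mxE [RHS]mxE.
  have Dj : is_derive (yb s) (ev j) (fun x' => \sum_i (P s 0 i *: (v x' (ub s) 0 i : R^o)))
      (\sum_i P s 0 i *: (dvel f g l0 hl1 j (yb s) (ub s) 0 i : R^o)).
    have Di i : is_derive (yb s) (ev j) (fun x' => P s 0 i *: (v x' (ub s) 0 i : R^o))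
        (P s 0 i *: (dvel f g l0 hl1 j (yb s) (ub s) 0 i : R^o)).
      have D1 := dV i j (yb s) (ub s) (Uub s).
      by have := @is_deriveZ _ _ _ _ (P s 0 i) _ _ _ D1.
    by have := is_derive_sum Di; congr is_derive; apply/funext => x'; rewrite fct_sumE.
  have -> : (fun x' => Ham f g l0 hl1 x' p0 (p s) 0 lam (w0b s) (wb s) (alb s)) =
      (fun x' => \sum_i (P s 0 i *: (v x' (ub s) 0 i : R^o))).
    apply/funext => x'; have := Ham_dotp f g l0 hl1 x' (p s) p0 lam (ub s).
    by rewrite {1 2 3}uE pack_w0 pack_w pack_a => ->; rewrite -PE.
  by rewrite derive_val; apply: eq_bigr => i _; rewrite !mxE.
  (* The two endpoints are discarded as well, because [H0] concerns interior times. *)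
  apply: negligibleS (nullU (nullU (nullU nE nN0) (null_set1 0)) (null_set1 Sb)) => s /= /not_implyP[sS H]; apply: contrapT => Es; apply: H.
  have sI : 0 < s < Sb.
    case/andP: (sS) => s0 sS'; rewrite !lt_neqAle s0 sS' !andbT; apply/andP; split.
      by apply/eqP => e; apply: Es; left; right; rewrite -e.
    by apply/eqP => e; apply: Es; right.
  rewrite HM0 //; have := HamE s (ub s) sS.
  rewrite {1 2 3}ubE // ?pack_w0 ?pack_w ?pack_a; last by move=> h; apply: Es; left; left; right.
  by move=> ->; apply: H0 => // h; apply: Es; left; left; left.
- move=> s sS; split; first exact: HM0.
  + move=> i; have k b := Hle s _ sS (axis_ctrl_in lineC1 C20 i b Aa0).
    have kE b : v (yb s) (axis_ctrl m2 (pk_a (ub 0)) i b) =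
        (if b then g (lshift m2 i) (yb s) else - g (lshift m2 i) (yb s)) *m @embY R n.
      exact: (vel_axis_ctrl f g l0 lineC1 C20 hl10 (yb s) i b Aa0).
    move: (k true) (k false); rewrite !kE !dotp_embY -/(p s) dotpNr => k1 k2.
    by apply/le_anti/andP; split => //; lra.
  + move=> Bv [b [F [fb lb HF ->]]].
    have ub' : uniq (fleaves b) by rewrite (perm_uniq fb) iota_uniq.
    have Cb : bracket_class F b 0 by apply: bracket_class_fdepth => // j jb; have [_] := HF j jb.
    have Fg j : j \in fleaves b -> exists i : 'I_m1, F j = g (lshift m2 i) by move=> /HF[].
    (* Length at least 2 excludes a leaf; for a node, swapping the branches gives the opposite
       field. *)
    case: b {fb HF ub'} lb Cb Fg => [j //|b1 b2] lb Cb Fg.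
    have lb' : (2 <= flength (FNode b2 b1))%N by move: lb; rewrite /flength /= !size_cat addnC.
    have Fg' j : j \in fleaves (FNode b2 b1) -> exists i : 'I_m1, F j = g (lshift m2 i).
      by move=> jb; apply: Fg; move: jb; rewrite /= !mem_cat orbC.
    have k1 : dotp (p s) (feval F (FNode b1 b2) (yb s)) <= 0.
      rewrite -(xbY s); apply: (pB s _ sS).
      exact: (insert_bracket f l0 lineC1 C20 hg hl10 Aa0 lxb sS lb Cb Fg).
    have k2 : dotp (p s) (feval F (FNode b2 b1) (yb s)) <= 0.
      rewrite -(xbY s); apply: (pB s _ sS).
      exact: (insert_bracket f l0 lineC1 C20 hg hl10 Aa0 lxb sS lb' (bracket_class_swap Cb) Fg').
    move: k2; rewrite feval_swap dotpNr oppr_le0 => k2.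
    by apply/le_anti; rewrite k1 k2.
Qed.
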